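(* Let $(X_t)_{t\ge 0}$ be a regular jump Lévy process in $\mathbf{R}^d$, with transition densities $p(t,x)$ and $t_b>0$ a time such that $p(t_b,\cdot)$ is strictly positive and bounded on $\mathbf{R}^d$, and let $V$ be a confining $X$-Kato class potential with Feynman--Kac semigroup $\{T_t: t\ge0\}$ (all terms as defined in the context). Suppose in addition that there exist $R_0>1$ and a constant $C_{14}=C_{14}(V)$ such that for every $|x|>R_0$, $V(y)\le C_{14}V(x)$ for all $y\in B(x,1)$. Then: (1) $\{T_t: t\ge0\}$ is GSD if and only if $$\lim_{|x|\to\infty}\frac{V(x)}{|\log\nu(x)|}=\infty.$$ Moreover, this limit condition is necessary for IUC, and it is sufficient for IUC whenever $p(t,\cdot)$ is bounded for every fixed $t>0$. (2) $\{T_t: t\ge0\}$ is AGSD (or, equivalently, AIUC) if and only if there exist a constant $C_{15}$ and $R>0$ such that $$\frac{V(x)}{|\log\nu(x)|}\ge C_{15},\qquad |x|\ge R. \qquad ( * )$$ Specifically, if $( * )$ is satisfied, then $\{T_t\}$ is $t_0$-GSD with $t_0=4/C_{15}$, and it is $t_0$-IUC with $t_0=2(t_b\vee 4/C_{15})$. If $\{T_t\}$ is $t_0$-GSD, then $( * )$ holds with $C_{15}=1/(2C_{14}t_0)$. Similarly, $t_0$-IUC implies $( * )$ with $C_{15}=1/(4C_{14}t_0)$.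
   Context: Conventions. $(X_t)_{t\ge0}$ is a Lévy process in $\mathbf{R}^d$, $d\ge1$; $\mathbf{P}^x,\mathbf{E}^x$ refer to the process started at $x$. $B(x,r)$ is the open ball; $\mathbf{1}$ is the function identically $1$; $a\vee b=\max(a,b)$. $C, C_i$ denote positive constants; $C(X,a,\dots)$ depends only on the process (and the dimension $d$) and on the listed parameters. $f\asymp Cg$ means $C^{-1}g\le f\le Cg$. Regular jump Lévy process: a Lévy process satisfying (A1)--(A3). (A1) $(X_t)$ is symmetric, its Lévy measure is absolutely continuous with a strictly positive density $\nu$, and: (1) for every $0<r\le 1/2$ there is $C_1=C_1(X,r)\ge1$ with $\nu(x)\asymp C_1\nu(y)$ for $r\le|y|\le|x|\le|y|+1$; (2) there is $C_2=C_2(X)\ge1$ with $\nu(x)\le C_2\nu(y)$ for $1/2\le|y|\le|x|$; (3) there is $C_3=C_3(X)\ge1$ with $\int_{|z-x|>1/2,\,|z-y|>1/2}\nu(x-z)\nu(z-y)\,dz\le C_3\nu(x-y)$ for $|y-x|\ge1$. (A2) $(X_t)$ is strong Feller, equivalently it has transition densities $p(t,x,y)=p(t,y-x)$ for $t>0$; moreover there are $t_b>0$ and a constant $C(X,t_b)$ with $0<p(t_b,x)\le C(X,t_b)$ for all $x\in\mathbf{R}^d$. (A3) For all $0<p<q<R\le1$, $\sup_{x\in B(0,p)}\sup_{y\in B(0,q)^c}G_{B(0,R)}(x,y)<\infty$, where for a bounded open set $D$, $G_D(x,y)=\int_0^\infty p_D(t,x,y)\,dt$ for $x,y\in D$ (and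 $0$ otherwise), and $p_D$ is the transition density of the process killed upon exiting $D$. Potentials. A Borel function $V:\mathbf{R}^d\to\mathbf{R}$ belongs to $\mathcal{K}^X$ if $\lim_{t\to0}\sup_x\mathbf{E}^x[\int_0^t|V(X_s)|ds]=0$, and to $\mathcal{K}^X_{\mathrm{loc}}$ if $V\mathbf{1}_B\in\mathcal{K}^X$ for every ball $B$. $V$ is an $X$-Kato class potential if $V_-\in\mathcal{K}^X$ and $V_+\in\mathcal{K}^X_{\mathrm{loc}}$. It is confining if also $V(x)\to\infty$ as $|x|\to\infty$. Feynman--Kac semigroup: $T_tf(x)=\mathbf{E}^x[e^{-\int_0^tV(X_s)ds}f(X_t)]$, $t>0$. Whenever $(X_t)$ is a regular jump Lévy process and $V$ is a confining $X$-Kato class potential, $\{T_t\}$ is a strongly continuous semigroup of symmetric compact operators on $L^2(\mathbf{R}^d)$; there is an orthonormal basis $\{\varphi_n\}_{n\ge0}$ of $L^2(\mathbf{R}^d)$ with $T_t\varphi_n=e^{-\lambda_nt}\varphi_n$, where $\lambda_0<\lambda_1\le\lambda_2\le\cdots\to\infty$; each $\varphi_n$ is bounded and continuous, and the ground state $\varphi_0$ is chosen strictly positive. Intrinsic semigroup: $\widetilde T_tf(x)=\frac{e^{\lambda_0t}}{\varphi_0(x)}T_t(\varphi_0f)(x)$ on $L^2(\mathbf{R}^d,\varphi_0^2dx)$. $\{T_t\}$ is IUC if $\widetilde T_t$ is bounded from $L^2(\mathbf{R}^d,\varphi_0^2dx)$ to $L^\infty(\mathbf{R}^d)$ for every $t>0$;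 it is $t_0$-IUC if this holds for $t=t_0$ (hence for all $t\ge t_0$); it is AIUC if it is $t_0$-IUC for some $t_0>0$. $\{T_t\}$ is GSD if for every $t>0$ there is $C_{12}=C_{12}(X,V,t)$ with $T_t\mathbf{1}(x)\le C_{12}\varphi_0(x)$ for all $x\in\mathbf{R}^d$; it is $t_0$-GSD if this holds for $t=t_0$ (hence for all $t\ge t_0$); it is AGSD if it is $t_0$-GSD for some $t_0>0$. *)

(* Defs.v *)
From HB Require Import structures.
From mathcomp Require Import all_boot all_order all_algebra.
From mathcomp Require Import lra.
From mathcomp Require Import all_classical all_reals all_analysis.
From mathcomp Require Import measurable_realfun.
Set Implicit Arguments. Unset Strict Implicit. Unset Printing Implicit Defensive.
Import Order.TTheory GRing.Theory Num.Theory numFieldNormedType.Exports.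
Local Open Scope classical_set_scope. Local Open Scope ring_scope.

(* R^n is 'rV[R]_n with its Borel sigma-algebra, generated by the open sets. *)
Section borel_rV.
Context {R : realType} {n : nat}.
Let G : set (set 'rV[R]_n) := open.

Let borel0 : <<s G >> set0.
Proof. exact: sigma_algebra0. Qed.

Let borelC A : <<s G >> A -> <<s G >> (~` A).
Proof. exact: sigma_algebraC. Qed.

Let borel_bigcup (F : (set 'rV[R]_n)^nat) :
  (forall i, <<s G >> (F i)) -> <<s G >> (\bigcup_i F i).
Proof. exact: sigma_algebra_bigcup. Qed.

HB.instance Definition _ := @isMeasurable.Build (sigma_display G) 'rV[R]_n
  <<s G >> borel0 borelC borel_bigcup.
End borel_rV.

Lemma open_rV_measurable (R : realType) n (A : set 'rV[R]_n) :
  open A -> measurable A.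
Proof. exact: sub_gen_smallest. Qed.

Lemma open_rV_bigcup (R : realType) n (A : set 'rV[R]_n) : open A ->
  A = \bigcup_(p in [set p : 'rV[rat]_n * rat | (forall y : 'rV[R]_n,
          (forall i, `|y 0 i - ratr (p.1 0 i)| < ratr p.2) -> A y)])
      [set y : 'rV[R]_n | forall i, `|y 0 i - ratr (p.1 0 i)| < ratr p.2].
Proof.
move=> oA; apply/seteqP; split=> [y Ay|y [p /= Hp] /Hp//].
have /nbhs_ballP[e /= e0 He] : nbhs y A by exact: open_nbhs_nbhs.
have e20 : 0 < e / 2 by rewrite divr_gt0.
have [q] := rat_in_itvoo e20; rewrite in_itv/= => /andP[q0 qe].
have H i : exists c : rat, `|y 0 i - ratr c| < ratr q.
  have : y 0 i - ratr q < y 0 i + ratr q by rewrite ltrBlDr -addrA ltrDl addr_gt0.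
  move=> /rat_in_itvoo[c]; rewrite in_itv/= => /andP[c1 c2]; exists c.
  by rewrite ltr_norml; apply/andP; split; lra.
have [c Hc] := choice H.
exists (\row_i c i, q); last by move=> i /=; rewrite mxE; exact: Hc.
move=> z /= Hz; apply: He; split=> // i j.
rewrite !ord1 -ball_normE/=.
have := Hz j; rewrite mxE => Hzj.
rewrite (_ : y 0 j - z 0 j = (y 0 j - ratr (c j)) - (z 0 j - ratr (c j))); last first.
  by rewrite opprB addrA subrK.
rewrite (le_lt_trans (ler_normB _ _))// [e]splitr ltrD// (lt_trans _ qe)//; exact: Hc.
Qed.

Lemma measurable_fun_rV d (T : measurableType d) (R : realType) n
    (f : T -> 'rV[R]_n) :
  (forall i, measurable_fun setT (fun x => f x 0 i)) -> measurable_fun setT f.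
Proof.
move=> mf; apply: (@measurability _ _ _ _ _ f open) => //.
move=> _ [A oA <-]; rewrite setTI (open_rV_bigcup oA) preimage_bigcup.
rewrite bigcup_mkcond; apply: countable_bigcupT_measurable => [|[c q]].
  exact: countableP.
case: ifPn => // _.
rewrite (_ : _ @^-1` _ = \bigcap_(i in [set: 'I_n])
   [set x | `|f x 0 i - ratr (c 0 i)| < ratr q]); last first.
  by apply/seteqP; split=> [x /= H i _|x /= H i]; exact: H.
apply: fin_bigcap_measurable => // i _.
have mh : measurable_fun setT (fun x => `|f x 0 i - ratr (c 0 i)|).
  by apply: measurableT_comp => //; exact: measurable_funB.
have := mh measurableT `]-oo, (ratr q)[%classic (measurable_itv _).
by rewrite setTI set_itvE.
Qed.

Lemma measurable_coord (R : realType) n (i : 'I_n) :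
  measurable_fun setT (fun x : 'rV[R]_n => x 0 i).
Proof.
apply: (measurability (@RGenOpens.G R)); first exact: RGenOpens.measurableE.
move=> _ [_ [a [b ->]] <-]; rewrite setTI; apply: open_rV_measurable.
apply: open_comp => [x _|]; last exact: interval_open.
exact: coord_continuous.
Qed.

Section lebesgue_rV.
Context {R : realType}.

Definition rV_cons n (p : measurableTypeR R * 'rV[R]_n) : 'rV[R]_n.+1 :=
  row_mx (const_mx p.1 : 'rV_1) p.2.

Lemma measurable_rV_cons n : measurable_fun setT (@rV_cons n).
Proof.
apply: measurable_fun_rV => i; rewrite /rV_cons.
under eq_fun do rewrite mxE.
case: splitP => [j _|j _].
  by under eq_fun do rewrite mxE; exact: measurable_fst.
exact: (measurableT_comp (measurable_coord j)).
Qed.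


Definition rV_uncons n (x : 'rV[R]_n.+1) : measurableTypeR R * 'rV[R]_n :=
  (x 0 ord0, rsubmx (x : 'rV_(1 + n))).

Lemma rV_consK n : cancel (@rV_cons n) (@rV_uncons n).
Proof.
move=> [a x]; rewrite /rV_uncons /rV_cons row_mxKr; congr (_, _).
by rewrite mxE; case: splitP => // j _; rewrite mxE.
Qed.

Lemma measurable_rV_uncons n : measurable_fun setT (@rV_uncons n).
Proof.
apply/measurable_fun_pairP; split; first exact: measurable_coord.
apply: measurable_fun_rV => i /=; rewrite /comp /=.
by under eq_fun do rewrite mxE; exact: measurable_coord.
Qed.

Section cons_measure.
Context (n : nat) (mu : {sigma_finite_measure set 'rV[R]_n -> \bar R}).
Let nu : {measure set (measurableTypeR R * 'rV[R]_n)%type -> \bar R} :=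
  (lebesgue_measure \x mu)%E.

Definition lebesgue_cons : set 'rV[R]_n.+1 -> \bar R :=
  pushforward (lebesgue_measure \x mu)%E (@rV_cons n).

Let lebesgue_cons0 : lebesgue_cons set0 = 0%E.
Proof. by rewrite /lebesgue_cons /pushforward preimage_set0 (measure0 nu). Qed.

Let lebesgue_cons_ge0 A : (0 <= lebesgue_cons A)%E.
Proof. exact: (measure_ge0 nu). Qed.

Let lebesgue_cons_sigma_additive : semi_sigma_additive lebesgue_cons.
Proof.
move=> F mF tF mUF; rewrite /lebesgue_cons /pushforward preimage_bigcup.
apply: (@measure_semi_sigma_additive _ _ _ nu).
- by move=> k; rewrite -[X in measurable X]setTI; exact: measurable_rV_cons.
- apply/trivIsetP => /= i j _ _ ij; rewrite -preimage_setI.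
  by move/trivIsetP : tF => /(_ _ _ _ _ ij) ->//; rewrite preimage_set0.
- rewrite -preimage_bigcup -[X in measurable X]setTI.
  exact: measurable_rV_cons.
Qed.

HB.instance Definition _ := isMeasure.Build _ _ _ lebesgue_cons
  lebesgue_cons0 lebesgue_cons_ge0 lebesgue_cons_sigma_additive.

Let lebesgue_cons_sigma_finite : sigma_finite setT lebesgue_cons.
Proof.
have /sigma_finiteP[F [TF ndF Foo]] :=
  sigma_finiteT (@lebesgue_measure R).
have /sigma_finiteP[G [TG ndG Goo]] := sigma_finiteT mu.
exists (fun k => @rV_uncons n @^-1` (F k `*` G k)).
  rewrite -preimage_bigcup (_ : \bigcup_k _ = setT) ?preimage_setT//.
  apply/seteqP; split=> // -[x y] _.
  have [k _ Fkx] : (\bigcup_k F k) x by rewrite -TF.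
  have [l _ Gly] : (\bigcup_k G k) y by rewrite -TG.
  exists (maxn k l) => //; split=> /=.
  - by move: x Fkx; exact/subsetPset/ndF/leq_maxl.
  - by move: y Gly; exact/subsetPset/ndG/leq_maxr.
move=> k; have [mF Fk] := Foo k; have [mG Gk] := Goo k; split.
  rewrite -[X in measurable X]setTI.
  by apply: measurable_rV_uncons => //; exact: measurableX.
rewrite /lebesgue_cons /pushforward -comp_preimage.
rewrite (_ : _ \o _ = id) ?preimage_id; last exact/funext/rV_consK.
by rewrite product_measure1E// lte_mul_pinfty// ge0_fin_numE.
Qed.

HB.instance Definition _ := Measure_isSigmaFinite.Build _ _ _ lebesgue_cons
  lebesgue_cons_sigma_finite.
End cons_measure.

(* Lebesgue measure on R^n, as the n-fold product measure. *)
Fixpoint lebesgue_rV n : {sigma_finite_measure set 'rV[R]_n -> \bar R} :=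
  match n with
  | 0 => \d_(0 : 'rV[R]_0)
  | n.+1 => lebesgue_cons (lebesgue_rV n)
  end.

End lebesgue_rV.

Lemma lebesgue_rV_box (R : realType) n (A : nat -> set (measurableTypeR R)) :
  (forall i, measurable (A i)) ->
  (lebesgue_rV n [set x : 'rV[R]_n | forall i : 'I_n, A i (x 0%R i)] =
   \prod_(i < n) lebesgue_measure (A i))%E.
Proof.
elim: n A => [|n IH] A mA.
  rewrite big_ord0 /= diracE mem_set// => -[]//.
rewrite big_ord_recl/= -(IH (fun i => A i.+1))//.
rewrite /lebesgue_cons /pushforward -product_measure1E//.
  congr (_ _); apply/seteqP; split=> -[a x] /=.
    move=> H; split=> [|i].
      by have := H ord0; rewrite /rV_cons mxE; case: splitP => //= j _; rewrite mxE.
    have := H (lift ord0 i); rewrite /rV_cons mxE; case: splitP => /= j.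
      by rewrite ord1.
    by rewrite /bump/= add1n => -[/val_inj ->].
  move=> [Ha Hx] i; rewrite /rV_cons mxE; case: splitP => /= j ij.
    by rewrite mxE ij ord1.
  by rewrite ij add1n; exact: Hx.
rewrite (_ : mkset _ = \bigcap_(i in [set: 'I_n]) ((fun x : 'rV[R]_n => x 0 i : R) @^-1` A i.+1)); last first.
  by apply/seteqP; split=> [x /= H i _|x /= H i]; exact: H.
apply: fin_bigcap_measurable => // i _.
by rewrite -[X in measurable X]setTI; apply: (measurable_coord i) => //; exact: mA.
Qed.

Section sq_measure.
Context {R : realType} {n : nat} (phi : {mfun 'rV[R]_n >-> R}).
Local Open Scope ereal_scope.

(* The measure phi^2 dx. *)
Definition sq_measure (A : set 'rV[R]_n) : \bar R :=
  \int[lebesgue_rV n]_(x in A) ((phi x) ^+ 2)%:E.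

Let sq_measure0 : sq_measure set0 = 0.
Proof. exact: integral_set0. Qed.

Let sq_measure_ge0 A : 0 <= sq_measure A.
Proof. by apply: integral_ge0 => x _; rewrite lee_fin sqr_ge0. Qed.

Let sq_measure_sigma_additive : semi_sigma_additive sq_measure.
Proof.
move=> F mF tF mUF; rewrite /sq_measure ge0_integral_bigcup//.
- apply: is_cvg_ereal_nneg_natsum_cond => k _ _.
  by apply: integral_ge0 => x _; rewrite lee_fin sqr_ge0.
- apply: measurable_funTS; apply/measurable_EFinP.
  exact: measurable_funX.
- by move=> x _; rewrite lee_fin sqr_ge0.
Qed.

HB.instance Definition _ := isMeasure.Build _ _ _ sq_measure
  sq_measure0 sq_measure_ge0 sq_measure_sigma_additive.

End sq_measure.

Section euclidean.
Context {R : realType} {n : nat}.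
Implicit Types (x y : 'rV[R]_n) (f : 'rV[R]_n -> R).

Definition dot x y : R := (x *m y^T) 0 0.

(* The library's norm on 'rV[R]_n is the max-norm. *)
Definition enorm x : R := Num.sqrt (\sum_i x 0 i ^+ 2).

Definition eball x (r : R) : set 'rV[R]_n := [set y | enorm (y - x) < r].

Definition tends_to_pinfty_at_infty f : Prop :=
  forall M : R, exists r : R, forall x, r < enorm x -> M < f x.

End euclidean.

Section levy_process.
Context {R : realType} {n : nat} {dO : measure_display} {Om : measurableType dO}.
Variables (P : probability Om R) (X : R -> Om -> 'rV[R]_n).
Local Notation leb := (lebesgue_rV n).

Definition cadlag (f : R -> 'rV[R]_n) : Prop :=
  (forall t, 0 <= t -> f @ t^'+ --> f t) /\
  (forall t, 0 < t -> cvg (f @ t^'-)).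

Definition independent_increments : Prop :=
  forall (k : nat) (t : nat -> R) (B : nat -> set 'rV[R]_n),
    0 <= t 0%N -> {homo t : i j / (i < j)%N >-> i < j} ->
    (forall i, measurable (B i)) ->
    (P (\bigcap_(i < k) [set w | B i (X (t i.+1) w - X (t i) w)%R]) =
     \prod_(i < k) P [set w | B i (X (t i.+1) w - X (t i) w)%R])%E.

Definition stationary_increments : Prop :=
  forall (s t : R) (B : set 'rV[R]_n), 0 <= s -> 0 <= t -> measurable B ->
    P [set w | B (X (s + t) w - X s w)] = P [set w | B (X t w)].

(* X is indexed by R but only its values at times t >= 0 matter. It starts at
   0; the process started at x is x + X, so that P^x and E^x are the
   probability and expectation under P of functionals of x + X. *)
Definition levy_process : Prop :=
  [/\ forall t, 0 <= t -> measurable_fun setT (X t),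
      {ae P, forall w, X 0 w = 0},
      independent_increments,
      stationary_increments &
      {ae P, forall w, cadlag (X^~ w)}].

Definition symmetric_process : Prop :=
  forall (t : R) (B : set 'rV[R]_n), 0 <= t -> measurable B ->
    P [set w | B (X t w)] = P [set w | B (- X t w)].

(* N is the Levy measure of X: for some covariance matrix A and drift b, the
   Levy-Khintchine formula E[exp(i xi.X_t)] = exp(t eta(xi)) holds with
     eta(xi) = i b.xi - (xi A).xi / 2
       + \int (exp(i xi.y) - 1 - i xi.y 1_{|y| <= 1}) N(dy),
   written below in real and imaginary parts. *)
Definition levy_measure (N : {measure set 'rV[R]_n -> \bar R}) : Prop :=
  [/\ N [set 0] = 0%E,
      (\int[N]_y (Num.min 1 (enorm y ^+ 2))%:E < +oo)%E &
      exists (A : 'M[R]_n) (b : 'rV[R]_n),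
        [/\ A^T = A, forall xi, 0 <= dot (xi *m A) xi &
        forall (t : R) (xi : 'rV[R]_n), 0 <= t ->
          let re := - (dot (xi *m A) xi / 2)
            + \int[N]_y (cos (dot xi y) - 1) in
          let im := dot b xi + \int[N]_y
            (sin (dot xi y) - dot xi y * \1_[set z | enorm z <= 1] y) in
          \int[P]_w cos (dot xi (X t w)) = expR (t * re) * cos (t * im) /\
          \int[P]_w sin (dot xi (X t w)) = expR (t * re) * sin (t * im)]].

Definition levy_density (nu : 'rV[R]_n -> R) : Prop :=
  measurable_fun setT nu /\
  exists N : {measure set 'rV[R]_n -> \bar R}, levy_measure N /\
    forall B, measurable B -> N B = (\int[leb]_(y in B) (nu y)%:E)%E.

(* A Levy measure does not charge the origin, so nothing is asked of nu 0. *)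
Definition assumption_A1 (nu : 'rV[R]_n -> R) : Prop :=
  [/\ symmetric_process,
      levy_density nu /\ (forall x, x != 0 -> 0 < nu x),
      forall r : R, 0 < r <= 1 / 2 -> exists2 C1 : R, 1 <= C1 &
        forall x y, r <= enorm y -> enorm y <= enorm x <= enorm y + 1 ->
          C1^-1 * nu y <= nu x <= C1 * nu y,
      exists2 C2 : R, 1 <= C2 &
        forall x y, 1 / 2 <= enorm y -> enorm y <= enorm x ->
          nu x <= C2 * nu y &
      exists2 C3 : R, 1 <= C3 &
        forall x y, 1 <= enorm (y - x) ->
          let D := [set z | 1 / 2 < enorm (z - x) /\ 1 / 2 < enorm (z - y)] in
          (\int[leb]_(z in D) (nu (x - z) * nu (z - y))%:E
             <= (C3 * nu (x - y))%:E)%E].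

(* p(t,x,y) = p t (y - x). The Chapman-Kolmogorov identity at every point
   singles out one version of the densities, so that pointwise conditions on
   p t make sense; that version may take the value +oo. *)
Definition transition_density (p : R -> 'rV[R]_n -> \bar R) : Prop :=
  (forall t, 0 < t ->
    [/\ measurable_fun setT (p t), forall x, (0 <= p t x)%E &
        forall B, measurable B ->
          P [set w | B (X t w)] = (\int[leb]_(y in B) p t y)%E]) /\
  (forall s t x, 0 < s -> 0 < t ->
    p (s + t) x = (\int[leb]_z (p s (x - z)%R * p t z))%E).

Definition bounded_at (p : R -> 'rV[R]_n -> \bar R) (t : R) : Prop :=
  exists C : R, forall x, (p t x <= C%:E)%E.

Definition positive_bounded_at (p : R -> 'rV[R]_n -> \bar R) (t : R) : Prop :=
  (forall x, (0 < p t x)%E) /\ bounded_at p t.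

Definition assumption_A2 (p : R -> 'rV[R]_n -> \bar R) : Prop :=
  transition_density p /\ exists2 tb : R, 0 < tb & positive_bounded_at p tb.

Definition exit_time (D : set 'rV[R]_n) (x : 'rV[R]_n) (w : Om) : \bar R :=
  ereal_inf [set s%:E | s in [set s : R | 0 <= s /\ ~ D (x + X s w)]].

(* P^x(X_t \in B, t < exit time of D). The event is measurable with respect to
   the P-completion only. It is measured through the integral of its indicator,
   i.e., a supremum over measurable simple functions below it, which is the
   value of the completion (P itself is unspecified on such sets). *)
Definition killed_kernel (D : set 'rV[R]_n) (t : R) (x : 'rV[R]_n)
    (B : set 'rV[R]_n) : \bar R :=
  (\int[P]_w (\1_[set w' | (t%:E < exit_time D x w')%E /\
                           B (x + X t w')%R] w)%:E)%E.

(* As for transition_density, symmetry and Chapman-Kolmogorov at every point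
   single out one version. *)
Definition killed_transition_density (D : set 'rV[R]_n)
    (pD : R -> 'rV[R]_n -> 'rV[R]_n -> \bar R) : Prop :=
  [/\ measurable_fun
        (`]0, +oo[%classic `*` (D `*` D)
           : set (measurableTypeR R * ('rV[R]_n * 'rV[R]_n))%type)
        (fun z => pD z.1 z.2.1 z.2.2),
      forall t x y, 0 < t -> D x -> D y -> (0 <= pD t x y)%E,
      forall t x B, 0 < t -> D x -> measurable B ->
        killed_kernel D t x B = (\int[leb]_(y in B `&` D) pD t x y)%E,
      forall t x y, 0 < t -> D x -> D y -> pD t x y = pD t y x &
      forall s t x y, 0 < s -> 0 < t -> D x -> D y ->
        pD (s + t) x y = (\int[leb]_(z in D) (pD s x z * pD t z y))%E].

Definition green (D : set 'rV[R]_n)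
    (pD : R -> 'rV[R]_n -> 'rV[R]_n -> \bar R) (x y : 'rV[R]_n) : \bar R :=
  if `[< D x /\ D y >]
  then (\int[lebesgue_measure]_(t in `]0%R, +oo[) pD t x y)%E else 0%E.

Definition assumption_A3 : Prop :=
  forall p q r : R, 0 < p -> p < q -> q < r -> r <= 1 ->
    exists2 pD, killed_transition_density (eball 0 r) pD &
      (ereal_sup [set green (eball 0%R r) pD z.1 z.2 |
         z in (eball 0%R p `*` ~` eball 0%R q)] < +oo)%E.

Definition regular_jump_levy (nu : 'rV[R]_n -> R)
    (p : R -> 'rV[R]_n -> \bar R) : Prop :=
  [/\ levy_process, assumption_A1 nu, assumption_A2 p & assumption_A3].

Definition kato (V : 'rV[R]_n -> R) : Prop :=
  measurable_fun setT V /\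
  (ereal_sup (range (fun x =>
     \int[P]_w \int[lebesgue_measure]_(s in `[0%R, t]) `|V (x + X s w)|%:E))
   @[t --> 0^'+] --> 0)%E.

Definition kato_loc (V : 'rV[R]_n -> R) : Prop :=
  forall a r, kato (fun x => V x * \1_(eball a r) x).

Definition confining_kato (V : 'rV[R]_n -> R) : Prop :=
  [/\ measurable_fun setT V, kato V^\-, kato_loc V^\+ &
      tends_to_pinfty_at_infty V].

(* The value is in \bar R since it may be infinite for unbounded f. *)
Definition feynman_kac (V : 'rV[R]_n -> R) (t : R) (f : 'rV[R]_n -> R)
    (x : 'rV[R]_n) : \bar R :=
  (\int[P]_w (expeR (- \int[lebesgue_measure]_(s in `[0%R, t])
                         (V (x + X s w)%R)%:E) * (f (x + X t w))%:E))%E.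

End levy_process.

Section semigroup.
Context {R : realType} {n : nat}.
Local Notation leb := (lebesgue_rV n).
Variable T : R -> ('rV[R]_n -> R) -> 'rV[R]_n -> \bar R.

Definition eigenbasis (phi : nat -> {mfun 'rV[R]_n >-> R})
    (lambda : nat -> R) : Prop :=
  [/\ [/\ forall k, (phi k : 'rV[R]_n -> R) \in Lfun leb 2%:E,
          forall j k, (\int[leb]_x (phi j x * phi k x)%:E = (j == k)%:R%:E)%E &
          forall f, f \in Lfun leb 2%:E ->
            ('N[leb]_2%:E [(fun x => (f x - \sum_(k < N)
                (\int[leb]_y (f y * phi k y))%R * phi k x)%:E)]
             @[N --> \oo] --> 0)%E],
      forall k t, 0 < t -> {ae leb, forall x,
        T t (phi k) x = (expR (- lambda k * t) * phi k x)%:E},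
      [/\ lambda 0%N < lambda 1%N,
          forall k, (0 < k)%N -> lambda k <= lambda k.+1 &
          lambda @ \oo --> +oo],
      forall k, (exists M : R, forall x, `|phi k x| <= M) /\
                continuous (phi k : 'rV[R]_n -> R) &
      forall x, 0 < phi 0%N x].

Section ground_state.
Variables (phi0 : {mfun 'rV[R]_n >-> R}) (lambda0 : R).

Definition intrinsic (t : R) (f : 'rV[R]_n -> R) (x : 'rV[R]_n) : \bar R :=
  ((expR (lambda0 * t) / phi0 x)%:E * T t (fun y => phi0 y * f y)%R x)%E.

Definition IUC_at (t : R) : Prop :=
  exists C : R, forall f, f \in Lfun (sq_measure phi0) 2%:E ->
    ('N[sq_measure phi0]_+oo [intrinsic t f] <=
     C%:E * 'N[sq_measure phi0]_2%:E [EFin \o f])%E.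

Definition IUC : Prop := forall t : R, 0 < t -> IUC_at t.

Definition AIUC : Prop := exists2 t : R, 0 < t & IUC_at t.

Definition GSD_at (t : R) : Prop :=
  exists C : R, forall x, (T t (cst 1%R) x <= (C * phi0 x)%:E)%E.

Definition GSD : Prop := forall t : R, 0 < t -> GSD_at t.

Definition AGSD : Prop := exists2 t : R, 0 < t & GSD_at t.

End ground_state.
End semigroup.

Definition ratio_bounded_below {R : realType} {n : nat}
    (V nu : 'rV[R]_n -> R) (C : R) : Prop :=
  exists2 r : R, 0 < r &
    forall x, r <= enorm x -> C <= V x / `|ln (nu x)|.

(* Main.v *)
(* Write [tame] for the density [nu], replaced by 1 on the ball of radius 1/2.
   It is bounded, comparable on unit balls and [tame * tame <= C tame].
   Smoothing it gives [h] with [L h <= K h] ([L] the generator), and a bump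
   [chi] supported in the unit ball has [L chi >= c tame] off a ball and
   [L chi >= - lam chi] everywhere; Dynkin's formula, obtained from the
   characteristic function by trigonometric approximation, turns these bounds
   into inequalities for the Feynman-Kac semigroup [T].  Khasminskii's lemma
   controls Kato class creation rates.
   Sufficiency: comparing with [T phi0 <= exp (- lambda0 t) phi0], the potential
   of [tame] for the process killed at rate [V] is at most [C phi0]; under (2),
   Jensen's inequality bounds the survival probability at time [2 / C15] by
   [C tame], and averaging over [0, 2 / C15] gives GSD at time [4 / C15].  With
   bounded densities, Cauchy-Schwarz upgrades GSD at [t] to IUC at [2 t].
   Necessity: [phi0 <= C tame] almost everywhere, by killing the process on a
   large ball at a rate tending to infinity, while [L chi >= - lam chi] gives
   [T 1_B(x, 1) >= c exp (- C14 V(x) t)] near [x]. *)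
Require Import Defs.
From HB Require Import structures.
From mathcomp Require Import all_boot all_order all_algebra.
From mathcomp Require Import ring lra.
From mathcomp Require Import all_classical all_reals all_analysis.
From mathcomp Require Import measurable_realfun.
Set Implicit Arguments. Unset Strict Implicit. Unset Printing Implicit Defensive.
Import Order.TTheory GRing.Theory Num.Theory numFieldNormedType.Exports.
Local Open Scope classical_set_scope.
Local Open Scope ring_scope.


(** * Integrals of bounded functions and the Euclidean norm *)

Section bounded_measurable.
Context d (T : measurableType d) (R : realType).

(** The functions to which the generator is applied have at best bounded second differences, so no
    formula with derivatives is used. Cosines satisfy Dynkin's formula exactly, and the convolution
    of any integrable [B] with a cosine sum is a combination of cosines and sines. Discretised
    generators commute with convolution, so a pointwise bound for them on [B] survives convolution
    with a nonnegative kernel. Powers of cosines provide such kernels with a Gaussian limit, and a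
    narrow Gaussian gives back [B]. Only inequalities survive these limits, and only inequalities
    are used.

    The eigenvalue equation is known almost everywhere only. Absolute continuity of the law at
    positive times makes it usable under [T], and continuity of the ground state upgrades one half
    of it to an inequality at every point.

    The sign of [V] is handled by writing [V = u - f] with [u, f >= 0] and [f] supported in a ball.
    There the ground state is bounded below, so that for sufficiency creation, expanded by Duhamel's
    formula, costs at most a multiple of the ground state. *)

Definition bmeas (f : T -> R) : Prop :=
  measurable_fun setT f /\ exists M, forall x, `|f x| <= M.

Implicit Types f g : T -> R.

Lemma bmeas_bound f : bmeas f -> exists2 M, 0 <= M & forall x, `|f x| <= M.
Proof.
move=> [_ [M fM]]; exists `|M| => // x; exact: le_trans (fM x) (ler_norm _).
Qed.

Lemma bmeas_cst c : bmeas (fun _ => c).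
Proof. by split => //; exists `|c|. Qed.

Lemma bmeasD f g : bmeas f -> bmeas g -> bmeas (fun x => f x + g x).
Proof.
move=> [mf [M fM]] [mg [N gN]]; split; first exact: measurable_funD.
by exists (M + N) => x; rewrite (le_trans (ler_normD _ _))// lerD.
Qed.

Lemma bmeasM f g : bmeas f -> bmeas g -> bmeas (fun x => f x * g x).
Proof.
move=> [mf [M fM]] [mg [N gN]]; split; first exact: measurable_funM.
by exists (M * N) => x; rewrite normrM ler_pM.
Qed.

Lemma bmeasN f : bmeas f -> bmeas (fun x => - f x).
Proof.
move=> [mf [M fM]]; split; first exact: measurableT_comp.
by exists M => x; rewrite normrN.
Qed.

Lemma bmeasB f g : bmeas f -> bmeas g -> bmeas (fun x => f x - g x).
Proof. by move=> bf bg; apply: bmeasD => //; exact: bmeasN. Qed.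

Lemma bmeasZ c f : bmeas f -> bmeas (fun x => c * f x).
Proof. by move=> bf; apply: bmeasM => //; exact: bmeas_cst. Qed.

Lemma bmeas_sum I (s : seq I) (F : I -> T -> R) :
  (forall i, bmeas (F i)) -> bmeas (fun x => \sum_(i <- s) F i x).
Proof.
move=> bF; elim: s => [|a s ih].
  by under eq_fun do rewrite big_nil; exact: bmeas_cst.
by under eq_fun do rewrite big_cons; exact: bmeasD.
Qed.

(** Inside the section [bmeas] is tied to the domain [T], so for the domain [T'] its body is spelled
    out. *)
Lemma bmeas_comp d' (T' : measurableType d') (u : T' -> T) f :
  measurable_fun setT u -> bmeas f ->
  measurable_fun setT (f \o u) /\ exists M, forall x, `|(f \o u) x| <= M.
Proof.
move=> mu [mf [M fM]]; split; first exact: measurableT_comp.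
by exists M => x; exact: fM.
Qed.

Lemma bmeas_indic (A : set T) : measurable A -> bmeas (\1_A : T -> R).
Proof.
move=> mA; split; first exact: measurable_indic.
by exists 1 => x; rewrite indicE; case: (_ \in _); rewrite ?normr1 ?normr0.
Qed.

Section finite.
Variable mu : {finite_measure set T -> \bar R}.

Lemma bmeas_integrable f : bmeas f -> mu.-integrable setT (EFin \o f).
Proof.
move=> [mf [M fM]]; apply: measurable_bounded_integrable => //.
  by have := fin_num_measure mu _ (@measurableT _ T); rewrite ge0_fin_numE.
by exists M; split; [exact: num_real|move=> x /ltW Mx y _; exact: le_trans (fM y) Mx].
Qed.

Lemma RintegralD_bmeas f g : bmeas f -> bmeas g ->
  (\int[mu]_x (f x + g x) = \int[mu]_x f x + \int[mu]_x g x)%R.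
Proof. by move=> bf bg; rewrite RintegralD//; exact: bmeas_integrable. Qed.

Lemma RintegralB_bmeas f g : bmeas f -> bmeas g ->
  (\int[mu]_x (f x - g x) = \int[mu]_x f x - \int[mu]_x g x)%R.
Proof. by move=> bf bg; rewrite RintegralB//; exact: bmeas_integrable. Qed.

Lemma RintegralZ_bmeas c f : bmeas f ->
  (\int[mu]_x (c * f x) = c * \int[mu]_x f x)%R.
Proof. by move=> bf; rewrite RintegralZl//; exact: bmeas_integrable. Qed.

Lemma Rintegral_sum_bmeas I (s : seq I) (F : I -> T -> R) :
  (forall i, bmeas (F i)) ->
  (\int[mu]_x (\sum_(i <- s) F i x) = \sum_(i <- s) \int[mu]_x F i x)%R.
Proof.
move=> bF; elim: s => [|a s ih].
  rewrite big_nil; under eq_Rintegral do rewrite big_nil.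
  by rewrite Rintegral_cst// mul0r.
rewrite big_cons -ih -RintegralD_bmeas//; last exact: bmeas_sum.
by apply: eq_Rintegral => x _; rewrite big_cons.
Qed.

Lemma le_Rintegral_bmeas f g : bmeas f -> bmeas g -> (forall x, f x <= g x) ->
  (\int[mu]_x f x <= \int[mu]_x g x)%R.
Proof.
by move=> bf bg fg; apply: le_Rintegral => //; exact: bmeas_integrable.
Qed.

Lemma EFin_Rintegral_bmeas f : bmeas f ->
  (\int[mu]_x f x)%R%:E = (\int[mu]_x (f x)%:E)%E.
Proof.
by move=> bf; rewrite fineK//; apply: integrable_fin_num => //; exact: bmeas_integrable.
Qed.

Lemma Rintegral_bmeas_cst c : (\int[mu]_(x in setT) c = c * fine (mu setT))%R.
Proof. by rewrite Rintegral_cst. Qed.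

Lemma Rintegral_bmeas_bound f M : bmeas f -> (forall x, `|f x| <= M) ->
  `|\int[mu]_x f x|%R <= M * fine (mu setT).
Proof.
move=> bf fM; rewrite -Rintegral_bmeas_cst; have bM := bmeas_cst M.
rewrite ler_norml; apply/andP; split; last first.
  apply: le_Rintegral_bmeas => // x; exact: le_trans (ler_norm _) (fM x).
rewrite -mulN1r -RintegralZ_bmeas//; apply: le_Rintegral_bmeas => //.
  exact: bmeasZ.
by move=> x; rewrite mulN1r; have := fM x; rewrite ler_norml => /andP[].
Qed.

Lemma cvg_Rintegral_bmeas (F : nat -> T -> R) f M :
  (forall n, measurable_fun setT (F n)) -> (forall n x, `|F n x| <= M) ->
  (forall x, F n x @[n --> \oo] --> f x) ->
  bmeas f /\ (\int[mu]_x F n x)%R @[n --> \oo] --> (\int[mu]_x f x)%R.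
Proof.
move=> mF FM Ff; have bf : bmeas f.
  split; first by apply: (measurable_fun_cvg mF) => x _; exact: Ff.
  exists M => x; apply: (cvgr_to_le (cvg_norm (Ff x))).
  by apply: nearW => n; exact: FM.
split => //.
have [|||||_ _ H] := @dominated_convergence _ _ _ mu setT measurableT
  (fun n => EFin \o F n) (EFin \o f) (EFin \o cst M).
- by move=> n; apply/measurable_EFinP.
- by apply/measurable_EFinP; exact: bf.1.
- by apply: aeW => x _ /=; apply: cvg_EFin; [exact: nearW|exact: Ff].
- exact: (bmeas_integrable (bmeas_cst M)).
- by apply: aeW => x n _ /=; rewrite lee_fin.
apply: fine_cvg; rewrite fineK//; apply: integrable_fin_num => //.
exact: bmeas_integrable.
Qed.

End finite.
End bounded_measurable.

Lemma cvg_sumr (R : realType) (S I : Type) (F : set_system S) {FF : Filter F}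
    (s : seq I) (f : I -> S -> R) (l : I -> R) :
  (forall i, f i @ F --> l i) ->
  (fun x => \sum_(i <- s) f i x) @ F --> \sum_(i <- s) l i.
Proof.
move=> fl; elim: s => [|a s ih].
  by rewrite big_nil; under eq_fun do rewrite big_nil; exact: cvg_cst.
by rewrite big_cons; under eq_fun do rewrite big_cons; exact: cvgD.
Qed.

Section euclidean_norm.
Context {R : realType} {n : nat}.
Implicit Types (x y z : 'rV[R]_n) (r s : R).

Lemma dotE x y : dot x y = \sum_i x 0 i * y 0 i.
Proof. by rewrite /dot mxE; apply: eq_bigr => i _; rewrite mxE. Qed.

Lemma dotDr x y z : dot x (y + z) = dot x y + dot x z.
Proof. by rewrite /dot linearD/= mulmxDr mxE. Qed.

Lemma dotNr x y : dot x (- y) = - dot x y.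
Proof. by rewrite /dot linearN/= mulmxN mxE. Qed.

Lemma dotBr x y z : dot x (y - z) = dot x y - dot x z.
Proof. by rewrite dotDr dotNr. Qed.

Lemma dot0r x : dot x 0 = 0.
Proof. by rewrite /dot linear0 mulmx0 mxE. Qed.

Lemma dotDl x y z : dot (x + y) z = dot x z + dot y z.
Proof. by rewrite /dot mulmxDl mxE. Qed.

Lemma dotNl x y : dot (- x) y = - dot x y.
Proof. by rewrite /dot mulNmx mxE. Qed.

Lemma dotBl x y z : dot (x - y) z = dot x z - dot y z.
Proof. by rewrite dotDl dotNl. Qed.

Lemma dotC x y : dot x y = dot y x.
Proof. by rewrite !dotE; apply: eq_bigr => i _; rewrite mulrC. Qed.

Lemma dotZr a x y : dot x (a *: y) = a * dot x y.
Proof. by rewrite !dotE mulr_sumr; apply: eq_bigr => i _; rewrite mxE mulrCA. Qed.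

Lemma sqr_enorm x : enorm x ^+ 2 = \sum_i x 0 i ^+ 2.
Proof. by rewrite sqr_sqrtr// sumr_ge0// => i _; rewrite sqr_ge0. Qed.

Lemma sqr_enormE x : enorm x ^+ 2 = dot x x.
Proof. by rewrite sqr_enorm dotE; apply: eq_bigr => i _; rewrite expr2. Qed.

Lemma enorm_ge0 x : 0 <= enorm x. Proof. exact: sqrtr_ge0. Qed.

Lemma enorm0 : enorm (0 : 'rV[R]_n) = 0.
Proof.
by rewrite /enorm big1 ?sqrtr0// => i _; rewrite mxE expr0n.
Qed.

Lemma enormN x : enorm (- x) = enorm x.
Proof. by rewrite /enorm; congr Num.sqrt; apply: eq_bigr => i _; rewrite mxE sqrrN. Qed.

Lemma enormB x y : enorm (x - y) = enorm (y - x).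
Proof. by rewrite -enormN opprB. Qed.

Lemma enormZ a x : enorm (a *: x) = `|a| * enorm x.
Proof.
rewrite /enorm -sqrtr_sqr -sqrtrM ?sqr_ge0// mulr_sumr; congr Num.sqrt.
by apply: eq_bigr => i _; rewrite mxE exprMn.
Qed.

Lemma le_coord_enorm x i : `|x 0 i| <= enorm x.
Proof.
rewrite -sqrtr_sqr /enorm ler_wsqrtr// (bigD1 i)//= lerDl sumr_ge0// => j _.
exact: sqr_ge0.
Qed.

Lemma enorm_eq0 x : enorm x = 0 -> x = 0.
Proof.
move=> x0; apply/rowP => i; rewrite mxE; apply/eqP; rewrite -normr_le0 -x0.
exact: le_coord_enorm.
Qed.

Lemma enorm_gt0 x : (0 < enorm x) = (x != 0).
Proof.
rewrite lt_neqAle enorm_ge0 andbT eq_sym; congr (~~ _).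
by apply/eqP/eqP => [/enorm_eq0//|->]; exact: enorm0.
Qed.

(** The squared norm of [enorm x ^+ 2 *: y - dot x y *: x] is [enorm x ^+ 2] times the difference of
    the two sides. *)
Lemma sqr_dot_le x y : dot x y ^+ 2 <= enorm x ^+ 2 * enorm y ^+ 2.
Proof.
have [->|x0] := eqVneq x 0.
  by rewrite dotC dot0r expr0n/= mulr_ge0// sqr_ge0.
have A0 : 0 < enorm x ^+ 2 by rewrite exprn_gt0// enorm_gt0.
have : 0 <= enorm (enorm x ^+ 2 *: y - dot x y *: x) ^+ 2 by exact: sqr_ge0.
rewrite sqr_enormE !(dotBl, dotBr) !(dotZr, dotC (_ *: _)) -!sqr_enormE.
rewrite (dotC y x) => H.
rewrite -subr_ge0 -(pmulr_rge0 _ A0); apply: le_trans H _.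
by rewrite le_eqVlt; apply/orP; left; apply/eqP; ring.
Qed.

Lemma norm_dot_le x y : `|dot x y| <= enorm x * enorm y.
Proof.
rewrite -(@ler_pXn2r _ 2) ?nnegrE ?normr_ge0 ?mulr_ge0 ?enorm_ge0//.
by rewrite real_normK ?num_real// exprMn sqr_dot_le.
Qed.

Lemma sqr_enormD x y :
  enorm (x + y) ^+ 2 = enorm x ^+ 2 + 2 * dot x y + enorm y ^+ 2.
Proof. by rewrite !sqr_enormE dotDl !dotDr (dotC y x); ring. Qed.

Lemma ler_enormD x y : enorm (x + y) <= enorm x + enorm y.
Proof.
rewrite -(@ler_pXn2r _ 2) ?nnegrE ?addr_ge0 ?enorm_ge0// sqr_enormD.
have := le_trans (ler_norm _) (norm_dot_le x y); lra.
Qed.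

Lemma ler_enormB x y : enorm (x - y) <= enorm x + enorm y.
Proof. by rewrite -(enormN y) ler_enormD. Qed.

Lemma enorm_lerB x y : enorm x - enorm y <= enorm (x - y).
Proof. by rewrite lerBlDr -{1}(subrK y x) ler_enormD. Qed.

Lemma enorm_lerD x y : enorm x - enorm y <= enorm (x + y).
Proof. by rewrite -{2}(opprK y) -(enormN y) enorm_lerB. Qed.

Lemma enorm_le_sum x : enorm x <= \sum_i `|x 0 i|.
Proof.
rewrite -(@ler_pXn2r _ 2) ?nnegrE ?enorm_ge0 ?sumr_ge0// sqr_enorm.
rewrite expr2 mulr_suml ler_sum// => i _.
rewrite -real_normK ?num_real// expr2 ler_wpM2l// (bigD1 i)//= lerDl sumr_ge0//.
Qed.

Lemma continuous_enorm : continuous (@enorm R n).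
Proof.
move=> x; apply: (@continuous_comp _ _ _ _ Num.sqrt); last exact: sqrt_continuous.
apply: (@cvg_sumr _ _ _ (nbhs x) _ _ (fun i (y : 'rV[R]_n) => y 0 i ^+ 2)
  (fun i => x 0 i ^+ 2)) => i.
rewrite expr2; under eq_fun do rewrite expr2.
by apply: cvgM; exact: coord_continuous.
Qed.

Lemma open_eball x r : open (eball x r).
Proof.
have cB : continuous (fun y => enorm (y - x)).
  move=> y; apply: (@cvg_comp _ _ _ (fun z => z - x) (@enorm R n) _ (nbhs (y - x))).
    exact: (cvgB cvg_id (cvg_cst x)).
  exact: continuous_enorm.
by move/continuousP : cB => /(_ [set a | a < r] (@open_lt _ r)).
Qed.

(** The topology is that of the max-norm, which is at most [enorm], so the Euclidean ball of the
    same radius fits. *)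
Lemma nbhs_eball x (A : set 'rV[R]_n) : nbhs x A ->
  exists2 e, 0 < e & eball x e `<=` A.
Proof.
move=> /nbhs_ballP[e /= e0 xA]; exists e => // y /= xy; apply: xA.
split => // i j; rewrite !ord1 /= -ball_normE/= distrC.
by have := le_lt_trans (le_coord_enorm (y - x) j) xy; rewrite !mxE.
Qed.

Lemma measurable_continuous_rV (f : 'rV[R]_n -> R) :
  continuous f -> measurable_fun setT f.
Proof.
move=> cf; apply: (measurability (@RGenOpens.G R)); first exact: RGenOpens.measurableE.
move=> _ [_ [a [b ->]] <-]; rewrite setTI; apply: open_rV_measurable.
apply: open_comp; last exact: interval_open.
by move=> x _; exact: cf.
Qed.

Lemma measurable_enorm : measurable_fun setT (@enorm R n).
Proof. by apply: measurable_continuous_rV; exact: continuous_enorm. Qed.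

Lemma measurable_eball x r : measurable (eball x r).
Proof. by apply: open_rV_measurable; exact: open_eball. Qed.

Lemma measurable_rVD d (T : measurableType d) (f g : T -> 'rV[R]_n) :
  measurable_fun setT f -> measurable_fun setT g ->
  measurable_fun setT (fun t => f t + g t).
Proof.
move=> mf mg; apply: measurable_fun_rV => i.
under eq_fun do rewrite mxE.
by apply: measurable_funD; exact: (measurableT_comp (measurable_coord i)).
Qed.

Lemma measurable_rVN d (T : measurableType d) (f : T -> 'rV[R]_n) :
  measurable_fun setT f -> measurable_fun setT (fun t => - f t).
Proof.
move=> mf; apply: measurable_fun_rV => i.
under eq_fun do rewrite mxE.
by apply: measurableT_comp => //; exact: (measurableT_comp (measurable_coord i)).
Qed.

Lemma measurable_rVB d (T : measurableType d) (f g : T -> 'rV[R]_n) :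
  measurable_fun setT f -> measurable_fun setT g ->
  measurable_fun setT (fun t => f t - g t).
Proof. by move=> mf mg; apply: measurable_rVD => //; exact: measurable_rVN. Qed.

Lemma measurable_dot x : measurable_fun setT (dot x).
Proof.
rewrite (_ : dot x = fun y => \sum_i x 0 i * y 0 i); last by apply/funext => y; rewrite dotE.
apply: measurable_sum => i.
by apply: measurable_funM => //; exact: measurable_coord.
Qed.

End euclidean_norm.

(** * Integration against a density *)

Section density.
Context d (T : measurableType d) (R : realType).
Local Open Scope ereal_scope.
Variables (m m' : {measure set T -> \bar R}) (w : T -> R).
Hypothesis mw : measurable_fun setT w.
Hypothesis w0 : forall x, (0 <= w x)%R.
Hypothesis m'E : forall B, measurable B -> m' B = \int[m]_(x in B) (w x)%:E.

Import HBNNSimple.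

(** Simple functions first, where [m'E] applies to each level set, then monotone convergence along
    [nnsfun_approx]. *)
Lemma ge0_integral_density (f : T -> \bar R) : measurable_fun setT f ->
  (forall x, 0 <= f x) -> \int[m']_x f x = \int[m]_x (f x * (w x)%:E).
Proof.
move=> mf f0; pose f_ := nnsfun_approx measurableT mf.
have step (h : {nnsfun T >-> R}) : \int[m']_x (h x)%:E = \int[m]_x ((h x)%:E * (w x)%:E).
  transitivity (\int[m']_x (\sum_(k \in range h) (k * \1_(h @^-1` [set k]) x)%:E)).
    by apply: eq_integral => x _; rewrite (fimfunE h) fsumEFin.
  rewrite ge0_integral_fsum//; last 2 first.
  - move=> r; apply/measurable_EFinP; exact: measurable_funM.
  - by move=> k x _; rewrite EFinM; exact: nnfun_muleindic_ge0.
  transitivity (\int[m]_x ((\sum_(k \in range h) (k * \1_(h @^-1` [set k]) x)%:E) * (w x)%:E)).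
    under [RHS]eq_integral.
      move=> x _; rewrite ge0_mule_fsuml; last first.
        by move=> k; rewrite EFinM; exact: nnfun_muleindic_ge0.
      over.
    rewrite ge0_integral_fsum//; last 2 first.
    - move=> r; apply: emeasurable_funM; apply/measurable_EFinP => //.
      exact: measurable_funM.
    - move=> k x _; apply: mule_ge0; last by rewrite lee_fin.
      by rewrite EFinM; exact: nnfun_muleindic_ge0.
    apply: eq_fsbigr => k _.
    under eq_integral do rewrite EFinM.
    under [RHS]eq_integral do rewrite EFinM -muleA.
    (* Here [k] is not known to be a value of [h]: for negative [k] the level set is empty, for the
       others [k] can leave the integral. *)
    have [k0|k0] := ltP k 0%R.
      rewrite preimage_nnfun0// !integral0_eq// => x _.
        by rewrite indic0 mul0e mule0.
      by rewrite indic0 mule0.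
    rewrite !ge0_integralZl//; try (first [exact/measurable_EFinP
      | by apply: emeasurable_funM; exact/measurable_EFinP
      | by move=> x _; apply: mule_ge0; rewrite ?lee_fin]).
    congr (_ * _); rewrite integral_indic// setIT m'E//.
    rewrite [LHS]integral_mkcond; apply: eq_integral => x _.
    rewrite /patch indicE; case: ifPn => _; first by rewrite mul1e.
    by rewrite mul0e.
  by apply: eq_integral => x _; rewrite [in RHS](fimfunE h) fsumEFin.
have cvgf x : (EFin \o f_^~ x) @ \oo --> f x by exact: cvg_nnsfun_approx.
have nd x : {homo (fun n => (f_ n x)%:E) : a b / (a <= b)%N >-> a <= b}.
  move=> a b ab; rewrite lee_fin; exact: (lefP _ _ (nd_nnsfun_approx measurableT mf ab)).
transitivity (limn (fun n => \int[m']_x (f_ n x)%:E)).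
  rewrite -monotone_convergence//.
  - by apply: eq_integral => x _; apply/esym/cvg_lim => //; exact: cvgf.
  - by move=> k; apply/measurable_EFinP.
  - by move=> k x _; rewrite lee_fin.
rewrite (_ : (fun n => _) = (fun n => \int[m]_x ((f_ n x)%:E * (w x)%:E))); last first.
  by apply/funext => k; rewrite step.
rewrite -monotone_convergence//.
- apply: eq_integral => x _; apply: cvg_lim => //.
  by apply: cvgeZr => //; exact: cvgf.
- by move=> k; apply: emeasurable_funM; exact/measurable_EFinP.
- by move=> k x _; apply: mule_ge0; rewrite ?lee_fin.
- by move=> x _ a b ab; apply: lee_wpmul2r; rewrite ?lee_fin//; exact: nd.
Qed.

End density.

(** * Translations and reflections of Lebesgue measure *)

Section lebesgue_translation.
Context {R : realType}.
Local Open Scope ereal_scope.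

(** Lebesgue measure is determined by its values on half-open intervals, so its pushforward under
    [f] is Lebesgue measure itself. *)
Lemma ge0_integral_measure_preserving (f : measurableTypeR R -> measurableTypeR R)
    (g : measurableTypeR R -> \bar R) :
  measurable_fun setT f ->
  (forall A, ocitv A -> pushforward lebesgue_measure f A = lebesgue_measure A) ->
  measurable_fun setT g -> (forall x, 0 <= g x) ->
  \int[lebesgue_measure]_x g (f x) = \int[lebesgue_measure]_x g x.
Proof.
move=> mf fE mg g0.
pose f_mixin := isMeasurableFun.Build _ _ _ _ _ mf.
pose f' : {mfun measurableTypeR R >-> measurableTypeR R} := HB.pack f f_mixin.
transitivity (\int[pushforward lebesgue_measure f']_x g x).
  by rewrite ge0_integral_pushforward.
apply: eq_measure_integral => A mA _.
by apply/esym/lebesgue_measure_unique => // B oB; exact/esym/fE.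
Qed.

Lemma ge0_integral_translation1 (c : R) (f : measurableTypeR R -> \bar R) :
  measurable_fun setT f -> (forall x, 0 <= f x) ->
  \int[lebesgue_measure]_x f (c + x)%R = \int[lebesgue_measure]_x f x.
Proof.
move=> mf f0; apply: (ge0_integral_measure_preserving (f := fun x => (c + x)%R)) => //.
  exact: measurable_funD.
move=> _ [[a b]] _ <-.
rewrite /pushforward (_ : _ @^-1` _ = `](a - c)%R, (b - c)%R]%classic); last first.
  by apply/seteqP; split => x /=; rewrite !in_itv/= ltrBlDl lerBrDl.
rewrite !lebesgue_measure_itv/= !lte_fin ltrD2r; case: ifPn => // _.
by rewrite -!EFinB; congr (_%:E); ring.
Qed.

Lemma ge0_integral_opp1 (f : measurableTypeR R -> \bar R) :
  measurable_fun setT f -> (forall x, 0 <= f x) ->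
  \int[lebesgue_measure]_x f (- x)%R = \int[lebesgue_measure]_x f x.
Proof.
move=> mf f0; apply: (ge0_integral_measure_preserving (f := fun x => (- x)%R)) => //.
  exact: (@measurableT_comp _ _ _ _ _ _ (@GRing.opp R) _ id).
by move=> A oA; apply: lebesgue_measureN; exact: sub_sigma_algebra.
Qed.

Lemma ge0_integral_rV_cons n (f : 'rV[R]_n.+1 -> \bar R) :
  measurable_fun setT f -> (forall x, 0 <= f x) ->
  \int[lebesgue_rV n.+1]_x f x =
  \int[lebesgue_measure]_a \int[lebesgue_rV n]_x f (rV_cons (a, x)).
Proof.
move=> mf f0; rewrite /= /lebesgue_cons.
rewrite ge0_integral_pushforward//; last exact: measurable_rV_cons.
rewrite preimage_setT fubini_tonelli1//; last by move=> z; exact: f0.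
by apply: measurableT_comp => //; exact: measurable_rV_cons.
Qed.

Lemma measurable_rV_cons1 n (a : R) : measurable_fun setT (fun x : 'rV[R]_n => rV_cons (a, x)).
Proof. by apply: measurableT_comp; [exact: measurable_rV_cons|exact: measurable_fun_pair]. Qed.

Lemma measurable_int_rV_cons n (f : 'rV[R]_n.+1 -> \bar R) :
  measurable_fun setT f -> (forall x, 0 <= f x) ->
  measurable_fun setT (fun a : measurableTypeR R => \int[lebesgue_rV n]_x f (rV_cons (a, x))).
Proof.
move=> mf f0.
apply: (measurable_fun_fubini_tonelli_F (f \o @rV_cons R n)); last by move=> z; exact: f0.
by apply: measurableT_comp => //; exact: measurable_rV_cons.
Qed.

Opaque lebesgue_rV.

(** Induction on the dimension: [ih] translates the tail for each fixed head, then the head is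
    translated on the line. *)
Lemma ge0_integral_translation n (v : 'rV[R]_n) (f : 'rV[R]_n -> \bar R) :
  measurable_fun setT f -> (forall x, 0 <= f x) ->
  \int[lebesgue_rV n]_x f (v + x)%R = \int[lebesgue_rV n]_x f x.
Proof.
elim: n v f => [|n ih] v f mf f0.
  by apply: eq_integral => x _; congr f; apply/rowP => -[].
have mvf : measurable_fun setT (fun x => f (v + x)%R).
  by apply: measurableT_comp => //; exact: measurable_rVD.
rewrite (ge0_integral_rV_cons mf f0) (ge0_integral_rV_cons mvf (fun x => f0 _)).
pose F (a : measurableTypeR R) := \int[lebesgue_rV n]_x f (rV_cons (a, x)).
transitivity (\int[lebesgue_measure]_a F (v 0 ord0 + a)%R); last first.
  rewrite ge0_integral_translation1//; first exact: measurable_int_rV_cons.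
  by move=> a; exact: integral_ge0.
apply: eq_integral => a _; rewrite /F.
rewrite -[RHS](ih (rsubmx (v : 'rV_(1 + n))))//; last first.
  by apply: measurableT_comp => //; exact: measurable_rV_cons1.
apply: eq_integral => x _; congr f; apply/rowP => i.
rewrite /rV_cons !mxE; case: splitP => j ij; rewrite !mxE//=.
  by congr (v 0 _ + _)%R; apply/val_inj; rewrite /= ij ord1.
by congr (v 0 _ + _)%R; apply/val_inj; rewrite /= ij.
Qed.

Lemma ge0_integral_opp n (f : 'rV[R]_n -> \bar R) :
  measurable_fun setT f -> (forall x, 0 <= f x) ->
  \int[lebesgue_rV n]_x f (- x)%R = \int[lebesgue_rV n]_x f x.
Proof.
elim: n f => [|n ih] f mf f0.
  by apply: eq_integral => x _; congr f; apply/rowP => -[].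
have mvf : measurable_fun setT (fun x : 'rV[R]_n.+1 => f (- x)%R).
  by apply: measurableT_comp => //; exact: measurable_rVN.
rewrite (ge0_integral_rV_cons mf f0) (ge0_integral_rV_cons mvf (fun x => f0 _)).
pose F (a : measurableTypeR R) := \int[lebesgue_rV n]_x f (rV_cons (a, x)).
transitivity (\int[lebesgue_measure]_a F (- a)%R); last first.
  rewrite ge0_integral_opp1//; first exact: measurable_int_rV_cons.
  by move=> a; exact: integral_ge0.
apply: eq_integral => a _; rewrite /F.
rewrite -[RHS]ih//; last first.
  by apply: measurableT_comp => //; exact: measurable_rV_cons1.
apply: eq_integral => x _; congr f; apply/rowP => i.
by rewrite /rV_cons !mxE; case: splitP => j ij; rewrite !mxE.
Qed.

Lemma ge0_integral_reflection n (v : 'rV[R]_n) (f : 'rV[R]_n -> \bar R) :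
  measurable_fun setT f -> (forall x, 0 <= f x) ->
  \int[lebesgue_rV n]_x f (v - x)%R = \int[lebesgue_rV n]_x f x.
Proof.
move=> mf f0; rewrite (ge0_integral_opp (f := fun x => f (v + x)%R))//.
  exact: ge0_integral_translation.
by apply: measurableT_comp => //; exact: measurable_rVD.
Qed.

End lebesgue_translation.

(** * Volumes of Euclidean balls *)

Section lebesgue_balls.
Context {R : realType} {n : nat}.
Local Notation leb := (@lebesgue_rV R n).
Implicit Types (x y : 'rV[R]_n) (r s : R).

Lemma lebesgue_eball_center x r : leb (eball x r) = leb (eball 0 r).
Proof.
have mB := measurable_eball x r; have mB0 := measurable_eball (0 : 'rV[R]_n) r.
have iE A : measurable A -> leb A = (\int[leb]_y (\1_A y)%:E)%E.
  by move=> mA; rewrite integral_indic ?setIT.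
rewrite (iE _ mB) (iE _ mB0) -[in LHS](ge0_integral_translation x); last 2 first.
- by apply/measurable_EFinP; exact: measurable_indic.
- by move=> y; rewrite lee_fin.
apply: eq_integral => y _; rewrite !indicE; congr ((_ : bool)%:R%:E).
by apply/idP/idP; rewrite !inE /eball/= subr0 addrAC subrr add0r.
Qed.

Lemma lebesgue_cube (I : interval R) :
  leb [set x | forall i, x 0 i \in I] = (lebesgue_measure [set` I] ^+ n)%E.
Proof.
transitivity (leb [set x : 'rV[R]_n | forall i : 'I_n, [set` I] (x 0%R i)]); first by [].
rewrite (lebesgue_rV_box n (A := fun _ => [set` I]))//.
by rewrite big_const card_ord; elim: n => // m ih; rewrite iterS ih expeS.
Qed.

Lemma lebesgue_eball_lty x r : (leb (eball x r) < +oo)%E.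
Proof.
rewrite lebesgue_eball_center.
pose I := `]- `|r|, `|r|[ : interval R.
apply: (@le_lt_trans _ _ (leb [set x : 'rV[R]_n | forall i, x 0 i \in I])).
  apply: le_measure; rewrite ?inE; first exact: measurable_eball.
    rewrite (_ : mkset _ = \bigcap_(i in [set: 'I_n])
        ((fun x : 'rV[R]_n => x 0 i : R) @^-1` [set` I])); last first.
      by apply/seteqP; split=> [z /= H i _|z /= H i]; exact: H.
    apply: fin_bigcap_measurable => // i _.
    by rewrite -[X in measurable X]setTI; exact: (measurable_coord i).
  move=> z; rewrite /eball/= subr0 => zr i.
  rewrite in_itv/= -ltr_norml (le_lt_trans (le_coord_enorm _ _))//.
  by rewrite (lt_le_trans zr)// ler_norm.
rewrite lebesgue_cube lebesgue_measure_itv/=; case: ifP => _.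
  by rewrite -EFinB -EFin_expe ltry.
by rewrite -EFin_expe ltry.
Qed.

(** The ball contains the cube of side [r / n.+1] at the origin, because [enorm] is at most the sum
    of the coordinates; [n.+1] keeps that sum strictly below [r], also when [n = 0]. *)
Lemma lebesgue_eball_ge r : 0 < r ->
  (((r / n.+1%:R) ^+ n)%:E <= leb (eball 0%R r))%E.
Proof.
move=> r0; pose e := r / n.+1%:R; have e0 : 0 < e by rewrite divr_gt0.
pose I := `]0, e[ : interval R.
apply: (@le_trans _ _ (leb [set x : 'rV[R]_n | forall i, x 0 i \in I])).
  by rewrite lebesgue_cube lebesgue_measure_itv/= lte_fin e0 sube0 -EFin_expe.
apply: le_measure; rewrite ?inE; last 2 first.
- exact: measurable_eball.
- move=> z /= zI; rewrite /eball/= subr0.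
  apply: (le_lt_trans (enorm_le_sum z)).
  apply: (@le_lt_trans _ _ (\sum_(i < n) e)).
    apply: ler_sum => i _; have := zI i; rewrite in_itv/= => /andP[z0 ze].
    by rewrite gtr0_norm// ltW.
  rewrite sumr_const card_ord -[_ *+ _]mulr_natr /e -mulrA gtr_pMr//.
  by rewrite mulrC ltr_pdivrMr// mul1r ltr_nat.
rewrite (_ : mkset _ = \bigcap_(i in [set: 'I_n])
    ((fun x : 'rV[R]_n => x 0 i : R) @^-1` [set` I])); last first.
  by apply/seteqP; split=> [z /= H i _|z /= H i]; exact: H.
apply: fin_bigcap_measurable => // i _.
by rewrite -[X in measurable X]setTI; exact: (measurable_coord i).
Qed.

Lemma lebesgue_eball_gt0 x r : 0 < r -> (0 < leb (eball x r))%E.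
Proof.
move=> r0; rewrite lebesgue_eball_center; apply: lt_le_trans (lebesgue_eball_ge r0).
by rewrite lte_fin exprn_gt0// divr_gt0.
Qed.

End lebesgue_balls.

(** * Path space and the Markov property *)

Section right_continuity.
Context {R : realType} {n : nat}.
Implicit Types (f : R -> 'rV[R]_n).

Lemma cvg_at_rightP f t (l : 'rV[R]_n) : f @ t^'+ --> l <->
  forall e : R, 0 < e -> exists2 d : R, 0 < d &
    forall u, t < u -> u < t + d -> enorm (f u - l) < e.
Proof.
split=> [fl e e0|H A /nbhs_eball[e e0 eA]].
  have /fl/nbhs_ballP[d /= d0 dP] : nbhs l (eball l e).
    by apply: open_nbhs_nbhs; split; [exact: open_eball|rewrite /eball/= subrr enorm0].
  exists d => // u tu ud; apply: dP => //=.
  by rewrite -ball_normE/= distrC ger0_norm ?subr_ge0 ?(ltW tu)// ltrBlDl.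
have [d d0 dP] := H e e0.
apply/nbhs_ballP; exists d => //= u; rewrite -ball_normE/= distrC => ud tu.
by apply: eA; apply: dP => //; rewrite -ltrBlDl (le_lt_trans (ler_norm _)).
Qed.

End right_continuity.

Definition path_axiom (R : realType) n (f : R -> 'rV[R]_n) : Prop :=
  (forall t, t <= 0 -> f t = 0) /\ (forall t, f @ t^'+ --> f t).

(* Right-continuous paths issued from 0, extended by 0 to negative times. *)
Record path (R : realType) (n : nat) := Path {
  path_fun :> R -> 'rV[R]_n ;
  path_funP : path_axiom path_fun }.

Section path_measurable.
Context {R : realType} {n : nat}.
Local Notation path := (path R n).

Lemma path_axiom0 : path_axiom (fun _ : R => 0 : 'rV[R]_n).
Proof. by split => // t; exact: cvg_cst. Qed.

HB.instance Definition _ := gen_eqMixin path.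
HB.instance Definition _ := gen_choiceMixin path.
HB.instance Definition _ := isPointed.Build path (Path path_axiom0).

Definition path_cylinders : set (set path) :=
  [set A | exists t B, measurable B /\ A = [set w : path | B (w t)]].

Let path_measurable0 : <<s path_cylinders >> set0.
Proof. exact: sigma_algebra0. Qed.

Let path_measurableC A : <<s path_cylinders >> A -> <<s path_cylinders >> (~` A).
Proof. exact: sigma_algebraC. Qed.

Let path_measurable_bigcup (F : (set path)^nat) :
  (forall i, <<s path_cylinders >> (F i)) -> <<s path_cylinders >> (\bigcup_i F i).
Proof. exact: sigma_algebra_bigcup. Qed.

HB.instance Definition _ := @isMeasurable.Build (sigma_display path_cylinders) path
  <<s path_cylinders >> path_measurable0 path_measurableC path_measurable_bigcup.

Lemma path0 (w : path) t : t <= 0 -> w t = 0.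
Proof. by case: w => f [/= f0 _]; exact: f0. Qed.

Lemma path_rcont (w : path) t : w @ t^'+ --> w t.
Proof. by case: w => f [/= _]; exact. Qed.

Lemma measurable_path_eval t : measurable_fun setT (fun w : path => w t).
Proof.
move=> _ B mB; rewrite setTI; apply: sub_sigma_algebra.
by exists t, B.
Qed.

Lemma measurable_to_path d (T : measurableType d) (f : T -> path) :
  (forall t, measurable_fun setT (fun x => f x t)) -> measurable_fun setT f.
Proof.
move=> mf; apply: (@measurability _ _ _ _ _ f path_cylinders) => //.
by move=> _ [_ [t [B [mB ->]]] <-]; exact: mf.
Qed.

(** The first point of the grid of mesh [1 / m.+1] strictly after [s]. Rounding up lets right
    continuity of the paths apply. *)
Definition right_grid (m : nat) (s : R) : R :=
  (Num.floor (s * m.+1%:R) + 1)%:~R / m.+1%:R.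

Lemma right_gridP m s : s < right_grid m s <= s + m.+1%:R^-1.
Proof.
rewrite /right_grid ltr_pdivlMr// ler_pdivrMr// mulrDl mulVf//.
by rewrite lt_succ_floor/= intrD lerD2r ge_floor.
Qed.

Lemma cvg_path_right_grid (w : path) s i :
  w (right_grid m s) 0 i @[m --> \oo] --> w s 0 i.
Proof.
apply/cvgrPdist_lt => e e0.
have /cvg_at_rightP/(_ e e0)[d d0 dP] := @path_rcont w s.
near=> m; have /andP[h1 h2] := right_gridP m s.
have := le_lt_trans (le_coord_enorm _ i) (dP _ h1 _).
rewrite !mxE distrC; apply; rewrite (le_lt_trans h2)// ltrD2l.
by near: m; exact: near_infty_natSinv_lt (PosNum d0).
Unshelve. all: by end_near. Qed.

(** By right continuity, [w s] is the limit of the values of [w] at grid points. The approximations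
    depend on [s] only through its grid cell, so preimages are countable unions of rectangles. *)
Lemma measurable_path_joint :
  measurable_fun setT (fun z : measurableTypeR R * path => z.2 z.1).
Proof.
apply: measurable_fun_rV => i.
apply: (@measurable_fun_cvg _ _ _ setT
  (fun m (z : measurableTypeR R * path) => z.2 (right_grid m z.1) 0 i)); last first.
  by move=> z _; exact: cvg_path_right_grid.
move=> m _ B mB; rewrite setTI.
rewrite (_ : _ @^-1` B = \bigcup_(k in [set: int])
   ([set s : measurableTypeR R | Num.floor (s * m.+1%:R) = k] `*`
    [set w : path | B (w ((k + 1)%:~R / m.+1%:R) 0 i)])); last first.
  apply/seteqP; split=> [[s w] /= H|[s w] [k _ [/= <-]]//].
  by exists (Num.floor (s * m.+1%:R)).
apply: countable_bigcupT_measurable => [|k]; first exact: countableP.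
apply: measurableX.
  rewrite (_ : [set _ | _] = `[k%:~R / m.+1%:R, (k + 1)%:~R / m.+1%:R[%classic)//.
  apply/seteqP; split=> s /=; rewrite in_itv/= ler_pdivrMr// ltr_pdivlMr//.
    by move=> <-; rewrite ge_floor lt_succ_floor.
  by move=> H; apply: floor_def.
have := measurableT_comp (measurable_coord i) (measurable_path_eval ((k + 1)%:~R / m.+1%:R)).
by move=> /(_ measurableT B mB); rewrite setTI.
Qed.

End path_measurable.

(** * Laws on path space determined by dyadic increments *)

Section path_measure_uniqueness.
Context {R : realType} {n : nat}.
Local Notation path := (path R n).
Variable delta : R.
Hypothesis delta0 : 0 < delta.

(** The mesh is [delta] over a power of two, with [delta] arbitrary: a prescribed time can thus be
    made a grid point, as [concat_measure] requires. *)
Definition dyadic (m j : nat) : R := delta * (j%:R / 2 ^+ m).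

Definition increment (m j : nat) (w : path) : 'rV[R]_n :=
  w (dyadic m j.+1) - w (dyadic m j).

Definition increment_box (m k : nat) (B : nat -> set 'rV[R]_n) : set path :=
  \bigcap_(i in `I_k) [set w | B i (increment m i w)].

Definition increment_boxes (m : nat) : set (set path) :=
  [set A | exists k B, (forall i, measurable (B i)) /\ A = increment_box m k B].

Lemma dyadicS m j : dyadic m.+1 j.*2 = dyadic m j.
Proof.
rewrite /dyadic; congr (_ * _); rewrite exprS -muln2 natrM.
by field; rewrite expf_neq0.
Qed.

Lemma increment_boxes_setI m : setI_closed (increment_boxes m).
Proof.
move=> _ _ [k [B [mB ->]]] [l [C [mC ->]]].
exists (maxn k l), (fun i => (if (i < k)%N then B i else setT) `&`
  (if (i < l)%N then C i else setT)); split.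
  by move=> i; apply: measurableI; case: ifP.
apply/seteqP; split=> w.
  by move=> [wB wC] i _; split => /=; case: ifPn => // il; [exact: wB|exact: wC].
move=> H; split=> i /= il.
  by have [] := H i (leq_trans il (leq_maxl _ _)); rewrite il.
by have [_] := H i (leq_trans il (leq_maxr _ _)); rewrite il.
Qed.

Lemma increment_sigma_measurable m j :
  measurable_fun setT
    ((fun w => increment m j w) : g_sigma_algebraType (increment_boxes m) -> 'rV[R]_n).
Proof.
move=> _ B mB; rewrite setTI; apply: sub_sigma_algebra.
exists j.+1, (fun i => if i == j then B else setT); split.
  by move=> i; case: ifP.
apply/seteqP; split => w /=.
  by move=> Bw i _ /=; case: eqP => // ->.
by move=> /(_ j (ltnSn j)) /=; rewrite eqxx.
Qed.

(** An increment over a dyadic interval is the sum of the increments over its two halves. *)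
Lemma increment_sigma_subS m :
  <<s increment_boxes m >> `<=` <<s increment_boxes m.+1 >>.
Proof.
apply: smallest_sub; first exact: smallest_sigma_algebra.
move=> _ [k [B [mB ->]]].
apply: (@fin_bigcap_measurable _ (g_sigma_algebraType (increment_boxes m.+1))).
  exact: finite_II.
move=> i _.
have E w : increment m.+1 i.*2 w + increment m.+1 i.*2.+1 w = increment m i w.
  by rewrite /increment -doubleS !dyadicS addrC subrKA.
have := measurable_rVD (@increment_sigma_measurable m.+1 i.*2)
  (@increment_sigma_measurable m.+1 i.*2.+1).
move=> /(_ measurableT (B i) (mB i)); rewrite setTI.
rewrite (_ : _ @^-1` _ = [set w | B i (increment m i w)])//.
by apply/seteqP; split => w /=; rewrite E.
Qed.

Lemma increment_sigma_sub m m' : (m <= m')%N ->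
  <<s increment_boxes m >> `<=` <<s increment_boxes m' >>.
Proof.
move=> /subnKC <-; elim: (m' - m)%N => [|k ih]; first by rewrite addn0.
by rewrite addnS; apply: subset_trans ih _; exact: increment_sigma_subS.
Qed.

Lemma measurable_increment_box m k (B : nat -> set 'rV[R]_n) :
  (forall i, measurable (B i)) -> measurable (increment_box m k B).
Proof.
move=> mB; apply: fin_bigcap_measurable; first exact: finite_II.
move=> i _; have := measurable_rVB (@measurable_path_eval R n (dyadic m i.+1))
  (@measurable_path_eval R n (dyadic m i)).
by move=> /(_ measurableT (B i) (mB i)); rewrite setTI.
Qed.

(** Paths start at 0, so a value at a dyadic time is a sum of increments; any other positive time is
    approached by dyadic times from the right. *)
Lemma path_sigma_increments :
  (@measurable _ path) = <<s \bigcup_m <<s increment_boxes m >> >>.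
Proof.
pose G : set (set path) := \bigcup_m <<s increment_boxes m >>.
have mev m j : measurable_fun setT
    ((fun w : path => w (dyadic m j)) : g_sigma_algebraType G -> 'rV[R]_n).
  elim: j => [|j ih].
    rewrite (_ : (fun _ => _) = cst 0)//; apply/funext => w.
    by rewrite path0// /dyadic mul0r mulr0.
  rewrite (_ : (fun _ => _) = (fun w : path => increment m j w + w (dyadic m j))); last first.
    by apply/funext => w; rewrite /increment subrK.
  apply: measurable_rVD => // _ B mB; rewrite setTI.
  apply: sub_sigma_algebra; exists m => //.
  by have := @increment_sigma_measurable m j measurableT B mB; rewrite setTI.
have mev' t : measurable_fun setT
    ((fun w : path => w t) : g_sigma_algebraType G -> 'rV[R]_n).
  have [t0|t0] := leP t 0.
    rewrite (_ : (fun _ => _) = cst 0)//; apply/funext => w.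
    by rewrite path0.
  apply: measurable_fun_rV => i.
  (* The successor puts [dyadic m (j m)] strictly to the right of [t]. *)
  pose j m := (Num.truncn (t / delta * 2 ^+ m)).+1.
  apply: (@measurable_fun_cvg _ _ _ setT
     (fun m (w : g_sigma_algebraType G) => (w : path) (dyadic m (j m)) 0 i)).
    by move=> m; apply: (measurableT_comp (measurable_coord i)); exact: mev.
  move=> w _; apply/cvgrPdist_lt => e e0.
  have /cvg_at_rightP/(_ e e0)[d d0 dP] := @path_rcont _ _ (w : path) t.
  have p0 m : 0 < 2 ^+ m :> R by rewrite exprn_gt0.
  have jP m : t < dyadic m (j m) <= t + delta * (2 ^+ m)^-1.
    have h0 : 0 <= t / delta * 2 ^+ m by rewrite mulr_ge0 ?divr_ge0 ?ltW.
    have /andP[a b] := truncn_itv h0.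
    rewrite /dyadic /j; apply/andP; split.
      by rewrite -ltr_pdivrMl// mulrC ltr_pdivlMr.
    rewrite -natr1 mulrDl mulrDr mul1r lerD2r mulrA ler_pdivrMr//.
    by rewrite -ler_pdivlMl// mulrA (mulrC delta^-1).
  near=> m; have /andP[h1 h2] := jP m.
  have := le_lt_trans (le_coord_enorm _ i) (dP _ h1 _).
  rewrite !mxE distrC; apply; rewrite (le_lt_trans h2)// ltrD2l.
  rewrite -ltr_pdivlMl// mulrC.
  near: m.
  have dd : 0 < d / delta by rewrite divr_gt0.
  have := @cvg_geometric R 1 (2^-1) _.
  rewrite gtr0_norm// invf_lt1// ltr1n => /(_ isT).
  move=> /cvgrPdist_lt /(_ _ dd); apply: filterS => m.
  by rewrite /geometric/= mul1r sub0r normrN exprVn gtr0_norm// invr_gt0.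
apply/seteqP; split.
  apply: smallest_sub; first exact: smallest_sigma_algebra.
  move=> _ [t [B [mB ->]]].
  by have := mev' t measurableT B mB; rewrite setTI.
apply: smallest_sub; first exact: sigma_algebra_measurable.
move=> A [m _]; apply: smallest_sub; first exact: sigma_algebra_measurable.
move=> _ [k [B [mB ->]]]; exact: measurable_increment_box.
Unshelve. all: by end_near. Qed.

(** Increment boxes of one level form a pi-system. The sigma-algebras they generate increase with
    the level, so their union is again a pi-system, and it generates everything: uniqueness is
    applied twice. *)
Lemma path_measure_unique (m1 m2 : {finite_measure set path -> \bar R}) :
  (forall m k B, (forall i, measurable (B i)) ->
    m1 (increment_box m k B) = m2 (increment_box m k B)) ->
  forall A, measurable A -> m1 A = m2 A.
Proof.
move=> m12.
have fin (mu : {finite_measure set path -> \bar R}) : (mu setT < +oo)%E.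
  by rewrite -ge0_fin_numE//; exact: fin_num_measure.
have step m A : <<s increment_boxes m >> A -> m1 A = m2 A.
  move=> mA; apply: (g_sigma_algebra_measure_unique (increment_boxes m) _ (fun=> setT)) => //.
  - move=> B iB; rewrite path_sigma_increments; apply: sub_sigma_algebra.
    by exists m => //; exact: sub_sigma_algebra.
  - move=> _; exists 0%N, (fun=> setT); split => //.
    by apply/seteqP; split.
  - by rewrite bigcup_const//; exists 0%N.
  - exact: increment_boxes_setI.
  - by move=> _ [k [B [mB ->]]]; exact: m12.
  - by move=> _; exact: fin.
move=> A mA; apply: (measure_unique (\bigcup_m <<s increment_boxes m >>) (fun=> setT)) => //.
- exact: path_sigma_increments.
- move=> B C [i _ Bi] [j _ Cj]; exists (maxn i j) => //.
  apply: (@measurableI _ (g_sigma_algebraType (increment_boxes (maxn i j)))).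
    exact: increment_sigma_sub (leq_maxl _ _) _ Bi.
  exact: increment_sigma_sub (leq_maxr _ _) _ Cj.
- by move=> _; exists 0%N => //; exact: (@measurableT _ (g_sigma_algebraType (increment_boxes 0))).
- by rewrite bigcup_const//; exists 0%N.
- by move=> B [m _ mB]; exact: step mB.
- by move=> _; exact: fin.
Qed.

End path_measure_uniqueness.

(** * Integrals of functions that are measurable off a null set *)

Section integral_off_null.
Context d (T : measurableType d) (R : realType) (mu : {measure set T -> \bar R}).
Local Open Scope ereal_scope.

Import HBNNSimple.

(** The integral of [f], possibly not measurable, is the supremum over simple functions below it.
    Away from [N] these lie below [g]; conversely a simple function below [g] can be cut to 0 on
    [N]. This carries functionals of [X] to path space although the paths of [X] may be bad on a
    null set. *)
Lemma ge0_integral_off_null (N : set T) (f g : T -> \bar R) :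
  measurable N -> mu N = 0 -> measurable_fun setT g ->
  (forall x, 0 <= f x) -> (forall x, 0 <= g x) ->
  (forall x, ~ N x -> f x = g x) -> \int[mu]_x f x = \int[mu]_x g x.
Proof.
move=> mN N0 mg f0 g0 fg; apply/eqP; rewrite eq_le; apply/andP; split.
  rewrite ge0_integralTE//; apply: ge_ereal_sup => _ [h /= hf <-].
  rewrite -integralT_nnsfun (ge0_negligible_integral _ _ _ _ N0)//; last 2 first.
  - exact/measurable_EFinP.
  - by move=> x _; rewrite lee_fin.
  rewrite [leRHS](ge0_negligible_integral _ _ _ _ N0)//.
  apply: ge0_le_integral.
  - exact: measurableD.
  - by move=> x _; rewrite lee_fin.
  - exact/measurable_funTS/measurable_EFinP.
  - exact: measurable_funTS.
  - by move=> x [_ Nx]; rewrite -fg.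
rewrite (ge0_negligible_integral _ _ _ _ N0)// integral_mkcond.
rewrite ge0_integralTE; last by move=> x; rewrite /patch; case: ifP.
rewrite ge0_integralTE//; apply: le_ereal_sup => _ [h /= hg <-].
exists h => // x; apply: le_trans (hg x) _; rewrite /patch; case: ifPn => //.
by rewrite inE => -[_ Nx]; rewrite fg.
Qed.

Lemma integral_off_null (N : set T) (f g : T -> \bar R) :
  measurable N -> mu N = 0 -> measurable_fun setT g ->
  (forall x, ~ N x -> f x = g x) -> \int[mu]_x f x = \int[mu]_x g x.
Proof.
move=> mN N0 mg fg; rewrite integralE [in RHS]integralE; congr (_ - _).
  apply: (ge0_integral_off_null mN N0) => //; first exact: measurable_funepos.
  by move=> x Nx; rewrite !funeposE fg.
apply: (ge0_integral_off_null mN N0) => //; first exact: measurable_funeneg.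
by move=> x Nx; rewrite !funenegE fg.
Qed.

End integral_off_null.

(** * Concatenation of paths *)

Section concatenation.
Context {R : realType} {n : nat}.
Local Notation path := (path R n).
Implicit Types w : path.

Lemma path_ext w w' : (forall t, w t = w' t) -> w = w'.
Proof.
case: w w' => [f fP] [g gP] /= fg; have {}fg : f = g by exact/funext.
by move: fP gP; rewrite fg => fP gP; congr Path; exact: Prop_irrelevance.
Qed.

(** One formula for both regimes: [w'] vanishes at nonpositive times, so nothing is added before
    [s], and the minimum freezes [w] after [s]. *)
Lemma concat_axiom s w w' : 0 <= s ->
  path_axiom (fun u => w (Num.min u s) + w' (u - s)).
Proof.
move=> s0; split=> [t t0|t].
  by rewrite !path0 ?addr0// ?subr_le0 ?(le_trans t0)// ge_min t0.
apply/cvg_at_rightP => e e0.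
have e20 : 0 < e / 2 by rewrite divr_gt0.
have /cvg_at_rightP/(_ _ e20)[d d0 dP] := @path_rcont _ _ w t.
have /cvg_at_rightP/(_ _ e20)[d' d'0 d'P] := @path_rcont _ _ w' (t - s).
exists (Num.min d d'); first by rewrite lt_min d0.
move=> u tu; rewrite -ltrBlDl lt_min => /andP[ud ud'].
rewrite opprD addrACA [e]splitr (le_lt_trans (ler_enormD _ _))// ltrD//.
  have [us|su] := leP u s.
    by rewrite min_l ?(le_trans (ltW tu))// dP// -ltrBlDl.
  have [ts|st] := leP t s; last by rewrite subrr enorm0.
  have [->|/eqP ts'] := eqVneq t s; first by rewrite subrr enorm0.
  apply: dP; first by rewrite lt_neqAle ts andbT; exact/eqP.
  by rewrite -ltrBlDl (le_lt_trans _ ud)// lerB// ltW.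
by apply: d'P; rewrite ?ltrD2r// addrAC ltrD2r -ltrBlDl.
Qed.

(** For negative [s] the value [w] is a mere default. *)
Definition concat s w w' : path :=
  if pselect (0 <= s) is left s0 then Path (concat_axiom w w' s0) else w.

Lemma concatE s w w' u : 0 <= s ->
  concat s w w' u = w (Num.min u s) + w' (u - s).
Proof. by move=> s0; rewrite /concat; case: pselect. Qed.

Lemma concat_le s w w' u : 0 <= s -> u <= s -> concat s w w' u = w u.
Proof.
move=> s0 us; rewrite concatE// min_l// [X in _ + X]path0 ?addr0//.
by rewrite subr_le0.
Qed.

Lemma concat_add s w w' u : 0 <= s -> 0 <= u -> concat s w w' (s + u) = w s + w' u.
Proof.
by move=> s0 u0; rewrite concatE// min_r ?lerDl// addrAC subrr add0r.
Qed.

Lemma measurable_concat s :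
  measurable_fun setT (fun z : (path * path)%type => concat s z.1 z.2).
Proof.
apply: measurable_to_path => t; have [s0|s0] := boolP (0 <= s).
  under eq_fun do rewrite concatE//.
  apply: measurable_rVD.
    by apply: (measurableT_comp (measurable_path_eval _)); exact: measurable_fst.
  by apply: (measurableT_comp (measurable_path_eval _)); exact: measurable_snd.
rewrite (_ : (fun _ => _) = (fun z : (path * path)%type => z.1 t)).
  by apply: (measurableT_comp (measurable_path_eval _)); exact: measurable_fst.
by apply/funext => z; rewrite /concat; case: pselect => // s0'; rewrite s0' in s0.
Qed.

End concatenation.

(** * The Markov property *)

Section markov.
Context {R : realType} {n : nat}.
Local Notation path := (path R n).

(* Independence and stationarity of the increments along dyadic grids, which
   determine the law of the path. *)
Definition levy_law (mu : probability path R) : Prop :=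
  forall delta m k (B : nat -> set 'rV[R]_n), 0 < delta ->
    (forall i, measurable (B i)) ->
    (mu (increment_box delta m k B) =
     \prod_(i < k) mu [set w | B i (w (delta / 2 ^+ m)%R)])%E.

Variable mu : probability path R.
Hypothesis muL : levy_law mu.
Local Open Scope ereal_scope.

(** With [delta = s] the gluing time is a grid point, so each dyadic increment of the glued path
    belongs to exactly one of the two paths and the product over a box factors. This is the Markov
    property at time [s]. *)
Lemma concat_measure s (A : set path) : (0 <= s)%R -> measurable A ->
  (mu \x mu) ((fun z : (path * path)%type => concat s z.1 z.2) @^-1` A) = mu A.
Proof.
move=> s_ge0 mA.
(* No grid has mesh 0, but gluing at time 0 just returns the second path. *)
have [->|s_neq0] := eqVneq s 0%R.
  rewrite (_ : _ @^-1` A = setT `*` A).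
    rewrite product_measure1E//.
    by rewrite [X in X * _](_ : _ = 1) ?mul1e//; exact: probability_setT.
  have c0 (w w' : path) : concat 0%R w w' = w'.
    apply: path_ext => t; rewrite concatE// [X in (X + _)%R]path0 ?ge_min ?lexx ?orbT//.
    by rewrite subr0 add0r.
  by apply/seteqP; split=> [[w w'] /=|[w w'] [_] /=]; rewrite c0.
have s0 : (0 < s)%R by rewrite lt_neqAle eq_sym s_neq0.
pose c_mixin := isMeasurableFun.Build _ _ _ _ _ (@measurable_concat R n s).
pose c : {mfun (path * path)%type >-> path} :=
  HB.pack (fun z : (path * path)%type => concat s z.1 z.2) c_mixin.
apply: (path_measure_unique s0 (m1 := distribution (mu \x mu)%E c)) => // m k B mB.
(* Time [s] has index [K] on the grid of level [m]; boxes are padded with [setT] so that they reach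
   beyond it. *)
pose K := (2 ^ m)%N.
pose B' i := if (i < k)%N then B i else setT.
have mB' i : measurable (B' i) by rewrite /B'; case: ifP.
have -> : increment_box s m k B = increment_box s m (K + k) B'.
  apply/seteqP; split=> w H i /= ik.
    by rewrite /B'; case: ifPn => // {}ik; exact: H.
  by have := H i (leq_trans ik (leq_addl _ _)); rewrite /= /B' ik.
have natK : (K%:R = 2 ^+ m :> R)%R by rewrite /K natrX.
have incl w w' i : (i < K)%N -> increment s m i (concat s w w') = increment s m i w.
  move=> iK; have dle j : (j <= K)%N -> (dyadic s m j <= s)%R.
    move=> jK; rewrite /dyadic ger_pMr// ler_pdivrMr ?exprn_gt0// mul1r.
    by rewrite -natK ler_nat.
  by rewrite /increment !concat_le ?dle// ltnW.
have incr w w' i : increment s m (K + i) (concat s w w') = increment s m i w'.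
  have dadd j : (dyadic s m (K + j) = s + dyadic s m j)%R.
    by rewrite /dyadic natrD natK mulrDl divff ?expf_neq0// mulrDr mulr1.
  have d0 j : (0 <= dyadic s m j)%R by rewrite mulr_ge0// divr_ge0// exprn_ge0.
  rewrite /increment -addnS !dadd !concat_add//.
  by rewrite opprD addrACA subrr add0r.
rewrite /distribution /pushforward/=.
rewrite (_ : _ @^-1` _ = increment_box s m K B' `*`
    increment_box s m k (fun i => B' (K + i)%N)); last first.
  apply/seteqP; split=> [[w w'] H|[w w'] [H1 H2] i /= iKk].
    split=> i /= ik.
      by have := H i (leq_trans ik (leq_addr _ _)); rewrite /= incl.
    by have := H (K + i)%N; rewrite /= ltn_add2l incr => /(_ ik).
  have [iK|Ki] := ltnP i K; first by rewrite incl//; exact: H1.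
  by rewrite -(subnKC Ki) incr; apply: H2; rewrite /= ltn_subLR.
rewrite product_measure1E//; try exact: measurable_increment_box.
rewrite [RHS](muL _ _ s0 mB') big_split_ord/=; congr (_ * _).
  exact: (muL _ _ s0 mB').
exact: (muL m k s0 (fun i => mB' (K + i)%N)).
Qed.

Lemma ge0_integral_concat s (f : path -> \bar R) : (0 <= s)%R ->
  measurable_fun setT f -> (forall w, 0 <= f w) ->
  \int[mu]_w f w = \int[mu]_w \int[mu]_w' f (concat s w w').
Proof.
move=> s0 mf f0.
pose c_mixin := isMeasurableFun.Build _ _ _ _ _ (@measurable_concat R n s).
pose c : {mfun (path * path)%type >-> path} :=
  HB.pack (fun z : (path * path)%type => concat s z.1 z.2) c_mixin.
transitivity (\int[pushforward (mu \x mu) c]_w f w).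
  apply: eq_measure_integral => A mA _; apply/esym; exact: concat_measure.
rewrite ge0_integral_pushforward// preimage_setT fubini_tonelli1//; last first.
  by move=> z; exact: f0.
by apply: measurableT_comp => //; exact: measurable_concat.
Qed.

End markov.

(** * The law of the process on path space *)

Section path_law.
Context {R : realType} {n : nat} {dO : measure_display} {Om : measurableType dO}.
Variables (P : probability Om R) (X : R -> Om -> 'rV[R]_n).
Local Notation path := (path R n).
Hypothesis XL : levy_process P X.

(** On the null set where the path does not start at 0 or is not cadlag, the zero path is
    substituted. *)
Lemma levy_process_path : exists (Y : Om -> path) (N : set Om),
  [/\ measurable_fun setT Y, measurable N, P N = 0%E &
      forall w, ~ N w -> forall t, 0 <= t -> Y w t = X t w].
Proof.
have [mX [N1 [mN1 N10 X0]] _ _ [N2 [mN2 N20 Xc]]] := XL.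
pose N := N1 `|` N2.
have mN : measurable N by exact: measurableU.
have XP w : ~ N w -> path_axiom (fun t => if t <= 0 then 0 else X t w).
  move=> Nw.
  have X00 : X 0 w = 0 by apply: contrapT => H; apply: Nw; left; exact: X0.
  have [Xr _] : cadlag (X^~ w) by apply: contrapT => H; apply: Nw; right; exact: Xc.
  split=> [t ->//|t]; apply/cvg_at_rightP => e e0.
  have [t0|t0] := ltP t 0.
    exists (- t); first by rewrite oppr_gt0.
    by move=> u _; rewrite subrr => /ltW ->; rewrite (ltW t0) subrr enorm0.
  have /cvg_at_rightP/(_ e e0)[d d0 dP] := Xr t t0.
  exists d => // u tu ud; rewrite leNgt (le_lt_trans t0 tu)/=.
  case: ifPn => [t0'|_]; last exact: dP.
  have {1}-> : 0 = X t w by rewrite -X00; congr (X _ w); apply/eqP; rewrite eq_le t0.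
  exact: dP.
pose Y w : path := if pselect (~ N w) is left h then Path (XP w h) else point.
(* This form shows that [Y] is measurable although it is defined by cases. *)
have YE w t : Y w t = (if t <= 0 then 0 else (1 - \1_N w) *: X t w).
  rewrite /Y; case: pselect => /= Nw.
    by rewrite indicE memNset// subr0 scale1r.
  by rewrite indicE mem_set ?subrr ?scale0r ?if_same//; exact: contrapT.
exists Y, N; split => //; last 2 first.
- by rewrite null_set_setU.
- move=> w Nw t t0; rewrite YE indicE memNset// subr0 scale1r; case: ifPn => // t0'.
  have -> : t = 0 by apply/eqP; rewrite eq_le t0'.
  by apply/esym; apply: contrapT => H; apply: Nw; left; exact: X0.
apply: measurable_to_path => t; under eq_fun do rewrite YE.
have [t0|t0] := leP t 0; first exact: measurable_cst.
apply: measurable_fun_rV => i; under eq_fun do rewrite mxE.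
apply: measurable_funM; first by apply: measurable_funB => //; exact: measurable_indic.
apply: (measurableT_comp (measurable_coord i)); exact: mX (ltW t0).
Qed.

(** [F] is only required to agree with [g] on paths that carry the values of the process. It may
    fail to be measurable because of the null set where no such path exists, which
    [integral_off_null] tolerates. *)
Lemma levy_process_law : exists2 mu : probability path R, levy_law mu &
  forall (F : Om -> \bar R) (g : path -> \bar R), measurable_fun setT g ->
    (forall w (y : path), (forall t, 0 <= t -> y t = X t w) -> F w = g y) ->
    (\int[P]_w F w = \int[mu]_y g y)%E.
Proof.
have [mX _ XI XS _] := XL.
have [Y [N [mY mN N0 YX]]] := levy_process_path.
pose Y_mixin := isMeasurableFun.Build _ _ _ _ _ mY.
pose Y' : {mfun Om >-> path} := HB.pack Y Y_mixin.
pose mu : probability path R := distribution P Y'.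
have transfer (F : Om -> \bar R) (g : path -> \bar R) : measurable_fun setT g ->
    (forall w (y : path), (forall t, 0 <= t -> y t = X t w) -> F w = g y) ->
    (\int[P]_w F w = \int[mu]_y g y)%E.
  move=> mg Fg; rewrite (@integral_off_null _ _ _ P N F (g \o Y))//; last 2 first.
  - exact: measurableT_comp.
  - by move=> w Nw; apply: Fg; exact: YX.
  rewrite integralE [in RHS]integralE; congr (_ - _)%E.
    rewrite /mu/= ge0_integral_pushforward//; last exact: measurable_funepos.
    by rewrite preimage_setT; apply: eq_integral => w _; rewrite /= !funeposE.
  rewrite /mu/= ge0_integral_pushforward//; last exact: measurable_funeneg.
  by rewrite preimage_setT; apply: eq_integral => w _; rewrite /= !funenegE.
have transfer_set (A : set Om) (B : set path) : measurable A -> measurable B ->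
    (forall w (y : path), (forall t, 0 <= t -> y t = X t w) -> A w <-> B y) ->
    P A = mu B.
  move=> mA mB AB.
  rewrite -(setIT A) -(setIT B) -!integral_indic//.
  apply: transfer; first exact/measurable_EFinP/measurable_indic.
  move=> w y yX; rewrite !indicE; congr ((_ : bool)%:R%:E).
  by apply/idP/idP; rewrite !inE => /(AB w y yX).
exists mu => // delta m k B delta0 mB.
have d0 j : 0 <= dyadic delta m j by rewrite mulr_ge0 ?divr_ge0 ?exprn_ge0// ltW.
have p0 : 0 < delta / 2 ^+ m by rewrite divr_gt0// exprn_gt0.
have mincr i : measurable [set w | B i (X (dyadic delta m i.+1) w - X (dyadic delta m i) w)].
  by have := measurable_rVB (mX _ (d0 i.+1)) (mX _ (d0 i)) measurableT (mB i); rewrite setTI.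
transitivity (P (\bigcap_(i in `I_k)
    [set w | B i (X (dyadic delta m i.+1) w - X (dyadic delta m i) w)])).
  apply/esym/transfer_set.
  - by apply: fin_bigcap_measurable; [exact: finite_II|move=> i _].
  - exact: measurable_increment_box.
  - move=> w y yX; split=> H i ik.
      by have := H i ik; rewrite /= /increment !yX.
    by have := H i ik; rewrite /= /increment !yX.
rewrite (XI k (dyadic delta m) B)//; last 1 first.
- by move=> i j ij; rewrite /dyadic ltr_pM2l// ltr_pM2r ?invr_gt0 ?exprn_gt0// ltr_nat.
apply: eq_bigr => i _.
have -> : dyadic delta m i.+1 = dyadic delta m i + delta / 2 ^+ m.
  by rewrite /dyadic -natr1 mulrDl mulrDr mul1r.
rewrite XS ?(ltW p0)//; apply: transfer_set.
- by have := mX _ (ltW p0) measurableT _ (mB i); rewrite setTI.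
- by have := @measurable_path_eval R n (delta / 2 ^+ m) measurableT _ (mB i); rewrite setTI.
- by move=> w y yX /=; rewrite yX// ltW.
Qed.

End path_law.

(** * The generator *)

Section weighted_functional.
Context {R : realType} {n : nat} {d} {S : measurableType d}.
Variables (m : {finite_measure set S -> \bar R}) (w : S -> R) (Y : S -> 'rV[R]_n).
Hypotheses (bw : bmeas w) (w0 : forall s, 0 <= w s) (mY : measurable_fun setT Y).
Implicit Types g : 'rV[R]_n -> R.

Definition wint g : R := (\int[m]_s (w s * g (Y s)))%R.

Lemma bmeas_wint g : bmeas g -> bmeas (fun s => w s * g (Y s)).
Proof. by move=> bg; apply: bmeasM => //; exact: bmeas_comp. Qed.

Lemma wintD g1 g2 : bmeas g1 -> bmeas g2 ->
  wint (fun y => g1 y + g2 y) = wint g1 + wint g2.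
Proof.
move=> b1 b2; rewrite -RintegralD_bmeas; try exact: bmeas_wint.
by apply: eq_Rintegral => s _; rewrite mulrDr.
Qed.

Lemma wintZ c g : bmeas g -> wint (fun y => c * g y) = c * wint g.
Proof.
move=> b1; rewrite -RintegralZ_bmeas; last exact: bmeas_wint.
by apply: eq_Rintegral => s _; rewrite mulrCA.
Qed.

Lemma wintB g1 g2 : bmeas g1 -> bmeas g2 ->
  wint (fun y => g1 y - g2 y) = wint g1 - wint g2.
Proof.
move=> b1 b2; rewrite -RintegralB_bmeas; try exact: bmeas_wint.
by apply: eq_Rintegral => s _; rewrite mulrBr.
Qed.

Lemma wint_sum I (s : seq I) (F : I -> 'rV[R]_n -> R) :
  (forall i, bmeas (F i)) ->
  wint (fun y => \sum_(i <- s) F i y) = \sum_(i <- s) wint (F i).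
Proof.
move=> bF; rewrite -Rintegral_sum_bmeas; last by move=> i; exact: bmeas_wint.
by apply: eq_Rintegral => t _; rewrite mulr_sumr.
Qed.

Lemma le_wint g1 g2 : bmeas g1 -> bmeas g2 -> (forall y, g1 y <= g2 y) ->
  wint g1 <= wint g2.
Proof.
move=> b1 b2 g12; apply: le_Rintegral_bmeas; try exact: bmeas_wint.
by move=> s; rewrite ler_wpM2l.
Qed.

Lemma wint_ge0 g : (forall y, 0 <= g y) -> 0 <= wint g.
Proof. by move=> g0; apply: Rintegral_ge0 => s _; rewrite mulr_ge0. Qed.

Lemma wint_dist g1 g2 (e : R) : bmeas g1 -> bmeas g2 ->
  (forall y, `|g1 y - g2 y| <= e) ->
  `|wint g1 - wint g2| <= e * wint (fun=> 1).
Proof.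
move=> b1 b2 g12; have b1' : bmeas (fun _ : 'rV[R]_n => 1 : R) by exact: bmeas_cst.
rewrite -wintB// -wintZ// ler_norml; apply/andP; split.
  rewrite -mulN1r -wintZ; last exact: bmeasZ.
  apply: le_wint; [by do 2 apply: bmeasZ|exact: bmeasB|].
  by move=> y; rewrite mulr1 mulN1r; have := g12 y; rewrite ler_norml => /andP[].
apply: le_wint; [exact: bmeasB|exact: bmeasZ|].
by move=> y; rewrite mulr1; exact: le_trans (ler_norm _) (g12 y).
Qed.

Lemma cvg_wint (F : nat -> 'rV[R]_n -> R) g M :
  (forall k, measurable_fun setT (F k)) -> (forall k y, `|F k y| <= M) ->
  (forall y, F k y @[k --> \oo] --> g y) ->
  wint (F k) @[k --> \oo] --> wint g.
Proof.
move=> mF FM Fg.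
have [N N0 wN] := bmeas_bound bw.
have [] // := @cvg_Rintegral_bmeas _ _ _ m
  (fun k s => w s * F k (Y s)) (fun s => w s * g (Y s)) (N * M).
- move=> k; apply: measurable_funM; first exact: bw.1.
  exact: measurableT_comp.
- by move=> k s; rewrite normrM ler_pM.
- by move=> s; apply: cvgM; [exact: cvg_cst|exact: Fg].
Qed.

End weighted_functional.

(** * Cosine sums *)

Section trigonometric_sums.
Context {R : realType} {n : nat}.
Implicit Types (k : 'rV[R]_n -> R) (x y v xi : 'rV[R]_n).

Definition trig_sum k : Prop := exists s : seq (R * 'rV[R]_n),
  forall y, k y = \sum_(p <- s) p.1 * cos (dot p.2 y).

Lemma trig_sum1 : trig_sum (fun=> 1).
Proof.
by exists [:: (1, 0)] => y; rewrite big_seq1/= dotC dot0r cos0 mulr1.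
Qed.

(** Product-to-sum formula: each pair of frequencies contributes its sum and its difference. *)
Lemma trig_sumM k1 k2 : trig_sum k1 -> trig_sum k2 ->
  trig_sum (fun y => k1 y * k2 y).
Proof.
move=> [s1 k1E] [s2 k2E].
pose h (p q : R * 'rV[R]_n) : seq (R * 'rV[R]_n) :=
  [:: (p.1 * q.1 / 2, p.2 + q.2); (p.1 * q.1 / 2, p.2 - q.2)].
exists (flatten [seq flatten [seq h p q | q <- s2] | p <- s1]) => y.
rewrite k1E k2E big_flatten/= big_map mulr_suml; apply: eq_bigr => p _.
rewrite big_flatten/= big_map mulr_sumr; apply: eq_bigr => q _.
rewrite big_cons big_seq1/= dotDl dotBl cosD cosB.
by field.
Qed.

Lemma trig_sum_prod I (s : seq I) (F : I -> 'rV[R]_n -> R) :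
  (forall i, trig_sum (F i)) -> trig_sum (fun y => \prod_(i <- s) F i y).
Proof.
move=> tF; elim: s => [|a s ih].
  by under eq_fun do rewrite big_nil; exact: trig_sum1.
by under eq_fun do rewrite big_cons; exact: trig_sumM.
Qed.

Lemma trig_sumX k N : trig_sum k -> trig_sum (fun y => k y ^+ N).
Proof.
move=> tk; elim: N => [|N ih].
  by under eq_fun do rewrite expr0; exact: trig_sum1.
by under eq_fun do rewrite exprS; exact: trig_sumM.
Qed.

Lemma trig_sum_cos (b : R) (i : 'I_n) : trig_sum (fun y => cos (b * y 0 i)).
Proof.
exists [:: (1, b *: delta_mx 0 i)] => y; rewrite big_seq1/= mul1r; congr cos.
rewrite dotC dotZr dotE (bigD1 i)//= mxE !eqxx mulr1 big1 ?addr0// => j ji.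
by rewrite mxE (negbTE ji) andbF mulr0.
Qed.

Lemma bmeas_cos xi (th : R) : bmeas (fun y => cos (dot xi y + th)).
Proof.
split; last by exists 1 => y; exact: cos_max.
apply: (measurableT_comp (continuous_measurable_fun (@continuous_cos R))).
by apply: measurable_funD => //; exact: measurable_dot.
Qed.

Lemma bmeas_cos0 xi : bmeas (fun y => cos (dot xi y)).
Proof. by have := bmeas_cos xi 0; under eq_fun do rewrite addr0. Qed.

Lemma bmeas_sin0 xi : bmeas (fun y => sin (dot xi y)).
Proof. by have := bmeas_cos xi (- (pi / 2)); under eq_fun do rewrite cosBpihalf. Qed.

Lemma bmeas_trig_sum k : trig_sum k -> bmeas k.
Proof.
move=> [s kE]; rewrite (_ : k = fun y => \sum_(p <- s) p.1 * cos (dot p.2 y)); last exact/funext.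
apply: bmeas_sum => p; exact/bmeasZ/bmeas_cos0.
Qed.

End trigonometric_sums.

(** * Powers of cosines tending to a Gaussian *)

Section gaussian_limit.
Context {R : realType}.

Lemma exprn_dist_le (a b : R) N : `|a| <= 1 -> `|b| <= 1 ->
  `|a ^+ N - b ^+ N| <= N%:R * `|a - b|.
Proof.
move=> a1 b1; elim: N => [|N ih]; first by rewrite subrr normr0 mul0r.
have -> : a ^+ N.+1 - b ^+ N.+1 = a * (a ^+ N - b ^+ N) + (a - b) * b ^+ N.
  by rewrite !exprS; ring.
rewrite (le_trans (ler_normD _ _))// -natr1 [leRHS]mulrDl mul1r !normrM lerD//.
  by rewrite (le_trans _ ih)// ler_piMl.
by rewrite ler_piMr// normrX exprn_ile1.
Qed.

(** The derivative of [sin] at 0, read along [h = u / N.+1]. *)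
Lemma cvg_natmul_sin (u : R) : N.+1%:R * sin (u / N.+1%:R) @[N --> \oo] --> u.
Proof.
have [->|u0] := eqVneq u 0.
  by under eq_fun do rewrite mul0r sin0 mulr0; exact: cvg_cst.
have [H1 H2] := is_derive_sin (0 : R).
have : h^-1 *: ((@sin R \o shift 0) (h *: 1) - sin 0) @[h --> 0^'] --> (cos 0 : R).
  by rewrite -H2; exact: H1.
have hN : u / N.+1%:R @[N --> \oo] --> 0^'.
  move=> A /nbhs_ballP[e /= e0 eA]; change (\forall N \near \oo, A (u / N.+1%:R)).
  near=> N; apply: eA => /=; last by rewrite mulf_neq0// invr_neq0.
  rewrite -ball_normE/= sub0r normrN normrM (gtr0_norm (_ : 0 < N.+1%:R^-1))//.
  rewrite -ltr_pdivlMl ?normr_gt0// mulrC.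
  near: N; have e1 : 0 < e / `|u| by rewrite divr_gt0 ?normr_gt0.
  exact: near_infty_natSinv_lt (PosNum e1).
move=> /(cvg_comp _ _ hN) /(cvgM (cvg_cst u)); rewrite cos0 mulr1; apply: cvg_trans.
apply: near_eq_cvg; apply: nearW => N /=.
rewrite sin0 subr0 addr0 [_ *: 1]mulr1 invf_div /GRing.scale/= !mulrA.
by congr (_ * _); field.
Unshelve. all: by end_near. Qed.

(** Squeeze: [x / (1 + x) <= 1 - exp (- x) <= x] at [x = t / N.+1 ^ 2], both inequalities coming
    from [1 + y <= exp y]. *)
Lemma cvg_natmul_expR (t : R) : 0 <= t ->
  N.+1%:R ^+ 2 * (1 - expR (- t / N.+1%:R ^+ 2)) @[N --> \oo] --> t.
Proof.
move=> t0.
have N0 N : 0 < N.+1%:R ^+ 2 :> R by rewrite exprn_gt0.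
have c0 : (1 + t / N.+1%:R ^+ 2)^-1 * t @[N --> \oo] --> t.
  rewrite -[X in _ --> X]mul1r -[X in X * _]invr1; apply: cvgM; last exact: cvg_cst.
  apply: cvgV => //; rewrite -[X in _ --> X]addr0; apply: cvgD; first exact: cvg_cst.
  rewrite -(mulr0 t); apply: cvgM; first exact: cvg_cst.
  under eq_fun do rewrite -exprVn expr2.
  have := cvgM (@cvg_harmonic R) (@cvg_harmonic R); rewrite mulr0; exact.
apply: (squeeze_cvgr _ c0 (cvg_cst t)); apply: nearW => N.
have tN : 0 <= t / N.+1%:R ^+ 2 by rewrite divr_ge0// ltW.
have tN1 : 0 < 1 + t / N.+1%:R ^+ 2 by rewrite ltr_wpDr.
have e1 := expR_ge1Dx (t / N.+1%:R ^+ 2).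
have e2 := expR_ge1Dx (- (t / N.+1%:R ^+ 2)).
apply/andP; split; last first.
  by rewrite mulNr -ler_pdivlMl// (mulrC _ t); move: e2; set E := expR _; set a := t / _; lra.
rewrite mulNr expRN -ler_pdivrMl//.
have : (expR (t / N.+1%:R ^+ 2))^-1 <= (1 + t / N.+1%:R ^+ 2)^-1.
  by rewrite lef_pV2// posrE expR_gt0.
suff -> : (N.+1%:R ^+ 2)^-1 * ((1 + t / N.+1%:R ^+ 2)^-1 * t) =
   1 - (1 + t / N.+1%:R ^+ 2)^-1 by move=> h; rewrite lerD2l lerN2.
rewrite mulrCA (mulrC _ t); move: tN1; set a := t / _ => a1.
by field; rewrite gt_eqF.
Qed.

(** With [N] for [N.+1]: [cos (u / N)] is compared with [exp (- u^2 / (2 N^2))], whose power of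
    order [2 N^2] is exactly [exp (- u^2)]. For bases in [[-1, 1]] a difference of powers is at most
    the exponent times the difference. The exponent is even so that the kernel built from it is
    nonnegative. *)
Lemma cvg_cosX (u : R) :
  cos (u / N.+1%:R) ^+ (N.+1 ^ 2).*2 @[N --> \oo] --> expR (- u ^+ 2).
Proof.
pose b N : R := expR (- (u ^+ 2 / 2) / N.+1%:R ^+ 2).
have N0 N : 0 < N.+1%:R ^+ 2 :> R by rewrite exprn_gt0.
have bE N : b N ^+ (N.+1 ^ 2).*2 = expR (- u ^+ 2).
  rewrite -expRM_natl; congr expR; rewrite -mul2n natrM natrX.
  by field; rewrite gt_eqF.
apply/cvgrPdist_lt => e e0.
(* The exponent times the difference of the bases; both terms in the bracket tend to
   [u ^+ 2 / 2]. *)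
pose D N : R := 2 * (N.+1%:R ^+ 2 * (1 - cos (u / N.+1%:R)) - N.+1%:R ^+ 2 * (1 - b N)).
have D0 : D N @[N --> \oo] --> 0.
  rewrite -(mulr0 2); apply: cvgM; first exact: cvg_cst.
  rewrite -(subrr (u ^+ 2 / 2)); apply: cvgB; last first.
    by apply: cvg_natmul_expR; rewrite divr_ge0// sqr_ge0.
  have h1 : (N.+1%:R * sin ((u / 2) / N.+1%:R)) ^+ 2 * 2 @[N --> \oo] --> (u / 2) ^+ 2 * 2.
    apply: cvgM; last exact: cvg_cst.
    under eq_fun do rewrite expr2.
    by rewrite expr2; apply: cvgM; exact: cvg_natmul_sin.
  rewrite (_ : u ^+ 2 / 2 = (u / 2) ^+ 2 * 2); last by field.
  apply: cvg_trans h1; apply: near_eq_cvg; apply: nearW => N.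
  have -> : u / N.+1%:R = (u / 2 / N.+1%:R) *+ 2 by rewrite mulr2n -mulrDl -splitr.
  by rewrite cos_mulr2n cos2sin2; ring.
move/cvgrPdist_lt : D0 => /(_ e e0); apply: filterS => N; rewrite sub0r normrN => DN.
rewrite distrC -(bE N); apply: le_lt_trans (exprn_dist_le _ _ _) _.
- exact: cos_max.
- rewrite gtr0_norm ?expR_gt0// expR_le1 mulNr oppr_le0.
  by rewrite divr_ge0 ?divr_ge0 ?sqr_ge0// ltW.
- apply: le_lt_trans DN; rewrite /D.
  rewrite (_ : 2 * _ = (N.+1 ^ 2).*2%:R * (b N - cos (u / N.+1%:R))); last first.
    by rewrite -mul2n natrM natrX; ring.
  by rewrite normrM ger0_norm// distrC.
Qed.

End gaussian_limit.

(** * Integrable functions and convolution *)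

Section lebesgue_integrable.
Context {R : realType} {n : nat}.
Local Notation leb := (@lebesgue_rV R n).
Implicit Types (f g B : 'rV[R]_n -> R) (u v y z xi : 'rV[R]_n).

Definition lint f : Prop := leb.-integrable setT (EFin \o f).

Lemma lint_meas f : lint f -> measurable_fun setT f.
Proof. by move=> /integrableP[/measurable_EFinP]. Qed.

Lemma lintP f : measurable_fun setT f ->
  (\int[leb]_x `|f x|%:E < +oo)%E -> lint f.
Proof. by move=> mf foo; apply/integrableP; split => //; exact/measurable_EFinP. Qed.

Lemma lint_lty f : lint f -> (\int[leb]_x `|f x|%:E < +oo)%E.
Proof. by move=> /integrableP[]. Qed.

Lemma le_lint f g : measurable_fun setT f -> (forall x, `|f x| <= g x) ->
  lint g -> lint f.
Proof.
move=> mf fg; apply: le_integrable => //; first exact/measurable_EFinP.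
by move=> x _ /=; rewrite lee_fin (le_trans (fg x))// ler_norm.
Qed.

Lemma lintN f : lint f -> lint (fun x => - f x).
Proof.
move=> lf; apply: (@le_lint _ (fun x => `|f x|)).
- by apply: measurableT_comp => //; exact: lint_meas.
- by move=> x; rewrite normrN.
- exact: integrable_norm.
Qed.

Lemma lint_norm f : lint f -> lint (fun x => `|f x|).
Proof. exact: integrable_norm. Qed.

Lemma lintD f g : lint f -> lint g -> lint (fun x => f x + g x).
Proof. by move=> lf lg; have := integrableD measurableT lf lg. Qed.

Lemma lintB f g : lint f -> lint g -> lint (fun x => f x - g x).
Proof. by move=> lf lg; apply: lintD => //; exact: lintN. Qed.

Lemma lintMb f g : lint f -> bmeas g -> lint (fun x => f x * g x).
Proof.
move=> lf [mg [M gM]].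
have := integrableMr measurableT (h := g) (g := EFin \o f) mg.
have bg : [bounded g x | x in setT].
  by exists M; split; [exact: num_real|move=> a /ltW Ma x _; exact: le_trans (gM x) Ma].
move=> /(_ leb bg lf); apply: eq_integrable => // x _ /=.
by rewrite EFinM muleC.
Qed.

Lemma lintZ c f : lint f -> lint (fun x => c * f x).
Proof.
move=> lf; under eq_fun do rewrite mulrC.
by apply: lintMb => //; exact: bmeas_cst.
Qed.

Lemma lint_sum I (s : seq I) (F : I -> 'rV[R]_n -> R) :
  (forall i, lint (F i)) -> lint (fun x => \sum_(i <- s) F i x).
Proof.
move=> lF; elim: s => [|a s ih].
  under eq_fun do rewrite big_nil; exact: integrable0.
by under eq_fun do rewrite big_cons; exact: lintD.
Qed.

Lemma lint_Rint_sum I (s : seq I) (F : I -> 'rV[R]_n -> R) :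
  (forall i, lint (F i)) ->
  (\int[leb]_x (\sum_(i <- s) F i x) = \sum_(i <- s) \int[leb]_x F i x)%R.
Proof.
move=> lF; elim: s => [|a s ih].
  by rewrite big_nil; under eq_Rintegral do rewrite big_nil; rewrite /Rintegral integral0.
rewrite big_cons -ih -RintegralD//; try exact: lint_sum; try exact: lF.
by apply: eq_Rintegral => x _; rewrite big_cons.
Qed.

Lemma lint_EFin f : lint f -> (\int[leb]_x f x)%R%:E = (\int[leb]_x (f x)%:E)%E.
Proof. by move=> lf; rewrite fineK//; exact: integrable_fin_num. Qed.

Lemma lint_Rint_bound f g : lint f -> lint g -> (forall x, `|f x| <= g x) ->
  `|\int[leb]_x f x|%R <= (\int[leb]_x g x)%R.
Proof.
move=> lf lg fg; apply: le_trans (le_normr_Rintegral measurableT lf) _.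
by apply: le_Rintegral => //; exact: lint_norm.
Qed.

Lemma integral_translation u (f : 'rV[R]_n -> \bar R) : measurable_fun setT f ->
  (\int[leb]_x f (u + x)%R = \int[leb]_x f x)%E.
Proof.
move=> mf; rewrite integralE [in RHS]integralE; congr (_ - _)%E.
  rewrite -(ge0_integral_translation u (f := f^\+%E)); [|exact: measurable_funepos|by move=> x; exact: funepos_ge0].
  by apply: eq_integral => x _; rewrite !funeposE.
rewrite -(ge0_integral_translation u (f := f^\-%E)); [|exact: measurable_funeneg|by move=> x; exact: funeneg_ge0].
by apply: eq_integral => x _; rewrite !funenegE.
Qed.

Lemma lint_translation u f : lint f -> lint (fun x => f (u + x)).
Proof.
move=> lf; apply: lintP; last first.
  rewrite (ge0_integral_translation u (f := fun x => `|f x|%:E)).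
  - exact: lint_lty.
  - by apply/measurable_EFinP; apply: measurableT_comp => //; exact: lint_meas.
  - by move=> x; rewrite lee_fin.
by apply: measurableT_comp; [exact: lint_meas|exact: measurable_rVD].
Qed.

Lemma Rint_translation u f : lint f ->
  (\int[leb]_x f (u + x) = \int[leb]_x f x)%R.
Proof.
move=> lf; rewrite /Rintegral (integral_translation u (f := EFin \o f))//.
by apply/measurable_EFinP; exact: lint_meas.
Qed.

Lemma lint_indic (D : set 'rV[R]_n) : measurable D -> (leb D < +oo)%E -> lint (\1_D).
Proof.
move=> mD Doo; apply: lintP; first exact: measurable_indic.
rewrite (eq_integral (fun x => (\1_D x)%:E)); first by rewrite integral_indic// setIT.
by move=> x _; rewrite ger0_norm.
Qed.

Lemma lint_ball f r : bmeas f -> (forall x, r <= enorm x -> f x = 0) -> lint f.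
Proof.
move=> bf f0; have [M M0 fM] := bmeas_bound bf.
apply: (@le_lint _ (fun x => M * \1_(eball 0 r) x)); first exact: bf.1.
  move=> x; rewrite indicE; have [xr|xr] := ltP (enorm x) r.
    by rewrite mem_set ?mulr1// /eball/= subr0.
  by rewrite f0// normr0 mulr_ge0.
by apply: lintZ; apply: lint_indic; [exact: measurable_eball|exact: lebesgue_eball_lty].
Qed.

(** The kernel [k] is bounded and carries the variable [y]: a trigonometric [k] makes the
    convolution trigonometric, whatever the integrable [B]. *)
Definition conv B (k : 'rV[R]_n -> R) y : R := (\int[leb]_v (B v * k (y - v)))%R.

Lemma bmeas_reflection (k : 'rV[R]_n -> R) y : bmeas k -> bmeas (fun v => k (y - v)).
Proof.
move=> bk; apply: bmeas_comp bk.
by apply: measurable_rVB => //; exact: measurable_cst.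
Qed.

Lemma lint_conv B k y : lint B -> bmeas k -> lint (fun v => B v * k (y - v)).
Proof. by move=> lB bk; apply: lintMb => //; exact: bmeas_reflection. Qed.

Lemma le_conv B G k y : lint B -> lint G -> bmeas k -> (forall x, 0 <= k x) ->
  (forall v, B v <= G v) -> conv B k y <= conv G k y.
Proof.
move=> lB lG bk k0 BG; apply: le_Rintegral => //; try exact: lint_conv.
by move=> v _; rewrite ler_wpM2r.
Qed.

Lemma conv_sum B I (s : seq I) (F : I -> 'rV[R]_n -> R) y : lint B ->
  (forall i, bmeas (F i)) ->
  conv B (fun x => \sum_(i <- s) F i x) y = \sum_(i <- s) conv B (F i) y.
Proof.
move=> lB bF; rewrite -lint_Rint_sum; last by move=> i; exact: lint_conv.
by apply: eq_Rintegral => v _; rewrite mulr_sumr.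
Qed.

Lemma convZ B c k y : lint B -> bmeas k -> conv B (fun x => c * k x) y = c * conv B k y.
Proof.
move=> lB bk; rewrite /conv -RintegralZl//; last exact: lint_conv.
by apply: eq_Rintegral => v _; rewrite mulrCA.
Qed.

(** Expanding the cosine of a difference separates the variables; the frequency is kept, but a sine
    appears. *)
Lemma conv_cosE B xi y : lint B ->
  conv B (fun x => cos (dot xi x)) y =
  (\int[leb]_v (B v * cos (dot xi v)))%R * cos (dot xi y) +
  (\int[leb]_v (B v * sin (dot xi v)))%R * sin (dot xi y).
Proof.
move=> lB.
have lc : lint (fun v => B v * cos (dot xi v)) by apply: lintMb => //; exact: bmeas_cos0.
have ls : lint (fun v => B v * sin (dot xi v)) by apply: lintMb => //; exact: bmeas_sin0.
rewrite mulrC [X in _ + X]mulrC -!RintegralZl// -RintegralD//; try exact: lintZ.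
by apply: eq_Rintegral => v _; rewrite dotBr cosB; ring.
Qed.

Lemma bmeas_conv_cos B xi : lint B -> bmeas (conv B (fun x => cos (dot xi x))).
Proof.
move=> lB; rewrite (_ : conv _ _ = fun y => (\int[leb]_v (B v * cos (dot xi v)))%R * cos (dot xi y) +
    (\int[leb]_v (B v * sin (dot xi v)))%R * sin (dot xi y)); last first.
  by apply/funext => y; exact: conv_cosE.
by apply: bmeasD; apply: bmeasZ; [exact: bmeas_cos0|exact: bmeas_sin0].
Qed.

Lemma conv_trig_sumE B k s y : lint B ->
  (forall x, k x = \sum_(p <- s) p.1 * cos (dot p.2 x)) ->
  conv B k y = \sum_(p <- s) p.1 * conv B (fun x => cos (dot p.2 x)) y.
Proof.
move=> lB kE; rewrite (_ : k = fun x => \sum_(p <- s) p.1 * cos (dot p.2 x)); last exact/funext.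
rewrite conv_sum//; last by move=> p; exact/bmeasZ/bmeas_cos0.
by apply: eq_bigr => p _; rewrite convZ//; exact: bmeas_cos0.
Qed.

Lemma bmeas_conv_trig_sum B k : lint B -> trig_sum k -> bmeas (conv B k).
Proof.
move=> lB [s kE]; rewrite (_ : conv B k = fun y =>
   \sum_(p <- s) p.1 * conv B (fun x => cos (dot p.2 x)) y); last first.
  by apply/funext => y; exact: conv_trig_sumE.
by apply: bmeas_sum => p; exact/bmeasZ/bmeas_conv_cos.
Qed.

End lebesgue_integrable.

(** * Elementary bounds for sine and cosine *)

Section sine_bounds.
Context {R : realType}.

Lemma norm_sin_natmul (N : nat) (a : R) : `|sin (N%:R * a)| <= N%:R * `|sin a|.
Proof.
elim: N => [|N ih]; first by rewrite !mul0r sin0 normr0.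
rewrite -natr1 !mulrDl !mul1r sinD (le_trans (ler_normD _ _))// !normrM lerD//.
  by rewrite (le_trans _ ih)// ler_piMr// cos_max.
by rewrite ler_piMl// cos_max.
Qed.

(** Limit of [|sin u| <= N |sin (u / N)|], whose right-hand side tends to [|u|]. *)
Lemma norm_sin_le (u : R) : `|sin u| <= `|u|.
Proof.
apply: (@cvgr_to_ge _ \oo _ _ (fun N => `|N.+1%:R * sin (u / N.+1%:R)|) `|u|).
  by apply: cvg_norm; exact: cvg_natmul_sin.
apply: nearW => N.
have := norm_sin_natmul N.+1 (u / N.+1%:R).
by rewrite mulrC divfK ?pnatr_eq0// normrM (@ger0_norm _ N.+1%:R).
Qed.

Lemma cos_le_sqr (u : R) : `|cos u - 1| <= u ^+ 2 / 2.
Proof.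
have -> : u = (u / 2) *+ 2 by rewrite mulr2n -splitr.
rewrite cos_mulr2n cos2sin2 (_ : _ - 1 = - (2 * sin (u / 2) ^+ 2)); last by ring.
rewrite normrN ger0_norm; last by rewrite mulr_ge0// sqr_ge0.
have -> : (u / 2 *+ 2) ^+ 2 / 2 = 2 * (u / 2) ^+ 2 by rewrite -mulr_natr; field.
rewrite ler_pM2l// -(real_normK (num_real (sin (u / 2)))) -(real_normK (num_real (u / 2))).
by rewrite lerXn2r ?nnegrE// norm_sin_le.
Qed.

Lemma cos_le2 (u : R) : `|cos u - 1| <= 2.
Proof.
have := cos_max u; rewrite !ler_norml => /andP[h1 h2]; apply/andP; split; lra.
Qed.

End sine_bounds.

(** * The discretised generator and its symbol *)

Section generator.
Context {R : realType} {n : nat}.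
Local Notation leb := (@lebesgue_rV R n).
Implicit Types (B G : 'rV[R]_n -> R) (u v y z xi : 'rV[R]_n).
Variables (A : 'M[R]_n) (nu : 'rV[R]_n -> R).
Hypotheses (mnu : measurable_fun setT nu) (nu_ge0 : forall y, 0 <= nu y).
Hypothesis nu_lty : (\int[leb]_y (Num.min 1 (enorm y ^+ 2) * nu y)%:E < +oo)%E.

Lemma cvg_lint (F : nat -> 'rV[R]_n -> R) G (f : 'rV[R]_n -> R) :
  (forall k, measurable_fun setT (F k)) -> lint G ->
  (forall k x, `|F k x| <= G x) -> (forall x, F k x @[k --> \oo] --> f x) ->
  lint f /\ (\int[leb]_x F k x)%R @[k --> \oo] --> (\int[leb]_x f x)%R.
Proof.
move=> mF lG FG Ff.
have mf : measurable_fun setT f by apply: (measurable_fun_cvg mF) => x _; exact: Ff.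
have lf : lint f.
  apply: le_lint lG => // x; apply: (cvgr_to_le (cvg_norm (Ff x))).
  by apply: nearW => k; exact: FG.
split => //.
have [|||||_ _ H] := @dominated_convergence _ _ _ leb setT measurableT
  (fun k => EFin \o F k) (EFin \o f) (EFin \o G).
- by move=> k; apply/measurable_EFinP.
- by apply/measurable_EFinP.
- by apply: aeW => x _ /=; apply: cvg_EFin; [exact: nearW|exact: Ff].
- exact: lG.
- by apply: aeW => x k _ /=; rewrite lee_fin.
by apply: fine_cvg; rewrite fineK//; exact: integrable_fin_num.
Qed.

Definition jump_mass y : R := Num.min 1 (enorm y ^+ 2) * nu y.

Lemma measurable_min_enorm : measurable_fun setT (fun y => Num.min 1 (enorm y ^+ 2) : R).
Proof.
by apply: measurable_minr => //; apply: measurable_funX; exact: measurable_enorm.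
Qed.

Lemma jump_mass_ge0 y : 0 <= jump_mass y.
Proof. by rewrite mulr_ge0// le_min ler01 sqr_ge0. Qed.

Lemma lint_jump_mass : lint jump_mass.
Proof.
apply: lintP; first by apply: measurable_funM => //; exact: measurable_min_enorm.
by under eq_integral do rewrite ger0_norm ?jump_mass_ge0//; exact: nu_lty.
Qed.

Definition truncated (e : R) y : R := if e < enorm y then nu y else 0.

Lemma truncated_ge0 e y : 0 <= truncated e y.
Proof. by rewrite /truncated; case: ifP. Qed.

Lemma measurable_truncated e : measurable_fun setT (truncated e).
Proof.
apply: measurable_fun_ifT => //; first by apply: measurable_fun_ltr => //; exact: measurable_enorm.
Qed.

Lemma truncated_le e y : 0 < e -> truncated e y <= (Num.min 1 (e ^+ 2))^-1 * jump_mass y.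
Proof.
move=> e0; have m0 : 0 < Num.min 1 (e ^+ 2) by rewrite lt_min ltr01 exprn_gt0.
rewrite /truncated; case: ifPn => [ey|_]; last by rewrite mulr_ge0 ?jump_mass_ge0// invr_ge0 ltW.
rewrite /jump_mass mulrA ler_peMl// ler_pdivlMl// mulr1 le_min ge_min lexx/=.
by rewrite ge_min lerXn2r ?nnegrE ?(ltW e0) ?enorm_ge0 ?(ltW ey)// orbT.
Qed.

Lemma lint_truncated e : 0 < e -> lint (truncated e).
Proof.
move=> e0; apply: (le_lint (measurable_truncated e) _ (lintZ (Num.min 1 (e ^+ 2))^-1 lint_jump_mass)).
by move=> x; rewrite ger0_norm ?truncated_ge0//; exact: truncated_le.
Qed.

(** The Levy-Khintchine exponent of a symmetric process: it is real, the drift and the compensated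
    sine having dropped out. *)
Definition exponent xi : R :=
  - (\sum_i \sum_j A i j * (xi 0 i * xi 0 j)) / 2 +
  (\int[leb]_y ((cos (dot xi y) - 1) * nu y))%R.

(** The eigenvalue of [generator_approx e] on functions of frequency [xi]: mixed differences at
    scale [e] replace [xi 0 i] by [sin (e * xi 0 i) / e]. *)
Definition exponent_approx (e : R) xi : R :=
  - (\sum_i \sum_j A i j * ((sin (e * xi 0 i) / e) * (sin (e * xi 0 j) / e))) / 2 +
  (\int[leb]_y ((cos (dot xi y) - 1) * truncated e y))%R.

Lemma cos_jump_mass xi y :
  `|cos (dot xi y) - 1| * nu y <= (2 + enorm xi ^+ 2 / 2) * jump_mass y.
Proof.
rewrite /jump_mass mulrA ler_wpM2r// /Num.min; case: ifPn => _.
  by rewrite mulr1 (le_trans (cos_le2 _))// lerDl divr_ge0 ?sqr_ge0.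
apply: le_trans (cos_le_sqr _) _; rewrite mulrDl ler_wpDl ?mulr_ge0 ?enorm_ge0//.
by rewrite [leRHS]mulrAC ler_pM2r ?invr_gt0// sqr_dot_le.
Qed.

(** Taken along the sequence [e / k.+1], so that dominated convergence applies, with a multiple of
    [jump_mass] as dominating function. *)
Lemma cvg_exponent e xi : 0 < e ->
  exponent_approx (e / k.+1%:R) xi @[k --> \oo] --> exponent xi.
Proof.
move=> e0; apply: cvgD.
  apply: cvgM; last exact: cvg_cst.
  apply: cvgN; apply: cvg_sumr => i; apply: cvg_sumr => j.
  have c (a : R) : sin (e / k.+1%:R * a) / (e / k.+1%:R) @[k --> \oo] --> a.
    have e1 : e != 0 by rewrite gt_eqF.
    rewrite -{2}[a](mulKf e1).
    have : e^-1 * (N.+1%:R * sin (e * a / N.+1%:R)) @[N --> \oo] --> e^-1 * (e * a).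
      by apply: cvgM; [exact: cvg_cst|exact: cvg_natmul_sin].
    apply: cvg_trans; apply: near_eq_cvg; apply: nearW => k /=.
    rewrite invf_div (_ : e / k.+1%:R * a = e * a / k.+1%:R); last by rewrite mulrAC.
    by rewrite mulrA mulrC; congr (_ * _); rewrite mulrC.
  by apply: cvgM; [exact: cvg_cst|exact: cvgM].
have [||||_ //] := @cvg_lint (fun k y => (cos (dot xi y) - 1) * truncated (e / k.+1%:R) y)
   (fun y => (2 + enorm xi ^+ 2 / 2) * jump_mass y) (fun y => (cos (dot xi y) - 1) * nu y).
- move=> k; apply: measurable_funM; last exact: measurable_truncated.
  by apply: measurable_funB => //; exact: (bmeas_cos0 xi).1.
- by apply: lintZ; exact: lint_jump_mass.
- move=> k y; rewrite normrM (ger0_norm (truncated_ge0 _ _)).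
  apply: le_trans (cos_jump_mass xi y); rewrite ler_wpM2l// /truncated.
  by case: ifP.
- move=> y; have [->|y0] := eqVneq y 0.
    rewrite dot0r cos0 subrr mul0r; under eq_fun do rewrite mul0r; exact: cvg_cst.
  apply: cvgM; first exact: cvg_cst.
  have ye : 0 < enorm y / e by rewrite divr_gt0// enorm_gt0.
  apply: cvg_near_cst; near=> k; rewrite /truncated ifT//.
  rewrite -ltr_pdivlMl// mulrC.
  by near: k; exact: near_infty_natSinv_lt (PosNum ye).
Unshelve. all: by end_near. Qed.

(* [second_sum B z v - 2 * B v] is the symmetric second difference of [B]. *)
Definition second_sum B z v : R := B (v + z) + B (v - z).

(** Polarisation: the second differences along these shifts for [s = 1] and [s = -1] differ by about
    [4 * e ^+ 2] times the mixed derivative in directions [i] and [j]. As the Gaussian part has a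
    factor one half, it is normalised by [8 * e ^+ 2]. *)
Definition mixed_shift (e : R) (i j : 'I_n) (s : R) : 'rV[R]_n :=
  e *: (delta_mx 0 i + s *: delta_mx 0 j).

(* The Gaussian part is replaced by mixed second differences at scale [e] and
   the jumps of size at most [e] are discarded. *)
Definition generator_approx (e : R) B v : R :=
  (\sum_i \sum_j A i j * (second_sum B (mixed_shift e i j 1) v
     - second_sum B (mixed_shift e i j (-1)) v)) / (8 * e ^+ 2) +
  (\int[leb]_z ((second_sum B z v - 2 * B v) * truncated e z))%R / 2.

Definition jump_part e B v : R :=
  (\int[leb]_z ((second_sum B z v - 2 * B v) * truncated e z))%R.

Lemma lint_second_sum B z : lint B -> lint (second_sum B z).
Proof.
move=> lB; apply: lintD; under eq_fun do rewrite addrC; exact: lint_translation.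
Qed.

Lemma measurable_second_diff B : measurable_fun setT B ->
  measurable_fun setT (fun p : 'rV[R]_n * 'rV[R]_n => second_sum B p.2 p.1 - 2 * B p.1).
Proof.
move=> mB; apply: measurable_funB; last first.
  by apply: measurable_funM => //; apply: measurableT_comp mB measurable_fst.
apply: measurable_funD; apply: measurableT_comp => //.
  by apply: measurable_rVD.
by apply: measurable_rVB.
Qed.

Lemma lint_jump_integrand e B v : 0 < e -> bmeas B ->
  lint (fun z => (second_sum B z v - 2 * B v) * truncated e z).
Proof.
move=> e0 bB; under eq_fun do rewrite mulrC.
apply: lintMb; first exact: lint_truncated.
apply: bmeasB; last exact: bmeas_cst.
by apply: bmeasD; apply: bmeas_comp bB;
  [apply: measurable_rVD|apply: measurable_rVB] => //; exact: measurable_cst.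
Qed.

(** Integrating in [v] first bounds each translate of [B] by the [L^1] norm of [B] and leaves the
    integrable [truncated]. *)
Lemma integrable_jump_integrand e B (k : 'rV[R]_n -> R) : 0 < e -> bmeas B -> lint B -> bmeas k ->
  (leb \x leb)%E.-integrable setT (fun p : 'rV[R]_n * 'rV[R]_n =>
    ((second_sum B p.2 p.1 - 2 * B p.1) * truncated e p.2 * k p.1)%:E).
Proof.
move=> e0 bB lB bk.
have mf : measurable_fun setT (fun p : 'rV[R]_n * 'rV[R]_n =>
    ((second_sum B p.2 p.1 - 2 * B p.1) * truncated e p.2 * k p.1)).
  apply: measurable_funM; last by apply: measurableT_comp bk.1 measurable_fst.
  apply: measurable_funM; first by apply: measurable_second_diff; exact: bB.1.
  by apply: measurableT_comp measurable_snd; exact: measurable_truncated.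
apply/integrable21ltyP; first exact/measurable_EFinP.
have [M M0 kM] := bmeas_bound bk.
pose b := (\int[leb]_v `|B v|)%R.
have lb : lint (fun v => `|B v|) by exact: lint_norm.
(* Two translates of [B] and [2 * B] account for the factor 4. *)
apply: (@le_lt_trans _ _ (\int[leb]_z (4 * b * M * truncated e z)%:E)%E); last first.
  have := lint_lty (lintZ (4 * b * M) (lint_truncated e0)).
  by under eq_integral do rewrite ger0_norm ?mulr_ge0 ?truncated_ge0 ?Rintegral_ge0//.
apply: ge0_le_integral => //.
- by move=> z _; apply: integral_ge0.
- apply: (measurable_fun_fubini_tonelli_G (fun p => `|((second_sum B p.2 p.1 - 2 * B p.1) * truncated e p.2 * k p.1)%:E|%E)) => //.
  by apply: measurableT_comp => //; exact/measurable_EFinP.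
- by apply/measurable_EFinP; apply: measurable_funM => //; exact: measurable_truncated.
move=> z _.
have lz : lint (fun v => (`|B (z + v)| + `|B (- z + v)| + 2 * `|B v|) * (truncated e z * M)).
  apply: lintMb; last exact: bmeas_cst.
  apply: lintD; last exact: lintZ.
  by apply: lintD; apply: (@lint_translation _ _ _ (fun v => `|B v|)).
apply: (@le_trans _ _ (\int[leb]_v ((`|B (z + v)| + `|B (- z + v)| + 2 * `|B v|) * (truncated e z * M))%:E)%E).
  apply: ge0_le_integral => //.
  - apply: measurableT_comp => //; apply/measurable_EFinP.
    exact: (measurableT_comp mf (measurable_pair2 z)).
  - by apply/measurable_EFinP; exact: (lint_meas lz).
  - move=> v _; rewrite lee_fin/= !normrM (ger0_norm (truncated_ge0 _ _)) mulrA.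
    apply: ler_pM => //; first by rewrite mulr_ge0// truncated_ge0.
    rewrite ler_wpM2r ?truncated_ge0//.
    rewrite /second_sum [v + z]addrC [v - z]addrC.
    by rewrite (le_trans (ler_normB _ _))// normrM (ger0_norm (ler0n _ 2)) lerD2r ler_normD.
rewrite -lint_EFin// lee_fin RintegralZr//; last first.
  apply: lintD; last exact: lintZ.
  by apply: lintD; apply: (@lint_translation _ _ _ (fun v => `|B v|)).
rewrite RintegralD//; [|by apply: lintD; apply: (@lint_translation _ _ _ (fun v => `|B v|))|exact: lintZ].
rewrite RintegralD//; [|exact: (@lint_translation _ _ _ (fun v => `|B v|))|exact: (@lint_translation _ _ _ (fun v => `|B v|))].
rewrite !(Rint_translation _ lb) RintegralZl// -/b.
by rewrite le_eqVlt; apply/orP; left; apply/eqP; ring.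
Qed.

Lemma conv_shift B (k : 'rV[R]_n -> R) u y : lint B -> bmeas k ->
  conv B k (y + u) = (\int[leb]_v (B (v + u) * k (y - v)))%R.
Proof.
move=> lB bk; rewrite /conv -(Rint_translation u)//; last exact: lint_conv.
apply: eq_Rintegral => v _; rewrite (addrC u); congr (_ * k _).
by rewrite opprD addrACA subrr addr0.
Qed.

Lemma conv_second_sum B (k : 'rV[R]_n -> R) z y : lint B -> bmeas k ->
  second_sum (conv B k) z y = conv (second_sum B z) k y.
Proof.
move=> lB bk; rewrite /second_sum !conv_shift// -RintegralD//.
- by apply: eq_Rintegral => v _; rewrite mulrDl.
- by apply: lintMb; [under eq_fun do rewrite addrC; exact: lint_translation|exact: bmeas_reflection].
- by apply: lintMb; [under eq_fun do rewrite addrC; exact: lint_translation|exact: bmeas_reflection].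
Qed.

(** Fubini moves the kernel inside the integral over the jumps, where second differences of [B]
    become second differences of the convolution. *)
Lemma jump_part_conv e B (k : 'rV[R]_n -> R) y : 0 < e -> bmeas B -> lint B -> bmeas k ->
  lint (jump_part e B) /\ conv (jump_part e B) k y = jump_part e (conv B k) y.
Proof.
move=> e0 bB lB bk'; pose k1 v := k (y - v).
have bk : bmeas k1 by exact: bmeas_reflection.
have JE v : (jump_part e B v)%:E =
    (\int[leb]_z ((second_sum B z v - 2 * B v) * truncated e z)%:E)%E.
  by rewrite lint_EFin//; exact: lint_jump_integrand.
have b1 : bmeas (fun _ : 'rV[R]_n => 1 : R) by exact: bmeas_cst.
split.
  have := integrable_fubini_F (integrable_jump_integrand e0 bB lB b1).
  apply: eq_integrable => // v _; rewrite /= JE.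
  by apply: eq_integral => z _; rewrite /= mulr1.
rewrite /conv /jump_part /Rintegral; congr fine.
transitivity (\int[leb]_v \int[leb]_z ((second_sum B z v - 2 * B v) * truncated e z * k1 v)%:E)%E.
  apply: eq_integral => v _; rewrite EFinM -/(jump_part e B v) JE muleC.
  rewrite -integralZl//; last exact: lint_jump_integrand.
  by apply: eq_integral => z _; rewrite -EFinM mulrC.
rewrite (Fubini (integrable_jump_integrand e0 bB lB bk)).
apply: eq_integral => z _ /=.
have ls : lint (fun v => second_sum B z v * k1 v) by apply: lintMb => //; exact: lint_second_sum.
have lBk : lint (fun v => 2 * (B v * k1 v)) by apply: lintZ; exact: lintMb.
rewrite -lint_EFin; last first.
  apply: (@eq_integrable _ _ _ leb setT _ (EFin \o (fun v => truncated e z * (second_sum B z v * k1 v - 2 * (B v * k1 v)))))=> //.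
    by move=> v _ /=; congr EFin; ring.
  by apply: lintZ; exact: lintB.
congr EFin; rewrite -/(conv B k) conv_second_sum// mulrC.
transitivity (\int[leb]_v (truncated e z * (second_sum B z v * k1 v - 2 * (B v * k1 v))))%R.
  by apply: eq_Rintegral => v _; ring.
rewrite RintegralZl//; last exact: lintB.
by rewrite RintegralB// RintegralZl//; exact: lintMb.
Qed.

(** [generator_approx e] is a superposition of translations, hence commutes with convolution. *)
Lemma generator_approx_conv e B (k : 'rV[R]_n -> R) y : 0 < e -> bmeas B -> lint B -> bmeas k ->
  lint (generator_approx e B) /\
  conv (generator_approx e B) k y = generator_approx e (conv B k) y.
Proof.
move=> e0 bB lB bk'; have [lJ JE] := jump_part_conv y e0 bB lB bk'.
have bk : bmeas (fun v => k (y - v)) by exact: bmeas_reflection.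
pose D i j v := A i j * (second_sum B (mixed_shift e i j 1) v
     - second_sum B (mixed_shift e i j (-1)) v).
have lD i j : lint (D i j) by apply: lintZ; apply: lintB; exact: lint_second_sum.
have lS : lint (fun v => \sum_i \sum_j D i j v).
  by apply: lint_sum => i; exact: lint_sum.
have gE v : generator_approx e B v =
    (8 * e ^+ 2)^-1 * (\sum_i \sum_j D i j v) + 2^-1 * jump_part e B v.
  by rewrite /generator_approx mulrC; congr (_ + _); rewrite mulrC.
have -> : generator_approx e B = fun v =>
    (8 * e ^+ 2)^-1 * (\sum_i \sum_j D i j v) + 2^-1 * jump_part e B v by exact/funext.
split; first by apply: lintD; exact: lintZ.
transitivity ((8 * e ^+ 2)^-1 * (\int[leb]_v ((\sum_i \sum_j D i j v) * k (y - v))) +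
   2^-1 * conv (jump_part e B) k y)%R.
  rewrite -!RintegralZl//; try exact: lintMb.
  rewrite -RintegralD//; try by apply: lintZ; exact: lintMb.
  by apply: eq_Rintegral => v _; ring.
rewrite JE /generator_approx -/(jump_part e (conv B k) y) [in RHS]mulrC; congr (_ + _); last by rewrite mulrC.
transitivity ((8 * e ^+ 2)^-1 * (\int[leb]_v (\sum_i \sum_j (D i j v * k (y - v)))))%R.
  congr (_ * _); apply: eq_Rintegral => v _; rewrite mulr_suml.
  by apply: eq_bigr => i _; rewrite mulr_suml.
rewrite lint_Rint_sum; last by move=> i; apply: lint_sum => j; exact: lintMb.
congr (_ * _); apply: eq_bigr => i _.
rewrite lint_Rint_sum; last by move=> j; exact: lintMb.
apply: eq_bigr => j _; rewrite !conv_second_sum// /conv -RintegralB//; last 2 first.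
- by apply: lintMb => //; exact: lint_second_sum.
- by apply: lintMb => //; exact: lint_second_sum.
rewrite -RintegralZl//; last by apply: lintB; apply: lintMb => //; exact: lint_second_sum.
by apply: eq_Rintegral => v _; rewrite /D; ring.
Qed.

Lemma dot_mixed_shift e i j s xi :
  dot xi (mixed_shift e i j s) = e * xi 0 i + s * (e * xi 0 j).
Proof.
have dd (l : 'I_n) : dot xi (delta_mx 0 l) = xi 0 l.
  rewrite dotE (bigD1 l)//= mxE !eqxx mulr1 big1 ?addr0// => m ml.
  by rewrite mxE (negbTE ml) andbF mulr0.
by rewrite dotZr dotDr dotZr !dd; ring.
Qed.

(** Cosines and sines of frequency [xi] alike satisfy [g (y + z) + g (y - z) = 2 cos (xi.z) g y], so
    their combinations are eigenfunctions of every second difference. *)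
Lemma generator_approx_conv_cos e B xi y : 0 < e -> lint B ->
  generator_approx e (conv B (fun x => cos (dot xi x))) y =
  exponent_approx e xi * conv B (fun x => cos (dot xi x)) y.
Proof.
move=> e0 lB; set g := conv B _; set c := g y.
have sE z : second_sum g z y = 2 * cos (dot xi z) * c.
  rewrite /second_sum /c /g !conv_cosE// !dotDr !dotNr !(cosD, sinD, cosN, sinN).
  by ring.
rewrite /generator_approx /exponent_approx [RHS]mulrDl; congr (_ + _).
  rewrite -sumrN !mulr_suml; apply: eq_bigr => i _.
  rewrite -sumrN !mulr_suml; apply: eq_bigr => j _.
  rewrite !sE !dot_mixed_shift mul1r mulN1r cosD cosB.
  by field; rewrite gt_eqF.
transitivity ((\int[leb]_z (2 * c * ((cos (dot xi z) - 1) * truncated e z)))%R / 2).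
  by congr (_ / 2); apply: eq_Rintegral => z _; rewrite sE -/c; ring.
rewrite RintegralZl//; first by field.
under eq_fun do rewrite mulrC; apply: lintMb; first exact: lint_truncated.
by apply: bmeasB; [exact: bmeas_cos0|exact: bmeas_cst].
Qed.

End generator.

(** * Gaussian mollification *)

Section gaussian_kernel.
Context {R : realType} {n : nat}.
Local Notation leb := (@lebesgue_rV R n).
Implicit Types (B G : 'rV[R]_n -> R) (v y : 'rV[R]_n).

(** A cosine sum with values in [[0, 1]] that tends to the Gaussian [gauss b]. *)
Definition cos_kernel (b : R) (N : nat) y : R :=
  \prod_(i <- enum 'I_n) cos (b * y 0 i / N.+1%:R) ^+ (N.+1 ^ 2).*2.

Definition gauss (b : R) y : R := expR (- (b ^+ 2 * enorm y ^+ 2)).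

Lemma trig_sum_cos_kernel b N : trig_sum (cos_kernel b N).
Proof.
apply: trig_sum_prod => i; apply: trig_sumX.
under eq_fun do rewrite mulrAC; exact: trig_sum_cos.
Qed.

Lemma cos_kernel_ge0 b N y : 0 <= cos_kernel b N y.
Proof. by apply: prodr_ge0 => i _; rewrite exprn_even_ge0// odd_double. Qed.

Lemma cos_kernel_le1 b N y : cos_kernel b N y <= 1.
Proof.
rewrite /cos_kernel; elim: (enum 'I_n) => [|i s ih]; first by rewrite big_nil.
have c0 j : 0 <= cos (b * y 0 j / N.+1%:R) ^+ (N.+1 ^ 2).*2.
  by rewrite exprn_even_ge0// odd_double.
by rewrite big_cons mulr_ile1//; apply: prodr_ge0 => j _.
Qed.

Lemma cvg_cos_kernel b y : cos_kernel b N y @[N --> \oo] --> gauss b y.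
Proof.
rewrite /gauss sqr_enorm mulr_sumr -sumrN expR_sum.
rewrite /cos_kernel -big_enum/=.
elim: (enum 'I_n) => [|i s ih].
  by rewrite big_nil; under eq_fun do rewrite big_nil; exact: cvg_cst.
rewrite big_cons; under eq_fun do rewrite big_cons; apply: cvgM => //.
rewrite -exprMn; exact: cvg_cosX.
Qed.

Lemma gauss_gt0 b y : 0 < gauss b y. Proof. exact: expR_gt0. Qed.

Lemma gauss_le1 b y : gauss b y <= 1.
Proof. by rewrite expR_le1 oppr_le0 mulr_ge0// sqr_ge0. Qed.

Lemma bmeas_gauss b : bmeas (gauss b).
Proof.
split; last by exists 1 => y; rewrite ger0_norm ?gauss_le1// ltW// gauss_gt0.
apply: measurableT_comp => //; apply: measurableT_comp => //.
by apply: measurable_funM => //; apply: measurable_funX; exact: measurable_enorm.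
Qed.

Definition gauss_mass (b r : R) : R :=
  (\int[leb]_v (\1_(eball 0 r) v * gauss b v))%R.

Lemma lint_gauss_ball b r : lint (fun v => \1_(eball (0 : 'rV[R]_n) r) v * gauss b v).
Proof.
apply: lintMb; last exact: bmeas_gauss.
by apply: lint_indic; [exact: measurable_eball|exact: lebesgue_eball_lty].
Qed.

Lemma fine_lebesgue_eball_gt0 r : 0 < r -> 0 < fine (leb (eball 0 r)).
Proof.
by move=> r0; rewrite fine_gt0// lebesgue_eball_gt0// lebesgue_eball_lty.
Qed.

Lemma gauss_mass_ge b r : 0 < r ->
  expR (- (b ^+ 2 * (r / 2) ^+ 2)) * fine (leb (eball 0 (r / 2))) <= gauss_mass b r.
Proof.
move=> r0; have mB := @measurable_eball R n 0 (r / 2).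
have -> : fine (leb (eball 0 (r / 2))) = (\int[leb]_v \1_(eball 0 (r / 2)) v)%R.
  by rewrite /Rintegral integral_indic// setIT.
have li : lint (\1_(eball (0 : 'rV[R]_n) (r / 2)) : _ -> R).
  by apply: lint_indic => //; exact: lebesgue_eball_lty.
rewrite -RintegralZl//; apply: le_Rintegral => //; [exact: lintZ|exact: lint_gauss_ball|].
move=> v _; rewrite !indicE; have [vr|vr] := boolP (v \in eball 0 (r / 2)); last first.
  by rewrite mulr0 mulr_ge0// ltW// gauss_gt0.
move: vr; rewrite inE /eball/= subr0 => vr.
rewrite mem_set ?mul1r ?mulr1; last by rewrite /eball/= subr0 (lt_le_trans vr)// ler_pdivrMr// mulr_natr mulr2n lerDl ltW.
rewrite ler_expR lerN2 ler_wpM2l ?sqr_ge0// lerXn2r ?nnegrE ?enorm_ge0 ?(ltW vr)//.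
by rewrite divr_ge0// ltW.
Qed.

Lemma gauss_mass_gt0 b r : 0 < r -> 0 < gauss_mass b r.
Proof.
move=> r0; apply: lt_le_trans (gauss_mass_ge b r0).
by rewrite mulr_gt0 ?expR_gt0// fine_lebesgue_eball_gt0// divr_gt0.
Qed.

(** The mass of the ball of radius [r] is at least a constant times the kernel at radius [r / 2],
    which exceeds the kernel at radius [r] by a factor exponential in [b ^+ 2]. *)
Lemma gauss_concentration r e : 0 < r -> 0 < e ->
  exists b, expR (- (b ^+ 2 * r ^+ 2)) <= e * gauss_mass b r.
Proof.
move=> r0 e0; pose L := fine (leb (eball 0 (r / 2))).
have L0 : 0 < L by rewrite fine_lebesgue_eball_gt0// divr_gt0.
have r20 : 0 < r ^+ 2 by rewrite exprn_gt0.
(* With this [b], [s = 3 / 4 * b ^+ 2 * r ^+ 2] is at least [(e * L)^-1], and then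
   [exp (- s) <= 1 / s <= e * L]. *)
pose b := 1 + 4 / (3 * r ^+ 2 * (e * L)); exists b.
have b1 : 1 <= b by rewrite lerDl divr_ge0// !mulr_ge0// ltW.
apply: le_trans (ler_wpM2l (ltW e0) (gauss_mass_ge b r0)).
rewrite -/L [leRHS]mulrCA -ler_pdivrMl ?expR_gt0// -expRN opprK -expRD.
have -> : b ^+ 2 * (r / 2) ^+ 2 - b ^+ 2 * r ^+ 2 = - (3 / 4 * b ^+ 2 * r ^+ 2) by field.
have s0 : (e * L)^-1 <= 3 / 4 * b ^+ 2 * r ^+ 2.
  apply: (@le_trans _ _ (3 / 4 * b * r ^+ 2)); last first.
    by rewrite ler_pM2r// ler_pM2l// expr2 ler_peMl// (le_trans ler01).
  have -> : 3 / 4 * b * r ^+ 2 = 3 / 4 * r ^+ 2 + (e * L)^-1.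
    by rewrite /b; field; rewrite ?gt_eqF// ?andbT.
  by rewrite lerDr mulr_ge0// ltW.
have eL0 : 0 < e * L by exact: mulr_gt0.
have t0 : 0 < 3 / 4 * b ^+ 2 * r ^+ 2 by apply: lt_le_trans s0; rewrite invr_gt0.
rewrite expRN -[e * L]invrK lef_pV2 ?posrE ?expR_gt0 ?invr_gt0//.
apply: le_trans s0 _; apply: le_trans (expR_ge1Dx _); by rewrite lerDr.
Qed.

Lemma Rint_gauss_reflection b r y :
  (\int[leb]_v (\1_(eball 0 r) (y - v) * gauss b (y - v)) = gauss_mass b r)%R.
Proof.
have mg : measurable_fun setT (fun v : 'rV[R]_n => (\1_(eball 0 r) v * gauss b v)%:E).
  by apply/measurable_EFinP; exact: lint_meas (lint_gauss_ball b r).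
have g0 v : (0 <= (\1_(eball 0%R r) v * gauss b v)%:E)%E.
  by rewrite lee_fin mulr_ge0// ltW// gauss_gt0.
exact: (congr1 fine (ge0_integral_reflection y mg g0)).
Qed.

Lemma lint_gauss_reflection b r y :
  lint (fun v => \1_(eball 0 r) (y - v) * gauss b (y - v)).
Proof.
have bm : bmeas (fun v => \1_(eball (0 : 'rV[R]_n) r) v * gauss b v).
  by apply: bmeasM; [apply: bmeas_indic; exact: measurable_eball|exact: bmeas_gauss].
apply: (@lint_ball _ _ _ (enorm y + r)); first exact: (bmeas_reflection y bm).
move=> v vr; rewrite indicE memNset ?mul0r// /eball/= subr0 => h.
have := enorm_lerB v y; rewrite enormB; lra.
Qed.

(** Within distance [r] of [y] the function is at most [c]; beyond, the kernel is at most its value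
    at radius [r]. *)
Lemma conv_gauss_le B b r y c : lint B -> 0 < r ->
  (forall v, enorm (v - y) < r -> B v <= c) ->
  conv B (gauss b) y <=
  c * gauss_mass b r + expR (- (b ^+ 2 * r ^+ 2)) * (\int[leb]_v `|B v|)%R.
Proof.
move=> lB r0 Bc.
rewrite -(Rint_gauss_reflection b r y) -!RintegralZl//; last 2 first.
- exact: lint_gauss_reflection.
- exact: lint_norm.
have l1 : lint (fun v => c * (\1_(eball 0 r) (y - v) * gauss b (y - v))).
  by apply: lintZ; exact: lint_gauss_reflection.
have l2 : lint (fun v => expR (- (b ^+ 2 * r ^+ 2)) * `|B v|).
  by apply: lintZ; exact: lint_norm.
rewrite -RintegralD//; apply: le_Rintegral => //.
- by apply: lint_conv => //; exact: bmeas_gauss.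
- exact: lintD.
move=> v _; have [vr|vr] := ltP (enorm (v - y)) r.
  rewrite indicE mem_set ?mul1r; last by rewrite /eball/= subr0 enormB.
  apply: ler_wpDr; first by rewrite mulr_ge0// expR_ge0.
  by rewrite ler_wpM2r ?Bc// ltW// gauss_gt0.
rewrite indicE memNset ?mul0r ?mulr0 ?add0r; last first.
  by rewrite /eball/= subr0 enormB => /lt_geF; rewrite vr.
rewrite [leRHS]mulrC; apply: (@le_trans _ _ (`|B v| * gauss b (y - v))).
  by rewrite ler_wpM2r ?ler_norm// ltW// gauss_gt0.
rewrite ler_wpM2l// ler_expR lerN2 ler_wpM2l ?sqr_ge0// lerXn2r ?nnegrE ?enorm_ge0 ?(ltW r0)//.
by rewrite enormB.
Qed.

Lemma convN B k y : lint B -> bmeas k -> conv (fun v => - B v) k y = - conv B k y.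
Proof.
move=> lB bk; rewrite /conv -mulN1r -RintegralZl//; last exact: lint_conv.
by apply: eq_Rintegral => v _; rewrite mulNr mulN1r.
Qed.

Lemma conv_gauss_ge B b r y c : lint B -> 0 < r ->
  (forall v, enorm (v - y) < r -> c <= B v) ->
  c * gauss_mass b r - expR (- (b ^+ 2 * r ^+ 2)) * (\int[leb]_v `|B v|)%R <=
  conv B (gauss b) y.
Proof.
move=> lB r0 Bc.
have := @conv_gauss_le (fun v => - B v) b r y (- c) (lintN lB) r0.
under eq_Rintegral do rewrite normrN.
rewrite convN//; last exact: bmeas_gauss.
move=> H; rewrite -lerN2 opprB addrC -mulNr; apply: H => v vr.
by rewrite lerN2 Bc.
Qed.

Lemma conv_norm_le B k y : lint B -> bmeas k -> (forall x, `|k x| <= 1) ->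
  `|conv B k y| <= (\int[leb]_v `|B v|)%R.
Proof.
move=> lB bk k1; apply: lint_Rint_bound; [exact: lint_conv|exact: lint_norm|].
by move=> v; rewrite normrM ler_piMr.
Qed.

Lemma cvg_conv_cos_kernel B b y : lint B ->
  conv B (cos_kernel b N) y @[N --> \oo] --> conv B (gauss b) y.
Proof.
move=> lB.
have [||||_ //] := @cvg_lint R n (fun N v => B v * cos_kernel b N (y - v))
  (fun v => `|B v|) (fun v => B v * gauss b (y - v)).
- move=> N; apply: lint_meas; apply: lint_conv => //.
  by apply: bmeas_trig_sum; exact: trig_sum_cos_kernel.
- exact: lint_norm.
- move=> N v; rewrite normrM ler_piMr// ger0_norm ?cos_kernel_le1//.
  exact: cos_kernel_ge0.
- by move=> v; apply: cvgM; [exact: cvg_cst|exact: cvg_cos_kernel].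
Qed.

End gaussian_kernel.

Section mean_bounds.
Context {R : realDomainType}.

(** Used with [m] the Gaussian mass of a small ball, [t] the bound of the kernel outside it, [N] an
    [L^1] norm and [c] the accuracy. *)
Lemma mean_ge (c m t N x : R) : t * N <= c * m * N ->
  m * (x - c * (1 + N)) <= (x - c) * m - t * N.
Proof. lra. Qed.

Lemma mean_le (c m t N x : R) : t * N <= c * m * N ->
  (x + c) * m + t * N <= m * (x + c * (1 + N)).
Proof. lra. Qed.

Lemma scaled_le (k h c t N m : R) : 0 <= N -> t <= c * m -> k <= h * m + t * N ->
  k <= m * (h + c * N).
Proof.
move=> N0 tc kh; apply: le_trans kh _.
by rewrite mulrDr mulrC lerD2l mulrA (mulrC m) ler_wpM2r.
Qed.

Lemma defect_combine (d d' I c1 c a G K : R) : d' <= I + c1 * G -> d - d' <= c1 * a ->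
  K = G + a -> c1 * K <= c -> d <= I + c.
Proof.
move=> h1 h2 -> h3; rewrite -lerBlDl; apply: le_trans h3; rewrite mulrDr.
by rewrite lerBlDl addrA -(subrK d' d) (addrC (d - d')) lerD.
Qed.

End mean_bounds.

(** * Dynkin's inequality for rough functions *)

Section rough_dynkin.
Context {R : realType} {n : nat}.
Local Notation leb := (@lebesgue_rV R n).
Implicit Types (B G : 'rV[R]_n -> R) (v y xi : 'rV[R]_n).
Variables (A : 'M[R]_n) (nu : 'rV[R]_n -> R).
Hypotheses (mnu : measurable_fun setT nu) (nu_ge0 : forall y, 0 <= nu y).
Hypothesis nu_lty : (\int[leb]_y (Num.min 1 (enorm y ^+ 2) * nu y)%:E < +oo)%E.

Context {d1} {S1 : measurableType d1} (m1 : {finite_measure set S1 -> \bar R})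
  (w1 : S1 -> R) (Y1 : S1 -> 'rV[R]_n).
Context {d2} {S2 : measurableType d2} (m2 : {finite_measure set S2 -> \bar R})
  (w2 : S2 -> R) (Y2 : S2 -> 'rV[R]_n).
Hypotheses (bw1 : bmeas w1) (w10 : forall s, 0 <= w1 s) (mY1 : measurable_fun setT Y1).
Hypotheses (bw2 : bmeas w2) (w20 : forall s, 0 <= w2 s) (mY2 : measurable_fun setT Y2).
Variables (q : 'rV[R]_n -> R) (x0 : 'rV[R]_n).
Hypothesis bq : bmeas q.
Local Notation I1 := (wint m1 w1 Y1).
Local Notation I2 := (wint m2 w2 Y2).
Local Notation eta := (exponent A nu).

(* In the application [I1 g] is the expectation of [g] at a fixed time and
   [I2 g] its integral in time, both weighted by the Feynman-Kac functional of
   [q]; the hypothesis is Dynkin's formula for trigonometric functions. *)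
Hypothesis trig : forall xi th,
  I1 (fun y => cos (dot xi y + th)) =
  cos (dot xi x0 + th) + I2 (fun y => (eta xi - q y) * cos (dot xi y + th)).

(** Dynkin's formula would read [defect g = I2 (L g)], with [L] the generator. *)
Definition defect g : R := I1 g - g x0 + I2 (fun y => q y * g y).

Lemma defectD g1 g2 : bmeas g1 -> bmeas g2 ->
  defect (fun y => g1 y + g2 y) = defect g1 + defect g2.
Proof.
move=> b1 b2; rewrite /defect wintD//.
rewrite (_ : (fun y => q y * (g1 y + g2 y)) = fun y => q y * g1 y + q y * g2 y); last first.
  by apply/funext => y; rewrite mulrDr.
rewrite wintD//; [|exact: bmeasM|exact: bmeasM]; ring.
Qed.

Lemma defectZ c g : bmeas g -> defect (fun y => c * g y) = c * defect g.
Proof.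
move=> b1; rewrite /defect wintZ//.
rewrite (_ : (fun y => q y * (c * g y)) = fun y => c * (q y * g y)); last first.
  by apply/funext => y; rewrite mulrCA.
rewrite wintZ//; [ring|exact: bmeasM].
Qed.

Lemma defect_sum I (s : seq I) (F : I -> 'rV[R]_n -> R) :
  (forall i, bmeas (F i)) ->
  defect (fun y => \sum_(i <- s) F i y) = \sum_(i <- s) defect (F i).
Proof.
move=> bF; elim: s => [|a s ih].
  under eq_fun do rewrite big_nil.
  rewrite big_nil /defect.
  have E0 (e : measure_display) (S : measurableType e) (m : {finite_measure set S -> \bar R}) w Y :
      wint m w Y (fun=> 0 : R) = 0.
    by rewrite /wint; under eq_Rintegral do rewrite mulr0; rewrite Rintegral_cst// mul0r.
  by under [X in _ + wint _ _ _ X]eq_fun do rewrite mulr0; rewrite !E0 subrr addr0.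
rewrite big_cons -ih -defectD//; last exact: bmeas_sum.
by congr defect; apply/funext => y; rewrite big_cons.
Qed.

Lemma defect_cos xi th :
  defect (fun y => cos (dot xi y + th)) = eta xi * I2 (fun y => cos (dot xi y + th)).
Proof.
have bc := bmeas_cos xi th.
have E (a b c : R) : a + b - a + c = b + c by ring.
rewrite /defect trig E -wintD//.
- rewrite -wintZ//; congr wint; apply/funext => y; ring.
- by apply: bmeasM => //; apply: bmeasB => //; exact: bmeas_cst.
- exact: bmeasM.
Qed.

Lemma defect_conv_cos B xi : lint B ->
  defect (conv B (fun x => cos (dot xi x))) =
  eta xi * I2 (conv B (fun x => cos (dot xi x))).
Proof.
move=> lB.
set a := (\int[leb]_v (B v * cos (dot xi v)))%R.
set b := (\int[leb]_v (B v * sin (dot xi v)))%R.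
have -> : conv B (fun x => cos (dot xi x)) =
    fun y => a * cos (dot xi y + 0) + b * cos (dot xi y + - (pi / 2)).
  by apply/funext => y; rewrite conv_cosE// addr0 cosBpihalf.
have bc th := bmeas_cos xi th.
rewrite defectD ?defectZ ?wintD ?wintZ//; try exact: bmeasZ.
by rewrite !defect_cos; ring.
Qed.

(** The exponent is the limit of its approximations along [e / m.+1]. For each [m] the approximating
    sum is [I2] of the convolution of [generator_approx] of [B] with [k], and the bound by [G]
    passes through because [k] and [I2] are positive. *)
Lemma defect_conv_trig_sum B G e k : lint B -> bmeas B -> lint G ->
  trig_sum k -> (forall y, 0 <= k y) -> 0 < e ->
  (forall t v, 0 < t -> t <= e -> generator_approx A nu t B v <= G v) ->
  defect (conv B k) <= I2 (conv G k).
Proof.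
move=> lB bB lG tk k0 e0 BG; have [s kE] := tk.
have bBc (p : R * 'rV[R]_n) : bmeas (conv B (fun x => cos (dot p.2 x))) by exact: bmeas_conv_cos.
have -> : conv B k = fun y => \sum_(p <- s) p.1 * conv B (fun x => cos (dot p.2 x)) y.
  by apply/funext => y; exact: conv_trig_sumE.
rewrite defect_sum; last by move=> p; exact: bmeasZ.
pose a m := \sum_(p <- s) p.1 * (exponent_approx A nu (e / m.+1%:R) p.2 *
   I2 (conv B (fun x => cos (dot p.2 x)))).
have am : a m @[m --> \oo] -->
    \sum_(p <- s) defect (fun y => p.1 * conv B (fun x => cos (dot p.2 x)) y).
  apply: cvg_sumr => p; rewrite defectZ// defect_conv_cos//.
  apply: cvgM; first exact: cvg_cst.
  by apply: cvgM; [exact: cvg_exponent|exact: cvg_cst].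
apply: (cvgr_to_le am); apply: nearW => m.
have em : 0 < e / m.+1%:R by rewrite divr_gt0.
have eme : e / m.+1%:R <= e by rewrite ler_pdivrMr// ler_peMr ?(ltW e0)// ler1n.
have gc xi0 y := @generator_approx_conv _ _ A _ mnu nu_ge0 nu_lty _ _ _ y em bB lB (bmeas_cos0 xi0).
have gl := (gc 0 0).1.
have -> : a m = I2 (conv (generator_approx A nu (e / m.+1%:R) B) k).
  rewrite (_ : conv _ k = fun y => \sum_(p <- s) p.1 *
     (exponent_approx A nu (e / m.+1%:R) p.2 * conv B (fun x => cos (dot p.2 x)) y)); last first.
    apply/funext => y; rewrite (conv_trig_sumE y gl kE); apply: eq_bigr => p _.
    by rewrite (gc _ _).2 (generator_approx_conv_cos A mnu nu_ge0 nu_lty).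
  rewrite wint_sum//; last by move=> p; do 2 apply: bmeasZ.
  by apply: eq_bigr => p _; rewrite !wintZ//; exact: bmeasZ.
apply: le_wint => //; try exact: bmeas_conv_trig_sum.
by move=> y; apply: le_conv => //; [exact: bmeas_trig_sum|move=> v; exact: BG].
Qed.

(** Bounded convergence in [N]: the kernels are at most 1, so every convolution is bounded by an
    [L^1] norm. *)
Lemma defect_conv_gauss B G e b : lint B -> bmeas B -> lint G -> 0 < e ->
  (forall t v, 0 < t -> t <= e -> generator_approx A nu t B v <= G v) ->
  [/\ bmeas (conv B (gauss b)), bmeas (conv G (gauss b)) &
  defect (conv B (gauss b)) <= I2 (conv G (gauss b))].
Proof.
move=> lB bB lG e0 BG.
have ts N := @trig_sum_cos_kernel R n b N.
have cB y := @cvg_conv_cos_kernel R n B b y lB.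
have cG y := @cvg_conv_cos_kernel R n G b y lG.
have mB N : bmeas (conv B (cos_kernel b N)) by exact: bmeas_conv_trig_sum.
have mG N : bmeas (conv G (cos_kernel b N)) by exact: bmeas_conv_trig_sum.
have k1 N (x : 'rV[R]_n) : `|cos_kernel b N x| <= 1.
  by rewrite ger0_norm ?cos_kernel_ge0// cos_kernel_le1.
have bkN N : bmeas (@cos_kernel R n b N) by exact: bmeas_trig_sum.
have bounded D N y : lint D -> `|conv D (cos_kernel b N) y| <= (\int[leb]_v `|D v|)%R.
  by move=> lD; exact: conv_norm_le.
have bc (D : 'rV[R]_n -> R) : lint D -> bmeas (conv D (gauss b)).
  move=> lD; split.
    apply: (measurable_fun_cvg (h := fun N => conv D (cos_kernel b N))).
      by move=> N; have [] := @bmeas_conv_trig_sum R n D (cos_kernel b N) lD (ts N).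
    by move=> y _; exact: cvg_conv_cos_kernel.
  exists (\int[leb]_v `|D v|)%R => y; apply: conv_norm_le => //; first exact: bmeas_gauss.
  by move=> x; rewrite ger0_norm ?gauss_le1// ltW// gauss_gt0.
split; [exact: bc|exact: bc|].
have [M M0 qM] := bmeas_bound bq.
have c1 : defect (conv B (cos_kernel b N)) @[N --> \oo] --> defect (conv B (gauss b)).
  apply: cvgD; first apply: cvgB.
  - apply: (cvg_wint bw1 mY1 (M := (\int[leb]_v `|B v|)%R)) => //.
    by move=> N; exact: (mB N).1.
    by move=> N y; exact: bounded.
  - exact: cB.
  - apply: (cvg_wint bw2 mY2 (M := M * (\int[leb]_v `|B v|)%R)) => //.
    + by move=> N; apply: measurable_funM; [exact: bq.1|exact: (mB N).1].
    + by move=> N y; rewrite normrM ler_pM//; exact: bounded.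
    + by move=> y; apply: cvgM; [exact: cvg_cst|exact: cB].
have c2 : I2 (conv G (cos_kernel b N)) @[N --> \oo] --> I2 (conv G (gauss b)).
  apply: (cvg_wint bw2 mY2 (M := (\int[leb]_v `|G v|)%R)) => //.
    by move=> N; exact: (mG N).1.
  by move=> N y; exact: bounded.
apply: (ler_cvg_to c1 c2); apply: nearW => N.
apply: (defect_conv_trig_sum (e := e)) => //; exact: cos_kernel_ge0.
Qed.

(** A normalised Gaussian convolution [Bt] is uniformly close to [B] by uniform continuity. No
    continuity is asked of [G]: [H] dominates it on balls of radius [r0], which is all that a
    concentrated kernel sees. *)
Lemma rough_dynkin B G H e r0 : lint B -> bmeas B -> lint G -> 0 < e ->
  (forall t v, 0 < t -> t <= e -> generator_approx A nu t B v <= G v) ->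
  (forall c, 0 < c -> exists2 r, 0 < r &
    forall v y, enorm (v - y) < r -> `|B v - B y| <= c) ->
  bmeas H -> 0 < r0 -> (forall v y, enorm (v - y) < r0 -> G v <= H y) ->
  I1 B + I2 (fun y => q y * B y) <= B x0 + I2 H.
Proof.
move=> lB bB lG e0 BG ucB bH r00 GH.
suff : defect B <= I2 H by rewrite /defect; lra.
have [M M0 qM] := bmeas_bound bq.
pose nB := (\int[leb]_v `|B v|)%R; pose nG := (\int[leb]_v `|G v|)%R.
have nB0 : 0 <= nB by exact: Rintegral_ge0.
have nG0 : 0 <= nG by exact: Rintegral_ge0.
pose W1 := I1 (fun=> 1); pose W2 := I2 (fun=> 1).
have W10 : 0 <= W1 by exact: wint_ge0.
have W20 : 0 <= W2 by exact: wint_ge0.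
(* [K] collects the factors of the accuracy [c1]: the far part of [G] under [I2], and the
   replacement of [B] by [Bt] in the three terms of [defect]. *)
pose K := nG * W2 + (1 + nB) * (W1 + 1 + M * W2).
have K0 : 0 <= K by rewrite addr_ge0 ?mulr_ge0 ?addr_ge0 ?mulr_ge0.
apply/ler_addgt0Pr => c c0.
pose c1 := c / (K + 1).
have c10 : 0 < c1 by rewrite divr_gt0// ltr_wpDl.
have [r1 r10 Br1] := ucB _ c10.
pose r := Num.min r1 r0; have r_gt0 : 0 < r by rewrite lt_min r10.
have [b bP] := @gauss_concentration R n r c1 r_gt0 c10.
set m := gauss_mass b r in bP; have m0 : 0 < m by exact: gauss_mass_gt0.
set t := expR _ in bP.
have [bcB bcG dle] := defect_conv_gauss b lB bB lG e0 BG.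
(* Normalised by the mass of the small ball rather than the total mass, since the contribution from
   outside that ball is negligible. *)
pose Bt y := m^-1 * conv B (gauss b) y.
have bBt : bmeas Bt by exact: bmeasZ.
have BtB y : `|Bt y - B y| <= c1 * (1 + nB).
  have H1 := @conv_gauss_le R n B b r y (B y + c1) lB r_gt0.
  have H2 := @conv_gauss_ge R n B b r y (B y - c1) lB r_gt0.
  have near v : enorm (v - y) < r -> `|B v - B y| <= c1.
    by rewrite lt_min => /andP[vr _]; exact: Br1.
  have {}H1 : conv B (gauss b) y <= (B y + c1) * m + t * nB.
    by apply: H1 => v /near; rewrite ler_distl => /andP[].
  have {}H2 : (B y - c1) * m - t * nB <= conv B (gauss b) y.
    by apply: H2 => v /near; rewrite ler_distl => /andP[].
  have tn : t * nB <= c1 * m * nB by rewrite ler_wpM2r.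
  rewrite /Bt ler_distl; apply/andP; split.
    rewrite ler_pdivlMl; last exact: m0.
    have h := @mean_ge R c1 m t nB (B y) tn.
    apply: le_trans H2.
    exact: h.
  rewrite ler_pdivrMl; last exact: m0.
    have h := @mean_le R c1 m t nB (B y) tn.
  exact: le_trans H1 h.
have dBt : defect Bt <= I2 H + c1 * (nG * W2).
  rewrite /Bt defectZ// ler_pdivrMl//; apply: le_trans dle _.
  have -> : c1 * (nG * W2) = I2 (fun=> c1 * nG * 1) by rewrite mulrA (wintZ m2 bw2 mY2 (c1 * nG))//; exact: bmeas_cst.
  rewrite -(wintD m2 bw2 mY2)//; last by apply: bmeasZ; exact: bmeas_cst.
  rewrite -(wintZ m2 bw2 mY2); last by apply: bmeasD => //; apply: bmeasZ; exact: bmeas_cst.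
  apply: le_wint => //.
    by apply: bmeasZ; apply: bmeasD => //; apply: bmeasZ; exact: bmeas_cst.
  move=> y; have := @conv_gauss_le R n G b r y (H y) lG r_gt0.
  have near v : enorm (v - y) < r -> G v <= H y.
    by rewrite lt_min => /andP[_ vr]; exact: GH.
  move=> /(_ near) h.
  by rewrite mulr1; apply: scaled_le h.
have dd : `|defect B - defect Bt| <= c1 * ((1 + nB) * (W1 + 1 + M * W2)).
  have bqB : bmeas (fun y => q y * B y) by exact: bmeasM.
  have bqBt : bmeas (fun y => q y * Bt y) by exact: bmeasM.
  have BBt y : `|B y - Bt y| <= c1 * (1 + nB) by rewrite distrC.
  have h1 : `|I1 B - I1 Bt| <= c1 * (1 + nB) * W1 by exact: wint_dist.
  have h2 : `|I2 (fun y => q y * B y) - I2 (fun y => q y * Bt y)| <= c1 * (1 + nB) * M * W2.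
    apply: wint_dist => // y; rewrite -mulrBr normrM mulrC ler_pM//.
  have h3 := BBt x0.
  rewrite /defect (_ : _ - _ = (I1 B - I1 Bt) - (B x0 - Bt x0) +
    (I2 (fun y => q y * B y) - I2 (fun y => q y * Bt y))); last by ring.
  apply: le_trans (ler_normD _ _) _.
  apply: le_trans (lerD (ler_normB _ _) h2) _.
  apply: le_trans (lerD (lerD h1 h3) (lexx _)) _.
  by rewrite le_eqVlt; apply/orP; left; apply/eqP; ring.
have cK : c1 * K <= c.
  rewrite /c1 mulrAC ler_pdivrMr ?ltr_wpDl// ler_wpM2l ?(ltW c0)//.
  by rewrite lerDl.
exact: defect_combine dBt (le_trans (ler_norm _) dd) _ cK.
Qed.

End rough_dynkin.

(** * The tamed jump density *)

(** (A1) as a property of [nu] alone, detached from the process, with [0 <= nu] also at the origin.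
    The density of the theorem satisfies it once its value at the origin is reset to 0. *)
Record jump_density (R : realType) (n : nat) (nu : 'rV[R]_n -> R) : Prop := JumpDensity {
  jd_dim : (0 < n)%N ;
  jd_meas : measurable_fun setT nu ;
  jd_ge0 : forall x, 0 <= nu x ;
  jd_gt0 : forall x, x != 0 -> 0 < nu x ;
  jd_lty : (\int[@lebesgue_rV R n]_y (Num.min 1 (enorm y ^+ 2) * nu y)%:E < +oo)%E ;
  jd_cmp : forall r : R, 0 < r <= 1 / 2 -> exists2 C1 : R, 1 <= C1 &
    forall x y, r <= enorm y -> enorm y <= enorm x <= enorm y + 1 ->
      C1^-1 * nu y <= nu x <= C1 * nu y ;
  jd_dec : exists2 C2 : R, 1 <= C2 &
    forall x y, 1 / 2 <= enorm y -> enorm y <= enorm x -> nu x <= C2 * nu y ;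
  jd_conv : exists2 C3 : R, 1 <= C3 &
    forall x y, 1 <= enorm (y - x) ->
      let D := [set z | 1 / 2 < enorm (z - x) /\ 1 / 2 < enorm (z - y)] in
      (\int[@lebesgue_rV R n]_(z in D) (nu (x - z) * nu (z - y))%:E
         <= (C3 * nu (x - y))%:E)%E }.

Section tamed_density.
Context {R : realType} {n : nat}.
Local Notation leb := (@lebesgue_rV R n).
Implicit Types (x y v z : 'rV[R]_n).
Variable nu : 'rV[R]_n -> R.
Hypothesis J : jump_density nu.

Definition tame x : R := if 1 / 2 < enorm x then nu x else 1.

Lemma tameE x : 1 / 2 < enorm x -> tame x = nu x.
Proof. by rewrite /tame => ->. Qed.

Lemma tame1 x : enorm x <= 1 / 2 -> tame x = 1.
Proof. by rewrite /tame ltNge => ->. Qed.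

Lemma exists_enorm (r : R) : 0 <= r -> exists x, enorm x = r.
Proof.
move=> r0; pose i0 : 'I_n := Ordinal (jd_dim J).
exists (r *: delta_mx 0 i0); rewrite enormZ ger0_norm// -[RHS]mulr1; congr (_ * _).
apply/eqP; rewrite -(@eqrXn2 _ 2) ?enorm_ge0// expr1n sqr_enorm (bigD1 i0)//= mxE !eqxx expr1n.
by rewrite big1 ?addr0// => i /negbTE ii; rewrite mxE ii andbF expr0n.
Qed.

Lemma nu_gt0 r x : 0 < r -> r <= enorm x -> 0 < nu x.
Proof. by move=> r0 rx; apply: (jd_gt0 J); rewrite -enorm_gt0 (lt_le_trans r0). Qed.

Lemma tame_gt0 x : 0 < tame x.
Proof. by rewrite /tame; case: ifPn => // xr; apply: (@nu_gt0 (1 / 2)) => //; exact: ltW. Qed.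

Lemma measurable_tame : measurable_fun setT tame.
Proof.
apply: measurable_fun_ifT => //; last exact: (jd_meas J).
by apply: measurable_fun_ltr => //; exact: measurable_enorm.
Qed.

Lemma tame_le : exists2 M : R, 0 < M & forall x, tame x <= M.
Proof.
have [y yr] := @exists_enorm (1 / 2) ltac:(by []).
have [C C1 H] := jd_dec J.
exists (1 + C * nu y) => [|x]; first by rewrite ltr_pwDl// mulr_ge0 ?(jd_ge0 J)// (le_trans _ C1).
rewrite /tame; case: ifPn => xr.
  by rewrite (le_trans (H x y _ _)) ?yr ?(ltW xr)// lerDr.
by rewrite lerDl mulr_ge0 ?(jd_ge0 J)// (le_trans _ C1).
Qed.

Lemma bmeas_tame : bmeas tame.
Proof.
split; first exact: measurable_tame.
have [M _ tM] := tame_le; exists M => x.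
by rewrite ger0_norm// ltW// tame_gt0.
Qed.

Lemma lint_tame : lint tame.
Proof.
have lj : lint (jump_mass nu).
  by apply: lint_jump_mass; [exact: jd_meas J|exact: jd_ge0 J|exact: jd_lty J].
have li : lint (\1_(eball (0 : 'rV[R]_n) 1) : _ -> R).
  by apply: lint_indic; [exact: measurable_eball|exact: lebesgue_eball_lty].
(* Beyond radius [1 / 2] one has [Num.min 1 (enorm x ^+ 2) >= 1 / 4]. *)
apply: (le_lint measurable_tame _ (lintD (lintZ 4 lj) li)) => x.
rewrite ger0_norm ?(ltW (tame_gt0 _))// indicE /tame; case: ifPn => xr.
  rewrite -[leLHS]addr0 lerD//; rewrite /jump_mass mulrA ler_peMl ?(jd_ge0 J)//.
  rewrite -ler_pdivrMl// mulr1 le_min invf_le1// ?ler1n//=.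
  rewrite (_ : 4^-1 = (1 / 2) ^+ 2); last by field.
  by rewrite lerXn2r ?nnegrE ?enorm_ge0// ltW.
rewrite mem_set/=; last by rewrite /eball/= subr0; move: xr; rewrite -leNgt; lra.
by rewrite lerDr mulr_ge0 ?jump_mass_ge0//; exact: jd_ge0 J.
Qed.

Lemma nu_lower r : 0 < r -> r <= 1 / 2 -> exists2 c : R, 0 < c &
  forall x, r <= enorm x -> enorm x <= r + 1 -> c <= nu x.
Proof.
move=> r0 r1; have [y yr] := @exists_enorm r (ltW r0).
have [C C1 H] := jd_cmp J (introT andP (conj r0 r1)).
have C0 : 0 < C by rewrite (lt_le_trans _ C1).
exists (C^-1 * nu y); first by rewrite mulr_gt0 ?invr_gt0// (nu_gt0 r0)// yr.
by move=> x rx xr; have := H x y; rewrite yr lexx rx xr => /(_ isT isT)/andP[].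
Qed.

(** Cases according to which points lie beyond radius [1 / 2]: (A1)(1) compares two such points, and
    the bound [M] together with the lower bound [c] on the shell up to radius [3 / 2] settles the
    mixed cases. *)
Lemma tame_cmp : exists2 C : R, 0 < C &
  forall x y, enorm x <= enorm y + 1 -> enorm y <= enorm x + 1 -> tame x <= C * tame y.
Proof.
have h2 : (0 < (1 / 2 : R)) && ((1 / 2 : R) <= 1 / 2) by apply/andP; split; lra.
have [C C1 H] := jd_cmp J h2.
have [M M0 tM] := tame_le.
have [c c0 lo] := @nu_lower (1 / 2) ltac:(lra) ltac:(lra).
have C0 : 0 < C by rewrite (lt_le_trans _ C1).
have Mc0 : 0 <= M / c by rewrite divr_ge0// ltW.
exists (C + M + c^-1 + 1); first by rewrite !addr_gt0// invr_gt0.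
move=> x y xy yx; rewrite !mulrDl.
have ty := tame_gt0 y.
have p1 : 0 <= C * tame y by rewrite mulr_ge0// ltW.
have p2 : 0 <= M * tame y by rewrite mulr_ge0// ltW.
have p3 : 0 <= c^-1 * tame y by rewrite mulr_ge0// ?invr_ge0 ltW.
have [x2|x2] := ltP (1 / 2) (enorm x); have [y2|y2] := ltP (1 / 2) (enorm y).
- suff : tame x <= C * tame y by lra.
  rewrite !tameE//; have [le|le] := leP (enorm y) (enorm x).
    by have /andP[] := H x y (ltW y2) (introT andP (conj le xy)).
  have /andP[+ _] := H y x (ltW x2) (introT andP (conj (ltW le) yx)).
  by rewrite ler_pdivrMl.
- suff : tame x <= M * tame y by lra.
  by rewrite (tame1 y2) mulr1.
- suff : tame x <= c^-1 * tame y by lra.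
  rewrite (tame1 x2) (tameE y2) ler_pdivlMl// mulr1.
  by apply: lo; [exact: ltW|move: yx x2; lra].
- by rewrite (tame1 x2) (tame1 y2); move: p1 p2 p3; rewrite (tame1 y2); lra.
Qed.

(** Near the origin and near [y] one factor is 1 and the other is comparable with [tame y], which
    costs [C * tame y] times the volume of a ball; on the rest both factors are [nu] and (A1)(3)
    applies. *)
Lemma tame_conv : exists2 C : R, 0 < C & forall y, conv tame tame y <= C * tame y.
Proof.
have [C C0 cmp] := tame_cmp; have [M M0 tM] := tame_le.
have [C3 C31 H3] := jd_conv J.
pose L := (\int[leb]_v tame v)%R.
have L0 : 0 <= L by apply: Rintegral_ge0 => v _; exact/ltW/tame_gt0.
have bt := bmeas_tame; have lt := lint_tame.
have li : lint (\1_(eball (0 : 'rV[R]_n) 1) : _ -> R).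
  by apply: lint_indic; [exact: measurable_eball|exact: lebesgue_eball_lty].
pose b := (\int[leb]_v \1_(eball (0 : 'rV[R]_n) 1) v)%R.
have b0 : 0 <= b by apply: Rintegral_ge0.
exists (M * L * C + C3 + 2 * C * b + 1).
  by rewrite ltr_wpDl// !addr_ge0 ?mulr_ge0 ?(ltW C0) ?(ltW M0)// (le_trans _ C31).
move=> y; have ty := tame_gt0 y.
have P1 : 0 <= M * L * C * tame y by rewrite !mulr_ge0// ltW.
have P2 : 0 <= C3 * tame y by rewrite mulr_ge0 ?(ltW ty)// (le_trans _ C31).
have P3 : 0 <= 2 * C * b * tame y by rewrite !mulr_ge0// ltW.
rewrite !mulrDl mul1r.
(* For [y] in the unit ball [tame y] is bounded below, so the crude bound [M * L] is enough. *)
have [y1|y1] := leP (enorm y) 1.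
  have h : conv tame tame y <= M * L.
    rewrite /conv /L -RintegralZl//; apply: le_Rintegral => //; [exact: lint_conv|exact: lintZ|].
    by move=> v _; rewrite [leRHS]mulrC ler_wpM2l// ltW// tame_gt0.
  have h2 : 1 <= C * tame y.
    have := cmp 0 y; rewrite enorm0 add0r tame1 ?enorm0 ?divr_ge0//; apply=> //.
    by rewrite addr_ge0// enorm_ge0.
  suff : M * L <= M * L * C * tame y by lra.
  by rewrite -[M * L * C * _]mulrA ler_peMr// mulr_ge0// ltW.
pose D := [set z | 1 / 2 < enorm (z - y) /\ 1 / 2 < enorm (z - 0)].
have mD : measurable D.
  have m1 (a : 'rV[R]_n) : measurable [set z | 1 / 2 < enorm (z - a)].
    have ma : measurable_fun setT (fun z : 'rV[R]_n => enorm (z - a)).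
      by apply: measurableT_comp; [exact: measurable_enorm|apply: measurable_rVB].
    have := ma measurableT `](1 / 2 : R), +oo[%classic (measurable_itv _).
    by rewrite setTI set_itvE.
  exact: measurableI (m1 y) (m1 0).
pose I1 v := \1_(eball (0 : 'rV[R]_n) 1) v : R.
have lI2 : lint (fun v => I1 (y - v)).
  apply: (@lint_ball _ _ _ (enorm y + 1)).
    by apply: bmeas_reflection; apply: bmeas_indic; exact: measurable_eball.
  move=> v vr; rewrite /I1 indicE memNset// /eball/= subr0 => h.
  by have := enorm_lerB v y; rewrite enormB; move: h vr; lra.
have bI2 : (\int[leb]_v I1 (y - v))%R = b.
  have mg : measurable_fun setT (fun v : 'rV[R]_n => (I1 v)%:E).
    by apply/measurable_EFinP; exact: lint_meas li.
  have g0 v : (0 <= (I1 v)%:E)%E by rewrite lee_fin.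
  exact: (congr1 fine (ge0_integral_reflection y mg g0)).
have lD : lint (fun v => \1_D v * (nu (y - v) * nu (v - 0))).
  apply: (le_lint _ _ (lint_conv y lt bt)).
    apply: measurable_funM; first exact: measurable_indic.
    by apply: measurable_funM; apply: (measurableT_comp (jd_meas J)); apply: measurable_rVB.
  move=> v; rewrite indicE; case: (boolP (v \in D)) => [|_]; last first.
    by rewrite mul0r normr0; exact: (mulr_ge0 (ltW (tame_gt0 v)) (ltW (tame_gt0 (y - v)))).
  rewrite inE => -[v1 v2]; rewrite mul1r -!tameE//; last by rewrite enormB.
  by rewrite ger0_norm ?mulr_ge0 ?(ltW (tame_gt0 _))// subr0 mulrC.
have hD : (\int[leb]_v (\1_D v * (nu (y - v) * nu (v - 0))))%R <= C3 * nu y.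
  have := H3 y 0; rewrite subr0 sub0r enormN => /(_ (ltW y1))/= h.
  rewrite -lee_fin lint_EFin//; apply: le_trans h.
  rewrite [leRHS]integral_mkcond le_eqVlt; apply/orP; left; apply/eqP/eq_integral => v _.
  rewrite patchE indicE; case: ifPn => vD.
    by rewrite mul1r subr0.
  by rewrite mul0r.
clear H3; have yE : tame y = nu y by rewrite tameE//; lra.
have Cty : 0 <= C * tame y by exact: (mulr_ge0 (ltW C0) (ltW ty)).
have i1 v : 0 <= I1 v by exact: ler0n.
have lT : lint (fun v => (\1_D v * (nu (y - v) * nu (v - 0)) + C * tame y * I1 v) +
    C * tame y * I1 (y - v)).
  by apply: lintD; [apply: lintD => //; exact: lintZ|exact: lintZ].
have main : conv tame tame y <= C3 * tame y + C * tame y * b + C * tame y * b.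
  apply: (@le_trans _ _ (\int[leb]_v ((\1_D v * (nu (y - v) * nu (v - 0)) + C * tame y * I1 v) +
    C * tame y * I1 (y - v)))%R); last first.
    have l1 : lint (fun v => C * tame y * I1 v) by exact: (lintZ _ li).
    have l2 : lint (fun v => C * tame y * I1 (y - v)) by exact: (lintZ _ lI2).
    rewrite (RintegralD measurableT (lintD lD l1) l2) (RintegralD measurableT lD l1).
    by rewrite (RintegralZl (C * tame y) measurableT li) (RintegralZl (C * tame y) measurableT lI2) -/b bI2 lerD2r lerD2r yE; exact: hD.
  apply: le_Rintegral => //; first exact: lint_conv.
  move=> v _; have t1 := ltW (tame_gt0 v); have t2 := ltW (tame_gt0 (y - v)).
  have nn : 0 <= \1_D v * (nu (y - v) * nu (v - 0)) :> R by rewrite !mulr_ge0 ?(jd_ge0 J).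
  have n1 : 0 <= C * tame y * I1 v by exact: (mulr_ge0 Cty (i1 v)).
  have n2 : 0 <= C * tame y * I1 (y - v) by exact: (mulr_ge0 Cty (i1 (y - v))).
  have [v2|v2] := leP (enorm v) (1 / 2).
    have -> : tame v = 1 by exact: tame1.
    have -> : I1 v = 1 by rewrite /I1 indicE mem_set// /eball/= subr0; lra.
    have : tame (y - v) <= C * tame y.
      by apply: cmp; [have := ler_enormB y v|have := enorm_lerB y v]; move: v2; lra.
    by move: nn n2; rewrite !mulr1 mul1r; lra.
  have [yv|yv] := leP (enorm (y - v)) (1 / 2).
    have -> : tame (y - v) = 1 by exact: tame1.
    have -> : I1 (y - v) = 1 by rewrite /I1 indicE mem_set// /eball/= subr0; lra.
    have : tame v <= C * tame y.
      by apply: cmp; [have := enorm_lerB v y; rewrite enormB|have := enorm_lerB y v]; move: yv; lra.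
    by move: nn n1; rewrite !mulr1; lra.
  rewrite indicE mem_set/=; last by rewrite /D/= subr0 enormB.
  by rewrite mul1r subr0 -!tameE// mulrC; move: n1 n2; lra.
by move: main; lra.
Qed.

(** [tame] is integrable and, by (A1)(2), at least a constant times [nu x] on the shell
    [1 <= |v| < |x|], whose volume tends to infinity with [|x|]. *)
Lemma tame_vanish (e : R) : 0 < e -> exists2 r : R, 1 / 2 <= r & forall x, r < enorm x -> tame x < e.
Proof.
move=> e0; have [C C1 H] := jd_dec J.
pose L := (\int[leb]_v tame v)%R.
have L0 : 0 <= L by apply: Rintegral_ge0 => v _; exact/ltW/tame_gt0.
pose l1 := fine (leb (eball 0 1)).
have l10 : 0 <= l1 by exact: fine_ge0.
(* Chosen so that the shell has volume at least [C * L / e + 1]; [1 <= K] gives [K <= K ^+ n]. *)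
pose K := C * L / e + l1 + 1.
have K1 : 1 <= K.
  by rewrite lerDr addr_ge0// divr_ge0 ?mulr_ge0 ?(ltW e0)// (le_trans _ C1).
pose r := n.+1%:R * K; exists (r + 1) => [|x rx].
  have : 0 <= r by rewrite mulr_ge0// (le_trans _ K1).
  by lra.
have r0 : 0 < r by rewrite mulr_gt0// (lt_le_trans _ K1).
have x0 : 0 < enorm x by rewrite (lt_trans _ rx)// addr_gt0.
have Kx : K <= fine (leb (eball 0 (enorm x))).
  rewrite -lee_fin fineK; last by rewrite ge0_fin_numE ?lebesgue_eball_lty.
  apply: le_trans (lebesgue_eball_ge x0); rewrite lee_fin.
  have Kx : K <= enorm x / n.+1%:R by rewrite ler_pdivlMr// mulrC -/r; move: rx; lra.
  apply: le_trans Kx _; rewrite -[leLHS]expr1 ler_weXn2l ?(jd_dim J)//.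
  by rewrite (le_trans K1)// ler_pdivlMr// mulrC -/r; move: rx; lra.
have bx : enorm x > 1 / 2 by move: rx r0; lra.
have li a : lint (\1_(eball (0 : 'rV[R]_n) a) : _ -> R).
  by apply: lint_indic; [exact: measurable_eball|exact: lebesgue_eball_lty].
have iE a : (\int[leb]_v \1_(eball (0 : 'rV[R]_n) a) v)%R = fine (leb (eball 0 a)).
  by rewrite /Rintegral integral_indic ?setIT//; exact: measurable_eball.
have : nu x * (fine (leb (eball 0 (enorm x))) - l1) <= C * L.
  have -> : nu x * (fine (leb (eball 0 (enorm x))) - l1) =
      (\int[leb]_v (nu x * (\1_(eball (0 : 'rV[R]_n) (enorm x)) v - \1_(eball (0 : 'rV[R]_n) 1) v)))%R.
    rewrite RintegralZl//; [congr (_ * _)|exact: lintB].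
    by rewrite /l1 -!iE; apply/esym; apply: RintegralB => //; exact: li.
  rewrite -RintegralZl//; last exact: lint_tame.
  apply: le_Rintegral => //; [by apply: lintZ; exact: lintB|by apply: lintZ; exact: lint_tame|].
  move=> v _; rewrite !indicE.
  have Cv : 0 <= C * tame v by rewrite mulr_ge0 ?(ltW (tame_gt0 _))// (le_trans _ C1).
  have nx := jd_ge0 J x.
  have [v1|v1] := ltP (enorm v) 1.
    rewrite (@mem_set _ (eball 0 1))/=; last by rewrite /eball/= subr0.
    apply: le_trans Cv; rewrite mulr_ge0_le0// subr_le0.
    by case: (_ \in _).
  rewrite (@memNset _ (eball 0 1))/=; last by rewrite /eball/= subr0 => h; move: h v1; lra.
  rewrite subr0; case: (boolP (v \in _)) => [|_]; last by rewrite mulr0.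
  rewrite inE /eball/= subr0 mulr1 => vx.
  by rewrite tameE ?H//; [lra|exact: ltW|lra].
rewrite (tameE bx) => h.
have Ke : C * L / e + 1 <= fine (leb (eball 0 (enorm x))) - l1 by move: Kx; rewrite /K; lra.
have p : 0 < C * L / e + 1 by rewrite ltr_wpDl// divr_ge0 ?mulr_ge0 ?(ltW e0)// (le_trans _ C1).
have : nu x * (C * L / e + 1) <= C * L.
  by apply: le_trans h; rewrite ler_wpM2l ?(jd_ge0 J).
rewrite -ler_pdivlMr// => /le_lt_trans; apply.
by rewrite ltr_pdivrMr// mulrDr mulr1 mulrCA divff ?gt_eqF// mulr1 ltrDl.
Qed.

End tamed_density.

(** * Squared positive parts *)

Section smooth_square.
Context {R : realFieldType}.
Implicit Types a s : R.

(** Convexity in [s]: the squared positive part lies above its tangent. *)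
Lemma max0_tangent a s s' :
  Num.max 0 (a - s) ^+ 2 - 2 * Num.max 0 (a - s) * (s' - s) <= Num.max 0 (a - s') ^+ 2.
Proof.
set p := Num.max 0 (a - s); set p' := Num.max 0 (a - s').
have p0 : 0 <= p by rewrite le_max lexx.
have p'a : a - s' <= p' by rewrite le_max lexx orbT.
have pE : p * (a - s) = p * p.
  by rewrite /p; case: (leP 0 (a - s)) => //; rewrite !mul0r.
have h : p * (p - p') <= p * (s' - s).
  by rewrite mulrBr -pE -mulrBr ler_wpM2l//; move: p'a; lra.
rewrite -subr_ge0; have := sqr_ge0 (p - p'); move: h; clearbody p p'; nra.
Qed.

(** The right-hand side is the square of [p - (s' - s)], [p] being the positive part at [s], and
    this number is at least [a - s']. *)
Lemma max0_smooth a s s' : Num.max 0 (a - s') ^+ 2 <=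
  Num.max 0 (a - s) ^+ 2 - 2 * Num.max 0 (a - s) * (s' - s) + (s' - s) ^+ 2.
Proof.
set p := Num.max 0 (a - s); set p' := Num.max 0 (a - s').
have -> : p ^+ 2 - 2 * p * (s' - s) + (s' - s) ^+ 2 = (p - (s' - s)) ^+ 2 by ring.
have [h|h] := leP (a - s') 0.
  by rewrite /p' max_l// expr0n sqr_ge0.
have pa : a - s <= p by rewrite le_max lexx orbT.
rewrite /p' max_r ?(ltW h)// lerXn2r ?nnegrE ?(ltW h)//; clearbody p; lra.
Qed.

(** Meant for [s = |v|^2], [d = v.z] and [q = |z|^2], when [s + 2 d + q] and [s - 2 d + q] are the
    squared norms of [v + z] and [v - z]. *)
Lemma max0_second a s q d : 0 <= q ->
  `|Num.max 0 (a - (s + 2 * d + q)) ^+ 2 + Num.max 0 (a - (s - 2 * d + q)) ^+ 2 -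
    2 * Num.max 0 (a - s) ^+ 2| <=
  4 * Num.max 0 (a - s) * q + 2 * q ^+ 2 + 8 * d ^+ 2.
Proof.
move=> q0.
have := max0_tangent a s (s + 2 * d + q); have := max0_tangent a s (s - 2 * d + q).
have := max0_smooth a s (s + 2 * d + q); have := max0_smooth a s (s - 2 * d + q).
set p := Num.max 0 (a - s); set p1 := Num.max 0 _; set p2 := Num.max 0 _.
have p0 : 0 <= p by rewrite le_max lexx.
have pq : 0 <= p * q by rewrite mulr_ge0.
have := sqr_ge0 d; have := sqr_ge0 q.
clearbody p p1 p2.
rewrite (_ : s + 2 * d + q - s = 2 * d + q); last by ring.
rewrite (_ : s - 2 * d + q - s = q - 2 * d); last by ring.
rewrite (_ : (2 * d + q) ^+ 2 = 4 * d ^+ 2 + 4 * d * q + q ^+ 2); last by ring.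
rewrite (_ : (q - 2 * d) ^+ 2 = 4 * d ^+ 2 - 4 * d * q + q ^+ 2); last by ring.
rewrite ler_norml => q2 d2 h1 h2 h3 h4; apply/andP; split; lra.
Qed.

End smooth_square.

(** * Bump functions *)

Section bump.
Context {R : realType} {n : nat}.
Local Notation leb := (@lebesgue_rV R n).
Implicit Types (x y v z : 'rV[R]_n).

(** Squaring the positive part gives a Lipschitz gradient, so second differences are quadratic in
    the increment. *)
Definition bump (r : R) y : R := Num.max 0 (r ^+ 2 - enorm y ^+ 2) ^+ 2.

Lemma bump_ge0 r y : 0 <= bump r y. Proof. exact: sqr_ge0. Qed.

Lemma bump_out r y : 0 <= r -> r <= enorm y -> bump r y = 0.
Proof.
move=> r0 ry; rewrite /bump max_l ?expr0n// subr_le0.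
by rewrite lerXn2r// nnegrE enorm_ge0.
Qed.

Lemma bump_base_le r y : 0 <= r -> r <= 1 -> Num.max 0 (r ^+ 2 - enorm y ^+ 2) <= 1.
Proof.
move=> r0 r1; rewrite ge_max ler01/= (@le_trans _ _ (r ^+ 2))//.
  by rewrite lerBlDr lerDl sqr_ge0.
by rewrite exprn_ile1.
Qed.

Lemma bump_base_ge0 r y : 0 <= Num.max 0 (r ^+ 2 - enorm y ^+ 2).
Proof. by rewrite le_max lexx. Qed.

Lemma bump_le1 r y : 0 <= r -> r <= 1 -> bump r y <= 1.
Proof. by move=> r0 r1; rewrite exprn_ile1// ?bump_base_ge0// bump_base_le. Qed.

Lemma bump_ge r s y : 0 <= s -> s <= r -> enorm y <= s -> (r ^+ 2 - s ^+ 2) ^+ 2 <= bump r y.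
Proof.
move=> s0 sr ys; have h : s ^+ 2 <= r ^+ 2 by rewrite lerXn2r ?nnegrE ?(le_trans s0).
have h' : enorm y ^+ 2 <= s ^+ 2 by rewrite lerXn2r ?nnegrE ?enorm_ge0.
rewrite /bump lerXn2r ?nnegrE ?bump_base_ge0 ?subr_ge0// le_max lerB// orbT//.
Qed.

Lemma bmeas_bump r : 0 <= r -> r <= 1 -> bmeas (bump r).
Proof.
move=> r0 r1; split; last first.
  by exists 1 => y; rewrite ger0_norm ?bump_ge0// bump_le1.
apply: measurable_funX; apply: measurable_maxr => //.
by apply: measurable_funB => //; apply: measurable_funX; exact: measurable_enorm.
Qed.

Lemma lint_bump r : 0 <= r -> r <= 1 -> lint (bump r).
Proof.
move=> r0 r1; apply: (@lint_ball _ _ _ r); first exact: bmeas_bump.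
by move=> x; exact: bump_out.
Qed.

Lemma bump_base_min (r t : R) : 0 <= r -> 0 <= t ->
  Num.max 0 (r ^+ 2 - t ^+ 2) = r ^+ 2 - Num.min t r ^+ 2.
Proof.
move=> r0 t0; case: (leP t r) => tr.
  by rewrite max_r// subr_ge0 lerXn2r.
by rewrite subrr max_l// subr_le0 lerXn2r ?nnegrE// ltW.
Qed.

Lemma min_lip (t t' r : R) : `|Num.min t r - Num.min t' r| <= `|t - t'|.
Proof.
case: (leP t r) => h; case: (leP t' r) => h' //.
- by rewrite distrC [leRHS]distrC !ger0_norm//; lra.
- by rewrite !ger0_norm//; lra.
- by rewrite subrr normr0.
Qed.

(** With [m] and [m'] the norms cut at [r], the difference factors as
    [(m - m') (m + m') (m^2 + m'^2 - 2 r^2)], and the last two factors are at most 2 in absolute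
    value. *)
Lemma bump_lip (r : R) x y : 0 <= r -> r <= 1 -> `|bump r x - bump r y| <= 4 * enorm (x - y).
Proof.
move=> r0 r1; rewrite /bump !bump_base_min ?enorm_ge0//.
have d1 : `|enorm x - enorm y| <= enorm (x - y).
  rewrite ler_norml; have := enorm_lerB x y; have := enorm_lerB y x; rewrite (enormB y).
  by move=> *; apply/andP; split; lra.
have := le_trans (min_lip (enorm x) (enorm y) r) d1.
set m := Num.min _ r; set m' := Num.min _ r.
have m0 : 0 <= m by rewrite le_min enorm_ge0.
have m'0 : 0 <= m' by rewrite le_min enorm_ge0.
have mr : m <= r by rewrite ge_min lexx orbT.
have m'r : m' <= r by rewrite ge_min lexx orbT.
have r21 : r ^+ 2 <= 1 by rewrite exprn_ile1.
have m2 : m ^+ 2 <= r ^+ 2 by rewrite lerXn2r.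
have m'2 : m' ^+ 2 <= r ^+ 2 by rewrite lerXn2r.
move=> mm.
rewrite (_ : _ - _ = (m - m') * ((m + m') * (m ^+ 2 + m' ^+ 2 - 2 * r ^+ 2))); last by ring.
rewrite normrM mulrC ler_pM// normrM (_ : 4 = 2 * 2); last by ring.
rewrite ler_pM//; first by rewrite ger0_norm ?addr_ge0//; lra.
have := sqr_ge0 m; have := sqr_ge0 m'.
by rewrite ler_norml => *; apply/andP; split; lra.
Qed.

(** For [|z| < 1] the second difference vanishes when [|v| >= 2]; otherwise the three terms of
    [max0_second] are at most 4, 2 and [8 * 4] times [|z|^2], which adds up to 38. *)
Lemma bump_second (r : R) z v : 0 <= r -> r <= 1 ->
  `|second_sum (bump r) z v - 2 * bump r v| <= 38 * Num.min 1 (enorm z ^+ 2).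
Proof.
move=> r0 r1; have [z1|z1] := leP 1 (enorm z).
  rewrite min_l ?exprn_ege1// mulr1 /second_sum.
  have := bump_ge0 r v; have := bump_ge0 r (v + z); have := bump_ge0 r (v - z).
  have := bump_le1 v r0 r1; have := bump_le1 (v + z) r0 r1; have := bump_le1 (v - z) r0 r1.
  by rewrite ler_norml => *; apply/andP; split; lra.
rewrite min_r ?exprn_ile1 ?enorm_ge0 ?(ltW z1)//.
have [v2|v2] := leP 2 (enorm v).
  rewrite /second_sum !bump_out//; first by rewrite addr0 mulr0 subrr normr0 mulr_ge0// sqr_ge0.
  - lra.
  - by have := enorm_lerB v z; lra.
  - by have := enorm_lerD v z; lra.
rewrite /second_sum /bump.
have -> : enorm (v - z) ^+ 2 = enorm v ^+ 2 - 2 * dot v z + enorm z ^+ 2.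
  by rewrite sqr_enormD dotNr enormN mulrN.
rewrite sqr_enormD; apply: le_trans (max0_second _ _ _ (sqr_ge0 _)) _.
have h1 := bump_base_le v r0 r1.
have h2 := sqr_dot_le v z.
have q1 : enorm z ^+ 2 <= 1 by rewrite exprn_ile1 ?enorm_ge0// ltW.
have v4 : enorm v ^+ 2 <= 4.
  by rewrite (_ : 4 = 2 ^+ 2); [rewrite lerXn2r ?nnegrE ?enorm_ge0// ltW|ring].
have h3 : Num.max 0 (r ^+ 2 - enorm v ^+ 2) * enorm z ^+ 2 <= 1 * enorm z ^+ 2.
  by rewrite ler_wpM2r ?sqr_ge0.
have h4 : (enorm z ^+ 2) ^+ 2 <= 1 * enorm z ^+ 2 by rewrite expr2 ler_wpM2r ?sqr_ge0.
have h5 : enorm v ^+ 2 * enorm z ^+ 2 <= 4 * enorm z ^+ 2 by rewrite ler_wpM2r ?sqr_ge0.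
by move: h2 h3 h4 h5; lra.
Qed.

End bump.

(** * The generator on bumps *)

Section bump_generator.
Context {R : realType} {n : nat}.
Local Notation leb := (@lebesgue_rV R n).
Implicit Types (x y v z : 'rV[R]_n).
Variables (A : 'M[R]_n) (nu : 'rV[R]_n -> R).
Hypothesis J : jump_density nu.
Local Notation tame := (tame nu).
Local Notation gen := (generator_approx A nu).
Local Notation gauss_part e B v := (\sum_i \sum_j A i j *
  (second_sum B (mixed_shift e i j 1) v - second_sum B (mixed_shift e i j (-1)) v)).

Lemma enorm_delta (i : 'I_n) : enorm (delta_mx 0 i : 'rV[R]_n) = 1.
Proof.
apply/eqP; rewrite -(@eqrXn2 _ 2) ?enorm_ge0// expr1n sqr_enorm (bigD1 i)//= mxE !eqxx expr1n.
by rewrite big1 ?addr0// => j /negbTE ij; rewrite mxE ij andbF expr0n.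
Qed.

Lemma enorm_mixed_shift (e s : R) i j : 0 <= e -> `|s| <= 1 ->
  enorm (mixed_shift e i j s : 'rV[R]_n) <= 2 * e.
Proof.
move=> e0 s1; rewrite /mixed_shift enormZ ger0_norm// mulrC ler_wpM2r//.
by apply: le_trans (ler_enormD _ _) _; rewrite enormZ !enorm_delta mulr1; lra.
Qed.

Lemma generator_approxD (e c : R) B1 B2 v : 0 < e -> bmeas B1 -> bmeas B2 ->
  gen e (fun y => B1 y + c * B2 y) v = gen e B1 v + c * gen e B2 v.
Proof.
move=> e0 b1 b2; rewrite /generator_approx.
have l1 := lint_jump_integrand (jd_meas J) (jd_ge0 J) (jd_lty J) v e0 b1.
have l2 := lint_jump_integrand (jd_meas J) (jd_ge0 J) (jd_lty J) v e0 b2.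
have -> : (\int[leb]_z ((second_sum (fun y => B1 y + c * B2 y) z v - 2 * (B1 v + c * B2 v)) *
    truncated nu e z))%R =
  (\int[leb]_z ((second_sum B1 z v - 2 * B1 v) * truncated nu e z))%R +
  c * (\int[leb]_z ((second_sum B2 z v - 2 * B2 v) * truncated nu e z))%R.
  rewrite -RintegralZl// -RintegralD//; last exact: lintZ.
  by apply: eq_Rintegral => z _; rewrite /second_sum; ring.
have -> : gauss_part e (fun y => B1 y + c * B2 y) v = gauss_part e B1 v + c * gauss_part e B2 v.
  rewrite mulr_sumr -big_split; apply: eq_bigr => i _ /=.
  rewrite mulr_sumr -big_split; apply: eq_bigr => j _ /=.
  by rewrite /second_sum; ring.
by rewrite !mulrDl !mulrA; ring.
Qed.

Lemma generator_approx_translation (e : R) B v x :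
  gen e (fun y => B (y - x)) v = gen e B (v - x).
Proof.
rewrite /generator_approx /second_sum.
have s u : v + u - x = v - x + u by rewrite addrAC.
congr (_ / _ + _ / _).
  by apply: eq_bigr => i _; apply: eq_bigr => j _; rewrite !s.
by apply: eq_Rintegral => z _; rewrite !s.
Qed.

Lemma bump_generator_bound (r : R) : 0 <= r -> r <= 1 -> exists2 K : R, 0 < K &
  forall e v, 0 < e -> `|gen e (bump r) v| <= K.
Proof.
move=> r0 r1; pose m0 := (\int[leb]_z jump_mass nu z)%R.
have m00 : 0 <= m0.
  by apply: Rintegral_ge0 => z _; apply: jump_mass_ge0; exact: jd_ge0 J.
pose SA := \sum_i \sum_j `|A i j|.
have SA0 : 0 <= SA by apply: sumr_ge0 => i _; apply: sumr_ge0.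
(* Mixed shifts have norm at most [2 * e], so each of two second differences is at most
   [38 * 4 * e ^+ 2], and [304 / 8 = 38]; the jump part contributes [38 / 2 = 19]. *)
exists (38 * SA + 19 * m0 + 1) => [|e v e0]; first by rewrite ltr_wpDl// addr_ge0// mulr_ge0.
rewrite /generator_approx; set g := gauss_part e (bump r) v; set j := (\int[leb]_z _)%R.
have hj : `|j| <= 38 * m0.
  have lj := lint_jump_mass (jd_meas J) (jd_ge0 J) (jd_lty J).
  rewrite /m0 -RintegralZl//; apply: lint_Rint_bound; last first.
  - move=> z; rewrite normrM [X in _ * X]ger0_norm ?truncated_ge0//; last exact: jd_ge0 J.
    rewrite /jump_mass [leRHS]mulrA ler_pM//; first exact: truncated_ge0 (jd_ge0 J) _ _.
      exact: bump_second.
    by rewrite /truncated; case: ifP; rewrite ?(jd_ge0 J).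
  - exact: lintZ.
  - apply: lint_jump_integrand => //; [exact: jd_meas J|exact: jd_ge0 J|exact: jd_lty J|].
    exact: bmeas_bump.
have hg : `|g| <= SA * (304 * e ^+ 2).
  rewrite /g /SA mulr_suml (le_trans (ler_norm_sum _ _ _))// ler_sum// => i _.
  rewrite mulr_suml (le_trans (ler_norm_sum _ _ _))// ler_sum// => k _.
  rewrite normrM ler_wpM2l//.
  have sh (s : R) : `|s| <= 1 -> `|second_sum (bump r) (mixed_shift e i k s) v - 2 * bump r v| <= 152 * e ^+ 2.
    move=> s1; apply: le_trans (bump_second _ _ r0 r1) _.
    apply: (@le_trans _ _ (38 * (2 * e) ^+ 2)); last by rewrite exprMn; lra.
    rewrite ler_wpM2l// ge_min; apply/orP; right.
    by rewrite lerXn2r ?nnegrE ?enorm_ge0 ?mulr_ge0 ?(ltW e0)//; apply: enorm_mixed_shift => //; exact: ltW.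
  have := sh 1; have := sh (-1); rewrite normrN normr1 lexx => /(_ isT) h1 /(_ isT) h2.
  rewrite (_ : _ - _ = (second_sum (bump r) (mixed_shift e i k 1) v - 2 * bump r v) -
     (second_sum (bump r) (mixed_shift e i k (-1)) v - 2 * bump r v)); last by ring.
  by apply: le_trans (ler_normB _ _) _; apply: le_trans (lerD h2 h1) _; lra.
apply: le_trans (ler_normD _ _) _; rewrite -[leRHS]addrA lerD//.
  rewrite normrM [X in _ * X]ger0_norm ?invr_ge0 ?mulr_ge0 ?exprn_ge0 ?(ltW e0)//.
  rewrite ler_pdivrMr ?mulr_gt0 ?exprn_gt0//; apply: le_trans hg _; lra.
by rewrite normrM [X in _ * X]ger0_norm// ler_pdivrMr//; apply: le_trans hj _; lra.
Qed.

Lemma bump_gauss_part (r r' e : R) v : 0 <= r -> 0 < e -> r + 2 * e <= r' -> r' <= enorm v ->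
  gauss_part e (bump r) v = 0.
Proof.
move=> r0 e0 er rv; rewrite big1// => i _; rewrite big1// => j _.
have sh (s : R) : `|s| <= 1 -> second_sum (bump r) (mixed_shift e i j s) v = 0.
  move=> s1; have h := enorm_mixed_shift i j (ltW e0) s1.
  rewrite /second_sum !bump_out ?addr0//.
    by have := enorm_lerB v (mixed_shift e i j s); lra.
  by have := enorm_lerD v (mixed_shift e i j s); lra.
by rewrite !sh ?subrr ?mulr0// ?normrN normr1.
Qed.

Lemma lint_Rint_ball (c : R) v (s : R) :
  [/\ lint (fun z => c * \1_(eball 0 s) (v - z)) ,
      lint (fun z => c * \1_(eball 0 s) (v + z)),
  (\int[leb]_z (c * \1_(eball 0%R s) (v - z)%R) = c * fine (leb (eball 0%R s)))%R &
  (\int[leb]_z (c * \1_(eball 0%R s) (v + z)%R) = c * fine (leb (eball 0%R s)))%R].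
Proof.
have li : lint (\1_(eball (0 : 'rV[R]_n) s) : _ -> R).
  by apply: lint_indic; [exact: measurable_eball|exact: lebesgue_eball_lty].
have mi : measurable_fun setT (fun z : 'rV[R]_n => (\1_(eball 0 s) z)%:E : \bar R).
  by apply/measurable_EFinP; exact: lint_meas li.
have iE : (\int[leb]_z (\1_(eball 0%R s) z)%:E = leb (eball 0%R s))%E.
  by rewrite integral_indic ?setIT//; exact: measurable_eball.
have l1 : lint (fun z => \1_(eball 0 s) (v + z) : R) by exact: lint_translation.
have l2 : lint (fun z => \1_(eball 0 s) (v - z) : R).
  apply: (@lint_ball _ _ _ (enorm v + s)).
    by apply: bmeas_reflection; apply: bmeas_indic; exact: measurable_eball.
  move=> z zr; rewrite indicE memNset// /eball/= subr0 => h.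
  by have := enorm_lerB z v; rewrite enormB; move: h zr; lra.
split; [exact: lintZ|exact: lintZ| |].
  rewrite RintegralZl//; congr (_ * _); rewrite /Rintegral -iE; congr fine.
  by apply: (ge0_integral_reflection v (f := fun z => (\1_(eball 0 s) z)%:E)) => // z; rewrite lee_fin.
rewrite RintegralZl//; congr (_ * _); rewrite /Rintegral -iE; congr fine.
by apply: (ge0_integral_translation v (f := fun z => (\1_(eball 0 s) z)%:E)) => // z; rewrite lee_fin.
Qed.

(** Off the support only jumps into the ball count, and those landing within [r / 2] of the origin
    have density comparable with [tame v]. *)
Lemma bump_generator_lower (r r' : R) : 0 < r -> r < r' -> r <= 1 ->
  exists2 c : R, 0 < c & exists2 e0 : R, 0 < e0 & forall e v, 0 < e -> e <= e0 ->
    r' <= enorm v -> c * tame v <= gen e (bump r) v.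
Proof.
move=> r0 rr' r1; have [C C0 cmp] := tame_cmp J.
have r20 : 0 < r / 2 by rewrite divr_gt0.
have r21 : r / 2 <= 1 / 2 by lra.
have [d d0 dP] := nu_lower J r20 r21.
have := fine_lebesgue_eball_gt0 (n := n) r20; set L := fine _ => L0.
pose b := (r ^+ 2 - (r / 2) ^+ 2) ^+ 2.
have b0 : 0 < b.
  rewrite exprn_gt0// (_ : _ - _ = 3 / 4 * r ^+ 2); last by field.
  by rewrite mulr_gt0 ?exprn_gt0// divr_gt0.
(* [nu] dominates a multiple of [tame] already from radius [r / 2] on, since up to radius [1 / 2]
   [tame] is 1 and [nu] at least [d]. *)
pose d1 := Num.min 1 d; have d10 : 0 < d1 by rewrite lt_min ltr01.
have nut z : r / 2 <= enorm z -> d1 * tame z <= nu z.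
  move=> rz; have [z2|z2] := ltP (1 / 2) (enorm z).
    by rewrite tameE// ler_piMl ?(jd_ge0 J)// ge_min lexx.
  rewrite tame1// mulr1 (le_trans _ (dP z rz _)) ?ge_min ?lexx ?orbT//; lra.
pose c := b * d1 * C^-1 * L / 2.
exists c.
  by rewrite /c; apply: divr_gt0 => //; apply: mulr_gt0 => //; apply: divr_gt0 => //; exact: mulr_gt0.
(* [e <= r / 4] leaves the relevant jumps, longer than [r / 2], untruncated; [e <= (r' - r) / 2]
   makes the Gaussian part vanish. *)
exists (Num.min (r / 4) ((r' - r) / 2)); first by rewrite lt_min !divr_gt0// subr_gt0.
move=> e v e0; rewrite le_min => /andP[er err] rv.
rewrite /generator_approx (@bump_gauss_part r r')//; [|exact: ltW|by move: err; lra].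
rewrite mul0r add0r ler_pdivlMr//.
have bv : bump r v = 0 by rewrite bump_out// ?ltW// (lt_le_trans rr').
have [l1 _ E _] := @lint_Rint_ball (b * d1 * C^-1 * tame v) v (r / 2).
rewrite (_ : c * tame v * 2 = b * d1 * C^-1 * tame v * L); last first.
  by clearbody b; rewrite /c; move: (C^-1) => i; field.
rewrite -E; apply: le_Rintegral => //.
  by apply: lint_jump_integrand => //; [exact: jd_meas J|exact: jd_ge0 J|exact: jd_lty J|apply: bmeas_bump; rewrite // ltW].
move=> z _; rewrite bv mulr0 subr0 /second_sum.
have t0 := truncated_ge0 (jd_ge0 J) e z.
rewrite indicE; case: (boolP (_ \in _)) => [|_]; last first.
  by rewrite mulr0 mulr_ge0// addr_ge0// bump_ge0.
rewrite inE /eball/= subr0 mulr1 => vz.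
have zr : r / 2 < enorm z by have := enorm_lerB v z; lra.
have -> : truncated nu e z = nu z by rewrite /truncated (lt_trans _ zr)//; lra.
apply: (@le_trans _ _ (bump r (v - z) * nu z)); last first.
  by rewrite ler_wpM2r ?(jd_ge0 J)// lerDr bump_ge0.
rewrite (_ : _ * tame v = b * (d1 * (C^-1 * tame v))); last by clearbody b; ring.
apply: ler_pM.
- exact: ltW.
- by rewrite !mulr_ge0 ?invr_ge0 ?ltW// tame_gt0.
- by apply: bump_ge; rewrite ?ltW//; lra.
apply: le_trans (nut z (ltW zr)); rewrite ler_wpM2l ?(ltW d10)// ler_pdivrMl//.
by apply: cmp; [have := enorm_lerB v z|have := enorm_lerB z v; rewrite enormB]; move: vz; lra.
Qed.

Lemma bump_truncated_le (C e : R) v z (u : 'rV[R]_n) :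
  (forall x y, enorm x <= enorm y + 1 -> enorm y <= enorm x + 1 -> tame x <= C * tame y) ->
  2 < enorm v -> 0 <= C * tame v -> enorm u < 1 ->
  enorm z <= enorm v + enorm u -> enorm v - enorm u <= enorm z ->
  bump 1 u * truncated nu e z <= C * tame v.
Proof.
move=> cmp v2 Ct u1 zu vz; apply: (@le_trans _ _ (truncated nu e z)).
  by rewrite ler_piMl ?truncated_ge0 ?bump_le1//; exact: jd_ge0 J.
rewrite /truncated; case: ifP => // _; rewrite -tameE; last by lra.
by apply: cmp; lra.
Qed.

(** For [|v| <= 2] the generator is bounded and [tame v] is bounded below; further out only jumps
    into the unit ball count, and their density is at most a constant times [tame v]. *)
Lemma bump_generator_upper : exists2 K : R, 0 < K &
  forall e v, 0 < e -> e <= 1 / 4 -> gen e (bump 1) v <= K * tame v.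
Proof.
have [C C0 cmp] := tame_cmp J.
have [K K0 KP] := @bump_generator_bound 1 ler01 (lexx _).
pose L := fine (leb (eball 0 1)); have L0 : 0 <= L by exact: fine_ge0.
exists (K * C ^+ 2 + C * L); first by rewrite ltr_wpDr ?mulr_ge0 ?mulr_gt0 ?exprn_gt0// ltW.
move=> e v e0 e4; have tv := tame_gt0 J v.
have [v2|v2] := leP (enorm v) 2.
  apply: le_trans (ler_norm _) (le_trans (KP e v e0) _).
  (* A unit vector is interposed since [cmp] compares only points whose norms differ by at most
     1. *)
  have [u u1] := exists_enorm J ler01.
  have h1 : tame 0 <= C * tame u by apply: cmp; rewrite enorm0 u1; lra.
  have h2 : tame u <= C * tame v.
    by apply: cmp; rewrite u1; have := enorm_ge0 v; move: v2; lra.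
  have h3 : 1 <= C ^+ 2 * tame v.
    rewrite (@tame1 _ _ nu 0) in h1; last by rewrite enorm0; lra.
    by rewrite (le_trans h1)// expr2 -mulrA ler_wpM2l// ltW.
  have : K <= K * C ^+ 2 * tame v by rewrite -mulrA ler_peMr// ltW.
  by move/le_trans; apply; rewrite ler_wpM2r ?(ltW tv)// lerDl mulr_ge0// ltW.
rewrite /generator_approx (@bump_gauss_part 1 2)//; [|lra|exact: ltW].
rewrite mul0r add0r ler_pdivrMr//.
have bv : bump 1 v = 0 by rewrite bump_out//; lra.
have [l1 l2 E1 E2] := @lint_Rint_ball (C * tame v) v 1.
apply: (@le_trans _ _ (C * tame v * L + C * tame v * L)); last first.
  have : 0 <= K * C ^+ 2 * tame v by rewrite !mulr_ge0 ?sqr_ge0// ltW.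
  by clear cmp KP E1 E2 l1 l2; lra.
rewrite -{1}E1 -E2 -RintegralD//; apply: le_Rintegral => //.
- by apply: lint_jump_integrand => //; [exact: jd_meas J|exact: jd_ge0 J|exact: jd_lty J|exact: bmeas_bump].
- exact: lintD.
move=> z _; rewrite bv mulr0 subr0 /second_sum addrC mulrDl.
have Ct : 0 <= C * tame v by rewrite mulr_ge0// ltW.
have t0 := truncated_ge0 (jd_ge0 J) e z.
have key u := @bump_truncated_le C e v z u cmp v2 Ct; clear cmp KP E1 E2 l1 l2 bv.
apply: lerD; rewrite indicE; case: (boolP (_ \in _)) => [|/negP h].
- rewrite inE /eball/= subr0 mulr1 => h; apply: key => //.
    by have := enorm_lerB z v; rewrite enormB; lra.
  by have := enorm_lerB v z; lra.
- rewrite bump_out ?mul0r ?mulr0//; rewrite leNgt; apply/negP => h'; apply: h.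
  by apply: mem_set; rewrite /eball/= subr0.
- rewrite inE /eball/= subr0 mulr1 => h; apply: key => //.
    by have := enorm_lerD z v; rewrite (addrC z); lra.
  by have := enorm_lerD v z; lra.
- rewrite bump_out ?mul0r ?mulr0//; rewrite leNgt; apply/negP => h'; apply: h.
  by apply: mem_set; rewrite /eball/= subr0.
Qed.

(** The generator of one bump may be negative on its support, where the bump itself gets arbitrarily
    small. Hence two of them: [bump (1 / 2)] makes the generator positive from radius [5 / 8] on,
    and a small multiple of [bump (3 / 4)] keeps [chi] bounded below up to [11 / 16]. Where the
    generator is negative, it is then at least a negative multiple of [chi]. *)
Lemma exists_subharmonic_bump : exists chi : 'rV[R]_n -> R,
  [/\ bmeas chi, lint chi, forall y, 0 <= chi y <= 2,
      forall y, 1 <= enorm y -> chi y = 0 &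
      [/\ forall x y, `|chi x - chi y| <= 8 * enorm (x - y),
      exists2 a : R, 0 < a & forall y, enorm y < 11 / 16 -> a <= chi y &
      exists c C e0 : R, [/\ 0 < c, 0 <= C, 0 < e0 & forall e v, 0 < e -> e <= e0 ->
        (if enorm v < 5 / 8 then - C else c * tame v) <= gen e chi v]]].
Proof.
have [c1 c10 [e1 e10 h1]] := @bump_generator_lower (1 / 2) (5 / 8) ltac:(lra) ltac:(lra) ltac:(lra).
have [c2 c20 [e2 e20 h2]] := @bump_generator_lower (3 / 4) (7 / 8) ltac:(lra) ltac:(lra) ltac:(lra).
have [K1 K10 k1] := @bump_generator_bound (1 / 2) ltac:(lra) ltac:(lra).
have [K2 K20 k2] := @bump_generator_bound (3 / 4) ltac:(lra) ltac:(lra).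
have [t t0 tP] := nu_lower J (r := 1 / 2) ltac:(lra) ltac:(lra).
pose m := Num.min 1 t; have m0 : 0 < m by rewrite lt_min ltr01.
have tm v : enorm v <= 1 -> m <= tame v.
  move=> v1; rewrite /tame; case: ifPn => v2; last by rewrite ge_min lexx.
  by rewrite ge_min tP ?orbT//; [exact: ltW|lra].
(* The second bump may lower the generator by [eps * K2]; on [5 / 8 <= |v| < 7 / 8] this takes at
   most half of what the first one provides. *)
pose eps := Num.min 1 (c1 * m / (2 * K2)).
have eps0 : 0 < eps by rewrite lt_min ltr01 divr_gt0 ?mulr_gt0.
have eps1 : eps <= 1 by rewrite ge_min lexx.
have epsK : eps * K2 <= c1 * m / 2.
  rewrite -ler_pdivlMr//; apply: (@le_trans _ _ (c1 * m / (2 * K2))).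
    by rewrite ge_min lexx orbT.
  by rewrite invfM mulrA.
have bb r : 0 <= r -> r <= 1 -> bmeas (@bump R n r) by exact: bmeas_bump.
have b1 : bmeas (@bump R n (1 / 2)) by apply: bb; lra.
have b2 : bmeas (@bump R n (3 / 4)) by apply: bb; lra.
exists (fun y => bump (1 / 2) y + eps * bump (3 / 4) y); split.
- by apply: bmeasD => //; exact: bmeasZ.
- by apply: lintD; [apply: lint_bump; lra|apply: lintZ; apply: lint_bump; lra].
- move=> y; have B1 := @bump_le1 R n (1 / 2) y ltac:(lra) ltac:(lra).
  have B2 := @bump_le1 R n (3 / 4) y ltac:(lra) ltac:(lra).
  have G1 := bump_ge0 (1 / 2) y; have G2 := bump_ge0 (3 / 4) y.
  have : 0 <= eps * bump (3 / 4) y by rewrite mulr_ge0// ltW.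
  have : eps * bump (3 / 4) y <= 1 by rewrite mulr_ile1// ltW.
  by move=> *; apply/andP; split; lra.
- by move=> y y1; rewrite !bump_out ?mulr0 ?addr0//; lra.
split.
- move=> x y.
  have L1 := @bump_lip R n (1 / 2) x y ltac:(lra) ltac:(lra).
  have L2 := @bump_lip R n (3 / 4) x y ltac:(lra) ltac:(lra).
  rewrite (_ : _ - _ = (bump (1 / 2) x - bump (1 / 2) y) + eps * (bump (3 / 4) x - bump (3 / 4) y)); last by ring.
  apply: le_trans (ler_normD _ _) _.
  have : `|eps * (bump (3 / 4) x - bump (3 / 4) y)| <= 1 * (4 * enorm (x - y)).
    by rewrite normrM ger0_norm ?(ltW eps0)// ler_pM// ltW.
  by lra.
- exists (eps * ((3 / 4) ^+ 2 - (11 / 16) ^+ 2) ^+ 2).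
    rewrite mulr_gt0// exprn_gt0// (_ : _ - _ = 23 / 256); last by field.
    by rewrite divr_gt0 ?ltr0n.
  move=> y /ltW yr; rewrite (le_trans _ (_ : eps * bump (3 / 4) y <= _))//.
    by rewrite ler_wpM2l ?(ltW eps0)//; apply: bump_ge => //; lra.
  by rewrite lerDr bump_ge0.
exists (c1 / 2), (K1 + K2), (Num.min e1 e2); split.
- by rewrite divr_gt0.
- by rewrite addr_ge0// ltW.
- by rewrite lt_min e10.
move=> e v e0; rewrite le_min => /andP[ee1 ee2]; rewrite generator_approxD//.
have B1 := k1 e v e0; have B2 := k2 e v e0.
have E2 : - (eps * K2) <= eps * gen e (bump (3 / 4)) v.
  by rewrite -mulrN ler_pM2l//; move: B2; rewrite ler_norml => /andP[].
have eK : eps * K2 <= K2 by rewrite ler_piMl// ltW.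
case: ifPn => [v5|]; first by move: B1; rewrite ler_norml => /andP[+ _]; clear h1 h2 k1 k2 tm tP; move: E2 eK; lra.
rewrite -leNgt => v5; have H1 := h1 e v e0 ee1 v5.
have tv := tame_gt0 J v; have ct : 0 < c1 * tame v by rewrite mulr_gt0.
have [v7|v7] := leP (7 / 8) (enorm v).
  have H2 := h2 e v e0 ee2 v7.
  have : 0 <= eps * gen e (bump (3 / 4)) v.
    by rewrite mulr_ge0 ?(ltW eps0)// (le_trans _ H2)// mulr_ge0// ltW.
  by clear h1 h2 k1 k2 tm tP; move: H1 ct; lra.
have : c1 * m <= c1 * tame v by rewrite ler_wpM2l ?(ltW c10)// tm//; lra.
by clear h1 h2 k1 k2 tm tP; move: H1 epsK E2; lra.
Qed.

End bump_generator.

(** * The smoothed tame density *)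

Section smooth_tame.
Context {R : realType} {n : nat}.
Local Notation leb := (@lebesgue_rV R n).
Implicit Types (x y v z : 'rV[R]_n).
Variables (A : 'M[R]_n) (nu : 'rV[R]_n -> R).
Hypothesis J : jump_density nu.
Local Notation tame := (tame nu).

(** Convolving with a bump preserves the size of [tame] up to constants and lets the generator act
    on the bump instead of the merely measurable [tame]. *)
Definition smooth_tame : 'rV[R]_n -> R := conv (bump 1) tame.

Lemma lipschitz_continuous_rV (f : 'rV[R]_n -> R) L :
  (forall x y, `|f x - f y| <= L * enorm (x - y)) -> continuous f.
Proof.
move=> fL x S /nbhs_ballP[e /= e0 eS].
have d0 : 0 < e / (`|L| + 1) by rewrite divr_gt0// ltr_wpDl.
have H : nbhs x (eball x (e / (`|L| + 1))).
  apply: open_nbhs_nbhs; split; first exact: open_eball.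
  by rewrite /eball/= subrr enorm0.
apply: filterS H => y; rewrite /eball/= enormB ltr_pdivlMr ?ltr_wpDl// => h.
apply: eS; rewrite -ball_normE/=; apply: le_lt_trans (fL x y) (le_lt_trans _ h).
rewrite mulrC; apply: le_trans (_ : enorm (x - y) * `|L| <= _).
  by rewrite ler_wpM2l ?enorm_ge0// ler_norm.
by rewrite ler_wpM2l ?enorm_ge0// lerDl.
Qed.

Let lbump : lint (bump (1 : R) : 'rV[R]_n -> R).
Proof. by apply: lint_bump. Qed.

Let bbump : bmeas (bump (1 : R) : 'rV[R]_n -> R).
Proof. by apply: bmeas_bump. Qed.

Lemma smooth_tameE y : smooth_tame y = (\int[leb]_v (tame v * bump 1 (y - v)))%R.
Proof.
have m : measurable_fun setT (fun v => (bump 1 v * tame (y - v))%:E : \bar R).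
  by apply/measurable_EFinP; apply: lint_meas; apply: lint_conv => //; exact: bmeas_tame.
have := ge0_integral_reflection y m.
rewrite /smooth_tame /conv /Rintegral => <-.
  by congr fine; apply: eq_integral => v _; rewrite subKr mulrC.
by move=> v; rewrite lee_fin mulr_ge0 ?bump_ge0// ltW// tame_gt0.
Qed.

Lemma lint_tame_bump y : lint (fun v => tame v * bump 1 (y - v)).
Proof. by apply: lint_conv; [exact: lint_tame|]. Qed.

Lemma smooth_tame_lip : exists2 L : R, 0 <= L &
  forall x y, `|smooth_tame x - smooth_tame y| <= L * enorm (x - y).
Proof.
have lt := lint_tame J.
exists (4 * (\int[leb]_v tame v)%R).
  by rewrite mulr_ge0//; apply: Rintegral_ge0 => v _; exact/ltW/tame_gt0.
move=> x y; rewrite !smooth_tameE -RintegralB//; try exact: lint_tame_bump.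
rewrite mulrAC -RintegralZl//; apply: lint_Rint_bound.
- by apply: lintB; exact: lint_tame_bump.
- exact: lintZ.
move=> v; rewrite -mulrBr normrM mulrC (ger0_norm (ltW (tame_gt0 J _))).
rewrite ler_wpM2r ?(ltW (tame_gt0 J _))//.
have := @bump_lip R n 1 (x - v) (y - v) ler01 (lexx _).
by rewrite opprB addrA subrK.
Qed.

Lemma smooth_tame_cmp : exists c C : R, [/\ 0 < c, 0 < C &
  forall y, c * tame y <= smooth_tame y <= C * tame y].
Proof.
have [C C0 cmp] := tame_cmp J.
have h0 : (0 : R) < 1 / 2 by lra.
have := fine_lebesgue_eball_gt0 (n := n) h0; set L := fine _ => L0.
pose M := (\int[leb]_v (bump 1 v : R))%R.
have M0 : 0 <= M by apply: Rintegral_ge0 => v _; exact: bump_ge0.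
(* [9 / 16 = (1 - 1 / 4) ^+ 2] bounds [bump 1] from below on the ball of radius [1 / 2]. *)
exists (9 / 16 * C^-1 * L), (C * M + 1); split.
- by rewrite !mulr_gt0 ?invr_gt0// divr_gt0.
- by rewrite ltr_wpDl// mulr_ge0// ltW.
move=> y; have ty := tame_gt0 J y; rewrite /smooth_tame /conv; apply/andP; split.
  have [_ _ _] := @lint_Rint_ball R n (9 / 16 * C^-1 * tame y) 0 (1 / 2).
  rewrite -/L => E; rewrite (_ : _ * tame y = 9 / 16 * C^-1 * tame y * L); last by ring.
  rewrite -E; apply: le_Rintegral => //.
  - by have [] := @lint_Rint_ball R n (9 / 16 * C^-1 * tame y) 0 (1 / 2).
  - by apply: lint_conv => //; exact: bmeas_tame.
  move=> v _; rewrite add0r indicE; case: (boolP (_ \in _)) => [|_]; last first.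
    by rewrite mulr0 mulr_ge0 ?bump_ge0// ltW// tame_gt0.
  rewrite inE /eball/= subr0 mulr1 => v2; rewrite -mulrA; apply: ler_pM => //.
  - by rewrite mulr_ge0 ?invr_ge0 ?(ltW C0) ?(ltW ty).
  - have := @bump_ge R n 1 (1 / 2) v ltac:(lra) ltac:(lra) (ltW v2).
    by rewrite (_ : (_ - _) ^+ 2 = 9 / 16)//; field.
  rewrite ler_pdivrMl//; apply: cmp.
    by have := enorm_lerB y v; lra.
  by have := ler_enormB y v; lra.
rewrite mulrDl mul1r (_ : C * M * tame y = C * tame y * M); last by ring.
rewrite -[leLHS]addr0 lerD ?(ltW ty)// -RintegralZl//; apply: le_Rintegral => //.
- by apply: lint_conv => //; exact: bmeas_tame.
- exact: lintZ.
move=> v _; have [v1|v1] := leP 1 (enorm v); first by rewrite bump_out// mul0r mulr0.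
rewrite mulrC ler_wpM2r ?bump_ge0//; apply: cmp.
  by have := ler_enormB y v; lra.
by have := enorm_lerB y v; lra.
Qed.

Lemma smooth_tame_gt0 y : 0 < smooth_tame y.
Proof.
have [c [C [c0 C0 cC]]] := smooth_tame_cmp.
have /andP[h _] := cC y; apply: lt_le_trans h; rewrite mulr_gt0// tame_gt0//.
Qed.

Lemma measurable_smooth_tame : measurable_fun setT smooth_tame.
Proof.
have [L L0 hL] := smooth_tame_lip.
exact: measurable_continuous_rV (lipschitz_continuous_rV hL).
Qed.

Lemma lint_smooth_tame : lint smooth_tame.
Proof.
have [c [C [c0 C0 cC]]] := smooth_tame_cmp.
apply: (le_lint measurable_smooth_tame _ (lintZ C (lint_tame J))) => y.
by rewrite ger0_norm ?(ltW (smooth_tame_gt0 _))//; have /andP[] := cC y.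
Qed.

Lemma bmeas_smooth_tame : bmeas smooth_tame.
Proof.
split; first exact: measurable_smooth_tame.
have [c [C [c0 C0 cC]]] := smooth_tame_cmp.
have [M M0 tM] := tame_le J; exists (C * M) => y.
rewrite ger0_norm ?(ltW (smooth_tame_gt0 _))//; have /andP[_ h] := cC y.
by apply: le_trans h _; rewrite ler_wpM2l// ltW.
Qed.

(** The generator commutes with the convolution and falls on the bump, where it is at most
    [K * tame]; then [tame_conv] bounds [tame] convolved with itself. *)
Lemma smooth_tame_generator : exists2 K : R, 0 < K & forall e v, 0 < e -> e <= 1 / 4 ->
  generator_approx A nu e smooth_tame v <= K * tame v.
Proof.
have [K K0 up] := bump_generator_upper A J; have [C C0 cC] := tame_conv J.
exists (K * C); first exact: mulr_gt0.
move=> e v e0 e4; have bt := bmeas_tame J.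
have [lg <-] := generator_approx_conv A (jd_meas J) (jd_ge0 J) (jd_lty J) v e0 bbump lbump bt.
apply: (@le_trans _ _ (conv (fun z => K * tame z) tame v)).
  by apply: le_conv => //; [apply: lintZ; exact: lint_tame|move=> x; exact/ltW/tame_gt0|move=> z; exact: up].
rewrite -mulrA (le_trans _ (ler_wpM2l (ltW K0) (cC v)))// /conv -RintegralZl//; last first.
  by apply: lint_conv => //; exact: lint_tame.
by rewrite le_eqVlt; apply/orP; left; apply/eqP/eq_Rintegral => z _; rewrite mulrA.
Qed.

End smooth_tame.

(** * Feynman-Kac functionals *)

Section time_measure.
Context {R : realType}.
Implicit Types (s t : R) (f : measurableTypeR R -> \bar R).
Local Open Scope ereal_scope.

Lemma lebesgue_itv_lty t : lebesgue_measure (`[0%R, t]%classic : set (measurableTypeR R)) < +oo.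
Proof. by rewrite lebesgue_measure_itv/=; case: ifP => _; rewrite ltry. Qed.

(** A finite measure on the whole line; it is zero for negative [t]. *)
Definition time t : {finite_measure set (measurableTypeR R) -> \bar R} :=
  @mfrestr _ (measurableTypeR R) R _ lebesgue_measure (measurable_itv `[0%R, t])
    (lebesgue_itv_lty t).

Lemma timeE t (A : set (measurableTypeR R)) : measurable A ->
  time t A = \int[lebesgue_measure]_(s in A) (\1_(`[0%R, t]%classic) s)%:E.
Proof.
move=> mA; rewrite (@integral_indic _ (measurableTypeR R) R lebesgue_measure A mA); last exact: measurable_itv.
by rewrite /time/= /mfrestr /mrestr setIC.
Qed.

Lemma integral_time t f : measurable_fun setT f -> (forall s, 0 <= f s) ->
  \int[time t]_s f s = \int[lebesgue_measure]_s (f s * (\1_(`[0%R, t]%classic) s)%:E).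
Proof.
move=> mf f0; by apply: (ge0_integral_density _ _ (timeE t)).
Qed.

Lemma integral_time_itv t f : measurable_fun setT f -> (forall s, 0 <= f s) ->
  \int[time t]_s f s = \int[lebesgue_measure]_(s in `[0%R, t]) f s.
Proof.
move=> mf f0; rewrite integral_time// [RHS]integral_mkcond.
apply: eq_integral => s _; rewrite patchE indicE.
by case: ifPn => _; rewrite ?mule1 ?mule0.
Qed.

Lemma eq_time t f g : measurable_fun setT f -> measurable_fun setT g ->
  (forall s, 0 <= f s) -> (forall s, 0 <= g s) ->
  (forall s, (0 <= s)%R -> (s <= t)%R -> f s = g s) ->
  \int[time t]_s f s = \int[time t]_s g s.
Proof.
move=> mf mg f0 g0 fg; rewrite !integral_time//; apply: eq_integral => s _.
rewrite indicE; case: (boolP (s \in _)) => [|_]; last by rewrite !mule0.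
by rewrite inE/= in_itv/= => /andP[s0 st]; rewrite fg.
Qed.

Lemma le_time t f g : measurable_fun setT f -> measurable_fun setT g ->
  (forall s, 0 <= f s) -> (forall s, 0 <= g s) ->
  (forall s, (0 <= s)%R -> (s <= t)%R -> f s <= g s) ->
  \int[time t]_s f s <= \int[time t]_s g s.
Proof.
move=> mf mg f0 g0 fg; rewrite !integral_time//; apply: ge0_le_integral => //.
- by move=> s _; rewrite mule_ge0.
- by apply: emeasurable_funM => //; apply/measurable_EFinP; exact: (measurable_indic (measurable_itv `[0%R, t])).
- by apply: emeasurable_funM => //; apply/measurable_EFinP; exact: (measurable_indic (measurable_itv `[0%R, t])).
move=> s _; rewrite indicE; case: (boolP (s \in _)) => [|_]; last by rewrite !mule0.
by rewrite inE/= in_itv/= !mule1 => /andP[s0 st]; rewrite fg.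
Qed.

Lemma integral_time_cst t (c : \bar R) : (0 <= t)%R -> 0 <= c -> \int[time t]_s c = c * t%:E.
Proof.
move=> t0 c0; have := @integral_cst _ _ _ (time t) _ measurableT c.
rewrite /cst => ->; congr (_ * _).
rewrite /time/= /mfrestr /mrestr setTI lebesgue_measure_itv/= lte_fin.
case: ltP => [_|t1]; first by rewrite sube0.
by congr EFin; apply/eqP; rewrite eq_le t0 t1.
Qed.

(** After a translation the two intervals overlap in the single point [s], a null set. *)
Lemma integral_time_split s t f : (0 <= s)%R -> (0 <= t)%R ->
  measurable_fun setT f -> (forall r, 0 <= f r) ->
  \int[time (s + t)]_r f r = \int[time s]_r f r + \int[time t]_r f (s + r)%R.
Proof.
move=> s0 t0 mf f0.
have mfs : measurable_fun setT (fun r : measurableTypeR R => f (s + r)%R).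
  by apply: measurableT_comp => //; exact: measurable_funD.
have mi a b : measurable_fun setT (fun r : measurableTypeR R => (\1_(`[a, b]%classic : set R) r)%:E : \bar R).
  by apply/measurable_EFinP; exact: (measurable_indic (measurable_itv `[a, b])).
rewrite !integral_time//.
have -> : \int[lebesgue_measure]_r (f (s + r)%R * (\1_(`[0%R, t]%classic) r)%:E) =
    \int[lebesgue_measure]_r (f r * (\1_(`[s, (s + t)%R]%classic) r)%:E).
  rewrite -[RHS](ge0_integral_translation1 s); last 2 first.
  - by apply: emeasurable_funM => //; exact: mi.
  - by move=> r; rewrite mule_ge0.
  apply: eq_integral => r _; rewrite !indicE; congr (_ * (nat_of_bool _)%:R%:E).
  by apply/idP/idP; rewrite !inE/= !in_itv/= => /andP[h1 h2]; apply/andP; split; lra.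
rewrite -ge0_integralD//; last 4 first.
- by move=> r _; rewrite mule_ge0.
- by apply: emeasurable_funM => //; exact: mi.
- by move=> r _; rewrite mule_ge0.
- by apply: emeasurable_funM => //; exact: mi.
apply: (@ge0_integral_off_null _ _ _ lebesgue_measure [set s]).
- exact: measurable_set1.
- exact: lebesgue_measure_set1.
- by apply: emeasurable_funD; apply: emeasurable_funM => //; exact: mi.
- by move=> r; rewrite mule_ge0.
- by move=> r; rewrite adde_ge0// mule_ge0.
move=> r rs; rewrite !indicE.
have [r0|r0] := ltP r 0%R.
  have h (a b : R) : (0 <= a)%R -> (r \in (`[a, b]%classic : set R)) = false.
    by move=> a0; apply/negbTE/negP; rewrite inE/= in_itv/= => /andP[h1 h2]; lra.
  by rewrite !h// !mule0 adde0.
have [h|h] := ltP r s.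
  rewrite [r \in `[s, _]%classic](_ : _ = false); last first.
    by apply/negbTE/negP; rewrite inE/= in_itv/= => /andP[h1 h2]; lra.
  rewrite !mem_set ?mule0 ?adde0//=; rewrite in_itv/=; apply/andP; split; lra.
rewrite [r \in `[0%R, s]%classic](_ : _ = false); last first.
  apply/negbTE/negP; rewrite inE/= in_itv/= => /andP[h1 h2]; apply: rs.
  by apply/eqP; rewrite eq_le h2 h.
rewrite mule0 add0e; congr (_ * (nat_of_bool _)%:R%:E).
by apply/idP/idP; rewrite !inE/= !in_itv/= => /andP[h1 h2]; apply/andP; split; lra.
Qed.

Lemma measurable_integral_time d (Z : measurableType d)
    (F : measurableTypeR R * Z -> \bar R) (tau : Z -> R) :
  measurable_fun setT F -> (forall p, 0 <= F p) -> measurable_fun setT tau ->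
  measurable_fun setT (fun z => \int[time (tau z)]_r F (r, z)).
Proof.
move=> mF F0 mtau.
rewrite (_ : (fun z => _) = fun z =>
  \int[lebesgue_measure]_r (F (r, z) * (\1_(`[0%R, tau z]%classic) r)%:E)); last first.
  by apply/funext => z; rewrite integral_time//; exact: measurableT_comp (measurable_pair2 z).
apply: (measurable_fun_fubini_tonelli_G (fun p : measurableTypeR R * Z =>
  F p * (\1_(`[0%R, tau p.2]%classic) p.1)%:E)); last first.
  by move=> p; rewrite mule_ge0.
apply: emeasurable_funM => //; apply/measurable_EFinP.
rewrite (_ : (fun p : measurableTypeR R * Z => _) = fun p =>
   ((0 <= p.1)%R && (p.1 <= tau p.2)%R)%:R); last first.
  apply/funext => p; rewrite indicE; congr ((nat_of_bool _)%:R).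
  by apply/idP/idP; rewrite inE/= in_itv.
have mb (b : measurableTypeR R * Z -> bool) : measurable_fun setT b ->
    measurable_fun setT (fun p => (b p)%:R : R).
  move=> mb; rewrite (_ : (fun p => _) = fun p => if b p then 1 else 0)%R.
    exact: measurable_fun_ifT.
  by apply/funext => p; case: (b p).
apply: mb; apply: measurable_and.
  by apply: measurable_fun_ler => //; exact: measurable_fst.
apply: measurable_fun_ler; first exact: measurable_fst.
exact: measurableT_comp mtau measurable_snd.
Qed.

End time_measure.

(** * Exponentials of primitives *)

Section exponential_formula.
Context {R : realType}.
Implicit Types (s t h T : R) (g : measurableTypeR R -> R).

Lemma time_setT t : 0 <= t -> time t setT = t%:E.
Proof.
move=> t0; have := @integral_time_cst R t 1%E t0 lee01; rewrite mul1e => <-.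
by have := @integral_cst _ _ _ (time t) _ measurableT 1%E; rewrite /cst => ->; rewrite mul1e.
Qed.

Lemma Rint_time_bound g K h : 0 <= h -> bmeas g ->
  (forall r, 0 <= r -> r <= h -> `|g r| <= K) -> `|\int[time h]_r g r|%R <= K * h.
Proof.
move=> h0 bg gK; have K0 : 0 <= K by apply: le_trans (gK 0 _ _).
apply: le_trans (le_normr_Rintegral measurableT (bmeas_integrable _ bg)) _.
have bn : bmeas (fun r => `|g r|).
  split; first by apply: measurableT_comp => //; exact: bg.1.
  by have [M _ gM] := bmeas_bound bg; exists M => r; rewrite normr_id.
rewrite -lee_fin EFin_Rintegral_bmeas// EFinM -(@integral_time_cst R h K%:E)//.
by apply: le_time => //; apply/measurable_EFinP; exact: bn.1.
Qed.

Lemma Rint_time_split g s t : 0 <= s -> 0 <= t -> bmeas g ->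
  (\int[time (s + t)]_r g r = \int[time s]_r g r + \int[time t]_r g (s + r))%R.
Proof.
move=> s0 t0 bg; have [M M0 gM] := bmeas_bound bg.
have bs : bmeas (fun r => g (s + r)).
  by apply: bmeas_comp bg => //; exact: measurable_funD.
have bM := @bmeas_cst _ (measurableTypeR R) R M.
have ge0 r : 0 <= g r + M by have := gM r; rewrite ler_norml => /andP[+ _]; lra.
have E u (k : measurableTypeR R -> R) : 0 <= u -> bmeas k ->
    (\int[time u]_r (k r + M) = \int[time u]_r k r + M * u)%R.
  move=> u0 bk; rewrite RintegralD_bmeas//; congr (_ + _).
  by rewrite Rintegral_bmeas_cst [X in fine X](time_setT u0).
have := @integral_time_split R s t (fun r => (g r + M)%:E) s0 t0.
have bgM : bmeas (fun r : measurableTypeR R => g r + M) by exact: bmeasD.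
have bsM : bmeas (fun r : measurableTypeR R => g (s + r) + M) by exact: bmeasD.
rewrite -!EFin_Rintegral_bmeas// -EFinD !E ?addr_ge0//.
have mm : measurable_fun setT (fun r : measurableTypeR R => (g r + M)%:E).
  by apply/measurable_EFinP; exact: bgM.1.
by move=> H; have [] := H mm ge0; lra.
Qed.

Lemma measurable_primitive g : bmeas g ->
  measurable_fun setT (fun s => (\int[time s]_r g r)%R).
Proof.
move=> bg; have [M M0 gM] := bmeas_bound bg.
have ge0 r : 0 <= g r + M by have := gM r; rewrite ler_norml => /andP[+ _]; lra.
have bM := @bmeas_cst _ (measurableTypeR R) R M.
rewrite (_ : (fun s => _) = fun s => fine (\int[time s]_r (g r + M)%:E)%E - M * fine (time s setT)).
  apply: measurable_funB.
    apply: measurableT_comp => //.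
    apply: (@measurable_integral_time R _ _ (fun p : measurableTypeR R * measurableTypeR R => (g p.1 + M)%:E) id) => //.
      apply/measurable_EFinP; apply: measurable_funD => //.
      by apply: measurableT_comp measurable_fst; exact: bg.1.
    by move=> p; rewrite lee_fin.
  apply: measurable_funM => //; apply: measurableT_comp => //.
  rewrite (_ : (fun s => _) = fun s : measurableTypeR R => \int[time s]_r (1 : \bar R))%E.
    exact: (@measurable_integral_time R _ _ (fun=> 1%E) id).
  by apply/funext => s; have := @integral_cst _ _ _ (time s) _ measurableT 1%E; rewrite /cst => ->; rewrite mul1e.
apply/funext => s; transitivity ((\int[time s]_r (g r + M))%R - M * fine (time s setT)); last by [].
rewrite RintegralD_bmeas// Rintegral_bmeas_cst.
by rewrite addrK.
Qed.

Lemma expR_dist1 (y : R) : `|expR y - 1| <= `|y| * expR `|y|.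
Proof.
have h1 := expR_ge1Dx y; have h2 := expR_ge1Dx (- y).
have [y0|y0] := leP 0 y.
  have e1 : 1 <= expR y by rewrite -expR0 ler_expR.
  rewrite ger0_norm ?subr_ge0// lerBlDr.
  have : expR y * (1 - y) <= expR y * expR (- y) by rewrite ler_wpM2l ?expR_ge0.
  rewrite -expRD subrr expR0 (ger0_norm y0); lra.
have e1 : expR y <= 1 by rewrite -expR0 ler_expR ltW.
rewrite ler0_norm ?subr_le0// opprB (ltr0_norm y0).
have : - y <= - y * expR (- y).
  by rewrite ler_peMr ?oppr_ge0 ?(ltW y0)// -expR0 ler_expR oppr_ge0 ltW.
by lra.
Qed.

Lemma expR_dist2 (y : R) : `|expR y - 1 - y| <= y ^+ 2 * expR `|y|.
Proof.
have h1 := expR_ge1Dx y; have h2 := expR_ge1Dx (- y).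
rewrite ger0_norm; last by lra.
have : expR y * (1 - y) <= expR y * expR (- y) by rewrite ler_wpM2l ?expR_ge0.
rewrite -expRD subrr expR0 => h3.
have h4 : y * (expR y - 1) <= y ^+ 2 * expR `|y|.
  rewrite -(real_normK (num_real y)) expr2 -mulrA.
  apply: le_trans (ler_norm _) _; rewrite normrM ler_wpM2l//; exact: expR_dist1.
apply: le_trans h4; lra.
Qed.

(** Over [N] equal steps the increments add up to at most [N K (T / N)^2], which tends to 0. *)
Lemma cst_of_quadratic (G : R -> R) K T : 0 <= T ->
  (forall s h, 0 <= s -> 0 <= h -> s + h <= T -> `|G (s + h) - G s| <= K * h ^+ 2) ->
  G T = G 0.
Proof.
move=> T0 HG.
have step N k : (k <= N.+1)%N -> `|G (k%:R * (T / N.+1%:R)) - G 0| <= k%:R * (K * (T / N.+1%:R) ^+ 2).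
  elim: k => [|k ih] kN; first by rewrite !mul0r subrr normr0.
  have {ih} := ih (ltnW kN); set u := k%:R * _ => ih.
  have h0 : 0 <= T / N.+1%:R by rewrite divr_ge0.
  have kE (x : R) : k.+1%:R * x = k%:R * x + x by rewrite -natr1 mulrDl mul1r.
  rewrite !kE -/u (_ : _ - G 0 = (G (u + T / N.+1%:R) - G u) + (G u - G 0)); last by ring.
  apply: le_trans (ler_normD _ _) _; rewrite addrC lerD//; apply: HG => //.
    by rewrite mulr_ge0.
  by rewrite -kE mulrCA -[leRHS]mulr1 ler_wpM2l// ler_pdivrMr// mul1r ler_nat.
have {}step N : `|G T - G 0| <= K * T ^+ 2 / N.+1%:R.
  have := step N N.+1 (leqnn _); rewrite mulrCA divff ?pnatr_eq0// mulr1 => /le_trans; apply.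
  by rewrite le_eqVlt; apply/orP; left; apply/eqP; field.
apply/eqP; rewrite -subr_eq0 -normr_le0 leNgt; apply/negP => pos.
pose N := Num.truncn (K * T ^+ 2 / `|G T - G 0|).
have := step N; apply/negP; by rewrite -ltNge ltr_pdivrMr// [ltRHS]mulrC -ltr_pdivrMr// truncnS_gt.
Qed.

(** [g] is only measurable, so its primitive may fail to be differentiable. Instead, the difference
    of the two sides changes by a quadratic amount over each step and [cst_of_quadratic] applies.
    The indicator makes [E] bounded on the whole line. *)
Lemma expR_time_formula g T : 0 <= T -> bmeas g ->
  let B s := (\int[time s]_r g r)%R in
  let E s := \1_(`[0, T]%classic : set R) s * (g s * expR (B s)) in
  bmeas (E : measurableTypeR R -> R) /\ (\int[time T]_s E s = expR (B T) - 1)%R.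
Proof.
move=> T0 bg B E; have [M M0 gM] := bmeas_bound bg.
have BM s : 0 <= s -> `|B s| <= M * s by move=> s0; exact: Rint_time_bound.
have BT s : 0 <= s -> s <= T -> expR `|B s| <= expR (M * T).
  move=> s0 sT; rewrite ler_expR (le_trans (BM s s0))// ler_wpM2l//.
have bE : bmeas (E : measurableTypeR R -> R).
  split.
    apply: measurable_funM; first exact: (measurable_indic (measurable_itv `[0, T])).
    apply: measurable_funM; first exact: bg.1.
    by apply: measurableT_comp => //; exact: measurable_primitive.
  exists (M * expR (M * T)) => s; rewrite /E indicE.
  case: (boolP (s \in _)) => [|_]; last by rewrite mul0r normr0 mulr_ge0// expR_ge0.
  rewrite inE/= in_itv/= => /andP[s0 sT]; rewrite mul1r normrM ler_pM//.
  rewrite ger0_norm ?expR_ge0// (le_trans _ (BT s s0 sT))// ler_expR ler_norm//.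
split => //.
pose G s := expR (B s) - (\int[time s]_r E r)%R.
have z (k : measurableTypeR R -> R) : bmeas k -> (\int[time 0]_r k r = 0)%R.
  move=> bk; apply/eqP; rewrite -normr_le0.
  have [N _ kN] := bmeas_bound bk.
  by have := @Rint_time_bound k N 0 (lexx _) bk (fun r _ _ => kN r); rewrite mulr0.
have : G T = G 0; last by rewrite /G /B !z// expR0 subr0 => h; rewrite -h; ring.
pose e := expR (M * T); have e0 : 0 <= e by exact: expR_ge0.
apply: (@cst_of_quadratic _ (e * (M ^+ 2 * e) + M * (e * (M * e)))) => // s h s0 h0 shT.
have sT : s <= T by lra.
have hT : h <= T by lra.
have bgs : bmeas (fun r : measurableTypeR R => g (s + r)).
  by apply: bmeas_comp bg => //; exact: measurable_funD.
have bEs : bmeas (fun r : measurableTypeR R => E (s + r)).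
  by apply: (bmeas_comp _ bE) => //; exact: measurable_funD.
pose D u := (\int[time u]_r g (s + r))%R.
have BD u : 0 <= u -> B (s + u) = B s + D u by move=> u0; exact: Rint_time_split.
have DM u : 0 <= u -> `|D u| <= M * u by move=> u0; exact: Rint_time_bound.
have De u : 0 <= u -> u <= h -> expR `|D u| <= e.
  move=> u0 uh; rewrite ler_expR (le_trans (DM u u0))// ler_wpM2l//; lra.
have Bse : expR (B s) <= e.
  by rewrite (le_trans _ (BT s s0 sT))// ler_expR ler_norm.
have alg (a b c u v : R) : a * b - (c + u) - (a - c) = a * (b - 1 - v) - (u - a * v) by ring.
have -> : G (s + h) - G s = expR (B s) * (expR (D h) - 1 - D h) -
    (\int[time h]_r (E (s + r)%R - expR (B s) * g (s + r)))%R.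
  rewrite RintegralB_bmeas//; last exact: bmeasZ.
  rewrite RintegralZ_bmeas// -/(D h) /G Rint_time_split// BD// expRD.
  exact: alg.
rewrite mulrDl; apply: le_trans (ler_normB _ _) _; apply: lerD.
  rewrite normrM ger0_norm ?expR_ge0// -mulrA ler_pM ?expR_ge0//.
  apply: le_trans (expR_dist2 _) _; rewrite [leRHS]mulrAC.
  apply: ler_pM; rewrite ?sqr_ge0 ?expR_ge0//; last exact: De.
  rewrite -(real_normK (num_real (D h))) -exprMn lerXn2r ?nnegrE// ?mulr_ge0//.
  exact: DM.
rewrite expr2 mulrA; apply: Rint_time_bound => //; first by apply: bmeasB => //; exact: bmeasZ.
move=> r r0 rh; rewrite /E indicE mem_set/=; last by rewrite in_itv/=; apply/andP; split; lra.
rewrite mul1r mulrC -mulrBl normrM mulrC -!mulrA ler_pM// BD// expRD.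
rewrite -{2}[expR (B s)]mulr1 -mulrBr normrM ger0_norm ?expR_ge0// ler_pM//.
apply: le_trans (expR_dist1 _) _; rewrite [e * h]mulrC mulrA ler_pM ?expR_ge0//; last exact: De.
by rewrite (le_trans (DM r r0))// ler_wpM2l.
Qed.

End exponential_formula.

Lemma ge0_cvg_integral_nd d (T : measurableType d) (R : realType)
    (m : {measure set T -> \bar R}) (F : nat -> T -> \bar R) (f : T -> \bar R) :
  (forall k, measurable_fun setT (F k)) -> (forall k x, 0 <= F k x)%E ->
  (forall x, nondecreasing_seq (F^~ x)) -> (forall x, F k x @[k --> \oo] --> f x) ->
  measurable_fun setT f /\ (\int[m]_x F k x @[k --> \oo] --> \int[m]_x f x)%E.
Proof.
move=> mF F0 ndF Ff; split; first exact: (emeasurable_fun_cvg F).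
have -> : f = fun x => limn (F^~ x) by apply/funext => x; apply/esym/cvg_lim.
by apply: cvg_monotone_convergence => // x _; exact: ndF.
Qed.

(** [expeR] is an increasing bijection onto the nonnegative extended reals, so it commutes with
    suprema. *)
Lemma cvg_expeR_nd (R : realType) (a : nat -> \bar R) l : nondecreasing_seq a ->
  a k @[k --> \oo] --> l -> expeR (a k) @[k --> \oo] --> expeR l.
Proof.
move=> nda al; have E : l = ereal_sup (range a).
  by apply: (cvg_unique _ al) => //; exact: ereal_nondecreasing_cvgn.
have -> : expeR l = ereal_sup (range (fun k => expeR (a k))).
  apply/eqP; rewrite eq_le; apply/andP; split; last first.
    apply: ge_ereal_sup => _ [k _ <-]; rewrite lee_expeR E.
    by apply: ereal_sup_ubound; exists k.
  have s0 : (0 <= ereal_sup (range (fun k => expeR (a k))))%E.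
    by apply: ereal_sup_ge; exists (expeR (a 0%N)); [exists 0%N|exact: expeR_ge0].
  have [y yE] := expeR_total s0; rewrite -yE lee_expeR E.
  apply: ge_ereal_sup => _ [k _ <-]; rewrite -lee_expeR yE.
  by apply: ereal_sup_ubound; exists k.
apply: ereal_nondecreasing_cvgn => k l' kl; rewrite lee_expeR; exact: nda.
Qed.

Lemma measurable_expeR (R : realType) : measurable_fun setT (@expeR R).
Proof.
move=> _; apply: (measurability _ (ErealGenOInfty.measurableE R)) => // _ [_ [r ->] <-].
rewrite setTI; have [r0|r0] := ltP r 0.
  rewrite (_ : _ @^-1` _ = setT)//; apply/seteqP; split=> // x _ /=.
  by rewrite in_itv/= andbT (lt_le_trans _ (expeR_ge0 x)).
have [y yr] := @expeR_total R r%:E r0.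
rewrite (_ : _ @^-1` _ = `]y, +oo[%classic); first exact: emeasurable_itv.
by apply/seteqP; split=> x /=; rewrite !in_itv/= !andbT -yr lte_expeR.
Qed.

(** * Additive functionals along a path *)

Section clock.
Context {R : realType} {n : nat}.
Local Notation path := (path R n).
Implicit Types (u f : 'rV[R]_n -> R) (x y : 'rV[R]_n) (w : path) (s t : R).

Definition clock u x w t : \bar R := (\int[time t]_s (u (x + w s))%:E)%E.

Lemma measurable_path w : measurable_fun setT (w : measurableTypeR R -> 'rV[R]_n).
Proof. exact: (measurableT_comp (@measurable_path_joint R n) (measurable_pair2 w)). Qed.

Lemma measurable_along u x w : measurable_fun setT u ->
  measurable_fun setT (fun s : measurableTypeR R => u (x + w s)).
Proof.
move=> mu; apply: measurableT_comp => //.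
by apply: measurable_rVD => //; exact: measurable_path.
Qed.

Lemma clock_ge0 u x w t : (forall y, 0 <= u y) -> (0 <= clock u x w t)%E.
Proof. by move=> u0; apply: integral_ge0 => s _; rewrite lee_fin. Qed.

Lemma measurable_clock d (Z : measurableType d) u (X : Z -> 'rV[R]_n)
    (W : Z -> path) (S T : Z -> R) : measurable_fun setT u -> (forall y, 0 <= u y) ->
  measurable_fun setT X -> measurable_fun setT W -> measurable_fun setT S -> measurable_fun setT T ->
  measurable_fun setT (fun z => \int[time (T z)]_r (u (X z + W z (S z + r)))%:E)%E.
Proof.
move=> mu u0 mX mW mS mT.
apply: (@measurable_integral_time R _ Z
  (fun p : measurableTypeR R * Z => (u (X p.2 + W p.2 (S p.2 + p.1)))%:E)) => //.
  apply/measurable_EFinP; apply: measurableT_comp => //; apply: measurable_rVD.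
    exact: measurableT_comp mX measurable_snd.
  have m2 : measurable_fun setT (fun p : measurableTypeR R * Z =>
      (S p.2 + p.1 : measurableTypeR R, W p.2)).
    apply: measurable_fun_pair; last exact: measurableT_comp mW measurable_snd.
    by apply: measurable_funD => //; exact: measurableT_comp mS measurable_snd.
  exact: (measurableT_comp (@measurable_path_joint R n) m2).
by move=> p; rewrite lee_fin.
Qed.

Lemma measurable_clock0 d (Z : measurableType d) u (X : Z -> 'rV[R]_n)
    (W : Z -> path) (T : Z -> R) : measurable_fun setT u -> (forall y, 0 <= u y) ->
  measurable_fun setT X -> measurable_fun setT W -> measurable_fun setT T ->
  measurable_fun setT (fun z => clock u (X z) (W z) (T z)).
Proof.
move=> mu u0 mX mW mT; have := measurable_clock mu u0 mX mW (@measurable_cst _ _ Z (measurableTypeR R) setT 0) mT.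
by rewrite /clock; congr measurable_fun; apply/funext => z; under eq_integral do rewrite add0r.
Qed.

Lemma clock_split u x w s t : measurable_fun setT u -> (forall y, 0 <= u y) -> 0 <= s -> 0 <= t ->
  clock u x w (s + t) = (clock u x w s + \int[time t]_r (u (x + w (s + r)))%:E)%E.
Proof.
move=> mu u0 s0 t0; rewrite /clock integral_time_split// => [|r]; last by rewrite lee_fin.
by apply/measurable_EFinP; exact: measurable_along.
Qed.

Lemma clock_concat_le u x s w w' t : measurable_fun setT u -> (forall y, 0 <= u y) -> 0 <= s -> t <= s ->
  clock u x (concat s w w') t = clock u x w t.
Proof.
move=> mu u0 s0 ts; apply: eq_time.
- by apply/measurable_EFinP; exact: measurable_along.
- by apply/measurable_EFinP; exact: measurable_along.
- by move=> r; rewrite lee_fin.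
- by move=> r; rewrite lee_fin.
by move=> r r0 rt; rewrite concat_le// (le_trans rt).
Qed.

Lemma clock_concat_shift u x s w w' t : measurable_fun setT u -> (forall y, 0 <= u y) -> 0 <= s ->
  (\int[time t]_r (u (x + concat s w w' (s + r)))%:E)%E = clock u (x + w s) w' t.
Proof.
move=> mu u0 s0; apply: eq_time.
- apply/measurable_EFinP; apply: (measurableT_comp (measurable_along x (concat s w w') mu)).
  exact: measurable_funD.
- by apply/measurable_EFinP; exact: measurable_along.
- by move=> r; rewrite lee_fin.
- by move=> r; rewrite lee_fin.
by move=> r r0 rt; rewrite concat_add// addrA.
Qed.

Lemma clock_concat u x s w w' t : measurable_fun setT u -> (forall y, 0 <= u y) -> 0 <= s -> 0 <= t ->
  clock u x (concat s w w') (s + t) = (clock u x w s + clock u (x + w s) w' t)%E.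
Proof. by move=> *; rewrite clock_split// clock_concat_le// clock_concat_shift. Qed.

Lemma le_clock u f x w t : measurable_fun setT u -> measurable_fun setT f ->
  (forall y, 0 <= u y) -> (forall y, u y <= f y) -> (clock u x w t <= clock f x w t)%E.
Proof.
move=> mu mf u0 uf; apply: ge0_le_integral => //.
- by move=> s _; rewrite lee_fin.
- by apply/measurable_EFinP; exact: measurable_along.
- by apply/measurable_EFinP; exact: measurable_along.
- by move=> s _; rewrite lee_fin.
Qed.

Lemma clock_le_cst u x w t c : measurable_fun setT u -> (forall y, 0 <= u y) -> 0 <= t ->
  (forall y, u y <= c) -> (clock u x w t <= (c * t)%:E)%E.
Proof.
move=> mu u0 t0 uc; rewrite EFinM -integral_time_cst//; last by rewrite lee_fin (le_trans (u0 x)).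
apply: ge0_le_integral => //.
- by move=> s _; rewrite lee_fin.
- by apply/measurable_EFinP; exact: measurable_along.
- by move=> s _; rewrite lee_fin.
Qed.

Lemma clock_mono u x w s t : measurable_fun setT u -> (forall y, 0 <= u y) -> 0 <= s -> s <= t ->
  (clock u x w s <= clock u x w t)%E.
Proof.
move=> mu u0 s0 st; rewrite -(subrKC s t) clock_split ?subr_ge0// leeDl//.
by apply: integral_ge0 => r _; rewrite lee_fin.
Qed.

Definition truncate u (m : nat) y : R := Num.min (u y) m%:R.

Lemma truncate_ge0 u m y : (forall y, 0 <= u y) -> 0 <= truncate u m y.
Proof. by move=> u0; rewrite le_min u0/=. Qed.

Lemma measurable_truncate u m : measurable_fun setT u -> measurable_fun setT (truncate u m).
Proof. by move=> mu; exact: measurable_minr. Qed.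

Lemma bmeas_truncate u m : measurable_fun setT u -> (forall y, 0 <= u y) -> bmeas (truncate u m).
Proof.
move=> mu u0; split; first exact: measurable_truncate.
by exists m%:R => y; rewrite ger0_norm ?truncate_ge0// ge_min lexx orbT.
Qed.

Lemma truncate_le u m y : truncate u m y <= u y.
Proof. by rewrite ge_min lexx. Qed.

Lemma truncate_nd u y : nondecreasing_seq (truncate u ^~ y).
Proof.
move=> m k mk; rewrite /truncate le_min ge_min lexx/= ge_min.
by apply/orP; right; rewrite ler_nat.
Qed.

Lemma truncate_eventually u y : \forall m \near \oo, truncate u m y = u y.
Proof.
exists (Num.truncn (u y)).+1 => // m /= um; apply/min_l/ltW.
by apply: lt_le_trans (truncnS_gt _) _; rewrite ler_nat.
Qed.

Lemma clock_truncate u x w t : measurable_fun setT u -> (forall y, 0 <= u y) ->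
  nondecreasing_seq (fun m => clock (truncate u m) x w t) /\
  clock (truncate u m) x w t @[m --> \oo] --> clock u x w t.
Proof.
move=> mu u0; split=> [m k mk|].
  apply: le_clock; [exact: measurable_truncate|exact: measurable_truncate| |].
    by move=> y; exact: truncate_ge0.
  by move=> y; exact: truncate_nd.
have [] // := @ge0_cvg_integral_nd _ _ R (time t) (fun m s => (truncate u m (x + w s))%:E)
  (fun s => (u (x + w s))%:E).
- by move=> m; apply/measurable_EFinP; apply: measurable_along; exact: measurable_truncate.
- by move=> m s; rewrite lee_fin truncate_ge0.
- by move=> s m k mk; rewrite lee_fin; exact: truncate_nd.
move=> s; apply: cvg_near_cst.
by near=> m; congr EFin; near: m; exact: truncate_eventually.
Unshelve. all: by end_near. Qed.

End clock.

Section clock_formulas.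
Context {R : realType} {n : nat}.
Local Notation path := (path R n).
Implicit Types (u f : 'rV[R]_n -> R) (x y : 'rV[R]_n) (w : path) (s t : R).

Definition rclock u x w t : R := (\int[time t]_s u (x + w s))%R.

Lemma bmeas_along u x w : bmeas u -> bmeas (fun s : measurableTypeR R => u (x + w s)).
Proof.
move=> bu; apply: bmeas_comp bu.
by apply: measurable_rVD => //; exact: measurable_path.
Qed.

Lemma rclockE u x w t : bmeas u -> (rclock u x w t)%:E = clock u x w t.
Proof. by move=> bu; rewrite EFin_Rintegral_bmeas//; exact: bmeas_along. Qed.

Lemma expR_rclock u c x w t : bmeas u -> 0 <= t ->
  let E s := \1_(`[0, t]%classic : set R) s * ((c - u (x + w s)) * expR (c * s - rclock u x w s)) in
  bmeas (E : measurableTypeR R -> R) /\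
  (\int[time t]_s E s = expR (c * t - rclock u x w t) - 1)%R.
Proof.
move=> bu t0 E; have bg := bmeas_along x w bu.
have bcg : bmeas (fun s : measurableTypeR R => c - u (x + w s)).
  by apply: bmeasB => //; exact: bmeas_cst.
have [bF FE] := expR_time_formula t0 bcg.
have BE s : 0 <= s -> (\int[time s]_r (c - u (x + w r)))%R = c * s - rclock u x w s.
  move=> s0; rewrite RintegralB_bmeas//; last exact: bmeas_cst.
  by rewrite Rintegral_bmeas_cst [X in fine X](time_setT s0).
have EF : E = fun s => \1_(`[0, t]%classic : set R) s *
    ((c - u (x + w s)) * expR (\int[time s]_r (c - u (x + w r)))%R).
  apply/funext => s; rewrite /E indicE; case: (boolP (s \in _)) => [|_]; last by rewrite !mul0r.
  by rewrite inE/= in_itv/= => /andP[s0 _]; rewrite BE.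
by rewrite EF; split => //; rewrite -BE.
Qed.

(** [expR_rclock] with [c = 0] integrates the derivative of [exp (- A_s)], where [A_s] is the clock;
    multiplying by [exp (A_t)] gives the formula. *)
Lemma clock_creation_bounded f x w t : bmeas f -> (forall y, 0 <= f y) -> 0 <= t ->
  (expeR (clock f x w t) = 1 + \int[time t]_s ((f (x + w s)%R)%:E *
     expeR (\int[time (t - s)%R]_r (f (x + w (s + r)))%R%:E)))%E.
Proof.
move=> bf f0 t0; have [bE] := expR_rclock 0 x w bf t0.
set E := (X in bmeas X) in bE *; move=> EE.
have mf := bf.1.
pose c := expR (rclock f x w t).
have -> : (\int[time t]_s ((f (x + w s)%R)%:E *
     expeR (\int[time (t - s)%R]_r (f (x + w (s + r)))%R%:E)) =
    \int[time t]_s (- c * E s)%:E)%E.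
  apply: eq_time.
  - apply: emeasurable_funM; first by apply/measurable_EFinP; exact: measurable_along.
    apply: (measurableT_comp (@measurable_expeR R)).
    apply: (measurable_clock (Z := measurableTypeR R) (X := fun=> x) (W := fun=> w) (S := id)
      (T := fun s => t - s)) => //.
    by apply: measurable_funB.
  - by apply/measurable_EFinP; apply: measurable_funM => //; exact: bE.1.
  - by move=> s; rewrite mule_ge0// ?lee_fin// expeR_ge0.
  - by move=> s; rewrite lee_fin mulNr oppr_ge0 /E sub0r !mulNr !mulrN oppr_le0 !mulr_ge0// expR_ge0.
  move=> s s0 st; have ts : 0 <= t - s by rewrite subr_ge0.
  have := @clock_split R n f x w s (t - s) mf f0 s0 ts; rewrite subrKC -!rclockE// => cs.
  have -> : (\int[time (t - s)%R]_r (f (x + w (s + r)))%R%:E = (rclock f x w t - rclock f x w s)%:E)%E.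
    by rewrite EFinB cs addeAC subee// add0e.
  rewrite /= -EFinM /E indicE mem_set/=; last by rewrite in_itv/= s0.
  by rewrite mul1r mul0r !sub0r (mulNr (f _)) mulrNN expRD /c mulrCA.
have bNE : bmeas (fun s : measurableTypeR R => - c * E s) by exact: bmeasZ.
rewrite -EFin_Rintegral_bmeas// -rclockE//= -EFinD; congr EFin.
rewrite RintegralZ_bmeas// EE mul0r sub0r mulNr mulrBr mulr1 -expRD subrr expR0.
by rewrite opprB addrC subrK.
Qed.

(** Both sides are monotone limits over the truncations of [f]. *)
Lemma clock_creation f x w t : measurable_fun setT f -> (forall y, 0 <= f y) -> 0 <= t ->
  (expeR (clock f x w t) = 1 + \int[time t]_s ((f (x + w s)%R)%:E *
     expeR (\int[time (t - s)%R]_r (f (x + w (s + r)))%R%:E)))%E.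
Proof.
move=> mf f0 t0.
have [nd cv] := clock_truncate x w t mf f0.
have c1 := cvg_expeR_nd nd cv.
pose I (h : 'rV[R]_n -> R) s : \bar R := (\int[time (t - s)%R]_r (h (x + w (s + r)))%R%:E)%E.
have mI (h : 'rV[R]_n -> R) : measurable_fun setT h -> (forall y, 0 <= h y) -> measurable_fun setT (I h : measurableTypeR R -> \bar R).
  move=> mh h0; apply: (measurable_clock (Z := measurableTypeR R) (X := fun=> x) (W := fun=> w) (S := id)
      (T := fun s => t - s)) => //.
  by apply: measurable_funB.
have tr0 m y : 0 <= truncate f m y by exact: truncate_ge0.
have mtr m : measurable_fun setT (truncate f m) by exact: measurable_truncate.
have ndI s : nondecreasing_seq (fun m => I (truncate f m) s).
  move=> m k mk; apply: ge0_le_integral => //.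
  - by move=> r _; rewrite lee_fin.
  - apply/measurable_EFinP; apply: (measurableT_comp (measurable_along x w (mtr m))).
    exact: measurable_funD.
  - apply/measurable_EFinP; apply: (measurableT_comp (measurable_along x w (mtr k))).
    exact: measurable_funD.
  - by move=> r _; rewrite lee_fin truncate_nd.
have cvI s : I (truncate f m) s @[m --> \oo] --> I f s.
  have [] // := @ge0_cvg_integral_nd _ _ R (time (t - s)) (fun m r => (truncate f m (x + w (s + r)))%:E)
    (fun r => (f (x + w (s + r)))%:E).
  - move=> m; apply/measurable_EFinP; apply: (measurableT_comp (measurable_along x w (mtr m))).
    exact: measurable_funD.
  - by move=> m r; rewrite lee_fin.
  - by move=> r m k mk; rewrite lee_fin; exact: truncate_nd.
  move=> r; apply: cvg_near_cst.
  by near=> m; congr EFin; near: m; exact: truncate_eventually.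
have c2 : (1 + \int[time t]_s ((truncate f m (x + w s)%R)%:E * expeR (I (truncate f m) s)))%E @[m --> \oo] -->
   (1 + \int[time t]_s ((f (x + w s)%R)%:E * expeR (I f s)))%E.
  apply: cvgeD => //; first exact: cvg_cst.
  have [] // := @ge0_cvg_integral_nd _ _ R (time t)
     (fun m s => (truncate f m (x + w s)%R)%:E * expeR (I (truncate f m) s))%E
     (fun s => (f (x + w s)%R)%:E * expeR (I f s))%E.
  - move=> m; apply: emeasurable_funM; first by apply/measurable_EFinP; exact: measurable_along.
    by apply: (measurableT_comp (@measurable_expeR R)); exact: mI.
  - by move=> m s; rewrite mule_ge0// ?lee_fin// expeR_ge0.
  - move=> s m k mk; apply: lee_pmul; rewrite ?lee_fin ?expeR_ge0//; first exact: truncate_nd.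
    by rewrite lee_expeR; exact: ndI.
  move=> s; have cE := cvg_expeR_nd (ndI s) (cvI s).
  apply: cvg_trans (cvgeZl _ cE); last by [].
  apply: near_eq_cvg; near=> m.
  congr (_%:E * _)%E; apply/esym; near: m; exact: truncate_eventually.
apply: (cvg_unique _ c1) => //.
rewrite (_ : (fun m => _) = fun m => (1 + \int[time t]_s ((truncate f m (x + w s)%R)%:E * expeR (I (truncate f m) s)))%E) //.
by apply/funext => m; apply: clock_creation_bounded => //; exact: bmeas_truncate.
Unshelve. all: by end_near. Qed.

End clock_formulas.

(** * Killing, creation and Duhamel's formula *)

Section feynman_kac_functional.
Context {R : realType} {n : nat}.
Local Notation path := (path R n).
Local Notation leb := (@lebesgue_rV R n).
Implicit Types (u f : 'rV[R]_n -> R) (g : 'rV[R]_n -> \bar R) (x y : 'rV[R]_n) (w : path) (s t : R).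
Variable mu : probability path R.
Hypothesis muL : levy_law mu.
Local Open Scope ereal_scope.

(** A product of two exponentials rather than the exponential of a difference, which might be
    [+oo - +oo]; each factor is monotone in its rate and additive clocks split it. *)
Definition weight u f x w t : \bar R := expeR (- clock u x w t) * expeR (clock f x w t).

(* [u] is the rate of killing and [f] the rate of creation. *)
Definition fk u f t g x : \bar R := \int[mu]_w (weight u f x w t * g (x + w t)%R).

Definition zero_rate : 'rV[R]_n -> R := cst 0%R.

Lemma clock_zero x w t : clock zero_rate x w t = 0.
Proof. by rewrite /clock /zero_rate integral0. Qed.

Lemma weight_zero_creation u x w t : weight u zero_rate x w t = expeR (- clock u x w t).
Proof. by rewrite /weight clock_zero expeR0 mule1. Qed.

Lemma weight_zero_killing f x w t : weight zero_rate f x w t = expeR (clock f x w t).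
Proof. by rewrite /weight clock_zero oppe0 expeR0 mul1e. Qed.

Lemma weight_ge0 u f x w t : 0 <= weight u f x w t.
Proof. by rewrite mule_ge0// expeR_ge0. Qed.

Lemma measurable_weight d (Z : measurableType d) u f (X : Z -> 'rV[R]_n)
    (W : Z -> path) (T : Z -> R) :
  measurable_fun setT u -> (forall y, 0 <= u y)%R ->
  measurable_fun setT f -> (forall y, 0 <= f y)%R ->
  measurable_fun setT X -> measurable_fun setT W -> measurable_fun setT T ->
  measurable_fun setT (fun z => weight u f (X z) (W z) (T z)).
Proof.
move=> mu' u0 mf f0 mX mW mT; apply: emeasurable_funM.
  apply: (measurableT_comp (@measurable_expeR R)); apply: measurableT_comp => //.
  exact: measurable_clock0.
by apply: (measurableT_comp (@measurable_expeR R)); exact: measurable_clock0.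
Qed.

Lemma measurable_position d (Z : measurableType d) (X : Z -> 'rV[R]_n)
    (W : Z -> path) (T : Z -> R) :
  measurable_fun setT X -> measurable_fun setT W -> measurable_fun setT T ->
  measurable_fun setT (fun z => X z + W z (T z))%R.
Proof.
move=> mX mW mT; apply: measurable_rVD => //.
have m2 : measurable_fun setT (fun z => (T z : measurableTypeR R, W z)).
  exact: measurable_fun_pair.
exact: (measurableT_comp (@measurable_path_joint R n) m2).
Qed.

Lemma measurable_fk d (Z : measurableType d) u f g (X : Z -> 'rV[R]_n) (T : Z -> R) :
  measurable_fun setT u -> (forall y, 0 <= u y)%R ->
  measurable_fun setT f -> (forall y, 0 <= f y)%R ->
  measurable_fun setT g -> (forall y, 0 <= g y) ->
  measurable_fun setT X -> measurable_fun setT T ->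
  measurable_fun setT (fun z => fk u f (T z) g (X z)).
Proof.
move=> mu' u0 mf f0 mg g0 mX mT.
have mX1 : measurable_fun setT (fun p : Z * path => X p.1) by exact: measurableT_comp mX measurable_fst.
have mT1 : measurable_fun setT (fun p : Z * path => T p.1) by exact: measurableT_comp mT measurable_fst.
have mW1 : measurable_fun setT (fun p : Z * path => p.2) by exact: measurable_snd.
apply: (@measurable_fun_fubini_tonelli_F _ _ _ _ R mu
  (fun p : Z * path => weight u f (X p.1) p.2 (T p.1) * g (X p.1 + p.2 (T p.1))%R)).
  apply: emeasurable_funM; first exact: measurable_weight.
  by apply: measurableT_comp => //; exact: measurable_position.
by move=> p; rewrite mule_ge0// weight_ge0.
Qed.

Lemma measurable_fk_integrand u f g x t :
  measurable_fun setT u -> (forall y, 0 <= u y)%R ->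
  measurable_fun setT f -> (forall y, 0 <= f y)%R -> measurable_fun setT g ->
  measurable_fun setT (fun w => weight u f x w t * g (x + w t)%R).
Proof.
move=> mu' u0 mf f0 mg; apply: emeasurable_funM; first exact: measurable_weight.
by apply: measurableT_comp => //; apply: measurable_position.
Qed.

Lemma fk_ge0 u f t g x : (forall y, 0 <= g y) -> 0 <= fk u f t g x.
Proof. by move=> g0; apply: integral_ge0 => w _; rewrite mule_ge0// weight_ge0. Qed.

Lemma ge0_integral_markov s x (Psi A : path -> \bar R) (B : 'rV[R]_n -> path -> \bar R) :
  (0 <= s)%R -> measurable_fun setT Psi -> (forall w, 0 <= Psi w) ->
  (forall y, measurable_fun setT (B y)) -> (forall y w, 0 <= B y w) -> (forall w, 0 <= A w) ->
  (forall w w', Psi (concat s w w') = A w * B (x + w s)%R w') ->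
  \int[mu]_w Psi w = \int[mu]_w (A w * \int[mu]_w' B (x + w s)%R w').
Proof.
move=> s0 mP P0 mB B0 A0 PE; rewrite (ge0_integral_concat muL s0 mP P0).
apply: eq_integral => w _; rewrite -ge0_integralZl//.
by apply: eq_integral => w' _; exact: PE.
Qed.

Lemma weight_concat u f x s t w w' :
  measurable_fun setT u -> (forall y, 0 <= u y)%R ->
  measurable_fun setT f -> (forall y, 0 <= f y)%R -> (0 <= s)%R -> (0 <= t)%R ->
  weight u f x (concat s w w') (s + t) = weight u f x w s * weight u f (x + w s) w' t.
Proof.
move=> mu' u0 mf f0 s0 t0; rewrite /weight !clock_concat//.
rewrite oppeD ?ge0_adde_def ?inE ?clock_ge0// !expeRD.
by rewrite muleACA.
Qed.

Lemma fk_semigroup u f s t g x :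
  measurable_fun setT u -> (forall y, 0 <= u y)%R ->
  measurable_fun setT f -> (forall y, 0 <= f y)%R ->
  measurable_fun setT g -> (forall y, 0 <= g y) -> (0 <= s)%R -> (0 <= t)%R ->
  fk u f (s + t) g x = fk u f s (fk u f t g) x.
Proof.
move=> mu' u0 mf f0 mg g0 s0 t0.
apply: (ge0_integral_markov (B := fun y w' => weight u f y w' t * g (y + w' t)%R)) => //.
- exact: measurable_fk_integrand.
- by move=> w; rewrite mule_ge0// weight_ge0.
- by move=> y; exact: measurable_fk_integrand.
- by move=> y w; rewrite mule_ge0// weight_ge0.
- by move=> w; exact: weight_ge0.
by move=> w w'; rewrite weight_concat// concat_add// addrA -muleA.
Qed.

Lemma le_fk u u' f f' t g g' x :
  measurable_fun setT u -> (forall y, 0 <= u y)%R ->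
  measurable_fun setT f -> (forall y, 0 <= f y)%R ->
  measurable_fun setT u' -> (forall y, 0 <= u' y)%R ->
  measurable_fun setT f' -> (forall y, 0 <= f' y)%R ->
  measurable_fun setT g -> (forall y, 0 <= g y) ->
  measurable_fun setT g' ->
  (forall y, u' y <= u y)%R -> (forall y, f y <= f' y)%R -> (forall y, g y <= g' y) ->
  fk u f t g x <= fk u' f' t g' x.
Proof.
move=> mu' u0 mf f0 mu1 u'0 mf' f'0 mg g0 mg' uu ff gg; apply: ge0_le_integral => //.
- by move=> w _; rewrite mule_ge0// weight_ge0.
- exact: measurable_fk_integrand.
- exact: measurable_fk_integrand.
move=> w _; apply: lee_pmul => //; first exact: weight_ge0.
by apply: lee_pmul; rewrite ?expeR_ge0// lee_expeR ?leeN2; exact: le_clock.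
Qed.

(** Duhamel's formula: the creation exponential is expanded by [clock_creation], the integrals are
    exchanged, and the Markov property is applied at each time [s]. *)
Lemma fk_perturbation u f t g x :
  measurable_fun setT u -> (forall y, 0 <= u y)%R ->
  measurable_fun setT f -> (forall y, 0 <= f y)%R ->
  measurable_fun setT g -> (forall y, 0 <= g y) -> (0 <= t)%R ->
  fk u f t g x = fk u zero_rate t g x +
    \int[time t]_s fk u zero_rate s (fun y => (f y)%:E * fk u f (t - s) g y) x.
Proof.
move=> mu' u0 mf f0 mg g0 t0.
have mz : measurable_fun setT zero_rate by [].
have z0 (y : 'rV[R]_n) : (0 <= zero_rate y)%R by [].
pose I w s := \int[time (t - s)]_r (f (x + w (s + r)))%R%:E.
(* The integrand at creation time [s]: killing over the whole of [[0, t]], creation only after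
   [s]. *)
pose Phi (p : measurableTypeR R * path) := (f (x + p.2 p.1)%R)%:E *
  (expeR (- clock u x p.2 t) * expeR (I p.2 p.1) * g (x + p.2 t)%R).
have mI : measurable_fun setT (fun p : measurableTypeR R * path => I p.2 p.1).
  apply: (measurable_clock (Z := (measurableTypeR R * path)%type) (X := fun=> x) (W := snd) (S := fst)
      (T := fun p => t - p.1)%R) => //.
  exact: measurable_funB.
have mpos : measurable_fun setT (fun p : measurableTypeR R * path => x + p.2 p.1)%R.
  by apply: (@measurable_position _ (measurableTypeR R * path)%type (fun=> x) snd fst).
have mpost : measurable_fun setT (fun p : measurableTypeR R * path => x + p.2 t)%R.
  by apply: (@measurable_position _ (measurableTypeR R * path)%type (fun=> x) snd (fun=> t)).
have mPhi : measurable_fun setT Phi.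
  apply: emeasurable_funM; first by apply/measurable_EFinP; exact: measurableT_comp mpos.
  apply: emeasurable_funM; last exact: measurableT_comp mpost.
  apply: emeasurable_funM; apply: (measurableT_comp (@measurable_expeR R)) => //.
  apply: measurableT_comp => //; by apply: (measurable_clock0 (Z := (measurableTypeR R * path)%type) (X := fun=> x) (W := snd) (T := fun=> t)).
have Phi0 p : 0 <= Phi p by rewrite !mule_ge0// ?lee_fin// expeR_ge0.
have step s : (0 <= s)%R -> (s <= t)%R -> \int[mu]_w Phi (s, w) =
    fk u zero_rate s (fun y => (f y)%:E * fk u f (t - s) g y) x.
  move=> s0 st; have ts : (0 <= t - s)%R by rewrite subr_ge0.
  rewrite (ge0_integral_markov (s := s) (x := x)
    (A := fun w => expeR (- clock u x w s) * (f (x + w s)%R)%:E)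
    (B := fun y w' => weight u f y w' (t - s) * g (y + w' (t - s))%R)) => //.
  - apply: eq_integral => w _; rewrite weight_zero_creation /fk muleA//.
  - exact: measurableT_comp mPhi (measurable_pair1 s).
  - by move=> y; exact: measurable_fk_integrand.
  - by move=> y w; rewrite mule_ge0// weight_ge0.
  - by move=> w; rewrite mule_ge0// ?expeR_ge0// lee_fin.
  move=> w w'; rewrite /Phi /= concat_le//.
  rewrite /I clock_concat_shift//.
  have -> : concat s w w' t = (w s + w' (t - s))%R.
    by rewrite -[X in concat s w w' X](subrKC s t) concat_add.
  have -> : clock u x (concat s w w') t = clock u x w s + clock u (x + w s) w' (t - s).
    by rewrite -[X in clock u x (concat s w w') X](subrKC s t) clock_concat.
  rewrite oppeD ?ge0_adde_def ?inE ?clock_ge0// expeRD addrA /weight -!muleA.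
  by rewrite [LHS]muleCA.
rewrite [in LHS]/fk.
transitivity (\int[mu]_w (weight u zero_rate x w t * g (x + w t)%R + \int[time t]_s Phi (s, w))).
  apply: eq_integral => w _; rewrite weight_zero_creation /weight.
  rewrite (clock_creation x w mf f0 t0).
  have mi : measurable_fun setT (fun s : measurableTypeR R => (f (x + w s)%R)%:E * expeR (I w s)).
    apply: emeasurable_funM; first by apply/measurable_EFinP; exact: measurable_along.
    by apply: (measurableT_comp (@measurable_expeR R)); exact: measurableT_comp mI (measurable_pair2 w).
  have i0 s : 0 <= (f (x + w s)%R)%:E * expeR (I w s) by rewrite mule_ge0 ?lee_fin// expeR_ge0.
  rewrite ge0_muleDr// ?integral_ge0// mule1 ge0_muleDl ?mule_ge0 ?expeR_ge0// ?integral_ge0//.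
  congr (_ + _); rewrite -ge0_integralZl// ?expeR_ge0//.
  rewrite muleC -ge0_integralZl//.
  - apply: eq_integral => s _; rewrite /Phi /= muleC [X in X * _]muleCA.
    by rewrite -muleA.
  - by apply: emeasurable_funM.
  - by move=> s _; rewrite mule_ge0// expeR_ge0.
rewrite ge0_integralD//; last 4 first.
- by move=> w _; rewrite mule_ge0// weight_ge0.
- exact: measurable_fk_integrand.
- by move=> w _; exact: integral_ge0.
- exact: (measurable_fun_fubini_tonelli_G Phi).
congr (_ + _).
transitivity (\int[time t]_s \int[mu]_w Phi (s, w)).
  by apply/esym; exact: fubini_tonelli.
apply: eq_time.
- exact: (measurable_fun_fubini_tonelli_F Phi).
- rewrite (_ : (fun s : measurableTypeR R => _) = fun s : measurableTypeR R =>
     \int[mu]_w (weight u zero_rate x w s * ((f (x + w s)%R)%:E * fk u f (t - s) g (x + w s)%R)))//.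
  apply: (measurable_fun_fubini_tonelli_F (fun p : measurableTypeR R * path =>
     weight u zero_rate x p.2 p.1 * ((f (x + p.2 p.1)%R)%:E * fk u f (t - p.1) g (x + p.2 p.1)%R))).
    apply: emeasurable_funM.
      by apply: (@measurable_weight _ (measurableTypeR R * path)%type _ _ (fun=> x) snd fst).
    apply: emeasurable_funM; first by apply/measurable_EFinP; exact: measurableT_comp mpos.
    apply: measurable_fk => //.
    by apply: measurable_funB => //; exact: measurable_fst.
  move=> p; apply: mule_ge0; first exact: weight_ge0.
  by apply: mule_ge0; [rewrite lee_fin|exact: fk_ge0].
- by move=> s; exact: integral_ge0.
- by move=> s; apply: fk_ge0 => y; apply: mule_ge0; [rewrite lee_fin|exact: fk_ge0].
- by move=> s s0 st; exact: step.
Qed.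

End feynman_kac_functional.

(** * Products of finite measures *)

Section finite_product.
Context d1 d2 (T1 : measurableType d1) (T2 : measurableType d2) (R : realType).
Variables (m1 : {finite_measure set T1 -> \bar R}) (m2 : {finite_measure set T2 -> \bar R}).

Definition finite_prod : set (T1 * T2)%type -> \bar R := (m1 \x m2)%E.

HB.instance Definition _ := Measure.on finite_prod.

Let finite_prod_fin : fin_num_fun finite_prod.
Proof.
move=> U mU; rewrite ge0_fin_numE//; apply: (@le_lt_trans _ _ (finite_prod setT)).
  by apply: le_measure; rewrite ?inE.
rewrite -setXTT /finite_prod product_measure1E// lte_mul_pinfty ?fin_num_measure//.
by rewrite ltey_eq fin_num_measure.
Qed.

HB.instance Definition _ := Measure_isFinite.Build _ _ _ finite_prod finite_prod_fin.

Lemma Rintegral_prod1 (F : T1 * T2 -> R) : bmeas F ->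
  bmeas (fun x => \int[m2]_y F (x, y))%R /\
  (\int[finite_prod]_p F p = \int[m1]_x \int[m2]_y F (x, y))%R.
Proof.
move=> bF; have iF := bmeas_integrable finite_prod bF.
have [M M0 FM] := bmeas_bound bF.
have bFx x : bmeas (fun y => F (x, y)).
  by apply: bmeas_comp bF; exact: measurable_pair1.
have FE x : (\int[m2]_y F (x, y))%R%:E = (\int[m2]_y (F (x, y))%:E)%E.
  by rewrite EFin_Rintegral_bmeas.
have b1 : bmeas (fun x => \int[m2]_y F (x, y))%R.
  split; last by exists (M * fine (m2 setT)) => x; exact: Rintegral_bmeas_bound.
  by apply: measurableT_comp => //; exact: (measurable_fubini_F iF).
split => //; rewrite /Rintegral; congr fine.
rewrite -(fubini1 iF)//; apply: eq_integral => x _.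
by rewrite /fubini_F -FE.
Qed.

Lemma Rintegral_prod2 (F : T1 * T2 -> R) : bmeas F ->
  bmeas (fun y => \int[m1]_x F (x, y))%R /\
  (\int[finite_prod]_p F p = \int[m2]_y \int[m1]_x F (x, y))%R.
Proof.
move=> bF; have iF := bmeas_integrable finite_prod bF.
have [M M0 FM] := bmeas_bound bF.
have bFx y : bmeas (fun x => F (x, y)).
  by apply: bmeas_comp bF; exact: measurable_pair2.
have FE y : (\int[m1]_x F (x, y))%R%:E = (\int[m1]_x (F (x, y))%:E)%E.
  by rewrite EFin_Rintegral_bmeas.
have b1 : bmeas (fun y => \int[m1]_x F (x, y))%R.
  split; last by exists (M * fine (m1 setT)) => x; exact: Rintegral_bmeas_bound.
  by apply: measurableT_comp => //; exact: (measurable_fubini_G iF).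
split => //; rewrite /Rintegral; congr fine.
rewrite -(fubini2 iF)//; apply: eq_integral => x _.
by rewrite /fubini_G -FE.
Qed.

End finite_product.

(** * Dynkin's formula for cosines *)

Section trigonometric_dynkin.
Context {R : realType} {n : nat}.
Local Notation path := (path R n).
Implicit Types (x y xi : 'rV[R]_n) (w : path) (s t th : R).
Variable mu : probability path R.
Hypothesis muL : levy_law mu.
Variable eta : 'rV[R]_n -> R.
Hypothesis char : forall t xi th, 0 <= t ->
  (\int[mu]_w cos (dot xi (w t) + th) = expR (t * eta xi) * cos th)%R.

(** Adding a bound for [Psi] reduces to the nonnegative case. *)
Lemma Rintegral_concat s (Psi : path -> R) : 0 <= s -> bmeas Psi ->
  (\int[mu]_w Psi w = \int[mu]_w \int[mu]_w' Psi (concat s w w'))%R.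
Proof.
move=> s0 bP; have [M M0 PM] := bmeas_bound bP.
have bM := @bmeas_cst _ path R M.
have bc : bmeas (fun p : (path * path)%type => Psi (concat s p.1 p.2)).
  by apply: bmeas_comp bP; exact: measurable_concat.
have bcw w : bmeas (fun w' => Psi (concat s w w')).
  exact: (bmeas_comp (measurable_pair1 w) bc).
have [bi _] := Rintegral_prod1 mu mu bc.
have muT : fine (mu setT) = 1 by rewrite probability_setT.
have ge0 w : (0 <= (Psi w + M)%:E)%E.
  by rewrite lee_fin; have := PM w; rewrite ler_norml => /andP[+ _]; lra.
have mP : measurable_fun setT (fun w => (Psi w + M)%:E).
  by apply/measurable_EFinP; apply: measurable_funD => //; exact: bP.1.
have := ge0_integral_concat muL s0 mP ge0.
under [RHS]eq_integral.
  move=> w _; rewrite -EFin_Rintegral_bmeas; last exact: bmeasD.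
  rewrite RintegralD_bmeas// Rintegral_bmeas_cst muT mulr1; over.
rewrite -!EFin_Rintegral_bmeas; [|exact: bmeasD|exact: bmeasD].
rewrite !RintegralD_bmeas// Rintegral_bmeas_cst => -[]; exact: addIr.
Qed.

Lemma rclock_concat_le u x s w w' : bmeas u -> (forall y, 0 <= u y) -> 0 <= s ->
  rclock u x (concat s w w') s = rclock u x w s.
Proof.
move=> bu u0 s0; apply: EFin_inj; rewrite !rclockE// clock_concat_le//; exact: bu.1.
Qed.

Section setting.
Variables (u : 'rV[R]_n -> R) (a t : R) (x : 'rV[R]_n).
Hypotheses (bu : bmeas u) (u0 : forall y, 0 <= u y) (t0 : 0 <= t).

(** [a] is a constant creation rate: the net killing rate [u - a] is the [q] of [rough_dynkin]. In
    [fkw2] the indicator keeps the weight bounded at all times. *)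
Definition fkw1 w : R := expR (a * t - rclock u x w t).

Definition fkw2 (p : measurableTypeR R * path) : R :=
  \1_(`[0, t]%classic : set R) p.1 * expR (a * p.1 - rclock u x p.2 p.1).

Definition fkY1 w := x + w t.

Definition fkY2 (p : measurableTypeR R * path) := x + p.2 p.1.

Lemma rclock_ge0 w s : 0 <= rclock u x w s.
Proof. by apply: Rintegral_ge0 => r _. Qed.

Lemma measurable_rclock_joint :
  measurable_fun setT (fun p : measurableTypeR R * path => rclock u x p.2 p.1).
Proof.
apply: measurableT_comp => //.
by apply: (@measurable_clock0 R n _ (measurableTypeR R * path)%type u (fun=> x) snd fst) => //; exact: bu.1.
Qed.

Lemma bmeas_fkw1 : bmeas fkw1.
Proof.
split.
  apply: measurableT_comp => //; apply: measurable_funB => //.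
  exact: (measurableT_comp measurable_rclock_joint (measurable_pair1 (t : measurableTypeR R))).
exists (expR (a * t)) => w; rewrite ger0_norm ?expR_ge0// ler_expR lerBlDr lerDl.
exact: rclock_ge0.
Qed.

Lemma bmeas_fkw2 : bmeas fkw2.
Proof.
split.
  apply: measurable_funM.
    apply: (measurableT_comp _ measurable_fst).
    exact: (measurable_indic (measurable_itv `[0, t])).
  apply: measurableT_comp => //; apply: measurable_funB; last exact: measurable_rclock_joint.
  by apply: measurable_funM => //; exact: measurable_fst.
exists (expR (`|a| * t)) => -[s w]; rewrite /fkw2/= indicE.
case: (boolP (s \in _)) => [|_]; last by rewrite mul0r normr0 expR_ge0.
rewrite inE/= in_itv/= => /andP[s0 st]; rewrite mul1r ger0_norm ?expR_ge0// ler_expR.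
rewrite (@le_trans _ _ (a * s))//; first by rewrite lerBlDr lerDl rclock_ge0.
by rewrite (le_trans (ler_norm _))// normrM (ger0_norm s0) ler_wpM2l.
Qed.

Lemma measurable_fkY1 : measurable_fun setT fkY1.
Proof. by apply: (@measurable_position R n _ path (fun=> x) id (fun=> t)). Qed.

Lemma measurable_fkY2 : measurable_fun setT fkY2.
Proof. by apply: (@measurable_position R n _ (measurableTypeR R * path)%type (fun=> x) snd fst). Qed.

(* Conditioning on the path up to time [s] turns [cos (xi X_t)] into
   [expR ((t - s) eta) cos (xi X_s)]. *)
Lemma trig_fk xi th :
  wint mu fkw1 fkY1 (fun y => cos (dot xi y + th)) =
  cos (dot xi x + th) + wint (finite_prod (time t) mu) fkw2 fkY2
    (fun y => (eta xi - (u y - a)) * cos (dot xi y + th)).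
Proof.
set c := fun y : 'rV[R]_n => cos (dot xi y + th).
have bc : bmeas c by exact: bmeas_cos.
have bcY1 : bmeas (fun w => c (fkY1 w)) by apply: bmeas_comp bc; exact: measurable_fkY1.
pose e := eta xi + a.
pose E w s : R := \1_(`[0, t]%classic : set R) s * ((e - u (x + w s)) * expR (e * s - rclock u x w s)).
have EE w : bmeas (E w : measurableTypeR R -> R) /\ (\int[time t]_s E w s = expR (e * t - rclock u x w t) - 1)%R.
  exact: expR_rclock.
(* The double integral of [G] is computed in both orders: over [w] first, the Markov property at [s]
   gives the integral [wint] over time; over [s] first, [expR_rclock] gives the two boundary
   terms. *)
pose G (p : measurableTypeR R * path) : R :=
  expR (- (eta xi * t)) * (E p.2 p.1 * c (fkY1 p.2)).
have bE : bmeas (fun p : measurableTypeR R * path => E p.2 p.1).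
  rewrite (_ : (fun p => _) = fun p : measurableTypeR R * path =>
     (\1_(`[0, t]%classic : set R) p.1 * expR (eta xi * p.1)) * ((e - u (fkY2 p)) * fkw2 p)); last first.
    apply/funext => -[s w]; rewrite /E /fkw2 /fkY2/= indicE.
    case: (boolP (s \in _)) => _; last by rewrite !mul0r.
    rewrite !mul1r mulrCA -expRD; congr (_ * expR _); rewrite /e; ring.
  apply: bmeasM; last first.
    apply: bmeasM; last exact: bmeas_fkw2.
    by apply: bmeasB; [exact: bmeas_cst|apply: bmeas_comp bu; exact: measurable_fkY2].
  suff b0 : bmeas (fun s : measurableTypeR R => \1_(`[0, t]%classic : set R) s * expR (eta xi * s)).
    exact: (bmeas_comp measurable_fst b0).
  split.
    apply: measurable_funM; first exact: (measurable_indic (measurable_itv `[0, t])).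
    by apply: measurableT_comp => //; apply: measurable_funM.
  exists (expR (`|eta xi| * t)) => s; rewrite indicE.
  case: (boolP (s \in _)) => [|_]; last by rewrite mul0r normr0 expR_ge0.
  rewrite inE/= in_itv/= => /andP[s0 st]; rewrite mul1r ger0_norm ?expR_ge0// ler_expR.
  by rewrite (le_trans (ler_norm _))// normrM (ger0_norm s0) ler_wpM2l.
have bG : bmeas G.
  apply: bmeasZ; apply: bmeasM => //.
  by apply: (bmeas_comp _ bcY1); exact: measurable_snd.
have -> : wint (finite_prod (time t) mu) fkw2 fkY2 (fun y => (eta xi - (u y - a)) * c y) =
    (\int[finite_prod (time t) mu]_p G p)%R.
  have bF : bmeas (fun p => fkw2 p * ((eta xi - (u (fkY2 p) - a)) * c (fkY2 p))).
    apply: bmeasM; first exact: bmeas_fkw2.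
    apply: bmeasM; last by apply: bmeas_comp bc; exact: measurable_fkY2.
    apply: bmeasB; first exact: bmeas_cst.
    apply: bmeasB; last exact: bmeas_cst.
    by apply: bmeas_comp bu; exact: measurable_fkY2.
  rewrite /wint (Rintegral_prod1 _ _ bF).2 (Rintegral_prod1 _ _ bG).2.
  apply: eq_Rintegral => s _ /=.
  have [/andP[s0 st]|sI] := boolP ((0 <= s) && (s <= t)); last first.
    have z : \1_(`[0, t]%classic : set R) s = 0 :> R.
      by rewrite indicE memNset//= in_itv/=; exact/negP.
    rewrite /fkw2 /G /E/= z.
    by apply: eq_Rintegral => w _; rewrite !mul0r mulr0.
  have z : \1_(`[0, t]%classic : set R) s = 1 :> R by rewrite indicE mem_set//= in_itv/= s0.
  have bGs : bmeas (fun w => G (s, w)) by apply: (bmeas_comp _ bG); exact: measurable_pair1.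
  rewrite [RHS](Rintegral_concat s0 bGs).
  apply: eq_Rintegral => w _.
  have ts : 0 <= t - s by rewrite subr_ge0.
  have cw w' : concat s w w' t = w s + w' (t - s).
    by rewrite -[X in concat s w w' X](subrKC s t) concat_add.
  transitivity (\int[mu]_w' (expR (- (eta xi * t)) * ((e - u (x + w s)) * expR (e * s - rclock u x w s)) *
      cos (dot xi (w' (t - s)) + (dot xi (x + w s) + th))))%R; last first.
    apply: eq_Rintegral => w' _; rewrite /G /E /= z mul1r concat_le// rclock_concat_le// -mulrA.
    congr (_ * (_ * _)); rewrite /c /fkY1 cw !dotDr; congr cos; ring.
  rewrite RintegralZ_bmeas; last first.
    exact: (bmeas_comp (@measurable_path_eval R n (t - s)) (bmeas_cos xi (dot xi (x + w s) + th))).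
  rewrite char// /fkw2 /= z mul1r /fkY2/= /c -/(c _).
  have -> : expR (e * s - rclock u x w s) = expR (eta xi * s) * expR (a * s - rclock u x w s).
    by rewrite -expRD; congr expR; rewrite /e; ring.
  have -> : expR (- (eta xi * t)) = expR (- (eta xi * s)) * expR (- ((t - s) * eta xi)).
    by rewrite -expRD; congr expR; ring.
  have h1 : expR (- (eta xi * s)) * expR (eta xi * s) = 1 by rewrite -expRD addNr expR0.
  have h2 : expR (- ((t - s) * eta xi)) * expR ((t - s) * eta xi) = 1 by rewrite -expRD addNr expR0.
  set C := c _; set A1 := expR (- (eta xi * s)) in h1 *; set A2 := expR (eta xi * s) in h1 *.
  set B1 := expR (- ((t - s) * eta xi)) in h2 *; set B2 := expR ((t - s) * eta xi) in h2 *.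
  set D := expR (a * s - _); set U := u _.
  transitivity ((A1 * A2) * (B1 * B2) * (D * ((e - U) * C))); last by ring.
  by rewrite h1 h2 !mul1r /e; congr (_ * (_ * _)); ring.
rewrite (Rintegral_prod2 _ _ bG).2.
have bw1 := bmeas_fkw1.
have bA : bmeas (fun w => fkw1 w * c (fkY1 w)) by exact: bmeasM.
have -> : (\int[mu]_w \int[time t]_s G (s, w))%R =
    (\int[mu]_w (fkw1 w * c (fkY1 w) - expR (- (eta xi * t)) * c (fkY1 w)))%R.
  apply: eq_Rintegral => w _; rewrite /G/=.
  under eq_Rintegral do rewrite (mulrC (E w _)) mulrA.
  rewrite RintegralZ_bmeas; last exact: (EE w).1.
  rewrite (EE w).2 mulrBr mulr1; congr (_ - _).
  rewrite mulrAC -expRD mulrC [RHS]mulrC; congr (_ * expR _); rewrite /e; ring.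
rewrite RintegralB_bmeas//; last exact: bmeasZ.
rewrite RintegralZ_bmeas//.
have -> : (\int[mu]_w c (fkY1 w))%R = expR (t * eta xi) * c x.
  rewrite /c -char//; apply: eq_Rintegral => w _.
  by rewrite /fkY1 dotDr; congr cos; ring.
rewrite mulrA -expRD [X in expR X](_ : _ = 0); last by ring.
by rewrite expR0 mul1r /wint addrC subrK.
Qed.

End setting.
End trigonometric_dynkin.

(** * Dynkin inequalities for the smoothed density and the bump *)

Section dynkin_inequalities.
Context {R : realType} {n : nat}.
Local Notation path := (path R n).
Local Notation leb := (@lebesgue_rV R n).
Implicit Types (u : 'rV[R]_n -> R) (x y v xi : 'rV[R]_n) (w : path) (s t th : R).
Variable mu : probability path R.
Hypothesis muL : levy_law mu.
Variables (A : 'M[R]_n) (nu : 'rV[R]_n -> R).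
Hypothesis J : jump_density nu.
Hypothesis char : forall t xi th, 0 <= t ->
  (\int[mu]_w cos (dot xi (w t) + th) = expR (t * exponent A nu xi) * cos th)%R.
Local Notation tame := (tame nu).
Local Notation fk := (fk mu).
Local Notation zero_rate := (@zero_rate R n).

Lemma fkw1E u a t x (g : 'rV[R]_n -> R) : bmeas u -> (forall y, 0 <= u y) -> 0 <= t ->
  bmeas g -> (forall y, 0 <= g y) ->
  ((wint mu (fkw1 u a t x) (fkY1 t x) g)%:E =
   (expR (a * t))%:E * fk u zero_rate t (EFin \o g) x)%E.
Proof.
move=> bu u0 t0 bg g0; have mu' := bu.1.
have mz : measurable_fun setT zero_rate by [].
rewrite /wint EFin_Rintegral_bmeas; last first.
  by apply: bmeasM; [exact: bmeas_fkw1|apply: bmeas_comp bg; exact: measurable_fkY1].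
rewrite /fk -ge0_integralZl//; last first.
- by move=> w _; rewrite mule_ge0 ?weight_ge0 ?lee_fin.
- by apply: measurable_fk_integrand => //; apply/measurable_EFinP; exact: bg.1.
apply: eq_integral => w _; rewrite weight_zero_creation -rclockE//= -!EFinM mulrA.
by rewrite /fkw1 expRD.
Qed.

Lemma fkw2E u a t x (g : 'rV[R]_n -> R) : bmeas u -> (forall y, 0 <= u y) -> 0 <= t ->
  bmeas g -> (forall y, 0 <= g y) ->
  ((wint (finite_prod (time t) mu) (fkw2 u a t x) (fkY2 x) g)%:E =
   \int[time t]_s ((expR (a * s))%:E * fk u zero_rate s (EFin \o g) x))%E.
Proof.
move=> bu u0 t0 bg g0; have mu' := bu.1.
have mz : measurable_fun setT zero_rate by [].
have mg : measurable_fun setT (EFin \o g) by apply/measurable_EFinP; exact: bg.1.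
have bF : bmeas (fun p => fkw2 u a t x p * g (fkY2 x p)).
  by apply: bmeasM; [exact: bmeas_fkw2|apply: bmeas_comp bg; exact: measurable_fkY2].
have F0 p : (0 <= (fkw2 u a t x p * g (fkY2 x p))%:E)%E.
  by rewrite lee_fin !mulr_ge0// expR_ge0.
have mF : measurable_fun setT (fun p => (fkw2 u a t x p * g (fkY2 x p))%:E).
  by apply/measurable_EFinP; exact: bF.1.
rewrite /wint EFin_Rintegral_bmeas// /finite_prod.
rewrite (fubini_tonelli1 (fun p => (fkw2 u a t x p * g (fkY2 x p))%:E))//.
apply: eq_time.
- exact: (measurable_fun_fubini_tonelli_F (fun p => (fkw2 u a t x p * g (fkY2 x p))%:E)).
- apply: emeasurable_funM.
    by apply/measurable_EFinP; apply: measurableT_comp => //; exact: measurable_funM.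
  apply: (@measurable_fk R n mu _ (measurableTypeR R) u zero_rate (EFin \o g) (fun=> x) id) => //.
- by move=> s; exact: integral_ge0.
- by move=> s; rewrite mule_ge0 ?lee_fin ?expR_ge0// fk_ge0// => y; rewrite lee_fin.
move=> s s0 st; rewrite /fk -ge0_integralZl//; last first.
- by move=> w _; rewrite mule_ge0 ?weight_ge0 ?lee_fin.
- exact: measurable_fk_integrand.
apply: eq_integral => w _; rewrite weight_zero_creation -rclockE//= -!EFinM mulrA.
by rewrite /fkw2 /= indicE mem_set/= ?in_itv/= ?s0// mul1r expRD.
Qed.

Lemma fk_rough_dynkin u a t x (B G H : 'rV[R]_n -> R) (e r0 : R) :
  bmeas u -> (forall y, 0 <= u y) -> 0 <= t -> lint B -> bmeas B -> lint G -> 0 < e ->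
  (forall s v, 0 < s -> s <= e -> generator_approx A nu s B v <= G v) ->
  (forall c, 0 < c -> exists2 r, 0 < r &
    forall v y, enorm (v - y) < r -> `|B v - B y| <= c) ->
  bmeas H -> 0 < r0 -> (forall v y, enorm (v - y) < r0 -> G v <= H y) ->
  wint mu (fkw1 u a t x) (fkY1 t x) B +
    wint (finite_prod (time t) mu) (fkw2 u a t x) (fkY2 x) (fun y => (u y - a) * B y) <=
  B x + wint (finite_prod (time t) mu) (fkw2 u a t x) (fkY2 x) H.
Proof.
move=> bu u0 t0 lB bB lG e0 BG uB bH r00 GH.
apply: (@rough_dynkin R n A nu (jd_meas J) (jd_ge0 J) (jd_lty J) _ _ _ _ _ _ _ _ _ _ _
  _ _ _ _ _ _ _ _ _ B G H e r0) => //.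
- exact: bmeas_fkw1.
- by move=> w; exact: expR_ge0.
- exact: measurable_fkY1.
- exact: bmeas_fkw2.
- by move=> p; rewrite mulr_ge0// expR_ge0.
- exact: measurable_fkY2.
- by apply: bmeasB => //; exact: bmeas_cst.
- by move=> xi th; apply: trig_fk.
Qed.

(** The generator of [h] is at most [K * h], so the discount [exp (- K t)] leaves two nonnegative
    terms in Dynkin's inequality, terminal value and killing; each alone is at most [h x]. *)
Lemma fk_smooth_tame : exists2 K : R, 0 <= K & forall u t x, bmeas u -> (forall y, 0 <= u y) -> 0 <= t ->
  ((expR (- K * t))%:E * fk u zero_rate t (EFin \o smooth_tame nu) x <= (smooth_tame nu x)%:E)%E /\
  (\int[time t]_s ((expR (- K * s))%:E * fk u zero_rate s (fun y => (u y * smooth_tame nu y)%:E) x) <=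
   (smooth_tame nu x)%:E)%E.
Proof.
have [K1 K10 gen] := smooth_tame_generator A J.
have [C C0 cmp] := tame_cmp J.
have [c [C' [c0 C'0 hc]]] := smooth_tame_cmp J.
have [L L0 hL] := smooth_tame_lip J.
pose h := smooth_tame nu; have h0 y : 0 <= h y by exact/ltW/smooth_tame_gt0.
have bh : bmeas h by exact: bmeas_smooth_tame.
(* Gives [K1 * tame v <= K1 * C * tame y <= K * h y] for [v] near [y]. *)
pose K := K1 * C / c; have K0 : 0 <= K by rewrite divr_ge0 ?mulr_ge0// ltW.
exists K => // u t x bu u0 t0.
have t1 : 0 < 1 / 4 :> R by rewrite divr_gt0.
have buh : bmeas (fun y => u y * h y) by exact: bmeasM.
have ineq : wint mu (fkw1 u (- K) t x) (fkY1 t x) h +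
    wint (finite_prod (time t) mu) (fkw2 u (- K) t x) (fkY2 x) (fun y => u y * h y) <= h x.
  have := @fk_rough_dynkin u (- K) t x h (fun y => K1 * tame y) (fun y => K * h y) (1 / 4) 1
    bu u0 t0 (lint_smooth_tame J) bh (lintZ _ (lint_tame J)) t1.
  have -> : wint (finite_prod (time t) mu) (fkw2 u (- K) t x) (fkY2 x) (fun y => (u y - - K) * h y) =
    wint (finite_prod (time t) mu) (fkw2 u (- K) t x) (fkY2 x) (fun y => u y * h y) +
    wint (finite_prod (time t) mu) (fkw2 u (- K) t x) (fkY2 x) (fun y => K * h y).
    rewrite -wintD//.
    - by congr wint; apply/funext => y; ring.
    - exact: bmeas_fkw2.
    - exact: measurable_fkY2.
    - exact: bmeasZ.
  rewrite addrA lerD2r; apply.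
  - by move=> e v e0 e4; exact: gen.
  - move=> e e0; have L10 : 0 < L + 1 by rewrite ltr_wpDl.
    exists (e / (L + 1)); first by rewrite divr_gt0.
    move=> v y; rewrite ltr_pdivlMr// => vy; apply: le_trans (hL v y) _.
    by apply: le_trans (ltW vy); rewrite mulrC ler_wpM2l ?enorm_ge0// lerDl.
  - exact: bmeasZ.
  - by [].
  move=> v y vy; rewrite /K -!mulrA ler_pM2l//.
  apply: (@le_trans _ _ (C * tame y)).
    by apply: cmp; [have := enorm_lerB v y|have := enorm_lerB y v; rewrite enormB]; lra.
  by rewrite ler_pM2l// ler_pdivlMl//; have /andP[] := hc y.
have n1 : 0 <= wint mu (fkw1 u (- K) t x) (fkY1 t x) h.
  by apply: wint_ge0 => // w; exact: expR_ge0.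
have n2 : 0 <= wint (finite_prod (time t) mu) (fkw2 u (- K) t x) (fkY2 x) (fun y => u y * h y).
  by apply: wint_ge0 => [p|y]; rewrite mulr_ge0// expR_ge0.
split.
  by rewrite -fkw1E// lee_fin; apply: le_trans ineq; rewrite lerDl.
have := @fkw2E u (- K) t x (fun y => u y * h y) bu u0 t0 buh.
by rewrite /comp => <-; [rewrite lee_fin; apply: le_trans ineq; rewrite lerDr|move=> y; rewrite mulr_ge0].
Qed.

(** Dynkin's inequality for [- chi]. Where [u <= b], the rate [b + lam] outweighs killing and the
    negative part of the generator: this is the fourth item. With [a = 0], the positive part of the
    generator gives the potential of [tame] in the fifth, at the cost of terms supported in the unit
    ball. *)
Lemma fk_bump : exists chi : 'rV[R]_n -> R, exists a0 lam c C : R,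
  [/\ [/\ 0 < a0, 0 <= lam, 0 < c & 0 <= C],
      bmeas chi /\ (forall y, 0 <= chi y <= 2 * \1_(eball 0 1) y),
      (forall y, enorm y < 1 / 2 -> a0 <= chi y),
      (forall u (b : R) t x v, bmeas u -> (forall y, 0 <= u y) -> 0 <= t ->
        (forall y, enorm (y - v) < 1 -> u y <= b) ->
        ((chi (x - v))%:E <= (expR ((b + lam) * t))%:E *
          fk u zero_rate t (fun y => (chi (y - v))%:E) x)%E) &
      (forall u t x, bmeas u -> (forall y, 0 <= u y) -> 0 <= t ->
        (c%:E * \int[time t]_s fk u zero_rate s (EFin \o tame) x <=
        fk u zero_rate t (fun y => (2 * \1_(eball 0%R 1) y)%:E) x +
        \int[time t]_s fk u zero_rate s (fun y => ((2 * u y + C) * \1_(eball 0%R 1) y)%:E) x)%E)].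
Proof.
have [chi [bchi lchi chi02 chi1 [chiL [a0 a00 chia] [c [C [e0 [c0 C0 e00 gen]]]]]]] := exists_subharmonic_bump A J.
have [Ct Ct0 cmp] := tame_cmp J.
have [M M0 tM] := tame_le J.
have chi_ge0 y : 0 <= chi y by have /andP[] := chi02 y.
have chi_le y : chi y <= 2 * \1_(eball 0 1) y.
  rewrite indicE; have [y1|y1] := ltP (enorm y) 1.
    by rewrite mem_set ?mulr1; [have /andP[] := chi02 y|rewrite /eball/= subr0].
  by rewrite chi1// mulr_ge0.
(* [G] bounds the generator of [- chi], and [H] bounds [G] on balls of radius [1 / 32]. The
   threshold [5 / 8 + 1 / 32 = 21 / 32] stays below [11 / 16], so [chi] is at least [a0] where [H]
   equals [C]. *)
pose H z := if enorm z < 21 / 32 then C else - (c / Ct * tame z).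
pose G z := if enorm z < 5 / 8 then C else - (c * tame z).
have mlt (r : R) : measurable_fun setT (fun z : 'rV[R]_n => enorm z < r).
  by apply: measurable_fun_ltr => //; exact: measurable_enorm.
have cCt : 0 <= c / Ct by rewrite divr_ge0 ?(ltW c0) ?(ltW Ct0).
have CM : 0 <= c / Ct * M by rewrite mulr_ge0// ltW.
have tame0 y : 0 <= c / Ct * tame y by rewrite mulr_ge0// ltW// tame_gt0.
have bH : bmeas H.
  split.
    apply: measurable_fun_ifT => //; apply: measurableT_comp => //.
    by apply: measurable_funM => //; exact: measurable_tame.
  exists (C + c / Ct * M) => z; have : 0 <= c / Ct * M by rewrite mulr_ge0// ltW.
  have : c / Ct * tame z <= c / Ct * M by rewrite ler_wpM2l.
  rewrite /H; case: ifPn => _; first by rewrite ger0_norm//; lra.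
  by rewrite normrN ger0_norm//; move: C0; lra.
have lG : lint G.
  have li : lint (\1_(eball (0 : 'rV[R]_n) 1) : _ -> R).
    by apply: lint_indic; [exact: measurable_eball|exact: lebesgue_eball_lty].
  apply: (le_lint _ _ (lintD (lintZ C li) (lintZ c (lint_tame J)))).
    apply: measurable_fun_ifT => //; apply: measurableT_comp => //.
    by apply: measurable_funM => //; exact: measurable_tame.
  move=> z1; have tz : 0 <= c * tame z1 by rewrite mulr_ge0 ?(ltW c0)// ltW// tame_gt0.
  rewrite /G; case: ifPn => [z5|_].
    rewrite ger0_norm// indicE mem_set ?mulr1; last by rewrite /eball/= subr0; lra.
    by rewrite lerDl.
  by rewrite normrN ger0_norm// ler_wpDl// mulr_ge0.
have lGv v : lint (fun y => G (y - v)).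
  by under eq_fun do rewrite addrC; exact: lint_translation.
have mB v : measurable_fun setT (fun y : 'rV[R]_n => y - v) by exact: measurable_rVB.
have bHv v : bmeas (fun y => H (y - v)) by exact: (bmeas_comp (mB v) bH).
have bchiv v : bmeas (fun y => chi (y - v)) by exact: (bmeas_comp (mB v) bchi).
have lchiv v : lint (fun y => chi (y - v)).
  by under eq_fun do rewrite addrC; exact: lint_translation.
have main u a t x v : bmeas u -> (forall y, 0 <= u y) -> 0 <= t ->
    chi (x - v) <= wint mu (fkw1 u a t x) (fkY1 t x) (fun y => chi (y - v)) +
    wint (finite_prod (time t) mu) (fkw2 u a t x) (fkY2 x)
      (fun y => (u y - a) * chi (y - v) + H (y - v)).
  move=> bu u0 t0.
  pose B y := - chi (y - v).
  have bB : bmeas B by exact: bmeasN.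
  have bq : bmeas (fun y => u y - a) by apply: bmeasB => //; exact: bmeas_cst.
  have := @fk_rough_dynkin u a t x B (fun y => G (y - v)) (fun y => H (y - v)) e0 (1 / 32)
    bu u0 t0 (lintN (lchiv v)) bB (lGv v) e00.
  have w1 : bmeas (fkw1 u a t x) by exact: bmeas_fkw1.
  have w2 : bmeas (fkw2 u a t x) by exact: bmeas_fkw2.
  have Y1 := @measurable_fkY1 R n t x; have Y2 := @measurable_fkY2 R n x.
  have -> : wint mu (fkw1 u a t x) (fkY1 t x) B = - wint mu (fkw1 u a t x) (fkY1 t x) (fun y => chi (y - v)).
    by rewrite -[RHS]mulN1r -wintZ//; congr wint; apply/funext => y; rewrite mulN1r.
  have -> : wint (finite_prod (time t) mu) (fkw2 u a t x) (fkY2 x) (fun y => (u y - a) * B y) =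
     - wint (finite_prod (time t) mu) (fkw2 u a t x) (fkY2 x) (fun y => (u y - a) * chi (y - v)).
    rewrite -[RHS]mulN1r -wintZ//; last exact: bmeasM.
    by congr wint; apply/funext => y; rewrite /B; ring.
  rewrite wintD//; last exact: bmeasM.
  move=> rd; suff : - wint mu (fkw1 u a t x) (fkY1 t x) (fun y => chi (y - v)) -
     wint (finite_prod (time t) mu) (fkw2 u a t x) (fkY2 x) (fun y => (u y - a) * chi (y - v)) <=
    B x + wint (finite_prod (time t) mu) (fkw2 u a t x) (fkY2 x) (fun y => H (y - v)).
    by rewrite /B; clear; move: (wint _ _ _ _) (wint _ _ _ _) (wint _ _ _ _) (chi _) => p1 p2 p3 p4; lra.
  apply: rd => //.
  - move=> e y e_gt0 ee.
    have -> : B = fun y => 0 + -1 * chi (y - v) by apply/funext => z; rewrite add0r mulN1r.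
    have b0 : bmeas (fun _ : 'rV[R]_n => 0 : R) by exact: bmeas_cst.
    rewrite (generator_approxD A J (-1) y e_gt0 b0 (bchiv v)).
    rewrite (generator_approx_translation A nu e chi y v) mulN1r.
    have -> : generator_approx A nu e (fun=> 0) y = 0.
      have := generator_approxD A J 1 y e_gt0 b0 b0; rewrite (_ : (fun _ => _) = fun=> 0).
        by rewrite mul1r => h; lra.
      by apply/funext => z; rewrite mulr0 addr0.
    rewrite add0r lerNl /G; have := gen e (y - v) e_gt0 ee.
    by case: ifP; rewrite ?opprK.
  - move=> r r0; exists (r / 8); first by rewrite divr_gt0.
    move=> y z; rewrite ltr_pdivlMr// => yz; rewrite /B opprK addrC.
    apply: le_trans (chiL (z - v) (y - v)) _.
    by rewrite opprB addrA subrK enormB mulrC ltW.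
  move=> y z yz; rewrite /G /H.
  have yzv : enorm (y - v - (z - v)) < 1 / 32 by rewrite opprB addrA subrK.
  have h1 := enorm_lerB (y - v) (z - v); have h2 := enorm_lerB (z - v) (y - v).
  rewrite [enorm (z - v - _)]enormB in h2.
  case: (ltP (enorm (y - v)) (5 / 8)) => hy; case: (ltP (enorm (z - v)) (21 / 32)) => hz //.
  - lra.
  - have : 0 <= c * tame (y - v) by rewrite mulr_ge0 ?(ltW c0)// ltW// tame_gt0.
    by move: C0; lra.
  - rewrite lerN2 -mulrA ler_pM2l// ler_pdivrMl//; apply: cmp; lra.
(* Then [C <= lam * chi] wherever [H] equals [C]. *)
pose lam := C / a0; have lam0 : 0 <= lam by rewrite divr_ge0// ltW.
exists chi, a0, lam, (c / Ct), (C + c / Ct * M); split.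
- split => //; first by rewrite divr_gt0.
  by rewrite addr_ge0.
- by split => // y; rewrite chi_ge0 chi_le.
- by move=> y y2; apply: chia; lra.
- move=> u b t x v bu u0 t0 ub.
  rewrite -(@fkw1E u (b + lam) t x (fun y => chi (y - v)))// lee_fin.
  apply: le_trans (main u (b + lam) t x v bu u0 t0) _; rewrite gerDl.
  have bF : bmeas (fun y => (u y - (b + lam)) * chi (y - v) + H (y - v)).
    apply: bmeasD => //; apply: bmeasM => //; apply: bmeasB => //; exact: bmeas_cst.
  have -> : 0 = wint (finite_prod (time t) mu) (fkw2 u (b + lam) t x) (fkY2 x) (fun=> 0 * 0).
    by rewrite wintZ ?mul0r//; [exact: bmeas_fkw2|exact: measurable_fkY2|exact: bmeas_cst].
  apply: le_wint => //.
  - exact: bmeas_fkw2.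
  - by move=> p; rewrite mulr_ge0// expR_ge0.
  - exact: measurable_fkY2.
  - exact: bmeas_cst.
  move=> y; rewrite mul0r; have [y1|y1] := ltP (enorm (y - v)) 1; last first.
    rewrite chi1// mulr0 add0r /H ifN ?oppr_le0//.
    by rewrite -leNgt; lra.
  have hu : (u y - (b + lam)) * chi (y - v) <= - lam * chi (y - v).
    by rewrite ler_wpM2r//; have := ub y y1; lra.
  have lc : 0 <= lam * chi (y - v) by rewrite mulr_ge0.
  have tz : 0 <= c / Ct * tame (y - v).
    by [].
  rewrite /H; case: ifPn => [y2|_]; last by lra.
  have : C <= lam * chi (y - v).
    by rewrite /lam mulrAC ler_pdivlMr// ler_wpM2l// chia//; lra.
  by lra.
move=> u t x bu u0 t0.
have w1 : bmeas (fkw1 u 0 t x) by exact: bmeas_fkw1.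
  have w2 : bmeas (fkw2 u 0 t x) by exact: bmeas_fkw2.
have Y1 := @measurable_fkY1 R n t x; have Y2 := @measurable_fkY2 R n x.
pose i1 y : R := \1_(eball (0 : 'rV[R]_n) 1) y.
have b1 : bmeas (i1 : 'rV[R]_n -> R) by apply: bmeas_indic; exact: measurable_eball.
have bt := bmeas_tame J.
have i10 y : 0 <= i1 y by rewrite /i1 indicE.
have bF : bmeas (fun y => (2 * u y + (C + c / Ct * M)) * i1 y).
  by apply: bmeasM => //; apply: bmeasD; [exact: bmeasZ|exact: bmeas_cst].
have F0 y : 0 <= (2 * u y + (C + c / Ct * M)) * i1 y.
  by rewrite mulr_ge0// addr_ge0 ?mulr_ge0// addr_ge0.
have E0 s : expR (0 * s) = 1 by rewrite mul0r expR0.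
have E1 := @fkw1E u 0 t x (fun y => 2 * i1 y) bu u0 t0 (bmeasZ 2 b1) (fun y => mulr_ge0 (ler0n _ 2) (i10 y)).
have E2 := @fkw2E u 0 t x tame bu u0 t0 bt (fun y => ltW (tame_gt0 J y)).
have E3 := @fkw2E u 0 t x _ bu u0 t0 bF F0.
rewrite E0 mul1e in E1.
have E0' (k : R -> \bar R) : (\int[time t]_s ((expR (0 * s))%:E * k s) = \int[time t]_s k s)%E.
  by apply: eq_integral => s _; rewrite E0 mul1e.
rewrite !E0' in E2 E3; rewrite -E2 -[X in (_ <= X + _)%E]E1 -E3 -EFinM -EFinD lee_fin.
have := main u 0 t x 0 bu u0 t0; rewrite subr0 => m.
have m1 : wint mu (fkw1 u 0 t x) (fkY1 t x) (fun y => chi (y - 0)) <=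
    wint mu (fkw1 u 0 t x) (fkY1 t x) (fun y => 2 * i1 y).
  apply: le_wint => //; [by move=> w; exact: expR_ge0|exact: bmeasZ|].
  by move=> y; rewrite subr0.
have m2 : wint (finite_prod (time t) mu) (fkw2 u 0 t x) (fkY2 x)
      (fun y => (u y - 0) * chi (y - 0) + H (y - 0)) <=
    wint (finite_prod (time t) mu) (fkw2 u 0 t x) (fkY2 x)
      (fun y => (2 * u y + (C + c / Ct * M)) * i1 y - c / Ct * tame y).
  apply: le_wint => //.
  - by move=> p; rewrite mulr_ge0// expR_ge0.
  - apply: bmeasD => //; apply: bmeasM => //.
    by apply: bmeasB => //; exact: bmeas_cst.
  - by apply: bmeasB => //; exact: bmeasZ.
  move=> y; rewrite !subr0.
  have h1 : u y * chi y <= u y * (2 * i1 y) by rewrite ler_wpM2l.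
  have cM : 0 <= c / Ct by rewrite divr_ge0// ltW.
  have ty : c / Ct * tame y <= c / Ct * M by rewrite ler_wpM2l.
  have h2 : H y <= (C + c / Ct * M) * i1 y - c / Ct * tame y.
    rewrite /H; case: ifPn => [y2|_].
      have -> : i1 y = 1 by rewrite /i1 indicE mem_set// /eball/= subr0; lra.
      by move: ty; lra.
    by rewrite lerBrDr addNr mulr_ge0// addr_ge0.
  by move: h1 h2; lra.
rewrite wintB// ?wintZ// in m2; last exact: bmeasZ.
have := chi_ge0 x; move: m m1 m2; clear.
move: (wint _ _ _ _) => p1; move: (wint _ _ _ _) => p2; move: (wint _ _ _ _) => p3.
move: (wint _ _ _ _) => p4; move: (wint _ _ _ _) => p5; lra.
Qed.

End dynkin_inequalities.

(** * Kato class creation rates *)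

Section gauge.
Context {R : realType} {n : nat}.
Local Notation path := (path R n).
Implicit Types (u f : 'rV[R]_n -> R) (g : 'rV[R]_n -> \bar R) (x y : 'rV[R]_n) (w : path) (s t : R).
Variable mu : probability path R.
Hypothesis muL : levy_law mu.
Local Open Scope ereal_scope.
Local Notation fk := (fk mu).
Local Notation zero_rate := (@zero_rate R n).
Local Notation one := (cst 1 : 'rV[R]_n -> \bar R).

(** Time 0 is a null set, and several bounds below hold at positive times only. *)
Lemma le_time_pos t (k l : measurableTypeR R -> \bar R) :
  measurable_fun setT k -> measurable_fun setT l ->
  (forall s, 0 <= k s) -> (forall s, 0 <= l s) ->
  (forall s, (0 < s)%R -> (s <= t)%R -> k s <= l s) ->
  \int[time t]_s k s <= \int[time t]_s l s.
Proof.
move=> mk ml k0 l0 kl.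
have m0 : measurable [set (0%R : measurableTypeR R)] by exact: measurable_set1.
pose k' (s : measurableTypeR R) := k s * (\1_(~` [set 0%R]) s)%:E.
have mk' : measurable_fun setT k'.
  apply: emeasurable_funM => //; apply/measurable_EFinP.
  by apply: measurable_indic; exact: measurableC.
have k'0 s : 0 <= k' s by rewrite mule_ge0// lee_fin indicE.
have -> : \int[time t]_s k s = \int[time t]_s k' s.
  apply: (ge0_integral_off_null m0) => //.
    apply/eqP; rewrite eq_le measure_ge0 andbT.
    have <- : lebesgue_measure [set (0%R : measurableTypeR R)] = 0 by exact: lebesgue_measure_set1.
    by rewrite /time/= /mfrestr /mrestr le_measure// inE//; exact: measurableI.
  by move=> s s0; rewrite /k' indicE mem_set ?mule1.
apply: le_time => // s s0 st; rewrite /k' indicE.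
have [->|sn] := eqVneq s 0%R; first by rewrite memNset ?mule0//=; exact.
by rewrite mem_set ?mule1; [apply: kl; rewrite // lt_neqAle eq_sym sn|exact/eqP].
Qed.

Lemma measurable_fk_dep u f (G : measurableTypeR R * 'rV[R]_n -> \bar R) x :
  measurable_fun setT u -> (forall y, 0 <= u y)%R ->
  measurable_fun setT f -> (forall y, 0 <= f y)%R ->
  measurable_fun setT G -> (forall p, 0 <= G p) ->
  measurable_fun setT (fun s : measurableTypeR R => fk u f s (fun y => G (s, y)) x).
Proof.
move=> mu' u0 mf f0 mG G0.
apply: (measurable_fun_fubini_tonelli_F (fun p : measurableTypeR R * path =>
  weight u f x p.2 p.1 * G (p.1, x + p.2 p.1)%R)).
  apply: emeasurable_funM.
    by apply: (@measurable_weight R n _ (measurableTypeR R * path)%type _ _ (fun=> x) snd fst).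
  apply: measurableT_comp => //; apply: measurable_fun_pair; first exact: measurable_fst.
  by apply: (@measurable_position R n _ (measurableTypeR R * path)%type (fun=> x) snd fst).
by move=> p; rewrite mule_ge0// weight_ge0.
Qed.

Lemma fkZ u f s (c : \bar R) g x : 
  measurable_fun setT u -> (forall y, 0 <= u y)%R ->
  measurable_fun setT f -> (forall y, 0 <= f y)%R ->
  measurable_fun setT g -> (forall y, 0 <= g y) -> 0 <= c ->
  fk u f s (fun y => c * g y) x = c * fk u f s g x.
Proof.
move=> mu' u0 mf f0 mg g0 c0; rewrite /fk -ge0_integralZl//.
- by apply: eq_integral => w _; rewrite muleCA.
- exact: measurable_fk_integrand.
- by move=> w _; rewrite mule_ge0 ?weight_ge0.
Qed.

Lemma fk_perturbation_le u f t g x (c : measurableTypeR R -> \bar R) f' :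
  measurable_fun setT u -> (forall y, 0 <= u y)%R ->
  measurable_fun setT f -> (forall y, 0 <= f y)%R ->
  measurable_fun setT g -> (forall y, 0 <= g y) -> (0 <= t)%R ->
  measurable_fun setT c -> (forall s, 0 <= c s) ->
  measurable_fun setT f' -> (forall y, 0 <= f' y)%R ->
  (forall s y, (0 < s)%R -> (s <= t)%R -> (f y)%:E * fk u f (t - s) g y <= c s * (f' y)%:E) ->
  fk u f t g x <= fk u zero_rate t g x +
    \int[time t]_s (c s * fk u zero_rate s (EFin \o f') x).
Proof.
move=> mu' u0 mf f0 mg g0 t0 mc c0 mf' f'0 H.
have mz : measurable_fun setT zero_rate by [].
have mEf' : measurable_fun setT (EFin \o f') by apply/measurable_EFinP.
have Ef'0 y : 0 <= (EFin \o f') y by rewrite lee_fin.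
rewrite fk_perturbation// leeD2l//.
have mG : measurable_fun setT (fun p : measurableTypeR R * 'rV[R]_n =>
    (f p.2)%:E * fk u f (t - p.1) g p.2).
  apply: emeasurable_funM; first by apply/measurable_EFinP; exact: measurableT_comp mf measurable_snd.
  apply: measurable_fk => //.
  by apply: measurable_funB => //; exact: measurable_fst.
have G0 y s : 0 <= (f y)%:E * fk u f (t - s) g y.
  by apply: mule_ge0; [rewrite lee_fin|exact: fk_ge0].
apply: le_time_pos.
- by apply: (measurable_fk_dep x mu' u0 mz _ mG) => [y|[s y]] //; exact: G0.
- apply: emeasurable_funM => //.
  exact: (@measurable_fk R n mu _ (measurableTypeR R) u zero_rate (EFin \o f') (fun=> x) id).
- by move=> s; exact: fk_ge0.
- by move=> s; rewrite mule_ge0// fk_ge0.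
move=> s s0 st; rewrite -fkZ//; apply: le_fk => //.
- apply: (measurableT_comp mG (measurable_pair1 (s : measurableTypeR R))).
- by apply: emeasurable_funM.
by move=> y; exact: H.
Qed.

Lemma fk_free s g x : fk zero_rate zero_rate s g x = \int[mu]_w g (x + w s)%R.
Proof.
by apply: eq_integral => w _; rewrite /weight !clock_zero oppe0 expeR0 !mul1e.
Qed.

Lemma integral_prob_cst (c : \bar R) : \int[mu]_w c = c.
Proof.
have := @integral_cst _ _ _ mu _ measurableT c; rewrite /cst => ->.
by rewrite [X in _ * X]probability_setT mule1.
Qed.

Lemma fk_free_one s x : fk zero_rate zero_rate s one x = 1.
Proof. by rewrite fk_free integral_prob_cst. Qed.

Lemma integral_time_fk_free f t x : measurable_fun setT f -> (forall y, 0 <= f y)%R ->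
  \int[time t]_s fk zero_rate zero_rate s (EFin \o f) x = \int[mu]_w clock f x w t.
Proof.
move=> mf f0; under eq_integral do rewrite fk_free.
apply: (@fubini_tonelli _ _ _ _ R (time t) mu (fun p : measurableTypeR R * path => (f (x + p.2 p.1)%R)%:E)).
  apply/measurable_EFinP; apply: measurableT_comp => //.
  by apply: (@measurable_position R n _ (measurableTypeR R * path)%type (fun=> x) snd fst).
by move=> p; rewrite lee_fin.
Qed.

Lemma fk_creation_le f t x (C : R) : measurable_fun setT f -> (forall y, 0 <= f y)%R ->
  (0 <= t)%R -> (0 <= C)%R ->
  (forall s y, (0 < s)%R -> (s <= t)%R -> fk zero_rate f (t - s) one y <= C%:E) ->
  fk zero_rate f t one x <= 1 + C%:E * \int[mu]_w clock f x w t.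
Proof.
move=> mf f0 t0 C0 H.
have := @fk_perturbation_le zero_rate f t one x (fun=> C%:E) f.
rewrite fk_free_one => h; apply: le_trans (h _ _ _ _ _ _ _ _ _ _ _ _) _ => //.
  by move=> s y s0 st; rewrite muleC lee_wpmul2r ?lee_fin ?H.
rewrite leeD2l// ge0_integralZl//.
- by rewrite integral_time_fk_free.
- apply: (@measurable_fk R n mu _ (measurableTypeR R) zero_rate zero_rate (EFin \o f) (fun=> x) id) => //.
  exact/measurable_EFinP.
- by move=> s _; apply: fk_ge0 => y; rewrite lee_fin.
Qed.

Lemma fk_creation_mono f s t x : measurable_fun setT f -> (forall y, 0 <= f y)%R ->
  (0 <= s)%R -> (s <= t)%R -> fk zero_rate f s one x <= fk zero_rate f t one x.
Proof.
move=> mf f0 s0 st; apply: ge0_le_integral.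
- by [].
- by move=> w _; rewrite mule_ge0 ?weight_ge0 ?lee01.
- exact: measurable_fk_integrand.
- exact: measurable_fk_integrand.
move=> w _; rewrite !weight_zero_killing lee_wpmul2r ?lee01// lee_expeR; exact: clock_mono.
Qed.

(** The supremum [S] over starting points is finite because [f] is bounded, and Duhamel's formula
    gives [S <= 1 + S / 2]. *)
Lemma khasminskii_bounded f t : bmeas f -> (forall y, 0 <= f y)%R -> (0 <= t)%R ->
  (forall x, \int[mu]_w clock f x w t <= (1 / 2)%:E) ->
  forall x, fk zero_rate f t one x <= 2%:E.
Proof.
move=> bf f0 t0 ft; have mf := bf.1; have [M M0 fM] := bmeas_bound bf.
pose S := ereal_sup (range (fk zero_rate f t one)).
have S1 x : fk zero_rate f t one x <= S by apply: ereal_sup_ubound; exists x.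
have S0 : 0 <= S by apply: le_trans (S1 0%R); exact: fk_ge0.
have Sfin : S <= (expR (M * t))%:E.
  apply: ge_ereal_sup => _ [x _ <-].
  apply: (@le_trans _ _ (\int[mu]_w (expR (M * t))%:E)); last first.
    by rewrite integral_prob_cst.
  apply: ge0_le_integral => //.
  - by move=> w _; rewrite mule_ge0// weight_ge0.
  - exact: measurable_fk_integrand.
  move=> w _; rewrite mule1 weight_zero_killing.
  apply: (@le_trans _ _ (expeR (M * t)%:E)); last by [].
  by rewrite lee_expeR clock_le_cst// => y; rewrite (le_trans _ (fM y))// ler_norm.
have [r Sr] : exists r : R, S = r%:E.
  by move: S0 Sfin; case: S S1 => //= r _ _ _; exists r.
have r0 : (0 <= r)%R by rewrite -lee_fin -Sr.
have : S <= (1 + r / 2)%:E.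
  apply: ge_ereal_sup => _ [x _ <-].
  apply: le_trans (fk_creation_le x mf f0 t0 r0 _) _.
    move=> s y s0 st; rewrite -Sr; apply: le_trans (S1 y).
    by apply: fk_creation_mono; rewrite ?subr_ge0 ?gerBl ?(ltW s0).
  rewrite EFinD leeD2l//; apply: le_trans (lee_wpmul2l _ (ft x)) _ => //.
  by rewrite -EFinM lee_fin mulrA mulr1.
rewrite Sr lee_fin => r2 x; apply: le_trans (S1 x) _; rewrite Sr lee_fin; lra.
Qed.

Lemma khasminskii f t : measurable_fun setT f -> (forall y, 0 <= f y)%R -> (0 <= t)%R ->
  (forall x, \int[mu]_w clock f x w t <= (1 / 2)%:E) ->
  forall x, fk zero_rate f t one x <= 2%:E.
Proof.
move=> mf f0 t0 ft x.
have fm0 m y : (0 <= truncate f m y)%R by exact: truncate_ge0.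
have mfm m : measurable_fun setT (truncate f m) by exact: measurable_truncate.
have H m : fk zero_rate (truncate f m) t one x <= 2%:E.
  apply: (khasminskii_bounded (bmeas_truncate m mf f0) (fm0 m) t0) => z.
  apply: le_trans (ft z); apply: ge0_le_integral => //.
  - by move=> w _; exact: clock_ge0.
  - by apply: (@measurable_clock0 R n _ path _ (fun=> z) id (fun=> t)).
  - by apply: (@measurable_clock0 R n _ path _ (fun=> z) id (fun=> t)).
  by move=> w _; apply: le_clock => // y; exact: truncate_le.
have cv : fk zero_rate (truncate f m) t one x @[m --> \oo] --> fk zero_rate f t one x.
  apply: (proj2 (@ge0_cvg_integral_nd _ _ R mu
    (fun m w => weight zero_rate (truncate f m) x w t * one (x + w t)%R)
    (fun w => weight zero_rate f x w t * one (x + w t)%R) _ _ _ _)).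
  - by move=> m; exact: measurable_fk_integrand.
  - by move=> m w; rewrite mule_ge0 ?weight_ge0 ?lee01.
  - move=> w m k mk; rewrite !weight_zero_killing lee_wpmul2r ?lee01// lee_expeR.
    by have [nd _] := clock_truncate x w t mf f0; exact: nd.
  move=> w; rewrite /cst mule1 weight_zero_killing.
  under eq_fun do rewrite mule1 weight_zero_killing.
  by have [nd cv] := clock_truncate x w t mf f0; exact: cvg_expeR_nd.
by have <- := cvg_lim _ cv => //; apply: lime_le => //; [apply/cvg_ex; eexists; exact: cv|exact: nearW].
Qed.

(** The semigroup property turns the bound 2 over time [t] into [2 ^+ k] over time [k * t]. *)
Lemma gauge f t : measurable_fun setT f -> (forall y, 0 <= f y)%R -> (0 < t)%R ->
  (forall x, \int[mu]_w clock f x w t <= (1 / 2)%:E) ->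
  forall T : R, exists2 C : R, (0 <= C)%R &
    forall s x, (0 <= s)%R -> (s <= T)%R -> fk zero_rate f s one x <= C%:E.
Proof.
move=> mf f0 t0 ft T.
have H (k : nat) x : fk zero_rate f (k%:R * t) one x <= (2 ^+ k)%:E.
  elim: k x => [|k ih] x.
    rewrite mul0r expr0; apply: le_trans (fk_creation_le x mf f0 (lexx _) (lexx 0%R) _) _.
      by move=> s y s0 st; move: (lt_le_trans s0 st); rewrite ltxx.
    by rewrite mul0e adde0.
  rewrite -natr1 mulrDl mul1r addrC fk_semigroup ?mulr_ge0 ?(ltW t0)//.
  apply: (@le_trans _ _ (fk zero_rate f t (fun y => (2 ^+ k)%:E * one y) x)).
    apply: le_fk => //; last by move=> y; rewrite mule1.
    - by apply: (@measurable_fk R n mu _ _ zero_rate f one id (fun=> (k%:R * t)%R)).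
    - by move=> y; exact: fk_ge0.
  rewrite fkZ ?lee_fin ?exprn_ge0// exprSr EFinM lee_pmul2l ?lte_fin ?exprn_gt0//.
  by apply: khasminskii => //; exact: ltW.
exists (2 ^+ (Num.truncn (T / t)).+1)%R => [|s x s0 sT]; first exact: exprn_ge0.
apply: le_trans (H _ x); apply: fk_creation_mono => //.
apply: le_trans sT _; rewrite -ler_pdivrMr//; exact/ltW/truncnS_gt.
Qed.

End gauge.

Lemma cvg_expeRN_nd (R : realType) (a : nat -> \bar R) l : nondecreasing_seq a ->
  a k @[k --> \oo] --> l -> expeR (- a k)%E @[k --> \oo] --> expeR (- l)%E.
Proof.
move=> nda al; have E : l = ereal_sup (range a).
  by apply: (cvg_unique _ al) => //; exact: ereal_nondecreasing_cvgn.
have -> : expeR (- l)%E = ereal_inf (range (fun k => expeR (- a k)%E)).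
  apply/eqP; rewrite eq_le; apply/andP; split.
    apply: le_ereal_inf_tmp => _ [k _ <-]; rewrite lee_expeR leeN2 E.
    by apply: ereal_sup_ubound; exists k.
  have s0 : (0 <= ereal_inf (range (fun k => expeR (- a k)%E)))%E.
    by apply: le_ereal_inf_tmp => _ [k _ <-]; exact: expeR_ge0.
  have [y yE] := expeR_total s0; rewrite -yE lee_expeR leeNr E.
  apply: ge_ereal_sup => _ [k _ <-]; rewrite leeNr -lee_expeR yE.
  by apply: ereal_inf_lbound; exists k.
by apply: ereal_nonincreasing_cvgn => k l' kl; rewrite lee_expeR leeN2; exact: nda.
Qed.

Lemma cvg_integral_dominated d (T : measurableType d) (R : realType)
    (m : {measure set T -> \bar R}) (k : nat -> T -> \bar R) k0 (F : T -> R) :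
  (forall i, measurable_fun setT (k i)) -> (forall i x, 0 <= k i x <= 1)%E ->
  (forall x, k i x @[i --> \oo] --> k0 x) ->
  measurable_fun setT F -> (forall x, 0 <= F x)%R -> (\int[m]_x (F x)%:E < +oo)%E ->
  (\int[m]_x (k i x * (F x)%:E) @[i --> \oo] --> \int[m]_x (k0 x * (F x)%:E))%E.
Proof.
move=> mk k01 kk mF F0 Foo; have mEF : measurable_fun setT (EFin \o F) by apply/measurable_EFinP.
apply: (@dominated_cvg _ _ _ m setT measurableT _ _ (EFin \o F)) => //.
- by move=> i; exact: emeasurable_funM.
- by move=> x _; exact: (cvgeZr _ (kk x)).
- apply/integrableP; split => //.
  by under eq_integral do rewrite /= ger0_norm//.
move=> i x _; have /andP[h0 h1] := k01 i x.
have F0' : (0 <= (F x)%:E)%E by rewrite lee_fin.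
by rewrite gee0_abs ?mule_ge0//; have := lee_wpmul2r F0' h1; rewrite mul1e.
Qed.

(** * Limits in the killing rate *)

Section killing_limits.
Context {R : realType} {n : nat}.
Local Notation path := (path R n).
Implicit Types (u f : 'rV[R]_n -> R) (g : 'rV[R]_n -> \bar R) (x y : 'rV[R]_n) (w : path) (s t : R).
Variable mu : probability path R.
Hypothesis muL : levy_law mu.
Local Open Scope ereal_scope.
Local Notation fk := (fk mu).
Local Notation zero_rate := (@zero_rate R n).

Lemma survival_bounds u x w t : (forall y, 0 <= u y)%R -> 0 <= expeR (- clock u x w t) <= 1.
Proof.
move=> u0; rewrite expeR_ge0/= -[leRHS](@expeR0 R) lee_expeR leeNl oppe0.
exact: clock_ge0.
Qed.

Lemma cvg_fk_killing (u : nat -> 'rV[R]_n -> R) (k0 : path -> \bar R) f x t :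
  (forall m, measurable_fun setT (u m)) -> (forall m y, 0 <= u m y)%R ->
  (forall w, expeR (- clock (u m) x w t) @[m --> \oo] --> k0 w) ->
  measurable_fun setT f -> (forall y, 0 <= f y)%R ->
  fk zero_rate zero_rate t (EFin \o f) x < +oo ->
  fk (u m) zero_rate t (EFin \o f) x @[m --> \oo] --> \int[mu]_w (k0 w * (f (x + w t)%R)%:E).
Proof.
move=> mU u0 uk mf f0 foo.
rewrite (_ : (fun m => _) = fun m => \int[mu]_w (expeR (- clock (u m) x w t) * (f (x + w t)%R)%:E)); last first.
  by apply/funext => m; apply: eq_integral => w _; rewrite weight_zero_creation.
apply: cvg_integral_dominated => //.
- move=> m; apply: (measurableT_comp (@measurable_expeR R)); apply: measurableT_comp => //.
  by apply: (@measurable_clock0 R n _ path _ (fun=> x) id (fun=> t)).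
- by move=> m w; exact: survival_bounds.
- by apply: measurableT_comp => //; exact: (@measurable_position R n _ path (fun=> x) id (fun=> t)).
by rewrite fk_free in foo.
Qed.

Lemma cvg_fk_truncate u f x t : measurable_fun setT u -> (forall y, 0 <= u y)%R ->
  measurable_fun setT f -> (forall y, 0 <= f y)%R ->
  fk zero_rate zero_rate t (EFin \o f) x < +oo ->
  fk (truncate u m) zero_rate t (EFin \o f) x @[m --> \oo] --> fk u zero_rate t (EFin \o f) x.
Proof.
move=> mU u0 mf f0 foo.
have -> : fk u zero_rate t (EFin \o f) x = \int[mu]_w (expeR (- clock u x w t) * (f (x + w t)%R)%:E).
  by apply: eq_integral => w _; rewrite weight_zero_creation.
apply: cvg_fk_killing => //.
- by move=> m; exact: measurable_truncate.
- by move=> m y; exact: truncate_ge0.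
by move=> w; have [nd cv] := clock_truncate x w t mU u0; exact: cvg_expeRN_nd.
Qed.

Lemma cvg_fk_killing_time (u : nat -> 'rV[R]_n -> R) (k0 : measurableTypeR R * path -> \bar R) f x t :
  (forall m, measurable_fun setT (u m)) -> (forall m y, 0 <= u m y)%R ->
  (forall p, expeR (- clock (u m) x p.2 p.1) @[m --> \oo] --> k0 p) -> (forall p, 0 <= k0 p) ->
  measurable_fun setT f -> (forall y, 0 <= f y)%R ->
  \int[mu]_w clock f x w t < +oo ->
  \int[time t]_s fk (u m) zero_rate s (EFin \o f) x @[m --> \oo] -->
    \int[mu]_w \int[time t]_s (k0 (s, w) * (f (x + w s)%R)%:E).
Proof.
move=> mU u0 uk k00 mf f0 foo.
have mk m : measurable_fun setT (fun p : measurableTypeR R * path => expeR (- clock (u m) x p.2 p.1)).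
  apply: (measurableT_comp (@measurable_expeR R)); apply: measurableT_comp => //.
  by apply: (@measurable_clock0 R n _ (measurableTypeR R * path)%type _ (fun=> x) snd fst).
have mf' : measurable_fun setT (fun p : measurableTypeR R * path => f (x + p.2 p.1)%R).
  by apply: measurableT_comp => //; exact: (@measurable_position R n _ (measurableTypeR R * path)%type (fun=> x) snd fst).
have mk0 : measurable_fun setT k0.
  by apply: (emeasurable_fun_cvg (fun m p => expeR (- clock (u m) x p.2 p.1))).
pose PI := finite_prod (time t) mu.
have fubG (k : measurableTypeR R * path -> \bar R) : measurable_fun setT k -> (forall p, 0 <= k p) ->
   \int[PI]_p (k p * (f (x + p.2 p.1)%R)%:E) = \int[time t]_s \int[mu]_w (k (s, w) * (f (x + w s)%R)%:E) /\
   \int[PI]_p (k p * (f (x + p.2 p.1)%R)%:E) = \int[mu]_w \int[time t]_s (k (s, w) * (f (x + w s)%R)%:E).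
  move=> mk' k'0.
  have mK : measurable_fun setT (fun p : measurableTypeR R * path => k p * (f (x + p.2 p.1)%R)%:E).
    by apply: emeasurable_funM => //; apply/measurable_EFinP.
  have K0 p : 0 <= k p * (f (x + p.2 p.1)%R)%:E by rewrite mule_ge0// lee_fin.
  split; first exact: (fubini_tonelli1 (fun p : measurableTypeR R * path => k p * (f (x + p.2 p.1)%R)%:E)).
  exact: (fubini_tonelli2 (fun p : measurableTypeR R * path => k p * (f (x + p.2 p.1)%R)%:E)).
rewrite -(fubG k0 mk0 k00).2.
rewrite (_ : (fun m => _) = fun m => \int[PI]_p (expeR (- clock (u m) x p.2 p.1) * (f (x + p.2 p.1)%R)%:E)); last first.
  apply/funext => m; rewrite (fubG _ (mk m) _).1 => [|p]; last exact: expeR_ge0.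
  apply: eq_integral => s _; apply: eq_integral => w _; by rewrite weight_zero_creation.
apply: cvg_integral_dominated => //.
  by move=> m p; exact: survival_bounds.
rewrite (_ : \int[_]_p _ = \int[PI]_p (1 * (f (x + p.2 p.1)%R)%:E)); last by apply: eq_integral => p _; rewrite mul1e.
rewrite (fubG (fun=> 1) (measurable_cst _) (fun=> lee01)).2.
apply: (@le_lt_trans _ _ (\int[mu]_w clock f x w t)) => //.
rewrite le_eqVlt; apply/orP; left; apply/eqP.
by apply: eq_integral => w _; apply: eq_integral => s _; rewrite mul1e.
Qed.

Lemma cvg_fk_truncate_time u f x t : measurable_fun setT u -> (forall y, 0 <= u y)%R ->
  measurable_fun setT f -> (forall y, 0 <= f y)%R ->
  \int[mu]_w clock f x w t < +oo ->
  \int[time t]_s fk (truncate u m) zero_rate s (EFin \o f) x @[m --> \oo] -->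
    \int[time t]_s fk u zero_rate s (EFin \o f) x.
Proof.
move=> mU u0 mf f0 foo.
pose k0 (p : measurableTypeR R * path) := expeR (- clock u x p.2 p.1).
have mk0 : measurable_fun setT k0.
  apply: (measurableT_comp (@measurable_expeR R)); apply: measurableT_comp => //.
  by apply: (@measurable_clock0 R n _ (measurableTypeR R * path)%type _ (fun=> x) snd fst).
have mpos : measurable_fun setT (fun p : measurableTypeR R * path => (f (x + p.2 p.1)%R)%:E).
  apply/measurable_EFinP; apply: measurableT_comp => //.
  exact: (@measurable_position R n _ (measurableTypeR R * path)%type (fun=> x) snd fst).
have fub : \int[time t]_s \int[mu]_w (k0 (s, w) * (f (x + w s)%R)%:E) =
    \int[mu]_w \int[time t]_s (k0 (s, w) * (f (x + w s)%R)%:E).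
  apply: (@fubini_tonelli _ _ _ _ R (time t) mu (fun p : measurableTypeR R * path =>
    k0 p * (f (x + p.2 p.1)%R)%:E)); first exact: emeasurable_funM.
  by move=> p; rewrite mule_ge0 ?expeR_ge0 ?lee_fin.
have fkk0 s : fk u zero_rate s (EFin \o f) x = \int[mu]_w (k0 (s, w) * (f (x + w s)%R)%:E).
  by apply: eq_integral => w _; rewrite weight_zero_creation.
under [X in _ --> X]eq_integral do rewrite fkk0.
rewrite fub.
apply: (@cvg_fk_killing_time (truncate u) k0) => //.
- by move=> m; exact: measurable_truncate.
- by move=> m y; exact: truncate_ge0.
- by move=> p; have [nd cv] := clock_truncate x p.2 p.1 mU u0; exact: cvg_expeRN_nd.
by move=> p; exact: expeR_ge0.
Qed.

(** By right continuity the path stays in the open ball for some time after [s1]. *)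
Lemma clock_eball_gt0 x w r s1 s2 : (enorm (x + w s1) < r)%R -> (0 <= s1)%R -> (s1 < s2)%R ->
  0 < clock (\1_(eball 0%R r)) x w s2.
Proof.
move=> xr s10 s12; have mb := measurable_eball (0 : 'rV[R]_n) r.
have mi : measurable_fun setT (\1_(eball (0 : 'rV[R]_n) r) : _ -> R) by exact: measurable_indic.
have i0 y : (0 <= \1_(eball (0 : 'rV[R]_n) r) y :> R)%R by rewrite indicE.
rewrite -(subrKC s1 s2) clock_split ?subr_ge0 ?(ltW s12)//.
have xr0 : (0 < r - enorm (x + w s1))%R by rewrite subr_gt0.
have [rc _] := cvg_at_rightP w s1 (w s1).
have [d d0 dP] := rc (@path_rcont R n w s1) _ xr0.
pose e := Num.min (s2 - s1)%R (d / 2)%R.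
have e0 : (0 < e)%R by rewrite lt_min subr_gt0 s12 divr_gt0.
have es : (0 <= s2 - s1 - e)%R by rewrite subr_ge0 ge_min lexx.
pose k (q : measurableTypeR R) : \bar R := (\1_(eball (0 : 'rV[R]_n) r) (x + w (s1 + q))%R)%:E.
have mk : measurable_fun setT k.
  apply/measurable_EFinP; apply: (measurableT_comp (measurable_along x w mi)).
  exact: measurable_funD.
have k0 q : 0 <= k q by rewrite lee_fin.
rewrite (_ : \int[time (s2 - s1)]_q _ = \int[time (s2 - s1)]_q k q)//.
have -> : \int[time (s2 - s1)]_q k q = \int[time (e + (s2 - s1 - e))]_q k q by rewrite subrKC.
rewrite integral_time_split ?(ltW e0)//.
suff h : e%:E <= \int[time e]_q k q.
  apply: (@lt_le_trans _ _ e%:E); first by rewrite lte_fin.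
  apply: le_trans h _; apply: (@le_trans _ _ (\int[time e]_q k q + \int[time (s2 - s1 - e)]_q k (e + q)%R)).
    by rewrite leeDl// integral_ge0.
  by rewrite leeDr// clock_ge0.
rewrite -[leLHS]mul1e -integral_time_cst ?(ltW e0)//; apply: le_time => // q q0 qe.
have [->|qn] := eqVneq q 0%R.
  by rewrite /k addr0 indicE mem_set//= /eball/= subr0.
have {}q0 : (0 < q)%R by rewrite lt_neqAle eq_sym qn.
rewrite /k indicE mem_set//= /eball/= subr0.
have h := dP (s1 + q)%R; rewrite ltrDl ltrD2l in h.
have {}h : (enorm (w (s1 + q) - w s1) < r - enorm (x + w s1))%R.
  apply: h => //; apply: le_lt_trans qe _; rewrite /e gt_min; apply/orP; right.
  by rewrite ltr_pdivrMr// ltr_pMr// ltr1n.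
have -> : (x + w (s1 + q) = (x + w s1) + (w (s1 + q) - w s1))%R.
  by rewrite addrACA subrr addr0.
apply: le_lt_trans (ler_enormD _ _) _; rewrite addrC -ltrBrDr//.
Qed.

(** In the limit a path keeps its weight only as long as it has spent no time in the ball. By
    [clock_eball_gt0] it can be in the ball with its clock still at 0 at one time at most, so the
    time integral of [f] vanishes. *)
Lemma fk_killing_ball f (r : R) x t : measurable_fun setT f -> (forall y, 0 <= f y)%R ->
  (forall y, ~ eball 0%R r y -> f y = 0%R) ->
  \int[mu]_w clock f x w t < +oo ->
  \int[time t]_s fk (fun y => m%:R * \1_(eball 0 r) y)%R zero_rate s (EFin \o f) x @[m --> \oo] --> 0.
Proof.
move=> mf f0 fr foo; have mb := measurable_eball (0 : 'rV[R]_n) r.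
have mi : measurable_fun setT (\1_(eball (0 : 'rV[R]_n) r) : _ -> R) by exact: measurable_indic.
have i0 y : (0 <= \1_(eball (0 : 'rV[R]_n) r) y :> R)%R by rewrite indicE.
pose L (p : measurableTypeR R * path) := clock (\1_(eball 0%R r)) x p.2 p.1.
pose k0 p : \bar R := (L p == 0)%:R%:E.
have := @cvg_fk_killing_time (fun m y => m%:R * \1_(eball 0 r) y)%R k0 f x t.
suff -> : \int[mu]_w \int[time t]_s (k0 (s, w) * (f (x + w s)%R)%:E) = 0.
  apply => //.
  - by move=> m; exact: measurable_funM.
  - move=> p; have LE m : clock (fun y => m%:R * \1_(eball 0 r) y)%R x p.2 p.1 = m%:R%:E * L p.
      rewrite /clock /L /clock -ge0_integralZl//.
      by apply/measurable_EFinP; exact: measurable_along.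
    under eq_fun do rewrite LE.
    have Lfin : L p < +oo.
      have [p0|p0] := leP 0%R p.1.
        apply: (@le_lt_trans _ _ (1 * p.1)%:E); last exact: ltry.
        by apply: clock_le_cst => // y; rewrite indicE; case: (_ \in _).
      have mL : measurable_fun setT (fun q : measurableTypeR R => (\1_(eball (0 : 'rV[R]_n) r) (x + p.2 q)%R)%:E : \bar R).
        by apply/measurable_EFinP; exact: measurable_along.
      rewrite /L /clock (integral_time _ mL) => [|q]; last by rewrite lee_fin.
      rewrite integral0_eq// => q _; rewrite [X in _ * X](_ : _ = 0) ?mule0// indicE memNset//=.
      by rewrite in_itv/= => /andP[h1 h2]; move: (le_lt_trans (le_trans h1 h2) p0); rewrite ltxx.
    have L0 : 0 <= L p by exact: clock_ge0.
    rewrite /k0; case: (L p) L0 Lfin => // l l0 _.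
    rewrite eqe; have [->|l1] := eqVneq l 0%R.
      by under eq_fun do rewrite mule0 oppe0 expeR0; exact: cvg_cst.
    have {}l0 : (0 < l)%R by rewrite lt_neqAle eq_sym l1.
    have -> : (fun m : nat => expeR (- (m%:R%:E * l%:E))) = fun m => (expR (- l) ^+ m)%:E.
      by apply/funext => m; rewrite -EFinM /= -expRM_natl mulrN.
    apply: cvg_EFin; first exact: nearW.
    apply: cvg_expr; rewrite ger0_norm ?expR_ge0// expR_lt1 oppr_lt0//.
  - by move=> p; rewrite lee_fin.
apply: integral0_eq => w _.
(* Two such times are impossible: the clock would be positive at the later one. *)
have [s1 s1P] : exists s1 : R, forall s, (0 <= s)%R -> s <> s1 -> eball 0%R r (x + w s)%R -> L (s, w) <> 0.
  have [[s1 [s10 xs1 L1]]|nos] := pselect (exists s1, [/\ (0 <= s1)%R, eball 0%R r (x + w s1)%R & L (s1, w) = 0]).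
    exists s1 => s s0 ss1 xs Ls; rewrite /eball/= !subr0 in xs xs1.
    have [h|h|//] := ltgtP s s1.
      by have := clock_eball_gt0 xs s0 h; rewrite -/(L (s1, w)) L1 ltxx.
    by have := clock_eball_gt0 xs1 s10 h; rewrite -/(L (s, w)) Ls ltxx.
  by exists 0%R => s s0 _ xs Ls; apply: nos; exists s.
pose N : set (measurableTypeR R) := [set s1] `|` [set` `]-oo, 0%R[%R].
have m1 : measurable [set (s1 : measurableTypeR R)] by exact: measurable_set1.
have mN : measurable N by apply: measurableU => //; exact: measurable_itv.
rewrite (@ge0_integral_off_null _ _ _ (time t) N _ (fun=> 0) mN)//.
- by rewrite integral0.
- apply/eqP; rewrite eq_le measure_ge0 andbT.
  have <- : lebesgue_measure [set (s1 : measurableTypeR R)] = 0 by exact: lebesgue_measure_set1.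
  rewrite /time/= /mfrestr /mrestr le_measure ?inE//.
    by apply: measurableI => //; exact: measurable_itv.
  by move=> s [[->//|]]; rewrite /= !in_itv/= => h /andP[h1 _]; move: (le_lt_trans h1 h); rewrite ltxx.
- by move=> s; rewrite mule_ge0// lee_fin.
move=> s sN; have [s0|s0] := leP 0%R s; last by case: sN; right; rewrite /= in_itv.
have ss1 : s <> s1 by move=> e; apply: sN; left.
have [xs|xs] := pselect (eball 0%R r (x + w s)%R); last by rewrite fr// mule0.
by rewrite /k0; have /eqP/negbTE -> := s1P s s0 ss1 xs; rewrite mul0e.
Qed.

End killing_limits.

(** * Unbounded killing rates *)

Section unbounded_killing.
Context {R : realType} {n : nat}.
Local Notation path := (path R n).
Implicit Types (u f : 'rV[R]_n -> R) (g : 'rV[R]_n -> \bar R) (x y v : 'rV[R]_n) (w : path) (s t : R).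
Variable mu : probability path R.
Hypothesis muL : levy_law mu.
Local Open Scope ereal_scope.
Local Notation fk := (fk mu).
Local Notation zero_rate := (@zero_rate R n).

Lemma le_fk_time u u' f f' t x :
  measurable_fun setT u -> (forall y, 0 <= u y)%R ->
  measurable_fun setT u' -> (forall y, 0 <= u' y)%R ->
  measurable_fun setT f -> (forall y, 0 <= f y)%R ->
  measurable_fun setT f' -> (forall y, 0 <= f' y)%R ->
  (forall y, u' y <= u y)%R -> (forall y, f y <= f' y)%R ->
  \int[time t]_s fk u zero_rate s (EFin \o f) x <= \int[time t]_s fk u' zero_rate s (EFin \o f') x.
Proof.
move=> mU u0 mU' u'0 mf f0 mf' f'0 uu ff.
have mz : measurable_fun setT zero_rate by [].
have mE (h : 'rV[R]_n -> R) : measurable_fun setT h -> measurable_fun setT (EFin \o h) by move=> mh; apply/measurable_EFinP.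
have E0 (h : 'rV[R]_n -> R) : (forall y, 0 <= h y)%R -> forall y, 0 <= (EFin \o h) y by move=> h0 y; rewrite lee_fin.
apply: le_time_pos.
- by apply: (@measurable_fk R n mu _ (measurableTypeR R) _ zero_rate _ (fun=> x) id) => //; by [exact: mE|exact: E0].
- by apply: (@measurable_fk R n mu _ (measurableTypeR R) _ zero_rate _ (fun=> x) id) => //; by [exact: mE|exact: E0].
- by move=> s; apply: fk_ge0; exact: E0.
- by move=> s; apply: fk_ge0; exact: E0.
move=> s s0 st; apply: le_fk; [exact: mU|exact: u0|exact: mz|by []|exact: mU'|exact: u'0|exact: mz|by []|exact: mE|exact: E0|exact: mE|exact: uu|by []|].
by move=> y; rewrite lee_fin.
Qed.

Variables (A : 'M[R]_n) (nu : 'rV[R]_n -> R).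
Hypothesis J : jump_density nu.
Hypothesis char : (forall t xi th, 0 <= t ->
  (\int[mu]_w cos (dot xi (w t) + th)) = expR (t * exponent A nu xi) * cos th)%R.
Local Notation tame := (tame nu).

(** The constants of [fk_bump] do not depend on [u], so both inequalities pass from the truncations
    of [u] to [u]; the finite potential provides the domination in the second one. *)
Lemma fk_bump_unbounded : exists chi : 'rV[R]_n -> R, exists a0 lam c C : R,
  [/\ [/\ 0 < a0, 0 <= lam, 0 < c & 0 <= C]%R,
      bmeas chi /\ (forall y, 0 <= chi y <= 2 * \1_(eball 0%R 1) y)%R,
      (forall y, enorm y < 1 / 2 -> a0 <= chi y)%R,
      (forall u (b : R) t x v, measurable_fun setT u -> (forall y, 0 <= u y)%R -> (0 <= t)%R ->
        (forall y, enorm (y - v) < 1 -> u y <= b)%R ->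
        (chi (x - v)%R)%:E <= (expR ((b + lam) * t))%:E *
          fk u zero_rate t (fun y => (chi (y - v)%R)%:E) x) &
      (forall u t x, measurable_fun setT u -> (forall y, 0 <= u y)%R -> (0 <= t)%R ->
        \int[mu]_w clock (fun y => (2 * u y + C) * \1_(eball 0%R 1) y)%R x w t < +oo ->
        c%:E * \int[time t]_s fk u zero_rate s (EFin \o tame) x <=
        fk u zero_rate t (fun y => (2 * \1_(eball 0%R 1) y)%:E) x +
        \int[time t]_s fk u zero_rate s (fun y => ((2 * u y + C) * \1_(eball 0%R 1) y)%:E) x)].
Proof.
have [chi [a0 [lam [c [C [[a00 lam0 c0 C0] [bchi chi2] chia growth sub]]]]]] := fk_bump muL J char.
exists chi, a0, lam, c, C; split => //.
  move=> u b t x v mU u0 t0 ub.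
  have mB : measurable_fun setT (fun y : 'rV[R]_n => y - v)%R by exact: measurable_rVB.
  have bchiv : bmeas (fun y => chi (y - v)%R) by exact: (bmeas_comp mB bchi).
  have cv := @cvg_fk_truncate R n mu u (fun y => chi (y - v)%R) x t mU u0 bchiv.1
    (fun y => proj1 (andP (chi2 (y - v)%R))).
  have {}cv : fk (truncate u m) zero_rate t (fun y => (chi (y - v)%R)%:E) x @[m --> \oo] -->
      fk u zero_rate t (fun y => (chi (y - v)%R)%:E) x.
    apply: cv; apply: (@le_lt_trans _ _ (\int[mu]_w 2%:E)); last by rewrite integral_prob_cst ltry.
    rewrite fk_free; apply: ge0_le_integral => //.
    - by move=> w _; rewrite lee_fin; have /andP[] := chi2 (x + w t - v)%R.
    - apply/measurable_EFinP; apply: (measurableT_comp bchiv.1).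
      exact: (@measurable_position R n _ path (fun=> x) id (fun=> t)).
    move=> w _; rewrite lee_fin; have /andP[_] := chi2 (x + w t - v)%R.
    by move=> /le_trans; apply; rewrite indicE; case: (_ \in _); rewrite ?mulr1 ?mulr0.
  have cv2 := @cvgeZl _ _ R _ _ (expR ((b + lam) * t))%:E isT cv.
  rewrite -(cvg_lim _ cv2)//; apply: lime_ge; first by apply/cvg_ex; eexists; exact: cv2.
  apply: nearW => m; apply: growth => //.
  - exact: bmeas_truncate.
  - by move=> y; exact: truncate_ge0.
  by move=> y yv; rewrite (le_trans (truncate_le _ _ _))// ub.
move=> u t x mU u0 t0 foo.
have mb := measurable_eball (0 : 'rV[R]_n) 1.
have mi : measurable_fun setT (\1_(eball (0 : 'rV[R]_n) 1) : _ -> R) by exact: measurable_indic.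
have i0 y : (0 <= \1_(eball (0 : 'rV[R]_n) 1) y :> R)%R by rewrite indicE.
pose i2 y : R := (2 * \1_(eball (0 : 'rV[R]_n) 1) y)%R.
have mi2 : measurable_fun setT i2 by exact: measurable_funM.
have i20 y : (0 <= i2 y)%R by rewrite mulr_ge0.
pose F y : R := ((2 * u y + C) * \1_(eball (0 : 'rV[R]_n) 1) y)%R.
have mF : measurable_fun setT F.
  by apply: measurable_funM => //; apply: measurable_funD => //; exact: measurable_funM.
have F0 y : (0 <= F y)%R by rewrite mulr_ge0// addr_ge0// mulr_ge0.
have cv1 := @cvg_fk_truncate R n mu u i2 x t mU u0 mi2 i20.
have {}cv1 : fk (truncate u m) zero_rate t (EFin \o i2) x @[m --> \oo] --> fk u zero_rate t (EFin \o i2) x.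
  apply: cv1; apply: (@le_lt_trans _ _ (\int[mu]_w 2%:E)); last by rewrite integral_prob_cst ltry.
  rewrite fk_free; apply: ge0_le_integral => //.
  - by move=> w _; rewrite lee_fin.
  - apply/measurable_EFinP; apply: (measurableT_comp mi2).
    exact: (@measurable_position R n _ path (fun=> x) id (fun=> t)).
  by move=> w _; rewrite lee_fin /i2 indicE; case: (_ \in _); rewrite ?mulr1 ?mulr0.
have cv2 := @cvg_fk_truncate_time R n mu u F x t mU u0 mF F0 foo.
have cv := @cvgeD _ _ _ R _ _ _ _ (ge0_adde_def _ _) cv1 cv2.
have {}cv : fk (truncate u m) zero_rate t (EFin \o i2) x + \int[time t]_s fk (truncate u m) zero_rate s (EFin \o F) x
    @[m --> \oo] --> fk u zero_rate t (EFin \o i2) x + \int[time t]_s fk u zero_rate s (EFin \o F) x.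
  apply: cv; rewrite inE; [apply: fk_ge0 => y|apply: integral_ge0 => s _; apply: fk_ge0 => y]; by rewrite lee_fin.
rewrite -[leRHS](cvg_lim _ cv)//; apply: lime_ge; first by apply/cvg_ex; eexists; exact: cv.
apply: nearW => m.
have mum : measurable_fun setT (truncate u m) by exact: measurable_truncate.
have um0 y : (0 <= truncate u m y)%R by exact: truncate_ge0.
apply: le_trans (_ : c%:E * \int[time t]_s fk (truncate u m) zero_rate s (EFin \o tame) x <= _).
  apply: lee_wpmul2l; first by rewrite lee_fin ltW.
  apply: le_fk_time => //; [exact: measurable_tame|by move=> y; exact/ltW/tame_gt0|exact: measurable_tame|by move=> y; exact/ltW/tame_gt0|].
  by move=> y; exact: truncate_le.
apply: le_trans (sub (truncate u m) t x (bmeas_truncate m mU u0) um0 t0) _.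
apply: leeD; first exact: lexx.
pose G y : R := ((2 * truncate u m y + C) * \1_(eball (0 : 'rV[R]_n) 1) y)%R.
have mG : measurable_fun setT G.
  by apply: measurable_funM => //; apply: measurable_funD => //; exact: measurable_funM.
have G0 y : (0 <= G y)%R by rewrite mulr_ge0// addr_ge0// mulr_ge0.
have GF y : (G y <= F y)%R by rewrite ler_wpM2r// lerD2r ler_pM2l// truncate_le.
exact: (@le_fk_time (truncate u m) (truncate u m) G F t x mum um0 mum um0 mG G0 mF F0 (fun=> lexx _) GF).
Qed.

End unbounded_killing.

(** * Creation rates of small potential *)

Section rates.
Context {R : realType} {n : nat}.
Local Notation path := (path R n).
Implicit Types (u f : 'rV[R]_n -> R) (g : 'rV[R]_n -> \bar R) (x y v : 'rV[R]_n) (w : path) (s t : R).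
Variable mu : probability path R.
Hypothesis muL : levy_law mu.
Local Open Scope ereal_scope.
Local Notation fk := (fk mu).
Local Notation zero_rate := (@zero_rate R n).
Local Notation one := (cst 1 : 'rV[R]_n -> \bar R).

(** The Kato condition for a nonnegative rate, read on path space. *)
Definition small_creation f : Prop :=
  [/\ measurable_fun setT f, (forall y, 0 <= f y)%R &
   forall e : R, (0 < e)%R -> exists2 t : R, (0 < t)%R & forall x, \int[mu]_w clock f x w t <= e%:E].

Lemma small_creation_gauge f : small_creation f -> forall T : R, exists2 C : R, (0 <= C)%R &
    forall s x, (0 <= s)%R -> (s <= T)%R -> fk zero_rate f s one x <= C%:E.
Proof.
move=> [mf f0 sf] T; have [t t0 H] := sf (1 / 2)%R ltac:(by []).
exact: (gauge muL mf f0 t0).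
Qed.

Lemma small_creation_clock f t x : small_creation f -> (0 <= t)%R -> \int[mu]_w clock f x w t < +oo.
Proof.
move=> kf t0; have [C C0 H] := small_creation_gauge kf t; have [mf f0 _] := kf.
apply: le_lt_trans (ltry C); apply: le_trans (H t x t0 (lexx _)); apply: ge0_le_integral => //.
- by move=> w _; exact: clock_ge0.
- by apply: (@measurable_clock0 R n _ path _ (fun=> x) id (fun=> t)).
- exact: measurable_fk_integrand.
move=> w _; rewrite mule1 weight_zero_killing.
have := clock_ge0 x w t f0; case: (clock _ _ _ _) => //= r _.
by rewrite lee_fin (le_trans _ (expR_ge1Dx r))// lerDr.
Qed.

Lemma small_creation_ae f t x : small_creation f -> (0 <= t)%R ->
  {ae mu, forall w, clock f x w t < +oo}.
Proof.
move=> kf t0; have [mf f0 _] := kf; have foo := small_creation_clock x kf t0.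
have mc : measurable_fun setT (fun w => clock f x w t).
  by apply: (@measurable_clock0 R n _ path _ (fun=> x) id (fun=> t)).
have ic : mu.-integrable setT (fun w => clock f x w t).
  apply/integrableP; split => //.
  by under eq_integral do rewrite gee0_abs ?clock_ge0//.
have := integrable_ae measurableT ic; apply: filterS => w /(_ I).
by rewrite ge0_fin_numE// clock_ge0.
Qed.

(** Almost surely the creation clocks are finite and can be cancelled, so only [u - f] matters; the
    two killing clocks are infinite together, and then both weights vanish. *)
Lemma fk_decomposition u f u' f' t g x :
  measurable_fun setT u -> (forall y, 0 <= u y)%R -> small_creation f ->
  measurable_fun setT u' -> (forall y, 0 <= u' y)%R -> small_creation f' ->
  (forall y, u y + f' y = u' y + f y)%R ->
  measurable_fun setT g -> (0 <= t)%R -> fk u f t g x = fk u' f' t g x.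
Proof.
move=> mU u0 kf mU' u'0 kf' uf mg t0; have [mf f0 _] := kf; have [mf' f'0 _] := kf'.
apply: ae_eq_integral => //; [exact: measurable_fk_integrand|exact: measurable_fk_integrand|].
have := small_creation_ae x kf t0; have := small_creation_ae x kf' t0.
apply: filterS2 => w b' b _; congr (_ * _).
have E : clock u x w t + clock f' x w t = clock u' x w t + clock f x w t.
  rewrite /clock -!ge0_integralD//; first (by apply: eq_integral => s _; rewrite -!EFinD uf);
    try (by move=> s _; rewrite lee_fin); by apply/measurable_EFinP; exact: measurable_along.
have := clock_ge0 x w t f0; have := clock_ge0 x w t f'0.
have := clock_ge0 x w t u0; have := clock_ge0 x w t u'0.
rewrite /weight; move: b b' E; case: (clock f x w t) => // b _; case: (clock f' x w t) => // b' _.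
case: (clock u x w t) => //; case: (clock u' x w t) => //; last by rewrite !mul0e.
move=> a' a; rewrite -!EFinD => -[e] _ _ _ _; rewrite /= -!EFinM -!expRD; congr (expR _)%:E.
by move: e; lra.
Qed.

Lemma small_creation_le f f' : measurable_fun setT f -> (forall y, 0 <= f y)%R ->
  (forall y, f y <= f' y)%R -> small_creation f' -> small_creation f.
Proof.
move=> mf f0 ff [mf' f'0 H]; split; [exact: mf|exact: f0|move=> e e0]; have [t t0 Ht] := H e e0.
exists t; first exact: t0.
move=> x; apply: le_trans (Ht x); apply: ge0_le_integral; first by [].
- by move=> w _; exact: clock_ge0.
- by apply: (@measurable_clock0 R n _ path _ (fun=> x) id (fun=> t)).
- by apply: (@measurable_clock0 R n _ path _ (fun=> x) id (fun=> t)).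
by move=> w _; exact: le_clock.
Qed.

Lemma small_creationD f f' : small_creation f -> small_creation f' ->
  small_creation (fun y => f y + f' y)%R.
Proof.
move=> [mf f0 H] [mf' f'0 H']; split => [||e e0].
- exact: measurable_funD.
- by move=> y; rewrite addr_ge0.
have e2 : (0 < e / 2)%R by rewrite divr_gt0.
have [t t0 Ht] := H _ e2; have [t' t'0 Ht'] := H' _ e2.
have m0 : (0 < Num.min t t')%R by rewrite lt_min t0.
exists (Num.min t t') => // x.
have mc (h : 'rV[R]_n -> R) (s : R) : measurable_fun setT h -> (forall y, 0 <= h y)%R -> measurable_fun setT (fun w => clock h x w s).
  by move=> mh h0; apply: (@measurable_clock0 R n _ path _ (fun=> x) id (fun=> s)).
have le (h : 'rV[R]_n -> R) (s s' : R) : measurable_fun setT h -> (forall y, 0 <= h y)%R -> (0 <= s)%R -> (s <= s')%R ->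
    \int[mu]_w clock h x w s <= \int[mu]_w clock h x w s'.
  move=> mh h0 s0 ss; apply: ge0_le_integral; [by []|by move=> w _; exact: clock_ge0|exact: mc|exact: mc|].
  by move=> w _; exact: clock_mono.
rewrite (_ : \int[mu]_w _ = \int[mu]_w (clock f x w (Num.min t t') + clock f' x w (Num.min t t'))).
  rewrite ge0_integralD//; try (by move=> w _; exact: clock_ge0); try exact: mc.
  rewrite [e]splitr EFinD; apply: leeD.
    by apply: le_trans (Ht x); apply: le => //; rewrite ?(ltW m0)// ge_min lexx.
  by apply: le_trans (Ht' x); apply: le => //; rewrite ?(ltW m0)// ge_min lexx orbT.
apply: eq_integral => w _; rewrite /clock -ge0_integralD//;
  try (by move=> s _; rewrite lee_fin); by apply/measurable_EFinP; exact: measurable_along.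
Qed.

Lemma small_creation_bounded f (M : R) : measurable_fun setT f -> (forall y, 0 <= f y)%R ->
  (forall y, f y <= M)%R -> small_creation f.
Proof.
move=> mf f0 fM; split => // e e0.
have M0 : (0 <= M)%R by rewrite (le_trans (f0 0%R)).
have t0 : (0 < e / (M + 1))%R by rewrite divr_gt0// ltr_wpDl.
exists (e / (M + 1))%R => // x; rewrite -[leRHS](integral_prob_cst mu); apply: ge0_le_integral => //.
- by move=> w _; exact: clock_ge0.
- by apply: (@measurable_clock0 R n _ path _ (fun=> x) id (fun=> (e / (M + 1))%R)).
move=> w _; apply: le_trans (clock_le_cst _ _ _ _ _ fM) _ => //; first exact: ltW.
by rewrite lee_fin mulrA ler_pdivrMr ?ltr_wpDl// mulrC ler_wpM2l ?(ltW e0)// lerDl.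
Qed.

End rates.

(** * Bounds on the ground state *)

Section ground_state_bounds.
Context {R : realType} {n : nat}.
Local Notation path := (path R n).
Local Notation leb := (@lebesgue_rV R n).
Implicit Types (u f : 'rV[R]_n -> R) (g : 'rV[R]_n -> \bar R) (x y v : 'rV[R]_n) (w : path) (s t : R).
Variable mu : probability path R.
Hypothesis muL : levy_law mu.
Local Open Scope ereal_scope.
Local Notation fk := (fk mu).
Local Notation zero_rate := (@zero_rate R n).
Local Notation one := (cst 1 : 'rV[R]_n -> \bar R).
Hypothesis mu_ac : forall t x (N : set 'rV[R]_n), (0 < t)%R -> measurable N -> leb N = 0 ->
  mu [set w : path | N (x + w t)%R] = 0.

(** The law at time [t > 0] is absolutely continuous, so the path almost surely avoids the
    exceptional null set at that time. *)
Lemma le_fk_ae u f t g g' x :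
  measurable_fun setT u -> (forall y, 0 <= u y)%R ->
  measurable_fun setT f -> (forall y, 0 <= f y)%R ->
  measurable_fun setT g -> (forall y, 0 <= g y) ->
  measurable_fun setT g' -> (forall y, 0 <= g' y) -> (0 < t)%R ->
  {ae leb, forall y, g y <= g' y} -> fk u f t g x <= fk u f t g' x.
Proof.
move=> mU u0 mf f0 mg g0 mg' g'0 t0 [N [mN N0 gg]].
apply: ae_ge0_le_integral => //.
- by move=> w _; rewrite mule_ge0 ?weight_ge0.
- exact: measurable_fk_integrand.
- by move=> w _; rewrite mule_ge0 ?weight_ge0.
- exact: measurable_fk_integrand.
exists [set w : path | N (x + w t)%R]; split; [|exact: mu_ac|].
  rewrite -[X in measurable X]setTI.
  have mp : measurable_fun setT (fun w : path => x + w t)%R.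
    exact: (@measurable_position R n _ path (fun=> x) id (fun=> t)).
  exact: mp.
move=> w Hw; apply: gg => /= h; apply: Hw => _.
by apply: lee_wpmul2l h; exact: weight_ge0.
Qed.

Variables (V : 'rV[R]_n -> R) (phi : 'rV[R]_n -> R) (lambda M : R).
Hypotheses (mV : measurable_fun setT V) (sV : small_creation mu V^\-%R).
Hypotheses (phi_cont : continuous phi) (mphi : measurable_fun setT phi).
Hypotheses (phi_gt0 : forall x, (0 < phi x)%R) (phi_le : forall x, (phi x <= M)%R).
Local Notation T := (fk V^\+%R V^\-%R).
Local Notation ephi := (EFin \o phi).
Hypothesis eig : forall t, (0 < t)%R ->
  {ae leb, forall x, T t ephi x = (expR (- lambda * t) * phi x)%:E}.

Let mVp : measurable_fun setT V^\+%R. Proof. exact: measurable_funrpos. Qed.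
Let mVm : measurable_fun setT V^\-%R. Proof. exact: measurable_funrneg. Qed.
Let Vp0 y : (0 <= V^\+ y)%R. Proof. exact: funrpos_ge0. Qed.
Let Vm0 y : (0 <= V^\- y)%R. Proof. exact: funrneg_ge0. Qed.
Let mephi : measurable_fun setT ephi. Proof. exact/measurable_EFinP. Qed.
Let ephi0 y : 0 <= ephi y. Proof. by rewrite lee_fin ltW. Qed.

Lemma ground_state_shift s t x : (0 < s)%R -> (0 < t)%R ->
  T (s + t) ephi x = (expR (- lambda * t))%:E * T s ephi x.
Proof.
move=> s0 t0; rewrite fk_semigroup ?(ltW s0) ?(ltW t0)// -fkZ//.
have mT : measurable_fun setT (T t ephi).
  exact: (@measurable_fk R n mu _ _ V^\+%R V^\-%R ephi id (fun=> t)).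
have mZ : measurable_fun setT (fun y => (expR (- lambda * t))%:E * ephi y).
  by apply: emeasurable_funM.
have Z0 y : 0 <= (expR (- lambda * t))%:E * ephi y by rewrite mule_ge0// lee_fin expR_ge0.
have T0 y : 0 <= T t ephi y by exact: fk_ge0.
apply/eqP; rewrite eq_le; apply/andP; split; apply: le_fk_ae => //;
  have := eig t0; apply: filterS => y ->; by rewrite /= EFinM.
Qed.

(** Right continuity of the paths and continuity of [phi] make the expectation of [phi] at time
    [1 / k.+1] tend to [phi x]. Killing only helps, and creation adds at most [M] times the excess
    of the gauge over 1, small by the Kato condition. *)
Lemma ground_state_time0 x (e : R) : (0 < e)%R ->
  \forall k \near \oo, T (k.+1%:R^-1)%R ephi x <= (phi x + e)%:E.
Proof.
move=> e0; have M0 : (0 < M)%R by apply: lt_le_trans (phi_le 0%R).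
have [C C0 HC] := small_creation_gauge muL sV 1%R.
have e20 : (0 < e / 2)%R by rewrite divr_gt0.
have [_ _ sVm] := sV.
have d0 : (0 < e / 2 / (M * C + 1))%R by rewrite divr_gt0// ltr_wpDl// mulr_ge0// ltW.
have [tau tau0 Htau] := sVm _ d0.
pose s (k : nat) : R := (k.+1%:R^-1)%R.
have s0 k : (0 < s k)%R by rewrite invr_gt0.
have s1 k : (s k <= 1)%R by rewrite invf_le1// ler1n.
have s_to0 : s @ \oo --> (0 : R)%R by exact: cvg_harmonic.
have bphi : bmeas phi.
  by split => //; exists M => y; rewrite ger0_norm// ltW.
have wcv w : (phi (x + w (s k))%R @[k --> \oo] --> phi x)%R.
  have wk : w (s k) @[k --> \oo] --> (0 : 'rV[R]_n)%R.
    have rc := @path_rcont R n w 0%R.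
    rewrite path0// in rc.
    move=> B /rc /nbhs_ballP[d /= d_gt0 dB].
    have : \forall k \near \oo, (s k < d)%R by apply: (cvgr_lt _ s_to0).
    apply: filterS => k sk; apply: dB => //=.
    by rewrite -ball_normE /= sub0r normrN ger0_norm// ltW.
  have xk : (x + w (s k))%R @[k --> \oo] --> x.
    by rewrite -[X in _ --> X]addr0; apply: cvgD => //; exact: cvg_cst.
  by apply: (cvg_comp _ _ xk); exact: phi_cont.
pose a k := (\int[mu]_w phi (x + w (s k)))%R.
have mpos k : measurable_fun setT (fun w : path => x + w (s k))%R.
  exact: (@measurable_position R n _ path (fun=> x) id (fun=> s k)).
have acv : a @ \oo --> phi x.
  have nphi k (w : path) : (`|phi (x + w (s k))%R| <= M)%R by rewrite ger0_norm// ltW.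
  have [_] := @cvg_Rintegral_bmeas _ path R mu (fun k w => phi (x + w (s k))%R) (fun=> phi x) M
    (fun k => measurableT_comp mphi (mpos k)) nphi wcv.
  by rewrite [X in _ --> X](_ : _ = phi x)// /Rintegral integral_prob_cst.
near=> k.
have sk0 := s0 k; have sk1 := s1 k.
have ak : (a k < phi x + e / 2)%R.
  near: k; apply: (cvgr_lt _ acv); by rewrite ltrDl.
have skt : (s k <= tau)%R by near: k; apply: (cvgr_le _ s_to0).
have mz : measurable_fun setT zero_rate by [].
(* The integrated form of [0 <= (exp b - 1) * (M - phi)], [b] being the creation clock, arranged
   without subtraction. *)
have key : fk zero_rate V^\-%R (s k) ephi x + M%:E <= (a k)%:E + M%:E * fk zero_rate V^\-%R (s k) one x.
  have bak : bmeas (fun w : path => phi (x + w (s k))%R) by exact: (bmeas_comp (mpos k) bphi).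
  have mcl : measurable_fun setT (fun w : path => expeR (clock V^\-%R x w (s k))).
    apply: (measurableT_comp (@measurable_expeR R)).
    by apply: (@measurable_clock0 R n _ path _ (fun=> x) id (fun=> s k)).
  have E1 : M%:E * fk zero_rate V^\-%R (s k) one x = \int[mu]_w (M%:E * expeR (clock V^\-%R x w (s k))).
    rewrite /fk -ge0_integralZl//; last 3 first.
    - exact: measurable_fk_integrand.
    - by move=> w _; rewrite mule_ge0 ?weight_ge0 ?lee01.
    - by rewrite lee_fin ltW.
    by apply: eq_integral => w _; rewrite weight_zero_killing mule1.
  have E2 : fk zero_rate V^\-%R (s k) ephi x = \int[mu]_w (expeR (clock V^\-%R x w (s k)) * (phi (x + w (s k))%R)%:E).
    by apply: eq_integral => w _; rewrite weight_zero_killing.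
  have mak : measurable_fun setT (fun w : path => (phi (x + w (s k))%R)%:E) by apply/measurable_EFinP; exact: bak.1.
  have ak0 (w : path) : 0 <= (phi (x + w (s k))%R)%:E by rewrite lee_fin ltW.
  have mc := measurable_cst M%:E : measurable_fun setT (fun _ : path => M%:E).
  have M0' : 0 <= M%:E by rewrite lee_fin ltW.
  rewrite E1 E2 /a EFin_Rintegral_bmeas// -[X in _ + X <= _](integral_prob_cst mu) -!ge0_integralD//;
    try (by move=> w _; rewrite mule_ge0 ?expeR_ge0); try (by apply: emeasurable_funM).
  apply: ge0_le_integral => //.
  - by move=> w _; rewrite adde_ge0// mule_ge0 ?expeR_ge0.
  - by apply: emeasurable_funD => //; apply: emeasurable_funM.
  - by apply: emeasurable_funD => //; apply: emeasurable_funM.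
  move=> w _; have := clock_ge0 x w (s k) Vm0.
  have := phi_le (x + w (s k))%R; move: (phi _) (phi_gt0 (x + w (s k))%R) => p p0 pM.
  case: (clock _ _ _ _) => //= [b b0|_]; last by rewrite gt0_muley ?lte_fin// addey ?leey.
  rewrite -!EFinM -!EFinD lee_fin; have b1 : (1 <= expR b)%R by rewrite -expR0 ler_expR -lee_fin.
  have h : (0 <= (expR b - 1) * (M - p))%R by rewrite mulr_ge0// subr_ge0.
  by move: h; rewrite mulrBl mul1r mulrBr; lra.
have Hs : \int[mu]_w clock V^\-%R x w (s k) <= (e / 2 / (M * C + 1))%:E.
  apply: le_trans (Htau x); apply: ge0_le_integral; first by [].
  - by move=> w _; exact: clock_ge0.
  - by apply: (@measurable_clock0 R n _ path _ (fun=> x) id (fun=> s k)).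
  - by apply: (@measurable_clock0 R n _ path _ (fun=> x) id (fun=> tau)).
  by move=> w _; apply: clock_mono => //; exact: ltW.
have Hc : fk zero_rate V^\-%R (s k) one x <= (1 + C * (e / 2 / (M * C + 1)))%:E.
  apply: le_trans (fk_creation_le muL x mVm Vm0 (ltW sk0) C0 _) _.
    move=> r y r0 rs; apply: HC; rewrite ?subr_ge0// (le_trans _ sk1)// gerBl ltW//.
  by rewrite EFinD EFinM leeD2l// lee_wpmul2l ?lee_fin.
have TE : T (s k) ephi x <= fk zero_rate V^\-%R (s k) ephi x by apply: le_fk.
apply: le_trans TE _.
have := le_trans key (leeD2l (a k)%:E (lee_wpmul2l (_ : 0 <= M%:E) Hc)).
have := fk_ge0 mu zero_rate V^\-%R (s k) x ephi0.
case: (fk _ _ _ _ _) => // [q _|_]; last first.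
  by rewrite -EFinM -EFinD => /(_ ltac:(by rewrite lee_fin ltW)).
rewrite -EFinM -!EFinD !lee_fin => /(_ (ltW M0)) h.
have : (M * C * (e / 2 / (M * C + 1)) <= e / 2)%R.
  rewrite mulrCA -[leRHS]mulr1 ler_wpM2l ?(ltW e20)// ler_pdivrMr ?ltr_wpDl ?mulr_ge0 ?(ltW M0)//.
  by rewrite mul1r lerDl.
move: h ak; move: (e / 2 / (M * C + 1))%R => X.
rewrite mulrDr mulr1 (mulrA M C X); move: (M * C * X)%R => Y; lra.
Unshelve. all: by end_near. Qed.

(** At every point [T t phi = exp (- lambda (t - s)) T s phi], because [T s] ignores null sets; now
    [s] tends to 0 and [ground_state_time0] bounds [T s phi]. *)
Lemma ground_state_le t x : (0 < t)%R -> T t ephi x <= (expR (- lambda * t) * phi x)%:E.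
Proof.
move=> t0.
have main e : (0 < e)%R -> exists2 s, (0 < s)%R && (s < t)%R & (s <= e)%R /\ T s ephi x <= (phi x + e)%:E.
  move=> e0; have h1 := ground_state_time0 x e0.
  have h2 : \forall k \near \oo, (k.+1%:R^-1 < Num.min t e)%R.
    by apply: (cvgr_lt _ (@cvg_harmonic R)); rewrite lt_min t0.
  have [k [h3 h4]] : exists k : nat, T (k.+1%:R^-1)%R ephi x <= (phi x + e)%:E /\ (k.+1%:R^-1 < Num.min t e)%R.
    have [k _ H] : \forall k \near \oo, T (k.+1%:R^-1)%R ephi x <= (phi x + e)%:E /\ (k.+1%:R^-1 < Num.min t e)%R.
      by near=> k; split; near: k.
    by exists k; apply: H => /=.
  exists (k.+1%:R^-1)%R; first by rewrite invr_gt0/= ltr0n; move: h4; rewrite lt_min => /andP[].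
  by split => //; move: h4; rewrite lt_min => /andP[_ /ltW].
have shift s : (0 < s)%R -> (s < t)%R -> T t ephi x = (expR (- lambda * (t - s)))%:E * T s ephi x.
  move=> s0 st; have ts : (0 < t - s)%R by rewrite subr_gt0.
  by rewrite -(ground_state_shift x s0 ts) subrKC.
have Tt0 : 0 <= T t ephi x by exact: fk_ge0.
have [r Tr] : exists r : R, T t ephi x = r%:E.
  have [s /andP[s0 st] [_ h]] := main 1%R ltac:(by []).
  have := shift s s0 st; have := fk_ge0 mu V^\+%R V^\-%R s x ephi0.
  move: h; case: (T s ephi x) => // q _ _ ->; by eexists; rewrite -EFinM.
rewrite Tr lee_fin in Tt0 *; pose Q := (r * expR (lambda * t))%R.
have Q0 : (0 <= Q)%R by rewrite mulr_ge0// expR_ge0.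
suff : (Q <= phi x)%R.
  rewrite /Q -ler_pdivlMr ?expR_gt0// -expRN mulNr => /le_trans; apply.
  by rewrite mulrC.
apply/ler_addgt0Pr => e e0.
(* Makes both errors, from [T s phi] and from [exp (- lambda s)], at most [e / 2]. *)
pose k := (Q * `|lambda| + 1)%R.
have k0 : (0 < k)%R by rewrite ltr_wpDl// mulr_ge0.
have ek : (0 < e / 2 / k)%R by rewrite !divr_gt0.
have [s /andP[s0 st] [se h]] := main _ ek.
have := shift s s0 st; rewrite Tr.
move: h (fk_ge0 mu V^\+%R V^\-%R s x ephi0); case: (T s ephi x) => // q; rewrite !lee_fin => h q0.
rewrite -EFinM => -[rE].
have QE : (Q * expR (- lambda * s) = q)%R.
  have ee : (expR (- lambda * (t - s)) * expR (lambda * t) * expR (- lambda * s) = 1)%R.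
    by rewrite -!expRD -[RHS]expR0; congr expR; ring.
  by rewrite -[RHS]mulr1 -ee /Q rE; ring.
have h1 : (1 - `|lambda| * s <= expR (- lambda * s))%R.
  apply: le_trans (expR_ge1Dx _); rewrite lerD2l mulNr lerN2 ler_wpM2r ?(ltW s0)//; exact: ler_norm.
have h2 : (Q * (1 - `|lambda| * s) <= q)%R by rewrite -QE ler_wpM2l.
have k1 : (e / 2 / k <= e / 2)%R.
  by rewrite ler_pdivrMr// ler_peMr ?divr_ge0 ?(ltW e0)// lerDr mulr_ge0.
have h3 : (Q * `|lambda| * s <= e / 2)%R.
  apply: (@le_trans _ _ (k * (e / 2 / k))%R); last by rewrite mulrC divfK// gt_eqF.
  by apply: ler_pM; rewrite ?mulr_ge0 ?(ltW s0)// lerDl.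
move: h2 h h3 k1; rewrite mulrBr mulr1 mulrA.
move: (Q * `|lambda| * s)%R (e / 2 / k)%R (phi x) => X Y p; lra.
Unshelve. all: by end_near. Qed.

Variables (u f : 'rV[R]_n -> R) (c : R).
Hypotheses (mU : measurable_fun setT u) (u0 : forall y, (0 <= u y)%R) (sf : small_creation mu f).
Hypothesis uf : forall y, (u y + V^\- y = V^\+ y + f y)%R.
Hypotheses (c0 : (0 < c)%R) (fc : forall y, f y != 0%R -> (c <= phi y)%R).

Lemma fk_creationE t g x : measurable_fun setT g -> (0 <= t)%R -> T t g x = fk u f t g x.
Proof. by move=> mg t0; apply: (fk_decomposition muL) => // y; rewrite uf. Qed.

Lemma fk_ground_state_le t g x (k : R) : (0 < t)%R -> measurable_fun setT g -> (forall y, 0 <= g y) ->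
  (0 <= k)%R -> (forall y, g y <= (k * phi y)%:E) ->
  fk u zero_rate t g x <= (k * (expR (- lambda * t) * phi x))%:E.
Proof.
move=> t0 mg g0 k0 gk; have [mf f0 _] := sf.
apply: (@le_trans _ _ (fk u f t (fun y => k%:E * ephi y) x)).
  by apply: le_fk => //; apply: emeasurable_funM.
rewrite fkZ ?lee_fin// -fk_creationE ?(ltW t0)// EFinM; apply: lee_wpmul2l; first by rewrite lee_fin.
exact: ground_state_le.
Qed.

(** Duhamel's formula for [T (t + t) phi] contains the potential of [f * T (t + t - s) phi]. Where
    [f] does not vanish, [phi] is at least [c], so the second factor is almost everywhere at least
    [c1], while the total is at most a multiple of [phi]. Keeping only [s <= t] ensures a positive
    remaining time. *)
Lemma creation_ground_state t : (0 < t)%R -> exists2 C : R, (0 <= C)%R &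
  forall x, \int[time t]_s fk u zero_rate s (EFin \o f) x <= (C * phi x)%:E.
Proof.
move=> t0; have [mf f0 _] := sf.
have mEf : measurable_fun setT (EFin \o f) by apply/measurable_EFinP.
have Ef0 y : 0 <= (EFin \o f) y by rewrite lee_fin.
have mz : measurable_fun setT zero_rate by [].
(* A lower bound for [exp (- lambda r) * c] over all remaining times [r <= t + t], whatever the sign
   of [lambda]. *)
pose c1 : R := (expR (- `|lambda| * (t + t)) * c)%R.
have c10 : (0 < c1)%R by rewrite mulr_gt0 ?expR_gt0.
have t20 : (0 < t + t)%R by rewrite addr_gt0.
exists (c1^-1 * expR (- lambda * (t + t)))%R => [|x]; first by rewrite mulr_ge0 ?expR_ge0// invr_ge0 ltW.
pose K s := fk u zero_rate s (fun y => (f y)%:E * fk u f (t + t - s) ephi y) x.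
have mG : measurable_fun setT (fun p : measurableTypeR R * 'rV[R]_n => (f p.2)%:E * fk u f (t + t - p.1) ephi p.2).
  apply: emeasurable_funM; first by apply/measurable_EFinP; exact: measurableT_comp mf measurable_snd.
  by apply: measurable_fk => //; apply: measurable_funB => //; exact: measurable_fst.
have G0 y s : 0 <= (f y)%:E * fk u f (t + t - s) ephi y.
  by apply: mule_ge0; [rewrite lee_fin|exact: fk_ge0].
have mK : measurable_fun setT (K : measurableTypeR R -> \bar R).
  by apply: (measurable_fk_dep mu x mU u0 mz _ mG) => [y|[s y]] //; exact: G0.
have K0 s : 0 <= K s by apply: fk_ge0 => y; exact: G0.
have mF : measurable_fun setT (fun s : measurableTypeR R => fk u zero_rate s (EFin \o f) x).
  exact: (@measurable_fk R n mu _ (measurableTypeR R) u zero_rate (EFin \o f) (fun=> x) id).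
have F0 s : 0 <= fk u zero_rate s (EFin \o f) x by exact: fk_ge0.
have step : c1%:E * \int[time t]_s fk u zero_rate s (EFin \o f) x <= (expR (- lambda * (t + t)) * phi x)%:E.
  apply: le_trans (ground_state_le x t20).
  rewrite fk_creationE ?(ltW t20)// (fk_perturbation muL) ?(ltW t20)//.
  apply: (@le_trans _ _ (\int[time (t + t)]_s K s)); last by rewrite leeDr// fk_ge0.
  rewrite integral_time_split ?(ltW t0)//.
  apply: (@le_trans _ _ (\int[time t]_s K s)); last by rewrite leeDl// integral_ge0.
  rewrite -ge0_integralZl//; last by rewrite lee_fin ltW.
  apply: le_time_pos => //.
  - exact: emeasurable_funM.
  - by move=> s; rewrite mule_ge0 ?lee_fin ?(ltW c10).
  move=> s s0 st; rewrite -fkZ ?lee_fin ?(ltW c10)//.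
  have ts : (0 < t + t - s)%R by rewrite subr_gt0 (le_lt_trans st)// ltrDl.
  apply: le_fk_ae => //.
  - exact: emeasurable_funM.
  - by move=> y; rewrite mule_ge0 ?lee_fin ?(ltW c10).
  - exact: (measurableT_comp mG (measurable_pair1 (s : measurableTypeR R))).
  have := eig ts; apply: filterS => y; rewrite fk_creationE ?(ltW ts)// => -> /=.
  rewrite -!EFinM lee_fin mulrC; have [->|fy] := eqVneq (f y) 0%R; first by rewrite !mul0r.
  apply: ler_wpM2l => //; apply: ler_pM; rewrite ?expR_ge0 ?(ltW c0) ?fc//.
  rewrite ler_expR !mulNr lerN2; apply: (@le_trans _ _ (`|lambda| * (t + t - s))%R).
    by rewrite ler_wpM2r ?(ltW ts)// ler_norm.
  by rewrite ler_wpM2l// gerBl ltW.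
by move: step; rewrite -lee_pdivlMl// -EFinM mulrA.
Qed.

End ground_state_bounds.

Section lower_bound.
Context {R : realType} {n : nat}.

Lemma continuous_gt0_lower (phi : 'rV[R]_n -> R) (r : R) : continuous phi ->
  (forall x, 0 < phi x) -> exists2 c : R, 0 < c & forall y, eball 0 r y -> c <= phi y.
Proof.
move=> cphi phi0; pose A := [set v : 'rV[R]_n | forall i, `[- `|r|, `|r|]%classic (v ord0 i)].
have [|||c _ H] := @EVT_min_rV R n phi A.
- by exists 0 => i; rewrite mxE /= in_itv/= oppr_le0 normr_ge0.
- by apply: (@rV_compact R n (fun=> `[- `|r|, `|r|]%classic)) => i; exact: segment_compact.
- exact: continuous_subspaceT.
exists (phi c) => // y; rewrite /eball/= subr0 => yr; apply: H; rewrite inE => i /=.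
rewrite in_itv/= -ler_norml; apply: le_trans (ltW (lt_le_trans yr (ler_norm r))).
exact: le_coord_enorm.
Qed.

End lower_bound.

(** * Jensen's inequality for the clock *)

Section jensen.
Context {R : realType} {n : nat}.
Local Notation path := (path R n).

(** The tangent inequality [exp (- t v) >= exp (- A) (1 + A - t v)], [A] being the clock and [v] the
    rate along the path: the time integral of the right-hand side is [t * exp (- A)]. *)
Lemma jensen_clock (u : 'rV[R]_n -> R) x (w : path) t : bmeas u -> (0 <= t) ->
  t * expR (- rclock u x w t) <= (\int[time t]_s expR (- (t * u (x + w s)%R)))%R.
Proof.
move=> bu t0; pose v (s : measurableTypeR R) := u (x + w s).
have bv : bmeas (v : measurableTypeR R -> R) by exact: bmeas_along.
have [M M0 vM] := bmeas_bound bv.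
have be : bmeas (fun s : measurableTypeR R => expR (- (t * v s))).
  split; first by apply: measurableT_comp => //; apply: measurableT_comp => //; apply: measurable_funM => //; exact: bv.1.
  exists (expR (t * M)) => s; rewrite ger0_norm ?expR_ge0// ler_expR -mulrN ler_wpM2l//.
  by rewrite lerNl; have := vM s; rewrite ler_norml => /andP[].
set A := rclock u x w t.
have AE : (\int[time t]_s v s)%R = A by [].
have b1 : bmeas (fun s : measurableTypeR R => t * v s) by exact: bmeasZ.
have b2 : bmeas (fun _ : measurableTypeR R => 1 + A) by exact: bmeas_cst.
have b3 : bmeas (fun s : measurableTypeR R => (1 + A) - t * v s) by exact: bmeasB.
have mt : fine (time t setT) = t.
  have := @integral_time_cst R t 1%E t0 lee01; rewrite mul1e.
  have := @integral_cst _ _ _ (time t) _ measurableT 1%E; rewrite /cst mul1e => -> -> //.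
have le : (\int[time t]_s (expR (- A) * ((1 + A) - t * v s)))%R <= (\int[time t]_s expR (- (t * v s)))%R.
  apply: le_Rintegral_bmeas => //; first exact: bmeasZ.
  move=> s; have -> : expR (- (t * v s)) = expR (- A) * expR (A - t * v s) by rewrite -expRD addrA addNr add0r.
  rewrite ler_wpM2l ?expR_ge0// -addrA; exact: expR_ge1Dx.
apply: le_trans le; rewrite RintegralZ_bmeas// RintegralB_bmeas// RintegralZ_bmeas// AE.
rewrite Rintegral_bmeas_cst mt mulrDl mul1r [t * A]mulrC addrK mulrC.
exact: lexx.
Qed.

End jensen.

(** * Sufficiency of the decay condition *)

Section sufficiency.
Context {R : realType} {n : nat}.
Local Notation path := (path R n).
Local Notation leb := (@lebesgue_rV R n).
Implicit Types (u f : 'rV[R]_n -> R) (g : 'rV[R]_n -> \bar R) (x y v : 'rV[R]_n) (w : path) (s t : R).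
Variable mu : probability path R.
Hypothesis muL : levy_law mu.
Local Open Scope ereal_scope.
Local Notation fk := (fk mu).
Local Notation zero_rate := (@zero_rate R n).
Local Notation one := (cst 1 : 'rV[R]_n -> \bar R).
Hypothesis mu_ac : forall t x (N : set 'rV[R]_n), (0 < t)%R -> measurable N -> leb N = 0 ->
  mu [set w : path | N (x + w t)%R] = 0.
Variables (A : 'M[R]_n) (nu : 'rV[R]_n -> R).
Hypothesis J : jump_density nu.
Hypothesis char : (forall t xi th, 0 <= t ->
  (\int[mu]_w cos (dot xi (w t) + th)) = expR (t * exponent A nu xi) * cos th)%R.
Local Notation tame := (tame nu).
Variables (V : 'rV[R]_n -> R) (phi : 'rV[R]_n -> R) (lambda M : R).
Hypotheses (mV : measurable_fun setT V) (sV : small_creation mu V^\-%R).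
Hypothesis sVloc : forall r, small_creation mu (fun y => V^\+ y * \1_(eball 0 r) y)%R.
Hypothesis V_infty : tends_to_pinfty_at_infty V.
Hypotheses (phi_cont : continuous phi) (mphi : measurable_fun setT phi).
Hypotheses (phi_gt0 : forall x, (0 < phi x)%R) (phi_le : forall x, (phi x <= M)%R).
Local Notation T := (fk V^\+%R V^\-%R).
Local Notation ephi := (EFin \o phi).
Hypothesis eig : forall t, (0 < t)%R ->
  {ae leb, forall x, T t ephi x = (expR (- lambda * t) * phi x)%:E}.

Lemma measurable_fk_time u f x : measurable_fun setT u -> (forall y, 0 <= u y)%R ->
  measurable_fun setT f -> (forall y, 0 <= f y)%R ->
  measurable_fun setT (fun s : measurableTypeR R => fk u zero_rate s (EFin \o f) x).
Proof.
move=> mU u0 mf f0; apply: (@measurable_fk R n mu _ (measurableTypeR R) u zero_rate (EFin \o f) (fun=> x) id) => //.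
exact/measurable_EFinP.
Qed.

Lemma fk_EFin_ge0 u s f x : (forall y, 0 <= f y)%R -> 0 <= fk u zero_rate s (EFin \o f) x.
Proof. by move=> f0; apply: fk_ge0 => y; rewrite lee_fin. Qed.

Lemma fk_EFinZ u s (k : R) f x : measurable_fun setT u -> (forall y, 0 <= u y)%R ->
  measurable_fun setT f -> (forall y, 0 <= f y)%R -> (0 <= k)%R ->
  fk u zero_rate s (EFin \o (fun y => k * f y)%R) x = k%:E * fk u zero_rate s (EFin \o f) x.
Proof.
by move=> mU u0 mf f0 k0; rewrite -fkZ//; apply/measurable_EFinP.
Qed.

Lemma integral_time_fkZ u t (k : R) f x : measurable_fun setT u -> (forall y, 0 <= u y)%R ->
  measurable_fun setT f -> (forall y, 0 <= f y)%R -> (0 <= k)%R ->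
  \int[time t]_s fk u zero_rate s (EFin \o (fun y => k * f y)%R) x =
  k%:E * \int[time t]_s fk u zero_rate s (EFin \o f) x.
Proof.
move=> mU u0 mf f0 k0; rewrite -ge0_integralZl//.
- by apply: eq_integral => s _; exact: fk_EFinZ.
- exact: measurable_fk_time.
- by move=> s _; exact: fk_EFin_ge0.
Qed.

Lemma small_creationZ (k : R) f : (0 <= k)%R -> small_creation mu f -> small_creation mu (fun y => k * f y)%R.
Proof.
move=> k0 [mf f0 H]; split => [||e e0]; [exact: measurable_funM|by move=> y; rewrite mulr_ge0|].
have k1 : (0 < k + 1)%R by rewrite ltr_wpDl.
have e1 : (0 < e / (k + 1))%R by rewrite divr_gt0.
have [t t0 Ht] := H _ e1; exists t => // x.
have -> : \int[mu]_w clock (fun y => k * f y)%R x w t = k%:E * \int[mu]_w clock f x w t.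
  rewrite -ge0_integralZl//; last 2 first.
  - by apply: (@measurable_clock0 R n _ path _ (fun=> x) id (fun=> t)).
  - by move=> w _; exact: clock_ge0.
  apply: eq_integral => w _; rewrite /clock -ge0_integralZl//.
    by apply/measurable_EFinP; exact: measurable_along.
  by move=> s _; rewrite lee_fin.
apply: le_trans (lee_wpmul2l _ (Ht x)) _; rewrite ?lee_fin//.
by rewrite mulrA ler_pdivrMr// mulrC ler_wpM2l ?(ltW e0)// lerDl.
Qed.

Lemma confining_decomposition : exists u f, 
  [/\ measurable_fun setT u, (forall y, 0 <= u y)%R, small_creation mu f &
      (forall y, u y + V^\- y = V^\+ y + f y)%R] /\
  [/\ exists2 c : R, (0 < c)%R & forall y, f y != 0%R -> (c <= phi y)%R,
      forall y, eball 0%R 1 y -> (u y <= 2 * f y)%R /\ (1 <= f y)%R &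
      forall y, (V y <= u y)%R].
Proof.
have [r Hr] := V_infty 0%R.
pose B := eball (0 : 'rV[R]_n) (Num.max 1 (r + 1))%R.
have mB : measurable B by exact: measurable_eball.
have mi : measurable_fun setT (\1_B : _ -> R) by exact: measurable_indic.
pose f y := ((`|V y| + 1) * \1_B y)%R.
have f0 y : (0 <= f y)%R by rewrite mulr_ge0// addr_ge0.
have mf : measurable_fun setT f.
  by apply: measurable_funM => //; apply: measurable_funD => //; exact: measurableT_comp.
have fB y : B y -> f y = (`|V y| + 1)%R by move=> By; rewrite /f indicE mem_set// mulr1.
have VB y : ~ B y -> f y = 0%R /\ (0 < V y)%R.
  move=> By; rewrite /f indicE memNset// mulr0; split => //; apply: Hr; rewrite ltNge.
  apply/negP => h; apply: By; rewrite /B /eball/= subr0 lt_max; apply/orP; right.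
  by rewrite (le_lt_trans h)// ltrDl.
have VE y : V y = (V^\+ y - V^\- y)%R by rewrite -{1}(funrposBneg V).
exists (fun y => V y + f y)%R, f; split; split.
- exact: measurable_funD.
- move=> y; have [By|/VB[-> /ltW]] := pselect (B y); last by rewrite addr0.
  by rewrite fB//; have := ler_norm (- V y)%R; rewrite normrN; lra.
- apply: (@small_creation_le R n mu f (fun y => V^\- y + (V^\+ y * \1_B y + \1_B y))%R mf f0).
    move=> y; rewrite /f; have [h0 h1] := (funrneg_ge0 V y, funrpos_ge0 V y).
    have -> : (`|V y| = V^\+ y + V^\- y)%R by have := congr1 (fun h => h y) (funrposDneg V) => /= <-.
    move: (V^\+ y)%R (V^\- y)%R h0 h1 => p q; rewrite indicE; case: (y \in B) => /=; rewrite ?mulr1 ?mulr0 ?addr0; lra.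
  have s1 : small_creation mu (\1_B : 'rV[R]_n -> R).
    apply: (@small_creation_bounded R n mu _ 1%R mi) => y; rewrite indicE; case: (y \in B) => //=.
  exact: (small_creationD sV (small_creationD (sVloc _) s1)).
- by move=> y; rewrite {1}VE; lra.
- have [c c0 Hc] := continuous_gt0_lower (Num.max 1 (r + 1))%R phi_cont phi_gt0.
  exists c => // y fy; apply: Hc; apply: contrapT => /VB[f0' _]; by rewrite f0' eqxx in fy.
- move=> y y1; have By : B y by move: y1; rewrite /B /eball/= => /lt_le_trans; apply; rewrite le_max lexx.
  by rewrite fB//; have := ler_norm (V y); have := normr_ge0 (V y); split; lra.
- by move=> y; rewrite lerDl.
Qed.

Section decomposed.
Variables (u f : 'rV[R]_n -> R) (c : R).
Hypotheses (mU : measurable_fun setT u) (u0 : forall y, (0 <= u y)%R) (sf : small_creation mu f).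
Hypothesis uf : forall y, (u y + V^\- y = V^\+ y + f y)%R.
Hypotheses (c0 : (0 < c)%R) (fc : forall y, f y != 0%R -> (c <= phi y)%R).
Hypothesis uf1 : forall y, eball 0%R 1 y -> (u y <= 2 * f y)%R /\ (1 <= f y)%R.
Hypothesis Vu : forall y, (V y <= u y)%R.

(** [fk_bump_unbounded] bounds the potential of [tame] by terms supported in the unit ball. There
    [phi] is bounded below and [2 u + C <= (4 + C) f], so the terminal term and the potential are
    each at most a multiple of [phi]. *)
Lemma tame_ground_state t : (0 < t)%R -> exists2 C : R, (0 <= C)%R &
  forall x, \int[time t]_s fk u zero_rate s (EFin \o tame) x <= (C * phi x)%:E.
Proof.
move=> t0; have [mf f0 _] := sf.
have [chi [a0 [lam [k [C [[_ _ k0 C0] _ _ _ sub]]]]]] := fk_bump_unbounded muL J char.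
have [D D0 HD] := creation_ground_state muL mu_ac mV sV phi_cont mphi phi_gt0 phi_le eig mU u0 sf uf c0 fc t0.
have [c' c'0 Hc'] := continuous_gt0_lower 1 phi_cont phi_gt0.
have mb := measurable_eball (0 : 'rV[R]_n) 1.
have mi : measurable_fun setT (\1_(eball (0 : 'rV[R]_n) 1) : _ -> R) by exact: measurable_indic.
pose F y : R := ((2 * u y + C) * \1_(eball (0 : 'rV[R]_n) 1) y)%R.
have mF : measurable_fun setT F.
  by apply: measurable_funM => //; apply: measurable_funD => //; exact: measurable_funM.
have F0 y : (0 <= F y)%R by rewrite mulr_ge0// addr_ge0// mulr_ge0.
have C40 : (0 <= 4 + C)%R by rewrite addr_ge0.
pose F' y : R := ((4 + C) * f y)%R.
have mF' : measurable_fun setT F' by exact: measurable_funM.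
have F'0 y : (0 <= F' y)%R by rewrite mulr_ge0.
have FF y : (F y <= F' y)%R.
  rewrite /F /F' indicE; have [y1|y1] := pselect (eball 0%R 1 y); last by rewrite memNset// mulr0 mulr_ge0.
  rewrite mem_set// mulr1; have [h1 h2] := uf1 y1.
  by have : (C * 1 <= C * f y)%R by [rewrite ler_wpM2l]; rewrite mulr1 mulrDl; lra.
pose K := (2 / c' * expR (- lambda * t) + (4 + C) * D)%R.
exists (K / k)%R => [|x].
  by rewrite divr_ge0 ?(ltW k0)// addr_ge0// ?mulr_ge0 ?expR_ge0// invr_ge0 ltW.
suff : k%:E * \int[time t]_s fk u zero_rate s (EFin \o tame) x <= (K * phi x)%:E.
  by rewrite -lee_pdivlMl// -EFinM mulrA [(k^-1 * K)%R]mulrC.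
apply: le_trans (sub u t x mU u0 (ltW t0) _) _.
  apply: (@le_lt_trans _ _ (\int[mu]_w clock F' x w t)).
    apply: ge0_le_integral => //.
    - by move=> w _; exact: clock_ge0.
    - by apply: (@measurable_clock0 R n _ path _ (fun=> x) id (fun=> t)).
    - by apply: (@measurable_clock0 R n _ path _ (fun=> x) id (fun=> t)).
    by move=> w _; exact: le_clock.
  by apply: (small_creation_clock muL); [exact: small_creationZ|exact: ltW].
rewrite mulrDl EFinD; apply: leeD.
  rewrite -mulrA.
  apply: (fk_ground_state_le muL mu_ac mV sV phi_cont mphi phi_gt0 phi_le eig mU u0 sf uf) => //.
  - by apply/measurable_EFinP; exact: measurable_funM.
  - by rewrite divr_ge0// ltW.
  move=> y; rewrite lee_fin indicE; have [y1|y1] := pselect (eball 0%R 1 y).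
    by rewrite mem_set// mulr1 mulrAC ler_pdivlMr// ler_pM2l// Hc'.
  by rewrite memNset// mulr0 mulr_ge0 ?divr_ge0 ?(ltW c'0)// ltW.
apply: (@le_trans _ _ (\int[time t]_s fk u zero_rate s (EFin \o F') x)).
  exact: (@le_fk_time R n mu u u F F' t x mU u0 mU u0 mF F0 mF' F'0 (fun=> lexx _) FF).
rewrite integral_time_fkZ// -mulrA EFinM; apply: lee_wpmul2l (HD x); by rewrite lee_fin.
Qed.

Lemma fk_killing_mono s t x : (0 <= s)%R -> (s <= t)%R -> fk u zero_rate t one x <= fk u zero_rate s one x.
Proof.
move=> s0 st; apply: ge0_le_integral.
- by [].
- by move=> w _; rewrite mule_ge0 ?weight_ge0 ?lee01.
- exact: measurable_fk_integrand.
- exact: measurable_fk_integrand.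
move=> w _; rewrite !weight_zero_creation lee_wpmul2r ?lee01// lee_expeR leeN2; exact: clock_mono.
Qed.

(* Jensen's inequality bounds the survival probability by the time average of
   the expectations of [expR (- t u)]. *)
Lemma survival_tame t (C1 : R) : (0 < t)%R -> (0 <= C1)%R ->
  (forall y, expR (- (t * u y)) <= C1 * tame y)%R ->
  exists2 C : R, (0 <= C)%R & forall x, fk u zero_rate t one x <= (C * tame x)%:E.
Proof.
move=> t0 C10 H; have [K K0 HK] := fk_smooth_tame muL J char.
have [a [b [a0 b0 ab]]] := smooth_tame_cmp J.
have mtame := measurable_tame J; have tame0 y : (0 <= tame y)%R by exact/ltW/tame_gt0.
have mh := measurable_smooth_tame J.
have h0 y : (0 <= smooth_tame nu y)%R by exact/ltW/(smooth_tame_gt0 J).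
have mz : measurable_fun setT zero_rate by [].
(* The free semigroup lets the smoothed density grow at most like [exp (K s)], so the expected clock
   of [tame] is at most a multiple of [tame]. *)
have P x : \int[mu]_w clock tame x w t <= (a^-1 * b * expR (K * t) * t * tame x)%:E.
  rewrite -(integral_time_fk_free mu t x mtame tame0).
  have E0 : (0 <= a^-1 * b * expR (K * t) * tame x)%R.
    by rewrite !mulr_ge0 ?expR_ge0 ?invr_ge0 ?(ltW a0) ?(ltW b0).
  apply: (@le_trans _ _ (\int[time t]_s (a^-1 * b * expR (K * t) * tame x)%:E)); last first.
    by rewrite (integral_time_cst (ltW t0)) ?lee_fin// mulrAC.
  apply: le_time_pos => //.
  - exact: measurable_fk_time.
  - by move=> s; exact: fk_EFin_ge0.
  move=> s s0 st.
  have bz : bmeas zero_rate by exact: bmeas_cst.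
  have [hs _] := HK zero_rate s x bz (fun=> lexx _) (ltW s0).
  apply: (@le_trans _ _ (fk zero_rate zero_rate s (EFin \o (fun y => a^-1 * smooth_tame nu y)%R) x)).
    apply: le_fk => //.
    - exact/measurable_EFinP.
    - by apply/measurable_EFinP; exact: measurable_funM.
    by move=> y; rewrite lee_fin ler_pdivlMl//; have /andP[] := ab y.
  rewrite fk_EFinZ ?invr_ge0 ?(ltW a0)// -!mulrA EFinM; apply: lee_wpmul2l; first by rewrite lee_fin invr_ge0 ltW.
  move: hs; rewrite mulNr expRN muleC -lee_pdivlMr ?invr_gt0 ?expR_gt0// invrK => hs.
  apply: le_trans hs _; rewrite -EFinM lee_fin mulrCA [leLHS]mulrC.
  apply: ler_pM => //; rewrite ?expR_ge0 ?ler_expR ?ler_wpM2l//.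
  by have /andP[] := ab x.
pose C := (C1 * (a^-1 * b * expR (K * t)))%R.
have C0 : (0 <= C)%R by rewrite !mulr_ge0 ?expR_ge0 ?invr_ge0 ?(ltW a0) ?(ltW b0).
exists C => // x; apply/lee_addgt0Pr => e e0.
(* Truncating [u] at level [m] keeps the rate bounded, as [jensen_clock] asks, at the price of an
   error [exp (- t m) <= e]. *)
pose m := (Num.truncn (e^-1 / t)).+1.
have mpos : (0 < (m%:R : R))%R by rewrite ltr0n.
have me : (expR (- (t * m%:R)) <= e)%R.
  have h : (e^-1 <= t * m%:R)%R by rewrite mulrC -ler_pdivrMr//; exact/ltW/truncnS_gt.
  rewrite expRN -[leRHS]invrK lef_pV2 ?posrE ?expR_gt0 ?invr_gt0//.
  by apply: le_trans h _; apply: le_trans (expR_ge1Dx _); rewrite lerDr.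
have bum := bmeas_truncate m mU u0; have um0 y : (0 <= truncate u m y)%R by exact: truncate_ge0.
have ptw w : t%:E * expeR (- clock u x w t) <= C1%:E * clock tame x w t + (e * t)%:E.
  apply: (@le_trans _ _ (t%:E * expeR (- clock (truncate u m) x w t))).
    rewrite lee_pmul2l ?lte_fin// lee_expeR leeN2; apply: le_clock => //; first exact: bum.1.
    by move=> y; exact: truncate_le.
  rewrite -rclockE//= -EFinM; apply: (@le_trans _ _ (\int[time t]_s expR (- (t * truncate u m (x + w s)%R)))%R%:E).
    by rewrite lee_fin; exact: jensen_clock bum (ltW t0).
  have bv := bmeas_along x w bum; have [N N0 vN] := bmeas_bound bv.
  have be : bmeas (fun s : measurableTypeR R => expR (- (t * truncate u m (x + w s)%R)))%R.
    split; first by apply: measurableT_comp => //; apply: measurableT_comp => //; apply: measurable_funM => //; exact: bv.1.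
    exists 1%R => s; rewrite ger0_norm ?expR_ge0// -expR0 ler_expR oppr_le0 mulr_ge0 ?(ltW t0)//.
  rewrite EFin_Rintegral_bmeas//.
  have mc : measurable_fun setT (fun s : measurableTypeR R => (tame (x + w s)%R)%:E).
    by apply/measurable_EFinP; exact: measurable_along.
  have tc s : 0 <= (tame (x + w s)%R)%:E by rewrite lee_fin.
  rewrite /clock -ge0_integralZl// ?lee_fin// EFinM -(integral_time_cst (ltW t0)) ?lee_fin ?(ltW e0)//.
  have mC : measurable_fun setT (fun s : measurableTypeR R => C1%:E * (tame (x + w s)%R)%:E) by exact: emeasurable_funM.
  have C1c s : 0 <= C1%:E * (tame (x + w s)%R)%:E by rewrite mule_ge0// lee_fin.
  rewrite -ge0_integralD//; last by move=> s _; rewrite lee_fin ltW.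
  apply: ge0_le_integral => //.
  - by apply/measurable_EFinP; exact: be.1.
  - exact: emeasurable_funD.
  move=> s _; rewrite -EFinM -EFinD lee_fin; have hH := H (x + w s)%R; have ht := tame0 (x + w s)%R.
  rewrite /truncate /Num.min; case: ifPn => _; first by apply: le_trans hH _; rewrite lerDl ltW.
  by apply: le_trans me _; rewrite lerDr mulr_ge0.
have mone : measurable_fun setT one by exact: measurable_cst.
have step : t%:E * fk u zero_rate t one x <= (t * (C * tame x + e))%:E.
  have mcl (h : 'rV[R]_n -> R) : measurable_fun setT h -> (forall y, 0 <= h y)%R -> measurable_fun setT (fun w => clock h x w t).
    by move=> mh' h0'; apply: (@measurable_clock0 R n _ path _ (fun=> x) id (fun=> t)).
  have mu1 : measurable_fun setT (fun w : path => weight u zero_rate x w t * one (x + w t)%R) by exact: measurable_fk_integrand.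
  rewrite /fk -ge0_integralZl//; last 2 first.
  - by move=> w _; rewrite mule_ge0 ?weight_ge0 ?lee01.
  - by rewrite lee_fin ltW.
  apply: (@le_trans _ _ (\int[mu]_w (C1%:E * clock tame x w t + (e * t)%:E))).
    apply: ge0_le_integral => //.
    - by move=> w _; apply: mule_ge0; [rewrite lee_fin ltW|rewrite mule_ge0 ?weight_ge0 ?lee01].
    - exact: emeasurable_funM.
    - by apply: emeasurable_funD => //; apply: emeasurable_funM => //; exact: mcl.
    by move=> w _; rewrite mule1 weight_zero_creation; exact: ptw.
  rewrite ge0_integralD//; last 3 first.
  - by move=> w _; rewrite mule_ge0 ?clock_ge0// lee_fin.
  - by apply: emeasurable_funM => //; exact: mcl.
  - by move=> w _; rewrite lee_fin mulr_ge0 ?(ltW e0) ?(ltW t0).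
  rewrite integral_prob_cst ge0_integralZl ?lee_fin//; last 2 first.
  - exact: mcl.
  - by move=> w _; exact: clock_ge0.
  rewrite mulrDr EFinD [(t * e)%R]mulrC; apply: leeD => //.
  apply: le_trans (lee_wpmul2l _ (P x)) _; rewrite ?lee_fin// /C le_eqVlt; apply/orP; left; apply/eqP; ring.
move: step; rewrite -lee_pdivlMl// -EFinM mulKf ?gt_eqF// EFinD//.
Qed.

(** Survival without creation up to [t + t] is split at every [s <= t]: the part after [s] lasts at
    least [t], hence is at most [C2 * tame], and averaging over [s] leaves the potential of [tame],
    at most a multiple of [phi]. Creation is added by Duhamel's formula, the gauge bound and
    [creation_ground_state]. *)
Lemma decay_ground_state (k r : R) : (0 < k)%R ->
  (forall x, r <= enorm x -> k * `|ln (nu x)| <= V x)%R ->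
  exists C : R, forall x, T (4 / k) one x <= (C * phi x)%:E.
Proof.
move=> k0 Hk; have [mf f0 _] := sf.
(* Half of the final time [4 / k]; since [t * k >= 1], [exp (- t u)] is at most [nu] far out. *)
pose t := (2 / k)%R; have t0 : (0 < t)%R by rewrite divr_gt0.
have tt : (4 / k = t + t)%R by rewrite /t -mulrDl; congr (_ / _)%R; ring.
have [a [b [a0 b0 ab]]] := smooth_tame_cmp J.
have [L L0 hL] := smooth_tame_lip J.
have [c1 c10 Hc1] := continuous_gt0_lower (Num.max 1 r)%R (lipschitz_continuous_rV hL) (smooth_tame_gt0 J).
have tame0 y : (0 <= tame y)%R by exact/ltW/tame_gt0.
have decay y : (expR (- (t * u y)) <= (1 + b / c1) * tame y)%R.
  have bc : (0 <= b / c1)%R by rewrite divr_ge0 ?ltW.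
  have [yr|yr] := ltP (enorm y) (Num.max 1 r)%R.
    have hy : (c1 <= b * tame y)%R.
      by have /andP[_ h] := ab y; apply: le_trans h; apply: Hc1; rewrite /eball/= subr0.
    apply: (@le_trans _ _ 1%R); first by rewrite -expR0 ler_expR oppr_le0 mulr_ge0 ?(ltW t0).
    rewrite mulrDl mul1r; apply: (@le_trans _ _ (b / c1 * tame y)%R); last by rewrite lerDr.
    by rewrite mulrAC ler_pdivlMr// mul1r.
  move: yr; rewrite ge_max => /andP[y1 yr].
  have y2 : (1 / 2 < enorm y)%R by apply: lt_le_trans y1; lra.
  have nu0 : (0 < nu y)%R by rewrite -(tameE nu y2) tame_gt0.
  apply: (@le_trans _ _ (tame y)); last by rewrite mulrDl mul1r lerDl mulr_ge0.
  rewrite (tameE nu y2) -[leRHS](lnK nu0) ler_expR.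
  apply: (@le_trans _ _ (- `|ln (nu y)|)%R); last by rewrite lerNl -normrN ler_norm.
  rewrite lerN2; apply: (@le_trans _ _ (t * (k * `|ln (nu y)|))%R).
    by rewrite mulrA /t divfK ?gt_eqF// ler_peMl// ler1n.
  by rewrite ler_wpM2l ?(ltW t0)// (le_trans (Hk y yr)).
have bc1 : (0 <= 1 + b / c1)%R by rewrite addr_ge0 ?divr_ge0 ?ltW.
have [C2 C20 HC2] := survival_tame t0 bc1 decay.
have [C3 C30 HC3] := tame_ground_state t0.
have t20 : (0 < t + t)%R by rewrite addr_gt0.
have [D D0 HD] := creation_ground_state muL mu_ac mV sV phi_cont mphi phi_gt0 phi_le eig mU u0 sf uf c0 fc t20.
have [C4 C40 HC4] := small_creation_gauge muL sf (t + t)%R.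
have mtame := measurable_tame J.
have mz : measurable_fun setT zero_rate by [].
have S x : fk u zero_rate (t + t) one x <= (t^-1 * (C2 * C3) * phi x)%:E.
  set Y := fk _ _ _ _ _; have Y0 : 0 <= Y by exact: fk_ge0.
  suff : t%:E * Y <= (C2 * C3 * phi x)%:E by rewrite -lee_pdivlMl// -EFinM !mulrA.
  (* [t * Y] becomes the time integral of a constant, so that the integrands can be compared for
     each [s]. *)
  rewrite muleC -(integral_time_cst (ltW t0) Y0).
  apply: (@le_trans _ _ (C2%:E * \int[time t]_s fk u zero_rate s (EFin \o tame) x)); last first.
    by rewrite -mulrA EFinM; apply: lee_wpmul2l (HC3 x); rewrite lee_fin.
  rewrite -ge0_integralZl ?lee_fin//; last 2 first.
  - exact: measurable_fk_time.
  - by move=> s _; exact: fk_EFin_ge0.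
  apply: le_time_pos => //.
  - by apply: emeasurable_funM => //; exact: measurable_fk_time.
  - by move=> s; rewrite mule_ge0 ?lee_fin ?fk_EFin_ge0.
  move=> s s0 st; rewrite -fk_EFinZ// /Y.
  have ts : (0 <= t + t - s)%R by rewrite subr_ge0 (le_trans st)// lerDl ltW.
  rewrite -(subrKC s (t + t)%R) fk_semigroup ?(ltW s0)//.
  apply: (@le_fk R n mu u u zero_rate zero_rate s _ _ x mU u0 mz (fun=> lexx _) mU u0 mz (fun=> lexx _));
    [|by move=> y; exact: fk_ge0| |by []|by []|].
  - exact: (@measurable_fk R n mu _ _ u zero_rate one id (fun=> (t + t - s)%R)).
  - by apply/measurable_EFinP; exact: measurable_funM.
  move=> y; apply: le_trans (HC2 y); apply: fk_killing_mono; first exact: ltW.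
  by rewrite -addrA lerDl subr_ge0.
exists (t^-1 * (C2 * C3) + C4 * D)%R => x; rewrite tt.
rewrite (fk_creationE muL mV sV mU u0 sf uf)// ?(ltW t20)//.
apply: le_trans (@fk_perturbation_le R n mu muL u f (t + t)%R one x (fun=> C4%:E) f _ _ _ _ _ _ _ _ _ _ _ _) _ => //.
- exact: ltW.
- move=> s y s0 st; rewrite muleC; apply: lee_wpmul2r; first by rewrite lee_fin.
  have h1 : (0 <= t + t - s)%R by rewrite subr_ge0.
  have h2 : (t + t - s <= t + t)%R by rewrite gerBl ltW.
  apply: le_trans (HC4 _ y h1 h2).
  exact: (@le_fk R n mu u zero_rate f f _ one one y mU u0 mf f0 mz (fun=> lexx _) mf f0 (measurable_cst _) (fun=> lee01)).
rewrite mulrDl EFinD; apply: leeD; first exact: S.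
rewrite ge0_integralZl ?lee_fin//; last 2 first.
- exact: measurable_fk_time.
- by move=> s _; exact: fk_EFin_ge0.
by rewrite -mulrA EFinM; apply: lee_wpmul2l (HD x); rewrite lee_fin.
Qed.

End decomposed.

Lemma decay_GSD (k r : R) : (0 < k)%R ->
  (forall x, r <= enorm x -> k * `|ln (nu x)| <= V x)%R ->
  exists C : R, forall x, T (4 / k) one x <= (C * phi x)%:E.
Proof.
have [u [f [[mU u0 sf uf] [[c c0 fc] uf1 Vu]]]] := confining_decomposition.
exact: (decay_ground_state mU u0 sf uf c0 fc uf1 Vu).
Qed.

End sufficiency.

(** * Necessity of the decay condition *)

Section necessity.
Context {R : realType} {n : nat}.
Local Notation path := (path R n).
Local Notation leb := (@lebesgue_rV R n).
Implicit Types (u f : 'rV[R]_n -> R) (g : 'rV[R]_n -> \bar R) (x y v : 'rV[R]_n) (w : path) (s t : R).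
Variable mu : probability path R.
Hypothesis muL : levy_law mu.
Local Open Scope ereal_scope.
Local Notation fk := (fk mu).
Local Notation zero_rate := (@zero_rate R n).
Local Notation one := (cst 1 : 'rV[R]_n -> \bar R).
Hypothesis mu_ac : forall t x (N : set 'rV[R]_n), (0 < t)%R -> measurable N -> leb N = 0 ->
  mu [set w : path | N (x + w t)%R] = 0.
Variables (A : 'M[R]_n) (nu : 'rV[R]_n -> R).
Hypothesis J : jump_density nu.
Hypothesis char : (forall t xi th, 0 <= t ->
  (\int[mu]_w cos (dot xi (w t) + th)) = expR (t * exponent A nu xi) * cos th)%R.
Local Notation tame := (tame nu).
Variables (V : 'rV[R]_n -> R) (phi : 'rV[R]_n -> R) (lambda M : R).
Hypotheses (mV : measurable_fun setT V) (sV : small_creation mu V^\-%R).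
Hypothesis sVloc : forall r, small_creation mu (fun y => V^\+ y * \1_(eball 0 r) y)%R.
Hypothesis V_infty : tends_to_pinfty_at_infty V.
Hypotheses (phi_cont : continuous phi) (mphi : measurable_fun setT phi).
Hypotheses (phi_gt0 : forall x, (0 < phi x)%R) (phi_le : forall x, (phi x <= M)%R).
Local Notation T := (fk V^\+%R V^\-%R).
Local Notation ephi := (EFin \o phi).
Hypothesis eig : forall t, (0 < t)%R ->
  {ae leb, forall x, T t ephi x = (expR (- lambda * t) * phi x)%:E}.


Lemma clock_time0 u x w : measurable_fun setT u -> (forall y, 0 <= u y)%R -> clock u x w 0 = 0.
Proof.
move=> mU u0; rewrite /clock (@eq_time R 0%R _ (fun=> (u x)%:E)) ?integral_time_cst ?mule0 ?lee_fin//.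
- by apply/measurable_EFinP; exact: measurable_along.
- by move=> s; rewrite lee_fin.
- by move=> s s0 s1; have -> : s = 0%R by [apply/eqP; rewrite eq_le s0 s1]; rewrite path0// addr0.
Qed.

Lemma fk_time0 u f g x : measurable_fun setT u -> (forall y, 0 <= u y)%R ->
  measurable_fun setT f -> (forall y, 0 <= f y)%R -> fk u f 0 g x = g x.
Proof.
move=> mU u0 mf f0; rewrite /fk -[RHS](integral_prob_cst mu); apply: eq_integral => w _.
by rewrite /weight !clock_time0// oppe0 expeR0 !mul1e path0// addr0.
Qed.

Lemma fk_killing_shift (a : R) u u' s g x :
  measurable_fun setT u -> (forall y, 0 <= u y)%R ->
  measurable_fun setT u' -> (forall y, 0 <= u' y)%R -> (0 <= a)%R -> (0 <= s)%R ->
  measurable_fun setT g -> (forall y, 0 <= g y) ->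
  (forall y, a + u' y <= u y)%R ->
  fk u zero_rate s g x <= (expR (- (a * s)))%:E * fk u' zero_rate s g x.
Proof.
move=> mU u0 mU' u'0 a0 s0 mg g0 au; have mz : measurable_fun setT zero_rate by [].
rewrite [in leRHS]/fk -ge0_integralZl//; last 2 first.
- exact: measurable_fk_integrand.
- by move=> w _; rewrite mule_ge0 ?weight_ge0.
apply: ge0_le_integral => //.
- by move=> w _; rewrite mule_ge0 ?weight_ge0.
- exact: measurable_fk_integrand.
- by apply: emeasurable_funM => //; exact: measurable_fk_integrand.
move=> w _; rewrite muleA; apply: lee_wpmul2r => //.
rewrite !weight_zero_creation.
have -> : (expR (- (a * s)))%:E = expeR (- (a * s)%:E) by [].
rewrite -expeRD lee_expeR -oppeD; last by rewrite ge0_adde_def// inE ?lee_fin ?mulr_ge0 ?clock_ge0.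
rewrite leeN2 EFinM -(integral_time_cst s0) ?lee_fin// /clock -ge0_integralD//; last 2 first.
- by move=> r _; rewrite lee_fin.
- by apply/measurable_EFinP; exact: measurable_along.
apply: ge0_le_integral => //.
- by move=> r _; rewrite -EFinD lee_fin addr_ge0.
- by apply: emeasurable_funD => //; apply/measurable_EFinP; exact: measurable_along.
- by apply/measurable_EFinP; exact: measurable_along.
- by move=> r _; rewrite -EFinD lee_fin.
Qed.

(* The killing rate [m] on a ball outside which [V] is large is compensated by
   an equal creation rate, and then [m] tends to infinity. *)
Lemma ground_state_tame : exists2 C : R, (0 < C)%R & {ae leb, forall x, (phi x <= C * tame x)%R}.
Proof.
have [K K0 HK] := fk_smooth_tame muL J char.
have [a [b [a0 b0 ab]]] := smooth_tame_cmp J.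
have [L L0 hL] := smooth_tame_lip J.
(* [al - lambda] is at least [K], the growth rate of the smoothed density, and at least 1, which
   makes the first term of [main] negligible for large [t]. *)
pose al := (`|lambda| + K + 1)%R.
have al0 : (0 <= al)%R by rewrite !addr_ge0.
have [r Hr] := V_infty al.
pose B := eball (0 : 'rV[R]_n) (r + 1)%R.
have mB : measurable B by exact: measurable_eball.
have [ch ch0 Hch] := continuous_gt0_lower (r + 1)%R (lipschitz_continuous_rV hL) (smooth_tame_gt0 J).
have mi : measurable_fun setT (\1_B : 'rV[R]_n -> R) by exact: measurable_indic.
have i0 (y : 'rV[R]_n) : (0 <= \1_B y :> R)%R by rewrite indicE.
have VB y : ~ B y -> (al < V y)%R.
  move=> By; apply: Hr; rewrite ltNge; apply/negP => h; apply: By.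
  by rewrite /B /eball/= subr0 (le_lt_trans h)// ltrDl.
(* [V2] differs from [V] on the ball only; [f2] creates back what is killed in excess. *)
pose V2 y := Num.max (V y) al; pose f2 y := (V2 y - V y)%R.
have mV2 : measurable_fun setT V2 by exact: measurable_maxr.
have V2al y : (al <= V2 y)%R by rewrite le_max lexx orbT.
have mf2 : measurable_fun setT f2 by exact: measurable_funB.
have f20 y : (0 <= f2 y)%R by rewrite subr_ge0 le_max lexx.
have f2B y : ~ B y -> f2 y = 0%R.
  by move=> /VB h; rewrite /f2 /V2 max_l ?subrr// ltW.
have VE y : V y = (V^\+ y - V^\- y)%R by rewrite -{1}(funrposBneg V).
have sf2 : small_creation mu f2.
  have sc : small_creation mu (fun=> al) by exact: (@small_creation_bounded R n mu _ al).
  apply: (small_creation_le mf2 f20 _ (small_creationD sV sc)) => y.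
  have := funrneg_ge0 V y; have := funrpos_ge0 V y.
  rewrite /f2 /V2 {2}VE /Num.max; case: ifPn => _ h1 h2; last by rewrite VE; lra.
  lra.
pose u' (m : nat) (y : 'rV[R]_n) : R := (m%:R * \1_B y)%R.
have mu' m : measurable_fun setT (u' m) by exact: measurable_funM.
have u'0 m y : (0 <= u' m y)%R by rewrite mulr_ge0.
have bu' m : bmeas (u' m).
  split => //; exists m%:R => y; rewrite ger0_norm// /u' indicE; case: (y \in B) => /=; by rewrite ?mulr1 ?mulr0.
pose u m y := (V2 y + u' m y)%R; pose f m y := (f2 y + u' m y)%R.
have mu_ m : measurable_fun setT (u m) by exact: measurable_funD.
have u0 m y : (0 <= u m y)%R by rewrite addr_ge0// (le_trans al0).
have mf_ m : measurable_fun setT (f m) by exact: measurable_funD.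
have f0 m y : (0 <= f m y)%R by rewrite addr_ge0.
have sf m : small_creation mu (f m).
  have su' : small_creation mu (u' m).
    apply: (@small_creation_bounded R n mu _ m%:R (mu' m) (u'0 m)) => y.
    by rewrite /u' indicE; case: (y \in B) => /=; rewrite ?mulr1 ?mulr0.
  exact: small_creationD sf2 su'.
have uf m y : (u m y + V^\- y = V^\+ y + f m y)%R.
  by rewrite /u /f /f2; have := VE y; move: (V y) (V2 y) (V^\+ y)%R (V^\- y)%R (u' m y) => p1 p2 p3 p4 p5; lra.
have mephi : measurable_fun setT ephi by exact/measurable_EFinP.
have ephi0 y : 0 <= ephi y by rewrite lee_fin ltW.
have M0 : (0 < M)%R by apply: lt_le_trans (phi_le 0%R).
have mz : measurable_fun setT zero_rate by [].
have mh := measurable_smooth_tame J; have h0 y : (0 <= smooth_tame nu y)%R by exact/ltW/(smooth_tame_gt0 J).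
have alK : (K <= al - lambda)%R by have := ler_norm lambda; rewrite /al; lra.
have al1 : (1 <= al - lambda)%R by have := ler_norm lambda; rewrite /al; lra.
have mfk m (g : 'rV[R]_n -> R) x : measurable_fun setT g -> (forall y, 0 <= g y)%R ->
  measurable_fun setT (fun s : measurableTypeR R => fk (u' m) zero_rate s (EFin \o g) x).
  by move=> mg g0; exact: measurable_fk_time.
have mexp (k : R) : measurable_fun setT (fun s : measurableTypeR R => (expR (k * s))%:E).
  by apply/measurable_EFinP; apply: measurableT_comp => //; exact: measurable_funM.
(* Three terms: no creation up to [t], where killing at rate at least [al] acts; creation at rate
   [m] on [B], whose discounted potential is at most [smooth_tame nu x / ch] for every [m] because
   killing on [B] has the same rate; and creation at rate [f2], whose potential tends to 0 as [m]
   grows. *)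
have main x t m : (0 < t)%R -> T t ephi x <= (M * expR (- (al * t)))%:E +
    (M * expR (- lambda * t))%:E * ((smooth_tame nu x / ch)%:E + \int[time t]_s fk (u' m) zero_rate s (EFin \o f2) x).
  move=> t0; rewrite (fk_creationE muL mV sV (mu_ m) (u0 m) (sf m) (uf m))// ?(ltW t0)//.
  pose c (s : measurableTypeR R) : \bar R := (M * expR (- lambda * (t - s)))%:E.
  have mc : measurable_fun setT c.
    apply/measurable_EFinP; apply: measurable_funM => //; apply: measurableT_comp => //.
    by apply: measurable_funM => //; exact: measurable_funB.
  have c0 s : 0 <= c s by rewrite lee_fin mulr_ge0 ?expR_ge0 ?(ltW M0).
  have H s y : (0 < s)%R -> (s <= t)%R -> (f m y)%:E * fk (u m) (f m) (t - s) ephi y <= c s * (f m y)%:E.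
    move=> s0 st; rewrite muleC; apply: lee_wpmul2r; first by rewrite lee_fin.
    have [ts|ts] := ltP 0%R (t - s)%R.
      rewrite -(fk_creationE muL mV sV (mu_ m) (u0 m) (sf m) (uf m))// ?(ltW ts)//.
      apply: le_trans (ground_state_le muL mu_ac mV sV phi_cont mphi phi_gt0 phi_le eig y ts) _.
      by rewrite lee_fin mulrC ler_wpM2r ?expR_ge0.
    have -> : (t - s = 0)%R by apply/eqP; rewrite eq_le ts subr_ge0.
    rewrite fk_time0//; rewrite /c (_ : (t - s = 0)%R); last by apply/eqP; rewrite eq_le ts subr_ge0.
    by rewrite mulr0 expR0 mulr1 lee_fin.
  apply: le_trans (@fk_perturbation_le R n mu muL (u m) (f m) t ephi x c (f m) (mu_ m) (u0 m) (mf_ m) (f0 m)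
    mephi ephi0 (ltW t0) mc c0 (mf_ m) (f0 m) H) _.
  apply: leeD.
    have cz : measurable_fun setT (fun _ : 'rV[R]_n => M%:E) by [].
    apply: le_trans (@fk_killing_shift al (u m) zero_rate t ephi x (mu_ m) (u0 m) mz (fun=> lexx _) al0 (ltW t0) mephi ephi0 _) _.
      by move=> y; rewrite /zero_rate/= addr0 (le_trans (V2al y))// lerDl.
    rewrite [leRHS](_ : _ = (expR (- (al * t)))%:E * M%:E); last by rewrite -EFinM mulrC.
    apply: lee_wpmul2l; first by rewrite lee_fin expR_ge0.
    rewrite fk_free -[leRHS](integral_prob_cst mu); apply: ge0_le_integral => //.
    - apply: (measurableT_comp mephi); exact: (@measurable_position R n _ path (fun=> x) id (fun=> t)).
    by move=> w _; rewrite lee_fin.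
  pose E (s : measurableTypeR R) := (expR (- K * s))%:E.
  have E0 s : 0 <= E s by rewrite lee_fin expR_ge0.
  have mE : measurable_fun setT E by exact: mexp.
  have Mt0 : 0 <= (M * expR (- lambda * t))%:E by rewrite lee_fin mulr_ge0 ?expR_ge0 ?(ltW M0).
  have F20 s : 0 <= fk (u' m) zero_rate s (EFin \o f2) x by exact: fk_EFin_ge0.
  have U'0 s : 0 <= fk (u' m) zero_rate s (EFin \o u' m) x by exact: fk_EFin_ge0.
  have mF2 := mfk m f2 x mf2 f20.
  have mU'2 := mfk m (u' m) x (mu' m) (u'0 m).
  have mEF2 : measurable_fun setT (fun s : measurableTypeR R => fk (u' m) zero_rate s (EFin \o f2) x).
    by [].
  have mEU : measurable_fun setT (fun s : measurableTypeR R => E s * fk (u' m) zero_rate s (EFin \o u' m) x).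
    exact: emeasurable_funM.
  have EU0 s : 0 <= E s * fk (u' m) zero_rate s (EFin \o u' m) x by exact: mule_ge0.
  apply: (@le_trans _ _ ((M * expR (- lambda * t))%:E * \int[time t]_s (E s * fk (u' m) zero_rate s (EFin \o u' m) x +
      fk (u' m) zero_rate s (EFin \o f2) x))).
    rewrite -ge0_integralZl//; last 2 first.
    - exact: emeasurable_funD.
    - by move=> s _; exact: adde_ge0.
    apply: le_time_pos => //.
    - by apply: emeasurable_funM; [exact: mc|exact: measurable_fk_time].
    - by apply: emeasurable_funM => //; exact: emeasurable_funD.
    - by move=> s; apply: mule_ge0 => //; exact: fk_EFin_ge0.
    - by move=> s; apply: mule_ge0 => //; exact: adde_ge0.
    move=> s s0 st.
    have mEf : measurable_fun setT (EFin \o f m) by exact/measurable_EFinP.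
    have Ef0 y : 0 <= (EFin \o f m) y by rewrite lee_fin.
    have sh := @fk_killing_shift al (u m) (u' m) s (EFin \o f m) x (mu_ m) (u0 m) (mu' m) (u'0 m) al0 (ltW s0) mEf Ef0
      (fun y => lerD (V2al y) (lexx _)).
    apply: le_trans (lee_wpmul2l (c0 s) sh) _.
    have fD : fk (u' m) zero_rate s (EFin \o f m) x = fk (u' m) zero_rate s (EFin \o f2) x + fk (u' m) zero_rate s (EFin \o u' m) x.
      rewrite /fk -ge0_integralD//.
      - by apply: eq_integral => w _; rewrite /= EFinD ge0_muleDr ?lee_fin.
      - by move=> w _; rewrite mule_ge0 ?weight_ge0 ?lee_fin.
      - by apply: measurable_fk_integrand => //; exact/measurable_EFinP.
      - by move=> w _; rewrite mule_ge0 ?weight_ge0 ?lee_fin.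
      - by apply: measurable_fk_integrand => //; exact/measurable_EFinP.
    rewrite muleA fD /c -EFinM.
    have -> : (M * expR (- lambda * (t - s)) * expR (- (al * s)) = M * expR (- lambda * t) * expR (- ((al - lambda) * s)))%R.
      by rewrite -!mulrA -!expRD; congr (_ * expR _)%R; ring.
    rewrite EFinM -muleA; apply: lee_wpmul2l => //.
    have X1 : (expR (- ((al - lambda) * s)) <= expR (- K * s))%R.
      by rewrite ler_expR mulNr lerN2 ler_wpM2r// ltW.
    have X2 : (expR (- ((al - lambda) * s)) <= 1)%R.
      by rewrite -expR0 ler_expR oppr_le0 mulr_ge0 ?(ltW s0)// (le_trans K0).
    rewrite ge0_muleDr// addeC; apply: leeD.
      by apply: lee_wpmul2r => //; rewrite lee_fin.
    by rewrite -[leRHS]mul1e; apply: lee_wpmul2r => //; rewrite lee_fin.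
  apply: lee_wpmul2l => //; rewrite ge0_integralD//; apply: leeD => //.
  have [_ hs] := HK (u' m) t x (bu' m) (u'0 m) (ltW t0).
  have Uh0 y : (0 <= u' m y * smooth_tame nu y)%R by rewrite mulr_ge0.
  have mUh : measurable_fun setT (fun y => u' m y * smooth_tame nu y)%R by exact: measurable_funM.
  suff : ch%:E * \int[time t]_s (E s * fk (u' m) zero_rate s (EFin \o u' m) x) <= (smooth_tame nu x)%:E.
    by rewrite -lee_pdivlMl// -EFinM mulrC.
  apply: le_trans hs; rewrite -ge0_integralZl//; last by rewrite lee_fin ltW.
  apply: le_time_pos.
  - exact: emeasurable_funM.
  - by apply: emeasurable_funM; [exact: mE|exact: (mfk m (fun y => u' m y * smooth_tame nu y)%R x mUh Uh0)].
  - by move=> s; rewrite mule_ge0// lee_fin ltW.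
  - by move=> s; apply: mule_ge0 => //; exact: (fk_EFin_ge0 mu (u' m) s x Uh0).
  move=> s s0 st; rewrite muleCA; apply: lee_wpmul2l => //.
  rewrite -fk_EFinZ ?(ltW ch0)//.
  apply: (@le_fk R n mu (u' m) (u' m) zero_rate zero_rate s _ _ x (mu' m) (u'0 m) mz (fun=> lexx _) (mu' m) (u'0 m) mz (fun=> lexx _));
    [ | | |by []|by []|].
  - by apply/measurable_EFinP; exact: measurable_funM.
  - by move=> y; rewrite lee_fin mulr_ge0// ltW.
  - by apply/measurable_EFinP.
  move=> y; rewrite lee_fin mulrC; have [By|By] := pselect (B y).
    by rewrite ler_wpM2l// Hch.
  by rewrite /u' indicE memNset// mulr0 !mul0r.
exists (M / ch * b)%R; first by rewrite mulr_gt0 ?divr_gt0.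
(* Integer times suffice and need a single null set. *)
have eigk : {ae leb, forall x, forall k : nat, T k.+1%:R ephi x = (expR (- lambda * k.+1%:R) * phi x)%:E}.
  by apply: ae_foralln => k; exact: eig.
apply: filterS eigk => x Hx.
apply: (@le_trans _ _ (M / ch * smooth_tame nu x)%R); last first.
  by rewrite -[leRHS]mulrA ler_wpM2l ?divr_ge0 ?(ltW M0) ?(ltW ch0)//; have /andP[] := ab x.
apply/ler_addgt0Pr => e e0.
(* [t >= M / (e / 2)] gives [M * exp (- t) <= e / 2]. *)
pose k := Num.truncn (M / (e / 2)); pose t : R := k.+1%:R.
have t0 : (0 < t)%R by rewrite ltr0n.
have [m Hm] : exists m : nat, \int[time t]_s fk (u' m) zero_rate s (EFin \o f2) x <= (e / 2 / M)%:E.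
  have e2M : (0 < e / 2 / M)%R by rewrite !divr_gt0.
  have cv := @fk_killing_ball R n mu f2 (r + 1)%R x t mf2 f20 f2B (small_creation_clock muL x sf2 (ltW t0)).
  have /fine_cvgP[fin cvf] := cv.
  have [m _ H] : \forall m \near \oo, (\int[time t]_s fk (u' m) zero_rate s (EFin \o f2) x) \is a fin_num /\
      (fine (\int[time t]_s fk (u' m) zero_rate s (EFin \o f2) x) <= e / 2 / M)%R.
    near=> m; split; first by near: m.
    by near: m; apply: (cvgr_le _ cvf).
  exists m; have [h1 h2] := H m (leqnn m).
  by rewrite -(fineK h1) lee_fin.
have := main x t m t0; rewrite Hx => H.
have := le_trans H (leeD2l _ (lee_wpmul2l (_ : 0 <= (M * expR (- lambda * t))%:E) (leeD2l _ Hm))).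
rewrite lee_fin mulr_ge0 ?expR_ge0 ?(ltW M0)// => /(_ isT).
move=> HH0.
have HH : (expR (- lambda * t) * phi x <= M * expR (- (al * t)) +
    M * expR (- lambda * t) * (smooth_tame nu x / ch + e / 2 / M))%R by rewrite -lee_fin; exact: HH0.
have Et : (0 < expR (lambda * t))%R by exact: expR_gt0.
have E1 : (expR (lambda * t) * expR (- lambda * t) = 1)%R by rewrite -expRD mulNr subrr expR0.
have {}HH : (phi x <= M * expR (- ((al - lambda) * t)) + M * (smooth_tame nu x / ch + e / 2 / M))%R.
  move: HH; rewrite -(ler_pM2l Et) mulrA E1 mul1r => /le_trans; apply.
  rewrite le_eqVlt; apply/orP; left; apply/eqP.
  have -> : (expR (- ((al - lambda) * t)) = expR (lambda * t) * expR (- (al * t)))%R.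
    by rewrite -expRD; congr expR; ring.
  rewrite mulrDr; congr (_ + _)%R; first by ring.
  by rewrite -[RHS]mul1r -E1; ring.
have X : (M * expR (- ((al - lambda) * t)) <= e / 2)%R.
  apply: (@le_trans _ _ (M * expR (- t))%R).
    by rewrite ler_wpM2l ?(ltW M0)// ler_expR lerN2 ler_peMl ?(ltW t0).
  rewrite expRN ler_pdivrMr ?expR_gt0// mulrC -ler_pdivrMr ?divr_gt0//.
  apply: le_trans (expR_ge1Dx _); apply: (@le_trans _ _ t); first exact/ltW/truncnS_gt.
  by rewrite lerDr.
apply: le_trans HH _.
have -> : (M * (smooth_tame nu x / ch + e / 2 / M) = M / ch * smooth_tame nu x + e / 2)%R.
  rewrite mulrDr; congr (_ + _)%R; first by rewrite mulrA mulrAC.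
  by rewrite mulrC divfK ?gt_eqF.
by move: X; move: (M * expR _)%R (M / ch * smooth_tame nu x)%R => p q; lra.
Unshelve. all: by end_near. Qed.

Lemma ae_eball (Q : set 'rV[R]_n) x (r : R) : {ae leb, forall y, Q y} -> (0 < r)%R -> exists2 y, eball x r y & Q y.
Proof.
move=> [N [mN N0 NQ]] r0; apply: contrapT => H.
have sub : eball x r `<=` N by move=> y xy; apply: NQ => /= Qy; apply: H; exists y.
have := lebesgue_eball_gt0 x r0; rewrite ltNge => /negP; apply.
by rewrite -N0; apply: le_measure; rewrite ?inE//; exact: measurable_eball.
Qed.

(** For [y] near [x], the bump centred at [x] makes [T t] of the indicator of the unit ball around
    [x] at least a multiple of [exp (- (C14 V x + lam) t)] at [y], while [HD] and
    [ground_state_tame] make it at most a multiple of [nu x]. Logarithms then compare [V x] with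
    [|ln (nu x)|]. *)
Lemma decay_necessary (t R0 C14 D : R) : (0 < t)%R -> (0 < C14)%R ->
  (forall x, R0 < enorm x -> forall y, eball x 1 y -> V y <= C14 * V x)%R ->
  (forall x, {ae leb, forall y, T t (EFin \o \1_(eball x 1)) y <= (D * phi y)%:E}) ->
  exists2 r : R, (0 < r)%R & forall x, (r <= enorm x ->
    0 < `|ln (nu x)| /\ 1 / (2 * C14 * t) * `|ln (nu x)| <= V x)%R.
Proof.
move=> t0 C140 VC HD.
have [chi [a0 [lam [k [C [[a00 lam0 k0 C0] [bchi chi2] chia growth _]]]]]] := fk_bump_unbounded muL J char.
have [G G0 HG] := ground_state_tame.
have [Ct Ct0 cmp] := tame_cmp J.
pose Q := (2 * (`|D| + 1) * G * Ct)%R.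
have Q0 : (0 < Q)%R by rewrite !mulr_gt0// ltr_wpDl.
have [rV HrV] := V_infty 0%R.
(* The additive constant left after taking logarithms. Far out [|ln (nu x)|] exceeds [2 |c2| + 1],
   so half of it absorbs [c2]: this is the 2 in [2 * C14 * t]. *)
pose c2 := (lam * t + ln (Q / a0))%R.
have e20 : (0 < expR (- (2 * `|c2| + 1)))%R by exact: expR_gt0.
have [rt rt2 Hrt] := tame_vanish J e20.
exists (`|R0| + `|rV| + rt + 1)%R => [|x xr]; first by rewrite ltr_wpDl// !addr_ge0// (le_trans _ rt2).
have [h1 h2] := (ler_norm R0, ler_norm rV); have [h3 h4] := (normr_ge0 R0, normr_ge0 rV).
have xR0 : (R0 < enorm x)%R by lra.
have xrV : (rV < enorm x)%R by lra.
have xrt : (rt < enorm x)%R by lra.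
have x2 : (1 / 2 < enorm x)%R by lra.
have Vx : (0 < V x)%R by exact: HrV.
have nux : (0 < nu x)%R by rewrite -(tameE nu x2) tame_gt0.
have lnx : (ln (nu x) < - (2 * `|c2| + 1))%R.
  have := Hrt x xrt; rewrite (tameE nu x2) -{1}(lnK nux) ltr_expR//.
have lnE : (`|ln (nu x)| = - ln (nu x))%R.
  by rewrite ltr0_norm//; apply: lt_le_trans lnx _; rewrite oppr_le0 addr_ge0// mulr_ge0.
have half0 : (0 < 1 / 2 :> R)%R by [].
have HDG : {ae leb, forall y, T t (EFin \o \1_(eball x 1)) y <= (D * phi y)%:E /\ (phi y <= G * tame y)%R}.
  by apply: filterS2 (HD x) HG => y.
(* Both bounds hold almost everywhere only, so a common good point is chosen within [1 / 2] of
   [x]. *)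
have [y xy [yD yG]] := @ae_eball _ x _ HDG half0.
have b0 : (0 <= C14 * V x)%R by rewrite mulr_ge0 ?ltW.
have g := growth V^\+%R (C14 * V x)%R t y x (measurable_funrpos mV) (funrpos_ge0 V) (ltW t0).
have {}g : (a0%:E <= (expR ((C14 * V x + lam) * t) * (2 * (D * phi y)))%:E).
  apply: le_trans (_ : (chi (y - x)%R)%:E <= _); first by rewrite lee_fin chia.
  apply: le_trans (g _) _.
    move=> z zx; rewrite /funrpos /= ge_max b0 andbT; exact: VC.
  rewrite EFinM; apply: lee_wpmul2l; first by rewrite lee_fin expR_ge0.
  have mxb : measurable_fun setT (\1_(eball x 1) : 'rV[R]_n -> R).
    by apply: measurable_indic; exact: measurable_eball.
  have mB : measurable_fun setT (fun y : 'rV[R]_n => y - x)%R by exact: measurable_rVB.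
  have mchi : measurable_fun setT (fun z : 'rV[R]_n => (chi (z - x)%R)%:E).
    by apply/measurable_EFinP; exact: (measurableT_comp bchi.1 mB).
  have mE1 : measurable_fun setT (EFin \o (\1_(eball x 1) : 'rV[R]_n -> R)) by exact/measurable_EFinP.
  have mE2 : measurable_fun setT (fun z : 'rV[R]_n => 2%:E * (EFin \o (\1_(eball x 1) : 'rV[R]_n -> R)) z).
    by apply: emeasurable_funM => //.
  have mz : measurable_fun setT zero_rate by [].
  apply: (@le_trans _ _ (T t (fun z => 2%:E * (EFin \o (\1_(eball x 1) : 'rV[R]_n -> R)) z) y)).
    apply: (@le_fk R n mu V^\+%R V^\+%R zero_rate V^\-%R t _ _ y (measurable_funrpos mV) (funrpos_ge0 V) mz (fun=> lexx _)
      (measurable_funrpos mV) (funrpos_ge0 V) (measurable_funrneg mV) (funrneg_ge0 V) mchi _ mE2 (fun=> lexx _) (funrneg_ge0 V)).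
    - by move=> z; rewrite lee_fin; have /andP[] := chi2 (z - x)%R.
    move=> z; rewrite /= -EFinM lee_fin; have /andP[_] := chi2 (z - x)%R.
    by rewrite !indicE /eball /=; under [in X in X -> _]eq_set do rewrite subr0.
  have i0 z : 0 <= (EFin \o (\1_(eball x 1) : 'rV[R]_n -> R)) z by rewrite lee_fin indicE.
  rewrite (fkZ mu t y (measurable_funrpos mV) (funrpos_ge0 V) (measurable_funrneg mV) (funrneg_ge0 V) mE1 i0 (_ : 0 <= 2%:E))//.
  by rewrite EFinM; apply: lee_wpmul2l.
rewrite lee_fin in g.
have yx : (phi y <= G * Ct * nu x)%R.
  apply: le_trans yG _; rewrite -mulrA ler_pM2l// -(tameE nu x2).
  have hxy : (enorm (y - x) < 1 / 2)%R by [].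
  have q1 := enorm_lerB y x; have q2 := enorm_lerB x y; rewrite [enorm (x - y)]enormB in q2.
  by apply: cmp; lra.
have {}g : (a0 <= expR ((C14 * V x + lam) * t) * (Q * nu x))%R.
  apply: le_trans g _; rewrite ler_wpM2l ?expR_ge0// /Q -!mulrA ler_pM2l//.
  apply: (@le_trans _ _ ((`|D| + 1) * phi y)%R).
    by rewrite ler_wpM2r ?(ltW (phi_gt0 y))// (le_trans (ler_norm D))// lerDl.
  by rewrite ler_wpM2l ?addr_ge0// mulrA.
have lg : (ln a0 <= (C14 * V x + lam) * t + (ln Q + ln (nu x)))%R.
  rewrite -[((C14 * V x + lam) * t)%R]expRK -!lnM ?posrE ?expR_gt0 ?mulr_gt0//.
  by rewrite ler_ln// posrE mulr_gt0 ?expR_gt0// mulr_gt0.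
have lnQ : (ln (Q / a0) = ln Q - ln a0)%R by rewrite ln_div ?posrE.
rewrite lnE; split; first by rewrite oppr_gt0; apply: lt_le_trans lnx _; rewrite oppr_le0 addr_ge0// mulr_ge0.
have C2t : (0 < 2 * C14 * t)%R by rewrite !mulr_gt0.
rewrite mul1r mulrC ler_pdivrMr//.
have := ler_norm c2; move: lg lnx; rewrite /c2 lnQ mulrDl.
have -> : (V x * (2 * C14 * t) = 2 * (C14 * V x * t))%R by ring.
move: (C14 * V x * t)%R (lam * t)%R (ln Q) (ln a0) (ln (nu x)) => p1 p2 p3 p4 p5.
move: (`|_|)%R => p6; lra.
Qed.

End necessity.


(** * From GSD to IUC *)

Section ultracontractivity.
Context {R : realType} {n : nat}.
Local Notation path := (path R n).
Local Notation leb := (@lebesgue_rV R n).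
Implicit Types (u f : 'rV[R]_n -> R) (x y v : 'rV[R]_n) (w : path) (s t : R).
Variable mu : probability path R.
Hypothesis muL : levy_law mu.
Local Open Scope ereal_scope.
Local Notation fk := (fk mu).
Local Notation zero_rate := (@zero_rate R n).
Local Notation one := (cst 1 : 'rV[R]_n -> \bar R).
Variables (V phi : 'rV[R]_n -> R).
Hypotheses (mV : measurable_fun setT V) (sV : small_creation mu V^\-%R).
Hypothesis phi_gt0 : forall x, (0 < phi x)%R.
Local Notation T := (fk V^\+%R V^\-%R).

(** Young's inequality [a b <= c a^2 + b^2 / c] with [a] the creation exponential, whose square is
    the exponential for the doubled rate; killing is dropped. *)
Lemma creation_young (c : R) t x (g : 'rV[R]_n -> R) w : (0 < c)%R -> (forall y, 0 <= g y)%R ->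
  weight V^\+%R V^\-%R x w t * (g (x + w t)%R)%:E <=
  c%:E * expeR (clock (fun y => 2 * V^\- y)%R x w t) + (c^-1 * g (x + w t)%R ^+ 2)%:E.
Proof.
move=> c0 g0; have Vm0 := funrneg_ge0 V; have Vp0 := funrpos_ge0 V.
have mVm := measurable_funrneg mV.
have -> : clock (fun y => 2 * V^\- y)%R x w t = 2%:E * clock V^\-%R x w t.
  rewrite /clock -ge0_integralZl//.
    by apply/measurable_EFinP; exact: measurable_along.
  by move=> s _; rewrite lee_fin.
have gg : 0 <= (g (x + w t)%R)%:E by rewrite lee_fin.
apply: (@le_trans _ _ (expeR (clock V^\-%R x w t) * (g (x + w t)%R)%:E)).
  apply: lee_wpmul2r => //; rewrite /weight -[leRHS]mul1e; apply: lee_wpmul2r; first exact: expeR_ge0.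
  rewrite -[leRHS](@expeR0 R) lee_expeR leeNl oppe0; exact: clock_ge0.
have := clock_ge0 x w t Vm0; case: (clock _ _ _ _) => //= [b _|_]; last first.
  rewrite (_ : 2%:E * +oo = +oo)/=; last by rewrite gt0_muley// lte_fin.
  by rewrite gt0_muley ?lte_fin// addye ?leey.
rewrite -!EFinM -EFinD lee_fin (_ : expR (2 * b) = expR b ^+ 2)%R; last by rewrite expRM_natl.
move: (expR b) (g _) => e h.
rewrite -(ler_pM2l c0) mulrDr [(c * (c^-1 * _))%R]mulrA mulfV ?gt_eqF// mul1r.
have : (0 <= (c * e - h / 2) ^+ 2 + 3 / 4 * h ^+ 2)%R by rewrite addr_ge0 ?sqr_ge0// mulr_ge0 ?sqr_ge0// divr_ge0.
by move=> H; rewrite -subr_ge0; apply: le_trans H _; rewrite le_eqVlt; apply/orP; left; apply/eqP; field.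
Qed.

(** Choosing [c] in [creation_young] amounts to Cauchy-Schwarz: the doubled creation rate has a
    bounded gauge, and the law at time [t] has a density bounded by [K]. *)
Lemma fk_square_bound t (K : R) : (0 < t)%R -> (0 <= K)%R ->
  (forall x (g : 'rV[R]_n -> \bar R), measurable_fun setT g -> (forall y, 0 <= g y) ->
    \int[mu]_w g (x + w t)%R <= K%:E * \int[leb]_y g y) ->
  exists2 C : R, (0 <= C)%R & forall (g : 'rV[R]_n -> R) (N : R), measurable_fun setT g ->
    (forall y, 0 <= g y)%R -> (0 <= N)%R -> \int[leb]_y (g y ^+ 2)%:E <= (N ^+ 2)%:E ->
    forall x, T t (EFin \o g) x <= (C * N)%:E.
Proof.
move=> t0 K0 HK; have mVm := measurable_funrneg mV.
have s2 := small_creationZ (ler0n R 2) sV.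
have [m2 p2 _] := s2.
have [D D0 HD] := small_creation_gauge muL s2 t.
exists (D + K)%R => [|g N mg g0 N0 gN x]; first exact: addr_ge0.
apply/lee_addgt0Pr => e e0.
have DK : (0 < D + K + 1)%R by rewrite ltr_wpDl// addr_ge0.
(* [c] should be of the order of [N]; a small amount is added since [N] may be 0. *)
pose c := (N + e / (D + K + 1))%R.
have c0 : (0 < c)%R by rewrite ltr_wpDl// divr_gt0.
have mpos : measurable_fun setT (fun w : path => x + w t)%R.
  exact: (@measurable_position R n _ path (fun=> x) id (fun=> t)).
have m1 : measurable_fun setT (fun w : path => expeR (clock (fun y => 2 * V^\- y)%R x w t)).
  apply: (measurableT_comp (@measurable_expeR R)).
  by apply: (@measurable_clock0 R n _ path _ (fun=> x) id (fun=> t)).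
have mg2 : measurable_fun setT (fun y => (g y ^+ 2)%:E).
  by apply/measurable_EFinP; exact: measurable_funX.
have m2' : measurable_fun setT (fun w : path => (g (x + w t)%R ^+ 2)%:E).
  exact: (measurableT_comp mg2 mpos).
have ci0 : (0 <= c^-1)%R by rewrite invr_ge0 ltW.
apply: (@le_trans _ _ (\int[mu]_w (c%:E * expeR (clock (fun y => 2 * V^\- y)%R x w t) + c^-1%:E * (g (x + w t)%R ^+ 2)%:E))).
  apply: ge0_le_integral => //.
  - by move=> w _; rewrite mule_ge0 ?weight_ge0 ?lee_fin.
  - apply: (measurable_fk_integrand x t (measurable_funrpos mV) (funrpos_ge0 V) mVm (funrneg_ge0 V)).
    exact/measurable_EFinP.
  - by apply: emeasurable_funD; exact: emeasurable_funM.
  by move=> w _; rewrite -EFinM; exact: creation_young.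
rewrite ge0_integralD//; last 4 first.
- by move=> w _; rewrite mule_ge0 ?expeR_ge0// lee_fin ltW.
- exact: emeasurable_funM.
- by move=> w _; rewrite mule_ge0// lee_fin// sqr_ge0.
- exact: emeasurable_funM.
rewrite ge0_integralZl ?lee_fin ?(ltW c0)//; last by move=> w _; exact: expeR_ge0.
rewrite ge0_integralZl ?lee_fin//; last by move=> w _; rewrite lee_fin sqr_ge0.
have h1 : \int[mu]_w expeR (clock (fun y => 2 * V^\- y)%R x w t) <= D%:E.
  apply: le_trans (HD t x (ltW t0) (lexx _)); rewrite le_eqVlt; apply/orP; left; apply/eqP.
  by apply: eq_integral => w _; rewrite weight_zero_killing mule1.
have h2 : \int[mu]_w (g (x + w t)%R ^+ 2)%:E <= (K * N ^+ 2)%:E.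
  apply: le_trans (HK x _ mg2 _) _; first by move=> y; rewrite lee_fin sqr_ge0.
  by rewrite EFinM; apply: lee_wpmul2l; rewrite ?lee_fin.
apply: (@le_trans _ _ ((c * D)%:E + (c^-1 * (K * N ^+ 2))%:E)).
  by rewrite !EFinM; apply: leeD; apply: lee_wpmul2l; rewrite ?lee_fin ?(ltW c0).
rewrite -!EFinD lee_fin.
have h3 : (c^-1 * (K * N ^+ 2) <= K * c)%R.
  rewrite mulrC ler_pdivrMr// -mulrA ler_wpM2l// -expr2 ler_pXn2r ?nnegrE ?(ltW c0)//.
  by rewrite lerDl divr_ge0 ?(ltW e0)// ltW.
apply: (@le_trans _ _ ((D + K) * c)%R); first by rewrite [leRHS]mulrDl; apply: lerD => //; rewrite mulrC.
rewrite /c mulrDr lerD2l mulrA ler_pdivrMr// mulrC ler_wpM2l ?(ltW e0)// lerDl//.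
Qed.

(** One half of the time gives boundedness from [L^2], the other half is GSD. *)
Lemma GSD_ultracontractive t (K D : R) : (0 < t)%R -> (0 <= K)%R ->
  (forall x (g : 'rV[R]_n -> \bar R), measurable_fun setT g -> (forall y, 0 <= g y) ->
    \int[mu]_w g (x + w t)%R <= K%:E * \int[leb]_y g y) ->
  (forall x, T t one x <= (D * phi x)%:E) ->
  exists2 C : R, (0 <= C)%R & forall (g : 'rV[R]_n -> R) (N : R), measurable_fun setT g ->
    (forall y, 0 <= g y)%R -> (0 <= N)%R -> \int[leb]_y (g y ^+ 2)%:E <= (N ^+ 2)%:E ->
    forall x, T (t + t) (EFin \o g) x <= (C * N * phi x)%:E.
Proof.
move=> t0 K0 HK HD; have [C C0 HC] := fk_square_bound t0 K0 HK.
have mVm := measurable_funrneg mV; have mVp := measurable_funrpos mV.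
have Vm0 := funrneg_ge0 V; have Vp0 := funrpos_ge0 V.
exists (C * `|D|)%R => [|g N mg g0 N0 gN x]; first exact: mulr_ge0.
have meg : measurable_fun setT (EFin \o g) by exact/measurable_EFinP.
have eg0 y : 0 <= (EFin \o g) y by rewrite lee_fin.
have CN0 : (0 <= C * N)%R by rewrite mulr_ge0.
rewrite (fk_semigroup muL x mVp Vp0 mVm Vm0 meg eg0 (ltW t0) (ltW t0)).
apply: (@le_trans _ _ (T t (fun y => (C * N)%:E * one y) x)).
  apply: (@le_fk R n mu _ _ _ _ t _ _ x mVp Vp0 mVm Vm0 mVp Vp0 mVm Vm0); [| | |by []|by []|].
  - exact: (@measurable_fk R n mu _ _ V^\+%R V^\-%R (EFin \o g) id (fun=> t)).
  - by move=> y; exact: fk_ge0.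
  - exact: measurable_cst.
  by move=> y; rewrite mule1; exact: HC.
rewrite (fkZ mu t x mVp Vp0 mVm Vm0 (measurable_cst _) (fun=> lee01)) ?lee_fin//.
apply: (@le_trans _ _ ((C * N)%:E * (D * phi x)%:E)); first by apply: lee_wpmul2l; rewrite ?lee_fin.
rewrite -EFinM lee_fin.
have -> : (C * `|D| * N * phi x = C * N * (`|D| * phi x))%R by ring.
by rewrite ler_wpM2l// ler_wpM2r ?(ltW (phi_gt0 x))// ler_norm.
Qed.

End ultracontractivity.

(** * From the path space to the process *)

Section transfer.
Context {R : realType} {n : nat} {dO : measure_display} {Om : measurableType dO}.
Variables (P : probability Om R) (X : R -> Om -> 'rV[R]_n).
Local Notation path := (path R n).
Local Notation leb := (@lebesgue_rV R n).
Implicit Types (x y v : 'rV[R]_n) (s t : R).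
Variable mu : probability path R.
Hypothesis muL : levy_law mu.
Local Open Scope ereal_scope.
Hypothesis transfer : forall (F : Om -> \bar R) (g : path -> \bar R), measurable_fun setT g ->
    (forall w (y : path), (forall t, (0 <= t)%R -> y t = X t w) -> F w = g y) ->
    \int[P]_w F w = \int[mu]_y g y.
Hypothesis mX : forall t, (0 <= t)%R -> measurable_fun setT (X t).

Lemma clock_itv (W : 'rV[R]_n -> R) x (w : path) t : measurable_fun setT W -> (forall y, 0 <= W y)%R ->
  clock W x w t = \int[lebesgue_measure]_(s in `[0%R, t]) (W (x + w s)%R)%:E.
Proof.
move=> mW W0; rewrite -integral_time_itv//; last by move=> s; rewrite lee_fin.
by apply/measurable_EFinP; exact: measurable_along.
Qed.

Lemma feynman_kac_path (V g : 'rV[R]_n -> R) t x :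
  measurable_fun setT V -> measurable_fun setT g -> (0 <= t)%R ->
  feynman_kac P X V t g x = \int[mu]_w (expeR (- (clock V^\+%R x w t - clock V^\-%R x w t)) * (g (x + w t)%R)%:E).
Proof.
move=> mV mg t0; have mVm := measurable_funrneg mV; have mVp := measurable_funrpos mV.
apply: transfer.
  apply: emeasurable_funM.
    apply: (measurableT_comp (@measurable_expeR R)); apply: measurableT_comp => //.
    apply: emeasurable_funB.
      by apply: (@measurable_clock0 R n _ path _ (fun=> x) id (fun=> t)).
    by apply: (@measurable_clock0 R n _ path _ (fun=> x) id (fun=> t)).
  apply/measurable_EFinP; apply: measurableT_comp => //.
  exact: (@measurable_position R n _ path (fun=> x) id (fun=> t)).
move=> w y yX; rewrite -yX//; congr (expeR (- _) * _).
rewrite integralE; congr (_ - _).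
  rewrite (clock_itv x y t mVp (funrpos_ge0 V)).
  apply: eq_integral => s; rewrite inE/= in_itv/= => /andP[s0 _].
  by rewrite funeposE yX// /funrpos EFin_max.
rewrite (clock_itv x y t mVm (funrneg_ge0 V)).
apply: eq_integral => s; rewrite inE/= in_itv/= => /andP[s0 _].
by rewrite funenegE yX// /funrneg EFin_max.
Qed.

(** The clock of the negative part is almost surely finite, so the exponential of the difference is
    the product in [weight], also when the other clock is infinite. *)
Lemma feynman_kac_fk (V g : 'rV[R]_n -> R) t x :
  measurable_fun setT V -> small_creation mu V^\-%R -> measurable_fun setT g -> (0 <= t)%R ->
  feynman_kac P X V t g x = fk mu V^\+%R V^\-%R t (EFin \o g) x.
Proof.
move=> mV sV mg t0; have mVm := measurable_funrneg mV; have mVp := measurable_funrpos mV.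
have Vm0 := funrneg_ge0 V; have Vp0 := funrpos_ge0 V.
rewrite feynman_kac_path//; apply: ae_eq_integral => //.
- apply: emeasurable_funM.
    apply: (measurableT_comp (@measurable_expeR R)); apply: measurableT_comp => //.
    apply: emeasurable_funB.
      by apply: (@measurable_clock0 R n _ path _ (fun=> x) id (fun=> t)).
    by apply: (@measurable_clock0 R n _ path _ (fun=> x) id (fun=> t)).
  apply/measurable_EFinP; apply: measurableT_comp => //.
  exact: (@measurable_position R n _ path (fun=> x) id (fun=> t)).
- by apply: (measurable_fk_integrand x t mVp Vp0 mVm Vm0); exact/measurable_EFinP.
have := small_creation_ae muL x sV t0; apply: filterS => w fin _; congr (_ * _).
rewrite /weight; move: fin (clock_ge0 x w t Vm0) (clock_ge0 x w t Vp0).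
case: (clock V^\-%R x w t) => // b _ _; case: (clock V^\+%R x w t) => //= [a _|_].
  by rewrite -EFinM -expRD opprB addrC.
by rewrite mul0e.
Qed.

Lemma feynman_kac_abs (V g : 'rV[R]_n -> R) t x :
  measurable_fun setT V -> small_creation mu V^\-%R -> measurable_fun setT g -> (0 <= t)%R ->
  `|feynman_kac P X V t g x| <= fk mu V^\+%R V^\-%R t (EFin \o (fun y => `|g y|%R)) x.
Proof.
move=> mV sV mg t0.
have mag : measurable_fun setT (fun y => `|g y|%R) by exact: measurableT_comp.
rewrite -feynman_kac_fk// !feynman_kac_path//.
apply: le_trans (le_abse_integral mu measurableT _) _.
  have mVm := measurable_funrneg mV; have mVp := measurable_funrpos mV.
  apply: emeasurable_funM.
    apply: (measurableT_comp (@measurable_expeR R)); apply: measurableT_comp => //.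
    apply: emeasurable_funB.
      by apply: (@measurable_clock0 R n _ path _ (fun=> x) id (fun=> t)).
    by apply: (@measurable_clock0 R n _ path _ (fun=> x) id (fun=> t)).
  apply/measurable_EFinP; apply: measurableT_comp => //.
  exact: (@measurable_position R n _ path (fun=> x) id (fun=> t)).
rewrite le_eqVlt; apply/orP; left; apply/eqP; apply: eq_integral => w _.
by rewrite abseM gee0_abs ?expeR_ge0.
Qed.

Lemma kato_small_creation (W : 'rV[R]_n -> R) : kato P X W -> (forall y, 0 <= W y)%R ->
  small_creation mu W.
Proof.
move=> [mW cvW] W0; split => // e e0.
pose S (t : R) := ereal_sup (range (fun x : 'rV[R]_n =>
  \int[P]_w \int[lebesgue_measure]_(s in `[0%R, t]) `|W (x + X s w)|%:E)).
have /fine_cvgP[fin cvf] : S t @[t --> (0%R : R)^'+] --> 0%:E by exact: cvW.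
have [t [t0 [h1 h2]]] : exists t : R, (0 < t)%R /\ (S t \is a fin_num /\ (fine (S t) <= e)%R).
  apply: (@filter_ex _ (0%R : R)^'+); near=> t; split; [|split].
  - by near: t; exact: nbhs_right_gt.
  - by near: t.
  by near: t; apply: (cvgr_le _ cvf).
exists t => // x; move: h2; rewrite -lee_fin fineK//; apply: le_trans.
apply: ereal_sup_ubound; exists x => //; apply: transfer.
  by apply: (@measurable_clock0 R n _ path _ (fun=> x) id (fun=> t)).
move=> w y yX; rewrite clock_itv//; apply: eq_integral => s.
by rewrite inE/= in_itv/= => /andP[s0 _]; rewrite yX// ger0_norm.
Unshelve. all: by end_near. Qed.

Variable p : R -> 'rV[R]_n -> \bar R.
Hypothesis pT : transition_density P X p.

Lemma path_density t x (g : 'rV[R]_n -> \bar R) (K : R) : (0 < t)%R -> 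
  measurable_fun setT g -> (forall y, 0 <= g y) -> (0 <= K)%R -> (forall y, p t y <= K%:E) ->
  \int[mu]_w g (x + w t)%R <= K%:E * \int[leb]_y g y.
Proof.
move=> t0 mg g0 K0 pK; have [pt _] := pT; have [mp p0 pP] := pt t t0.
pose w y := fine (p t y).
have pw y : p t y = (w y)%:E.
  by rewrite fineK// ge0_fin_numE//; exact: le_lt_trans (pK y) (ltry _).
have mw : measurable_fun setT w by exact: measurableT_comp.
have w0 y : (0 <= w y)%R by rewrite -lee_fin -pw.
have wK y : (w y <= K)%R by rewrite -lee_fin -pw.
have me := @measurable_path_eval R n t.
pose m := pushforward mu (fun w : path => w t).
have mgx : measurable_fun setT (fun y => g (x + y)%R).
  by apply: measurableT_comp => //; exact: measurable_rVD.
have -> : \int[mu]_w g (x + w t)%R = \int[m]_y g (x + y)%R.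
  by rewrite /m ge0_integral_pushforward// preimage_setT.
have mE B : measurable B -> m B = \int[leb]_(y in B) (w y)%:E.
  move=> mB; have <- : P [set w | B (X t w)] = \int[leb]_(y in B) (w y)%:E.
    by rewrite pP//; apply: eq_integral => y _; rewrite pw.
  have mA : measurable [set w' | B (X t w')] by have := mX (ltW t0) measurableT mB; rewrite setTI.
  have mA' : measurable [set w' : path | B (w' t)] by have := me measurableT B mB; rewrite setTI.
  rewrite /m /pushforward -(setIT [set w' | B (X t w')]) -(setIT (_ @^-1` _)) -!integral_indic//.
  apply/esym/transfer; first exact/measurable_EFinP/measurable_indic.
  move=> w' y yX; rewrite !indicE; congr ((_ : bool)%:R%:E).
  by apply/idP/idP; rewrite !inE /= yX// ltW.
rewrite (ge0_integral_density mw w0 mE)//.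
apply: (@le_trans _ _ (\int[leb]_y (K%:E * g (x + y)%R))).
  apply: ge0_le_integral => //.
  - by move=> y _; rewrite mule_ge0// lee_fin.
  - by apply: emeasurable_funM => //; exact/measurable_EFinP.
  - exact: emeasurable_funM.
  by move=> y _; rewrite muleC; apply: lee_wpmul2r; rewrite ?lee_fin.
by rewrite ge0_integralZl ?lee_fin// ge0_integral_translation.
Qed.

Lemma path_absolutely_continuous t x (N : set 'rV[R]_n) : (0 < t)%R -> measurable N -> leb N = 0 ->
  mu [set w : path | N (x + w t)%R] = 0.
Proof.
move=> t0 mN N0; have [pt _] := pT; have [mp p0 pP] := pt t t0.
pose B := [set y : 'rV[R]_n | N (x + y)%R].
have mB : measurable B.
  have mx : measurable_fun setT (fun y : 'rV[R]_n => x + y)%R by exact: measurable_rVD.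
  by have := mx measurableT N mN; rewrite setTI.
have B0 : leb B = 0.
  have mi : measurable_fun setT (EFin \o (\1_N : 'rV[R]_n -> R)) by exact/measurable_EFinP/measurable_indic.
  have i0 y : 0 <= (EFin \o (\1_N : 'rV[R]_n -> R)) y by rewrite lee_fin indicE.
  have e1 : \int[leb]_y (EFin \o (\1_N : 'rV[R]_n -> R)) y = 0 by rewrite integral_indic// setIT.
  rewrite -(setIT B) -integral_indic// -e1 -(ge0_integral_translation x mi i0); apply: eq_integral => y _.
  by rewrite /= !indicE; congr ((_ : bool)%:R%:E); apply/idP/idP; rewrite !inE.
have mA : measurable [set w' | B (X t w')] by have := mX (ltW t0) measurableT mB; rewrite setTI.
have mA' : measurable [set w' : path | N (x + w' t)%R].
  by have := @measurable_path_eval R n t measurableT B mB; rewrite setTI.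
transitivity (P [set w | B (X t w)]).
  rewrite -(setIT [set w' | B (X t w')]) -(setIT [set w' : path | _]) -!integral_indic//.
  apply/esym/transfer; first exact/measurable_EFinP/measurable_indic.
  move=> w' y yX; rewrite !indicE; congr ((_ : bool)%:R%:E).
  by apply/idP/idP; rewrite !inE /B /= yX// ltW.
rewrite pP//; apply: null_set_integral => //; exact: measurable_funTS.
Qed.

(** By Chapman-Kolmogorov, [p t] is an average of [p s] against the law at time [t - s]. *)
Lemma bounded_at_later s t : (0 < s)%R -> (s <= t)%R -> bounded_at p s -> bounded_at p t.
Proof.
move=> s0; rewrite le_eqVlt => /predU1P[<-//|st] [K HK].
have [pt CK] := pT; have [mps ps0 _] := pt s s0.
have ts : (0 < t - s)%R by rewrite subr_gt0.
have [mq q0 qP] := pt (t - s)%R ts.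
have K0 : (0 <= K)%R by rewrite -lee_fin; exact: le_trans (ps0 0%R) (HK 0%R).
exists K => x; rewrite -(subrKC s t) CK//.
apply: (@le_trans _ _ (\int[leb]_z (K%:E * p (t - s) z))).
  apply: ge0_le_integral => //.
  - by move=> z _; rewrite mule_ge0.
  - apply: emeasurable_funM => //; apply: measurableT_comp => //; apply: measurable_rVB => //.
  - exact: emeasurable_funM.
  by move=> z _; apply: lee_wpmul2r.
rewrite ge0_integralZl ?lee_fin// -qP// (_ : [set w | _] = setT); last by apply/seteqP; split.
by rewrite [X in _ * X]probability_setT mule1.
Qed.

End transfer.

(** * Symmetry and the jump density *)

Section symmetric_jump_measure.
Context {R : realType} {n : nat} {dO : measure_display} {Om : measurableType dO}.
Variables (P : probability Om R) (X : R -> Om -> 'rV[R]_n).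
Local Notation path := (path R n).
Local Notation leb := (@lebesgue_rV R n).
Implicit Types (x y v : 'rV[R]_n) (s t : R).
Variable mu : probability path R.
Local Open Scope ereal_scope.
Hypothesis transfer : forall (F : Om -> \bar R) (g : path -> \bar R), measurable_fun setT g ->
    (forall w (y : path), (forall t, (0 <= t)%R -> y t = X t w) -> F w = g y) ->
    \int[P]_w F w = \int[mu]_y g y.
Hypothesis mX : forall t, (0 <= t)%R -> measurable_fun setT (X t).
Variable nu : 'rV[R]_n -> R.
Hypotheses (n_gt0 : (0 < n)%N) (A1 : assumption_A1 P X nu).

(** Nothing is assumed of [nu 0]; the origin is a null set in positive dimension, so the value there
    is reset to 0, which makes the density nonnegative everywhere. *)
Definition punctured x : R := if x == 0%R then 0%R else nu x.

Lemma puncturedE x : (0 < enorm x)%R -> punctured x = nu x.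
Proof. by rewrite enorm_gt0 /punctured => /negbTE ->. Qed.

Lemma set1_rV_box : [set (0%R : 'rV[R]_n)] = [set x : 'rV[R]_n | forall i : 'I_n, [set (0%R : measurableTypeR R)] (x 0%R i)].
Proof.
apply/seteqP; split=> [x -> i /=|x /= H]; first by rewrite mxE.
by apply/rowP => i; rewrite mxE; exact: H.
Qed.

Lemma measurable_set1_rV : measurable [set (0%R : 'rV[R]_n)].
Proof.
rewrite set1_rV_box (_ : mkset _ = \bigcap_(i in [set: 'I_n]) ((fun x : 'rV[R]_n => x 0%R i : R) @^-1` [set 0%R])); last first.
  by apply/seteqP; split=> [x /= H i _|x /= H i]; exact: H.
apply: fin_bigcap_measurable => // i _.
by rewrite -[X in measurable X]setTI; apply: (measurable_coord i) => //; exact: measurable_set1.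
Qed.

Lemma lebesgue_rV_set1 : leb [set 0%R] = 0.
Proof.
rewrite set1_rV_box.
have := @lebesgue_rV_box R n (fun=> [set 0%R]) (fun=> measurable_set1 _) => ->.
by rewrite (bigD1 (Ordinal n_gt0))//= lebesgue_measure_set1 mul0e.
Qed.

Lemma punctured_gt0 x : x != 0%R -> (0 < punctured x)%R.
Proof. by move=> x0; rewrite /punctured (negbTE x0); have [_ [_ H] _ _ _] := A1; exact: H. Qed.

Lemma punctured_ge0 x : (0 <= punctured x)%R.
Proof. by have [->|/punctured_gt0/ltW//] := eqVneq x 0%R; rewrite /punctured eqxx. Qed.

Lemma measurable_punctured : measurable_fun setT punctured.
Proof.
have [_ [[mnu _] _] _ _ _] := A1.
have -> : punctured = fun x => (nu x * \1_(~` [set 0%R : 'rV[R]_n]) x)%R.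
  apply/funext => x; rewrite /punctured indicE; have [->|x0] := eqVneq x 0%R.
    by rewrite memNset ?mulr0//; exact.
  by rewrite mem_set ?mulr1//; exact/eqP.
by apply: measurable_funM => //; apply: measurable_indic; apply: measurableC; exact: measurable_set1_rV.
Qed.

Lemma levy_punctured (N : {measure set 'rV[R]_n -> \bar R}) :
  (forall B, measurable B -> N B = \int[leb]_(y in B) (nu y)%:E) ->
  forall B, measurable B -> N B = \int[leb]_(y in B) (punctured y)%:E.
Proof.
have [_ [[mnu _] _] _ _ _] := A1.
move=> NE B mB; rewrite NE//; apply: ae_eq_integral => //.
- by apply: measurable_funTS; exact/measurable_EFinP.
- by apply: measurable_funTS; apply/measurable_EFinP; exact: measurable_punctured.
exists [set 0%R]; split; [exact: measurable_set1_rV|exact: lebesgue_rV_set1|].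
move=> x /= H; apply: contrapT => x0; apply: H => _.
by rewrite /punctured; case: eqP.
Qed.

Lemma jump_density_punctured : jump_density punctured.
Proof.
have [_ [[mnu [N [[N0 Nfin _] NE]]] _] cmp dec cnv] := A1.
have half : (0 < 1 / 2 :> R)%R by [].
have E (r : R) x : (0 < r)%R -> (r <= enorm x)%R -> punctured x = nu x.
  by move=> r0 rx; apply: puncturedE; exact: lt_le_trans rx.
split.
- exact: n_gt0.
- exact: measurable_punctured.
- exact: punctured_ge0.
- exact: punctured_gt0.
- have mm : measurable_fun setT (fun y : 'rV[R]_n => (Num.min 1 (enorm y ^+ 2))%:E).
    apply/measurable_EFinP; apply: measurable_minr => //; apply: measurable_funX; exact: measurable_enorm.
  have m0 y : 0 <= (Num.min 1 (enorm (y : 'rV[R]_n) ^+ 2))%:E.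
    by rewrite lee_fin le_min ler01 sqr_ge0.
  apply: le_lt_trans Nfin; rewrite (ge0_integral_density measurable_punctured punctured_ge0 (levy_punctured NE) mm m0).
  by rewrite le_eqVlt; apply/orP; left; apply/eqP; apply: eq_integral => y _; rewrite EFinM.
- move=> r r2; have [C1 C11 H] := cmp r r2; exists C1 => // x y ry yx.
  have r0 : (0 < r)%R by have /andP[] := r2.
  rewrite (E r y r0 ry) (E r x r0); last by have /andP[h _] := yx; exact: le_trans h.
  exact: H.
- have [C2 C21 H] := dec; exists C2 => // x y y2 yx.
  by rewrite (E _ y half y2) (E _ x half) ?(le_trans y2)//; exact: H.
have [C3 C31 H] := cnv; exists C3; first by [].
move=> x y xy /=.
have xy0 : (0 < enorm (x - y))%R by rewrite enormB (lt_le_trans _ xy).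
rewrite (puncturedE xy0); apply: le_trans (H x y xy).
rewrite le_eqVlt; apply/orP; left; apply/eqP; apply: eq_integral => z; rewrite inE => -[z1 z2].
by rewrite (@E _ (x - z)%R half) ?(@E _ (z - y)%R half)// ?(ltW z2)// enormB ltW.
Qed.

Lemma symmetric_path t (f : 'rV[R]_n -> \bar R) : (0 <= t)%R -> measurable_fun setT f -> (forall y, 0 <= f y) ->
  \int[mu]_w f (w t) = \int[mu]_w f (- w t)%R.
Proof.
move=> t0 mf f0; have [sym _ _ _ _] := A1.
have me := @measurable_path_eval R n t.
have meN : measurable_fun setT (fun w : path => - w t)%R by exact: measurable_rVN.
have mXN : measurable_fun setT (fun w => - X t w)%R by apply: measurable_rVN; exact: mX.
pose m1 := pushforward mu (fun w : path => w t); pose m2 := pushforward mu (fun w : path => (- w t)%R).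
have mE (B : set 'rV[R]_n) : measurable B -> m1 B = m2 B.
  move=> mB.
  have h1 : P [set w | B (X t w)] = m1 B.
    have mA : measurable [set w' | B (X t w')] by have := mX t0 measurableT mB; rewrite setTI.
    have mA' : measurable [set w' : path | B (w' t)] by have := me measurableT B mB; rewrite setTI.
    rewrite /m1 /pushforward -(setIT [set w' | B (X t w')]) -(setIT (_ @^-1` _)) -!integral_indic//.
    apply/transfer; first exact/measurable_EFinP/measurable_indic.
    move=> w' y yX; rewrite !indicE; congr ((_ : bool)%:R%:E).
    by apply/idP/idP; rewrite !inE /= yX.
  have h2 : P [set w | B (- X t w)%R] = m2 B.
    have mA : measurable [set w' | B (- X t w')%R] by have := mXN measurableT B mB; rewrite setTI.
    have mA' : measurable [set w' : path | B (- w' t)%R] by have := meN measurableT B mB; rewrite setTI.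
    rewrite /m2 /pushforward -(setIT [set w' | B (- X t w')%R]) -(setIT (_ @^-1` _)) -!integral_indic//.
    apply/transfer; first exact/measurable_EFinP/measurable_indic.
    move=> w' y yX; rewrite !indicE; congr ((_ : bool)%:R%:E).
    by apply/idP/idP; rewrite !inE /= yX.
  by rewrite -h1 -h2; exact: sym.
have -> : \int[mu]_w f (w t) = \int[m1]_y f y.
  by rewrite /m1 ge0_integral_pushforward// preimage_setT.
have -> : \int[mu]_w f (- w t)%R = \int[m2]_y f y.
  by rewrite /m2 ge0_integral_pushforward// preimage_setT.
by apply: eq_measure_integral => B mB _; exact: mE.
Qed.

(** By symmetry the sine transform vanishes, hence [sin (s * im) = 0] for every [s >= 0]. At
    [s = t / 2] the duplication formula gives [cos (t * im) = 1], so only the real part of the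
    exponent is left. *)
Lemma symmetric_char : exists A : 'M[R]_n, (forall t xi th, 0 <= t ->
  (\int[mu]_w cos (dot xi (w t) + th)) = expR (t * exponent A punctured xi) * cos th)%R.
Proof.
have [sym [[mnu [N [[N0 Nfin [A [b [AT _ char]]]] NE]]] _] _ _ _] := A1.
exists A => t xi th t0.
pose c (s : R) := (\int[mu]_w cos (dot xi (w s)))%R.
pose sn (s : R) := (\int[mu]_w sin (dot xi (w s)))%R.
have md s : measurable_fun setT (fun w : path => dot xi (w s)).
  apply: (measurableT_comp (measurable_dot xi)); exact: measurable_path_eval.
have bc s : bmeas (fun w : path => cos (dot xi (w s))).
  split; first by apply: measurableT_comp => //; apply: continuous_measurable_fun; exact: continuous_cos.
  by exists 1%R => w; rewrite ler_norml cos_geN1 cos_le1.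
have bs s : bmeas (fun w : path => sin (dot xi (w s))).
  split; first by apply: measurableT_comp => //; apply: continuous_measurable_fun; exact: continuous_sin.
  by exists 1%R => w; rewrite ler_norml sin_geN1 sin_le1.
have cE s : (0 <= s)%R -> (\int[P]_w cos (dot xi (X s w)))%R = c s.
  move=> s0; rewrite /c /Rintegral; congr fine; apply: transfer; first by apply/measurable_EFinP; exact: (bc s).1.
  by move=> w y yX; rewrite yX.
have sE s : (0 <= s)%R -> (\int[P]_w sin (dot xi (X s w)))%R = sn s.
  move=> s0; rewrite /sn /Rintegral; congr fine; apply: transfer; first by apply/measurable_EFinP; exact: (bs s).1.
  by move=> w y yX; rewrite yX.
have s00 s : (0 <= s)%R -> sn s = 0%R.
  move=> s0; have b1 := @bmeas_cst _ path R 1%R.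
  have e1 : (\int[mu]_w (1 + sin (dot xi (w s))))%R = (\int[mu]_w (1 - sin (dot xi (w s))))%R.
    rewrite /Rintegral; congr fine.
    have mf : measurable_fun setT (fun y => (1 + sin (dot xi y))%:E).
      apply/measurable_EFinP; apply: measurable_funD => //; apply: measurableT_comp => //; last exact: measurable_dot.
      by apply: continuous_measurable_fun; exact: continuous_sin.
    rewrite (symmetric_path s0 mf); last by move=> y; rewrite lee_fin -lerBlDl sub0r sin_geN1.
    by apply: eq_integral => w _; rewrite /dot linearN /= mulmxN mxE sinN.
  have b1' : bmeas (fun _ : path => 1%R : R) by exact: b1.
  move: e1; rewrite RintegralD_bmeas// RintegralB_bmeas// -/(sn s).
  by move: (\int[mu]_w 1)%R (sn s) => p1 p2; lra.
have [re [im H]] : exists re im : R, re = exponent A punctured xi /\ forall s, (0 <= s)%R ->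
    (c s = expR (s * re) * cos (s * im) /\ sn s = expR (s * re) * sin (s * im))%R.
  eexists; eexists; split; last by move=> s s0; rewrite -cE// -sE//; exact: char.
  rewrite /exponent; congr (_ + _)%R.
    rewrite mulNr; congr (- (_ / _))%R; rewrite /dot mxE exchange_big; apply: eq_bigr => j _ /=.
    rewrite !mxE mulr_suml; apply: eq_bigr => i _; ring.
  have m1 : measurable_fun setT (fun y : 'rV[R]_n => (1 - cos (dot xi y))%R).
    apply: measurable_funB => //; apply: measurableT_comp => //; last exact: measurable_dot.
    by apply: continuous_measurable_fun; exact: continuous_cos.
  have p1 y : (0 <= 1 - cos (dot xi y))%R by rewrite subr_ge0 cos_le1.
  have mp := measurable_punctured; have pp := punctured_ge0.
  have q (m : {measure set 'rV[R]_n -> \bar R}) (g h : 'rV[R]_n -> R) : measurable_fun setT h ->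
      (forall y, 0 <= h y)%R -> (forall y, g y = - h y)%R -> \int[m]_y (g y)%:E = - \int[m]_y (h y)%:E.
    move=> mh h0 gh; rewrite -integral_ge0N//; last by move=> y _; rewrite lee_fin.
    by apply: eq_integral => y _; rewrite gh.
  rewrite /Rintegral; congr fine.
  rewrite (q N _ _ m1 p1); last by move=> y; rewrite opprB.
  rewrite (q leb _ (fun y => (1 - cos (dot xi y)) * punctured y)%R); last 3 first.
  - exact: measurable_funM.
  - by move=> y; rewrite mulr_ge0.
  - by move=> y; rewrite -mulNr opprB.
  congr (- _); rewrite (ge0_integral_density mp pp (levy_punctured NE)).
  - by apply: eq_integral => y _; rewrite EFinM.
  - exact/measurable_EFinP.
  - by move=> y; rewrite lee_fin.
have [reE {}H] := H.
have cim : cos (t * im) = 1%R.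
  have t2 : (0 <= t / 2)%R by rewrite divr_ge0.
  have [_ h] := H _ t2; rewrite s00// in h.
  have {}h : sin (t / 2 * im) = 0%R.
    by have /esym/eqP := h; rewrite mulf_eq0 gt_eqF ?expR_gt0//= => /eqP.
  have -> : (t * im = t / 2 * im + t / 2 * im)%R by rewrite -mulrDl -splitr.
  rewrite cosD h mulr0 subr0 -expr2; have := cos2Dsin2 (t / 2 * im)%R.
  by rewrite h expr0n/= addr0.
have [h1 h2] := H t t0; rewrite cim mulr1 reE in h1.
have -> : (\int[mu]_w cos (dot xi (w t) + th))%R = (c t * cos th - sn t * sin th)%R.
  have b1 := bmeasZ (cos th) (bc t); have b2 := bmeasZ (sin th) (bs t).
  rewrite [(c t * _)%R]mulrC [(sn t * _)%R]mulrC -!RintegralZ_bmeas// -RintegralB_bmeas//.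
  apply: eq_Rintegral => w _; rewrite cosD; ring.
by rewrite s00// mul0r subr0 h1.
Qed.

End symmetric_jump_measure.

Lemma ler_sqr_add1 (R : realFieldType) (x : R) : x <= x ^+ 2 + 1.
Proof. by have := sqr_ge0 (x - 1 / 2); rewrite !expr2; lra. Qed.

(** * Norms weighted by the squared ground state *)

Section squared_ground_state.
Context {R : realType} {n : nat} (phi : {mfun 'rV[R]_n >-> R}).
Local Notation leb := (@lebesgue_rV R n).
Hypothesis phi_gt0 : forall x, 0 < phi x.
Local Open Scope ereal_scope.
Local Notation sq := (sq_measure phi).

(** The density [phi ^+ 2] vanishes nowhere. *)
Lemma sq_measure_null N : measurable N -> sq N = 0 -> leb N = 0.
Proof.
move=> mN N0.
have m2 : measurable_fun N (fun x => ((phi x) ^+ 2)%:E).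
  by apply: measurable_funTS; apply/measurable_EFinP; exact: measurable_funX.
have := N0; rewrite /sq_measure.
have <- : \int[leb]_(x in N) `|((phi x) ^+ 2)%:E| = \int[leb]_(x in N) ((phi x) ^+ 2)%:E.
  by apply: eq_integral => x _; rewrite gee0_abs// lee_fin sqr_ge0.
have [ae0 _] := @ae_eq_integral_abs _ _ R leb N mN _ m2.
move/ae0 => [N' [mN' N'0 H]].
apply/eqP; rewrite eq_le measure_ge0 andbT -N'0; apply: le_measure; rewrite ?inE// => x Nx.
apply: H => /= /(_ Nx) [] /eqP; rewrite sqrf_eq0 => /eqP h.
by have := phi_gt0 x; rewrite h ltxx.
Qed.

Lemma sq_measure_ae (Q : set 'rV[R]_n) : {ae sq, forall x, Q x} -> {ae leb, forall x, Q x}.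
Proof. by move=> [N [mN N0 NQ]]; exists N; split => //; exact: sq_measure_null. Qed.

Lemma sq_measure_gt0 : 0 < sq setT.
Proof.
rewrite lt_neqAle measure_ge0 andbT eq_sym; apply/eqP => h.
have := sq_measure_null measurableT h => h'.
have := @lebesgue_eball_gt0 R n 0%R 1%R ltr01; rewrite ltNge => /negP; apply.
by rewrite -h'; apply: le_measure; rewrite ?inE//; exact: measurable_eball.
Qed.

Lemma Lnorm2_sq (f : 'rV[R]_n -> R) : measurable_fun setT f ->
  'N[sq]_2%:E [EFin \o f] `^ 2 = \int[leb]_x ((phi x * f x) ^+ 2)%:E.
Proof.
move=> mf; rewrite poweR_Lnorm//.
have mf2 : measurable_fun setT (fun x => (f x ^+ 2)%:E) by apply/measurable_EFinP; exact: measurable_funX.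
have mp2 : measurable_fun setT (fun x => (phi x ^+ 2)%R) by exact: measurable_funX.
rewrite (_ : \int[_]_x _ = \int[sq]_x (f x ^+ 2)%:E); last first.
  apply: eq_integral => x _; rewrite /= powR_mulrn ?normr_ge0// real_normK// num_real//.
have sqE B : measurable B -> sq B = \int[leb]_(x in B) (phi x ^+ 2)%:E by [].
rewrite (@ge0_integral_density _ _ R leb sq (fun x => phi x ^+ 2)%R mp2 (fun x => sqr_ge0 (phi x)) sqE _ mf2).
  by apply: eq_integral => x _; rewrite -EFinM exprMn mulrC.
by move=> x; rewrite lee_fin sqr_ge0.
Qed.

Lemma Lnormy_le (F : 'rV[R]_n -> \bar R) (c : R) : (0 <= c)%R -> (forall x, `|F x| <= c%:E) -> 'N[sq]_+oo [F] <= c%:E.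
Proof.
move=> c0 H; rewrite unlock; case: ifPn => _; last by rewrite lee_fin.
by apply/ess_sup_inf.ess_supP; apply: nearW => x; exact: H.
Qed.

Lemma Lnormy_ae (F : 'rV[R]_n -> \bar R) (c : \bar R) : 'N[sq]_+oo [F] <= c -> {ae leb, forall x, `|F x| <= c}.
Proof.
(* The norm of order [+oo] is 0 by convention for the zero measure, hence the appeal to positive
   total mass. *)
rewrite unlock; rewrite ifT; last exact: sq_measure_gt0.
by move/ess_sup_inf.ess_supP => h; exact: sq_measure_ae.
Qed.

End squared_ground_state.

(** * Assembly of the equivalences *)

Section assembly.
Context {R : realType} {d : nat} (hd : (0 < d)%N)
    {dO : measure_display} {Om : measurableType dO} (P : probability Om R)
    (X : R -> Om -> 'rV[R]_d)
    (nu : 'rV[R]_d -> R) (p : R -> 'rV[R]_d -> \bar R) (tb : R)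
    (V : 'rV[R]_d -> R)
    (phi : nat -> {mfun 'rV[R]_d >-> R}) (lambda : nat -> R)
    (R0 C14 : R).
Local Notation leb := (@lebesgue_rV R d).
Local Notation T := (feynman_kac P X V).
Local Notation one := (cst 1%E : 'rV[R]_d -> \bar R).
Hypotheses (XR : regular_jump_levy P X nu p) (VK : confining_kato P X V) (phiE : eigenbasis T phi lambda).
Hypotheses (C140 : 0 < C14) (VC : forall x, R0 < enorm x -> forall y, eball x 1 y -> V y <= C14 * V x).

Lemma star_mono (k k' : R) : k' <= k -> ratio_bounded_below V nu k -> ratio_bounded_below V nu k'.
Proof. by move=> kk [r r0 H]; exists r => // x /H; exact: le_trans. Qed.

Lemma star_decay (k : R) : 0 < k -> ratio_bounded_below V nu k ->
  exists r : R, forall x, r <= enorm x -> k * `|ln (punctured nu x)| <= V x.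
Proof.
move=> k0 [r r0 H]; exists r => x rx; rewrite puncturedE ?(lt_le_trans r0)//.
(* If [ln (nu x) = 0] the quotient is 0 by convention, which is below [k]: this case does not
   occur. *)
have := H x rx; have [->|l0] := eqVneq (`|ln (nu x)|) 0.
  by rewrite invr0 mulr0 leNgt k0.
by rewrite ler_pdivlMr// lt_neqAle eq_sym l0 normr_ge0.
Qed.

Lemma limit_of_star : (forall t, 0 < t -> ratio_bounded_below V nu (1 / (2 * C14 * t))) ->
  tends_to_pinfty_at_infty (fun x => V x / `|ln (nu x)|).
Proof.
move=> H M; have M1 : 0 < `|M| + 1 by rewrite ltr_wpDl.
(* The time at which [1 / (2 * C14 * t)] equals [|M| + 1]. *)
have t0 : 0 < (2 * C14 * (`|M| + 1))^-1 by rewrite invr_gt0 !mulr_gt0.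
have [r r0 Hr] := H _ t0; exists r => x /ltW /Hr; apply: lt_le_trans.
rewrite [ltRHS](_ : _ = `|M| + 1); first by rewrite (le_lt_trans (ler_norm M))// ltrDl.
by rewrite div1r invf_div mulrC mulKf// gt_eqF// mulr_gt0.
Qed.

Lemma star_of_limit : tends_to_pinfty_at_infty (fun x => V x / `|ln (nu x)|) ->
  forall k, 0 < k -> ratio_bounded_below V nu k.
Proof.
move=> H k k0; have [r Hr] := H k; exists (`|r| + 1) => [|x rx]; first by rewrite ltr_wpDl.
by apply/ltW/Hr; apply: lt_le_trans rx; rewrite (le_lt_trans (ler_norm r))// ltrDl.
Qed.

Lemma divK4 (t : R) : 0 < t -> 4 / (4 / t) = t.
Proof. by move=> t0; rewrite invf_div mulrC divfK// gt_eqF. Qed.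

(** The implications at fixed times, from which all claims follow by a choice of times. Necessity
    asks only for a bound of [T] on indicators of unit balls by a multiple of the ground state,
    which GSD and IUC both provide. *)
Lemma main_facts : 
  [/\ forall k, 0 < k -> ratio_bounded_below V nu k -> GSD_at T (phi 0%N) (4 / k),
      forall t, 0 < t -> GSD_at T (phi 0%N) t -> ratio_bounded_below V nu (1 / (2 * C14 * t)),
      forall t, 0 < t -> IUC_at T (phi 0%N) (lambda 0%N) t -> ratio_bounded_below V nu (1 / (2 * C14 * t)) &
      forall t, 0 < t -> bounded_at p t -> GSD_at T (phi 0%N) t -> IUC_at T (phi 0%N) (lambda 0%N) (t + t)].
Proof.
have [XL A1 [pT _] _] := XR.
have [mX _ _ _ _] := XL.
have [mu muL tr] := levy_process_law XL.
have J := jump_density_punctured hd A1.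
have [A char] := symmetric_char tr mX hd A1.
have [mV kV kVloc Vinf] := VK.
have sV : small_creation mu V^\- by exact: (kato_small_creation tr kV (funrneg_ge0 V)).
have sVloc r : small_creation mu (fun y => V^\+ y * \1_(eball 0 r) y).
  apply: (kato_small_creation tr (kVloc 0 r)) => y; by rewrite mulr_ge0 ?funrpos_ge0// indicE.
have ac := path_absolutely_continuous tr mX pT.
have [_ eig _ bc pos] := phiE.
have [[M HM] cont] := bc 0%N.
have phi_le x : phi 0%N x <= M by apply: le_trans (HM x); exact: ler_norm.
have mphi : measurable_fun setT (phi 0%N) by [].
have TE (g : 'rV[R]_d -> R) t x : measurable_fun setT g -> 0 <= t ->
    T t g x = fk mu V^\+ V^\- t (EFin \o g) x.
  by move=> mg t0; exact: (feynman_kac_fk muL tr).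
have eig' t : 0 < t -> {ae leb, forall x, fk mu V^\+ V^\- t (EFin \o phi 0%N) x =
    (expR (- lambda 0%N * t) * phi 0%N x)%:E}.
  by move=> t0; have := eig 0%N t t0; apply: filterS => x; rewrite TE// ltW.
have nec := decay_necessary muL ac J char mV sV Vinf cont mphi pos phi_le eig'.
have to_star t : (exists2 r : R, 0 < r & forall x, r <= enorm x ->
     0 < `|ln (punctured nu x)| /\ 1 / (2 * C14 * t) * `|ln (punctured nu x)| <= V x) ->
     ratio_bounded_below V nu (1 / (2 * C14 * t)).
  move=> [r r0 H]; exists r => // x rx; have [h1 h2] := H x rx.
  have nE : punctured nu x = nu x by apply: puncturedE; exact: lt_le_trans rx.
  by rewrite nE in h1 h2; rewrite ler_pdivlMr.
have mball x : measurable_fun setT (\1_(eball x 1) : 'rV[R]_d -> R).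
  by apply: measurable_indic; exact: measurable_eball.
have mone : measurable_fun setT (cst 1 : 'rV[R]_d -> R) by [].
split.
- move=> k k0 /(star_decay k0)[r Hr].
  have [C HC] := decay_GSD muL ac J char mV sV sVloc Vinf cont mphi pos phi_le eig' k0 Hr.
  exists C => x; rewrite TE ?divr_ge0 ?(ltW k0)//; exact: HC.
- move=> t t0 [C HC]; apply: to_star; apply: (nec t R0 C14 C t0 C140 VC) => x.
  apply: nearW => y; apply: le_trans (HC y); rewrite TE ?(ltW t0)//.
  have mVm := measurable_funrneg mV; have mVp := measurable_funrpos mV.
  have Vm0 := funrneg_ge0 V; have Vp0 := funrpos_ge0 V.
  have mE : measurable_fun setT (EFin \o (\1_(eball x 1) : 'rV[R]_d -> R)) by exact/measurable_EFinP.
  have mE1 : measurable_fun setT (EFin \o (cst 1 : 'rV[R]_d -> R)) by exact/measurable_EFinP.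
  apply: (@le_fk R d mu _ _ _ _ t _ _ y mVp Vp0 mVm Vm0 mVp Vp0 mVm Vm0 mE _ mE1) => //.
    by move=> z; rewrite lee_fin indicE.
  by move=> z; rewrite lee_fin indicE; case: (z \in _).
- move=> t t0 [C HC]; pose L := fine (leb (eball 0 1)).
  have L0 : 0 <= L by rewrite fine_ge0.
  have LE x : leb (eball x 1) = L%:E.
    by rewrite lebesgue_eball_center fineK// ge0_fin_numE// lebesgue_eball_lty.
  apply: to_star; apply: (nec t R0 C14 (`|C| * (L + 1) * expR (- (lambda 0%N * t))) t0 C140 VC) => x.
  (* Divided by the ground state, the indicator has weighted norm equal to the square root of the
     volume of the unit ball, whatever [x]. *)
  pose f y := (phi 0%N y)^-1 * \1_(eball x 1) y.
  have mf : measurable_fun setT f.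
    apply: measurable_funM => //; apply: measurable_continuous_rV => z.
    have z0 : phi 0%N z != 0 by rewrite gt_eqF.
    exact: (cvgV z0 (cont z)).
  have pf y : phi 0%N y * f y = \1_(eball x 1) y by rewrite /f mulrA divff ?mul1r// gt_eqF.
  have N2 : ('N[sq_measure (phi 0%N)]_2%:E [EFin \o f] `^ 2 = L%:E)%E.
    rewrite Lnorm2_sq// -(LE x) -(setIT (eball x 1)) -integral_indic//; last exact: measurable_eball.
    by apply: eq_integral => y _; rewrite pf indicE; case: (y \in _); rewrite ?expr1n ?expr0n.
  have [N NE N0] : exists2 N : R, ('N[sq_measure (phi 0%N)]_2%:E [EFin \o f] = N%:E)%E & 0 <= N.
    have := Lnorm_ge0 (sq_measure (phi 0%N)) 2%:E (EFin \o f); move: N2.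
    case: ('N[_]_2%:E [EFin \o f])%E => //= [r _ r0|]; first by exists r.
    by rewrite (_ : (2 == 0 :> R) = false)//; apply/negbTE; rewrite pnatr_eq0.
  (* Since [N ^+ 2 = L], the inequality [N <= N ^+ 2 + 1] avoids a square root. *)
  have NL : N <= L + 1.
    move: N2; rewrite NE poweR_EFin powR_mulrn// => -[NN].
    by rewrite -NN; exact: ler_sqr_add1.
  have fL : f \in Lfun (sq_measure (phi 0%N)) 2%:E.
    rewrite inE/=; apply/andP; split; rewrite inE//=.
    by rewrite /finite_norm NE ltry.
  have {HC} := HC f fL; rewrite NE -EFinM => HC.
  have := Lnormy_ae pos HC; apply: filterS => y; rewrite /intrinsic.
  have -> : (fun y0 => phi 0%N y0 * f y0) = \1_(eball x 1) by apply/funext => z; exact: pf.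
  rewrite TE ?(ltW t0)//.
  have k0 : 0 < expR (lambda 0%N * t) / phi 0%N y by rewrite divr_gt0 ?expR_gt0.
  rewrite gee0_abs; last by rewrite mule_ge0 ?lee_fin ?(ltW k0)// fk_ge0// => z; rewrite lee_fin indicE.
  rewrite -lee_pdivlMl// -EFinM => /le_trans; apply; rewrite lee_fin.
  rewrite invf_div.
  have -> : `|C| * (L + 1) * expR (- (lambda 0%N * t)) * phi 0%N y =
      phi 0%N y / expR (lambda 0%N * t) * (`|C| * (L + 1)) by rewrite expRN; ring.
  rewrite ler_wpM2l ?divr_ge0 ?expR_ge0 ?(ltW (pos _))//.
  apply: (@le_trans _ _ (`|C| * N)); first by rewrite ler_wpM2r// ler_norm.
  by rewrite ler_wpM2l.
move=> t t0 [K HK] [D HD].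
have K0 : 0 <= K.
  have [pt _] := pT; have [_ p0 _] := pt t t0.
  by rewrite -lee_fin; exact: le_trans (p0 0) (HK 0).
have HD' x : (fk mu V^\+%R V^\-%R t one x <= (D * phi 0%N x)%:E)%E.
  by apply: le_trans (HD x); rewrite TE ?(ltW t0).
have dens x (g : 'rV[R]_d -> \bar R) : measurable_fun setT g -> (forall y, (0 <= g y)%E) ->
    (\int[mu]_w g (x + w t)%R <= K%:E * \int[leb]_y g y)%E.
  by move=> mg g0; exact: (path_density tr mX pT x t0 mg g0 K0 HK).
have [C0 C00 HC0] := GSD_ultracontractive muL mV sV pos t0 K0 dens HD'.
exists (expR (lambda 0%N * (t + t)) * C0) => f.
rewrite inE => /andP[mf]; rewrite inE/= /finite_norm => fin.
move: mf; rewrite inE/= => mf.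
have [N NE N0] : exists2 N : R, ('N[sq_measure (phi 0%N)]_2%:E [EFin \o f] = N%:E)%E & 0 <= N.
  have := Lnorm_ge0 (sq_measure (phi 0%N)) 2%:E (EFin \o f); move: fin.
  by case: ('N[_]_2%:E [EFin \o f])%E => //= r _ r0; exists r.
rewrite NE -EFinM; apply: Lnormy_le => [|x]; first by rewrite !mulr_ge0 ?expR_ge0.
have mpf : measurable_fun setT (fun y => phi 0%N y * f y) by exact: measurable_funM.
have mg : measurable_fun setT (fun y => `|phi 0%N y * f y|) by exact: measurableT_comp.
have gN : (\int[leb]_y (`|phi 0%N y * f y| ^+ 2)%:E <= (N ^+ 2)%:E)%E.
  rewrite -[X in (_ <= X%:E)%E]powR_mulrn// -poweR_EFin -NE Lnorm2_sq//.
  rewrite le_eqVlt; apply/orP; left; apply/eqP; apply: eq_integral => y _.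
  by rewrite real_normK ?num_real.
have tt0 : 0 <= t + t by rewrite addr_ge0 ?ltW.
have k0 : 0 < expR (lambda 0%N * (t + t)) / phi 0%N x by rewrite divr_gt0 ?expR_gt0.
rewrite /intrinsic abseM gee0_abs ?lee_fin ?(ltW k0)//.
apply: (@le_trans _ _ ((expR (lambda 0%N * (t + t)) / phi 0%N x)%:E * (C0 * N * phi 0%N x)%:E)%E).
  apply: lee_wpmul2l; first by rewrite lee_fin ltW.
  apply: le_trans (feynman_kac_abs muL tr x mV sV mpf tt0) _.
  exact: (HC0 _ N mg (fun y => normr_ge0 _) N0 gN x).
rewrite -EFinM lee_fin le_eqVlt; apply/orP; left; apply/eqP.
by rewrite -!mulrA; congr (_ * _); rewrite mulrC -!mulrA mulfV ?mulr1 ?gt_eqF.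
Qed.

Lemma GSD_limit : GSD T (phi 0%N) <-> tends_to_pinfty_at_infty (fun x => V x / `|ln (nu x)|).
Proof.
have [suff nec _ _] := main_facts; split.
  move=> G; exact: limit_of_star (fun t t0 => nec t t0 (G t t0)).
by move=> /star_of_limit H t t0; rewrite -(divK4 t0); apply: suff; [rewrite divr_gt0|apply: H; rewrite divr_gt0].
Qed.

End assembly.

Theorem corollary2p3 (R : realType) (d : nat) (hd : (0 < d)%N)
    (dO : measure_display) (Om : measurableType dO) (P : probability Om R)
    (X : R -> Om -> 'rV[R]_d)
    (nu : 'rV[R]_d -> R) (p : R -> 'rV[R]_d -> \bar R) (tb : R)
    (V : 'rV[R]_d -> R)
    (phi : nat -> {mfun 'rV[R]_d >-> R}) (lambda : nat -> R)
    (R0 C14 : R) :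
  regular_jump_levy P X nu p ->
  0 < tb -> positive_bounded_at p tb ->
  confining_kato P X V ->
  let T := feynman_kac P X V in
  eigenbasis T phi lambda ->
  1 < R0 -> 0 < C14 ->
  (forall x, R0 < enorm x -> forall y, eball x 1 y -> V y <= C14 * V x) ->
  let limit_condition :=
    tends_to_pinfty_at_infty (fun x => V x / `|ln (nu x)|) in
  let star := ratio_bounded_below V nu in
  [/\ GSD T (phi 0%N) <-> limit_condition,
      IUC T (phi 0%N) (lambda 0%N) -> limit_condition &
      (forall t, 0 < t -> bounded_at p t) ->
        limit_condition -> IUC T (phi 0%N) (lambda 0%N)] /\
  [/\ AGSD T (phi 0%N) <-> (exists2 C15 : R, 0 < C15 & star C15),
      AIUC T (phi 0%N) (lambda 0%N) <-> (exists2 C15 : R, 0 < C15 & star C15),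
      forall C15 : R, 0 < C15 -> star C15 ->
        GSD_at T (phi 0%N) (4 / C15) /\
        IUC_at T (phi 0%N) (lambda 0%N) (2 * Num.max tb (4 / C15)),
      forall t0 : R, 0 < t0 -> GSD_at T (phi 0%N) t0 ->
        star (1 / (2 * C14 * t0)) &
      forall t0 : R, 0 < t0 -> IUC_at T (phi 0%N) (lambda 0%N) t0 ->
        star (1 / (4 * C14 * t0))].
Proof.
move=> XR tb0 [_ ptb] VK T phiE _ C140 VC limit_condition star.
have [XL A1 [pT _] _] := XR; have [mX _ _ _ _] := XL.
have [suff necG necI ultra] := main_facts hd XR VK phiE C140 VC.
have starI t : 0 < t -> bounded_at p t -> star (4 / t) -> IUC_at T (phi 0%N) (lambda 0%N) (t + t).
  move=> t0 bt st; apply: ultra => //; rewrite -(divK4 t0); apply: suff st; exact: divr_gt0.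
have specific C15 : 0 < C15 -> star C15 ->
    GSD_at T (phi 0%N) (4 / C15) /\ IUC_at T (phi 0%N) (lambda 0%N) (2 * Num.max tb (4 / C15)).
  move=> C0 sC; split; first exact: suff.
  pose s := Num.max tb (4 / C15).
  have s0 : 0 < s by rewrite lt_max tb0.
  rewrite (_ : 2 * _ = s + s); last by rewrite mulr_natl mulr2n.
  have tbs : tb <= s by rewrite le_max lexx.
  apply: starI => //; first exact: (bounded_at_later pT tb0 tbs ptb).
  (* As [s >= 4 / C15], the constant [4 / s] required at time [s] is at most [C15]. *)
  apply: star_mono sC; rewrite ler_pdivrMr// mulrC -ler_pdivrMr//.
  by rewrite le_max lexx orbT.
have starG t : 0 < t -> GSD_at T (phi 0%N) t -> star (1 / (2 * C14 * t)) := necG t.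
split; split.
- exact: (GSD_limit hd XR VK phiE C140 VC).
- by move=> I; exact: (limit_of_star C140 (fun t t0 => necI t t0 (I t t0))).
- move=> bp /star_of_limit lim t t0; have t20 : 0 < t / 2 by rewrite divr_gt0.
  by rewrite [t]splitr; apply: starI => //; [exact: bp|apply: lim; rewrite divr_gt0].
- split=> [[t t0 G]|[C C0 sC]].
    by exists (1 / (2 * C14 * t)); [rewrite divr_gt0// !mulr_gt0|exact: starG].
  by exists (4 / C); [rewrite divr_gt0|exact: suff].
- split=> [[t t0 I]|[C C0 sC]].
    by exists (1 / (2 * C14 * t)); [rewrite divr_gt0// !mulr_gt0|exact: necI].
  exists (2 * Num.max tb (4 / C)); last by have [] := specific C C0 sC.
  by rewrite mulr_gt0// lt_max tb0.
- exact: specific.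
- exact: starG.
(* [necI] gives the larger constant [1 / (2 * C14 * t)]. *)
move=> t t0 I; apply: star_mono (necI t t0 I).
rewrite !div1r lef_pV2 ?posrE ?mulr_gt0// ler_pM2r// ler_pM2r// ler_nat//.
Qed.
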